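(* Let $\tau\in\mathbf{C}$ satisfy $-\frac12<\Re(\tau)\le\frac12$, $\Im(\tau)>0$, $|\tau|\ge 1$, and $\Re(\tau)\ge 0$ if $|\tau|=1$. The function $s\mapsto\widetilde{E}_s(\tau)$, defined for $\Re(s)>2$ by the lattice sum in the context, admits an analytic continuation to all $s\in\mathbf{C}$ as an entire function. This continuation is given by $$2\cos\left(\frac{\pi}{2}s\right)\frac{\Gamma(1-s)\,e^{-is\pi}}{i\pi}\int_C z^{s-1}F(s,z)\,dz$$ (with removable singularities, at the poles of $\Gamma(1-s)$, filled in by continuity), where $$F(s,z)=e^{-is\pi/2}\,e^{-z}\frac{\cosh^2(\tau z/2)}{1-2e^{-z}\cosh(\tau z)+e^{-2z}}+e^{i\tau z}\frac{\cos^2(z/2)}{1-2e^{i\tau z}\cos(z)+e^{2i\tau z}}$$ and $C$ is the contour described in the context.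
   Context: Definition of $\widetilde E_s$ for $\Re(s)>2$: $$\widetilde{E}_s(\tau)=\lim_{K\to\infty}\sum_{|m|,|n|\le K}\frac{1}{(m+n\tau)^s},$$ over integers $m,n$, omitting $m=n=0$. For non-integer $s$ the lattice power is $\omega^s=|\omega|^s e^{is\arg\omega}$ with $\theta\le\arg(\omega)\le\theta+2\pi$, $\theta=\mathrm{Arg}(-1-\tau)\in(-\pi,-\pi/2)$ (cut along $\{-t(1+\tau):t>0\}$), and for lattice points on the cut ($\omega=-m-m\tau$, $m\ge 1$) the two boundary values are averaged: $\frac{1}{(-m-m\tau)^s}:=\frac{1}{2(m|1+\tau|)^s}\left(e^{-i\theta s}+e^{-i(\theta+2\pi)s}\right)$. Contour and branch in the integral: apart from $z=0$, the singularities of $F(s,\cdot)$ lie in $P=\{\pm\frac{2\pi i}{1\pm\tau}m,\ \pm\frac{2\pi}{1\pm\tau}n : m,n\in\mathbf{N}, m,n\ge1\}$ (all sign choices). Let $\rho=\min_{z\in P}|z|$. The contour $C$ begins at $\infty+iy$ with $y>0$, runs parallel to the real axis until it meets the circle of radius $r$ centered at the origin, where $y<r<\rho$, follows this circle counterclockwise around the origin, and runs back out to $\infty-iy$ parallel to the real axis; $y>0$ is small enough that $C$ encloses only the singularity at $z=0$. The factor $z^{s-1}$ has its branch cut along the positive real axis, with $0<\arg z<2\pi$, so that for $\lambda>0$, $\lim_{y\to0^+}(\lambda+iy)^{s-1}=\lambda^{s-1}$ and $\lim_{y\to0^+}(\lambda-iy)^{s-1}=e^{2\pi i(s-1)}\lambda^{s-1}$.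 *)

(* Defs.v *)
From Stdlib Require Import Reals ZArith.
From Coquelicot Require Export Coquelicot.

Open Scope R_scope.

Definition Cexp (z : C) : C :=
  (RtoC (exp (Re z)) * (cos (Im z), sin (Im z)))%C.

Definition Ccosh (z : C) : C := ((Cexp z + Cexp (- z)) / 2)%C.

Definition Ccos (z : C) : C := ((Cexp (Ci * z) + Cexp (- (Ci * z))) / 2)%C.

(* Principal argument, with values in (-PI, PI]; Arg 0 is a dummy value. *)
Definition Arg (z : C) : R :=
  if Rle_dec 0 (Im z) then acos (Re z / Cmod z) else - acos (Re z / Cmod z).

(* For -PI < theta <= 0 and z off the ray of angle theta, this is the
   determination of the argument with theta < arg < theta + 2 PI. *)
Definition arg_from (theta : R) (z : C) : R :=
  if Rlt_dec theta (Arg z) then Arg z else Arg z + 2 * PI.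

(* rho^s e^{i alpha s}: the power of the number of modulus rho > 0 whose
   argument is taken to be alpha. *)
Definition polar_pow (rho alpha : R) (s : C) : C :=
  Cexp (s * (RtoC (ln rho) + Ci * RtoC alpha))%C.

Definition Cpow_from (theta : R) (z s : C) : C :=
  polar_pow (Cmod z) (arg_from theta z) s.

Definition cut_angle (tau : C) : R := Arg (- 1 - tau)%C.

(* 1 / (m + n tau)^s; the points with m = n < 0 lie on the cut, where the
   two boundary values are averaged. *)
Definition lattice_term (tau s : C) (m n : Z) : C :=
  let w := (RtoC (IZR m) + RtoC (IZR n) * tau)%C in
  let theta := cut_angle tau in
  if ((m =? 0) && (n =? 0))%Z%bool then RtoC 0
  else if ((m =? n) && (m <? 0))%Z%bool then
    ((/ polar_pow (Cmod w) theta s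
      + / polar_pow (Cmod w) (theta + 2 * PI) s) / 2)%C
  else (/ Cpow_from theta w s)%C.

(* Sum over |m|, |n| <= K, with m = i - K and n = j - K for 0 <= i, j <= 2K. *)
Definition square_sum (tau s : C) (K : nat) : C :=
  sum_n (fun i => sum_n (fun j =>
    lattice_term tau s (Z.of_nat i - Z.of_nat K) (Z.of_nat j - Z.of_nat K))
    (2 * K)) (2 * K).

Definition is_Etilde (tau s l : C) : Prop :=
  filterlim (square_sum tau s) eventually (locally l).

Definition Gamma_integral (z : C) : C :=
  RInt_gen (V := C_R_CompleteNormedModule)
    (fun t : R => (polar_pow t 0 (z - 1) * RtoC (exp (- t)))%C)
    (at_right 0) (Rbar_locally p_infty).

Fixpoint rising (z : C) (n : nat) : C :=
  match n with
  | O => RtoC 1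
  | S k => (rising z k * (z + RtoC (INR k)))%C
  end.

(* The Gamma function: Euler's integral for Re z > 0, where n = 0 below, and
   Gamma(z + n) / (z (z + 1) ... (z + n - 1)) with n the least natural number
   such that Re z + n > 0 elsewhere. Meaningless at the poles 0, -1, -2, ... *)
Definition CGamma (z : C) : C :=
  let n := Z.to_nat (up (- Re z)) in
  (Gamma_integral (z + RtoC (INR n)) / rising z n)%C.

Definition F (tau s z : C) : C :=
  (Cexp (- (Ci * s * RtoC PI / 2)) * Cexp (- z)
     * (Ccosh (tau * z / 2) ^ 2
        / (1 - 2 * Cexp (- z) * Ccosh (tau * z) + Cexp (- (2 * z))))
   + Cexp (Ci * tau * z)
     * (Ccos (z / 2) ^ 2
        / (1 - 2 * Cexp (Ci * tau * z) * Ccos z + Cexp (2 * Ci * tau * z))))%C.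

Definition sing (tau z : C) : Prop :=
  exists (e d : R) (k : nat),
    (e = 1 \/ e = -1) /\ (d = 1 \/ d = -1) /\ (1 <= k)%nat /\
    (z = (RtoC e * (2 * RtoC PI * Ci / (1 + RtoC d * tau)) * RtoC (INR k))%C \/
     z = (RtoC e * (2 * RtoC PI / (1 + RtoC d * tau)) * RtoC (INR k))%C).

Definition is_sing_radius (tau : C) (rho : R) : Prop :=
  (exists p, sing tau p /\ Cmod p = rho) /\
  (forall p, sing tau p -> rho <= Cmod p).

(* The closed region bounded by the contour of radius r and half-width y. *)
Definition enclosed (r y : R) (z : C) : Prop :=
  Cmod z <= r \/ (0 <= Re z /\ Rabs (Im z) <= y).

Definition admissible (tau : C) (r y : R) : Prop :=
  0 < y /\ y < r /\
  (exists rho, is_sing_radius tau rho /\ r < rho) /\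
  (forall p, sing tau p -> ~ enclosed r y p).

(* The contour comes in along x + i y with x from oo down to sqrt (r^2 - y^2),
   follows the circle from angle asin (y/r) to 2 PI - asin (y/r), and goes out
   along x - i y. *)
Definition upper_leg (f : C -> C) (y x : R) : C := f (x, y).
Definition lower_leg (f : C -> C) (y x : R) : C := f (x, - y).
Definition arc (f : C -> C) (r phi : R) : C :=
  let e := (cos phi, sin phi) : C in
  (f (RtoC r * e) * (Ci * RtoC r * e))%C.

Definition ex_contour_int (f : C -> C) (r y : R) : Prop :=
  let x0 := sqrt (r ^ 2 - y ^ 2) in
  let phi0 := asin (y / r) in
  ex_RInt_gen (V := C_R_NormedModule) (upper_leg f y)
    (at_point x0) (Rbar_locally p_infty) /\
  ex_RInt (V := C_R_NormedModule) (arc f r) phi0 (2 * PI - phi0) /\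
  ex_RInt_gen (V := C_R_NormedModule) (lower_leg f y)
    (at_point x0) (Rbar_locally p_infty).

Definition contour_int (f : C -> C) (r y : R) : C :=
  let x0 := sqrt (r ^ 2 - y ^ 2) in
  let phi0 := asin (y / r) in
  (- RInt_gen (V := C_R_CompleteNormedModule) (upper_leg f y)
       (at_point x0) (Rbar_locally p_infty)
   + RInt (V := C_R_CompleteNormedModule) (arc f r) phi0 (2 * PI - phi0)
   + RInt_gen (V := C_R_CompleteNormedModule) (lower_leg f y)
       (at_point x0) (Rbar_locally p_infty))%C.

(* z^{s-1} F(s,z), the power being cut along the positive real axis with
   0 < arg z < 2 PI. *)
Definition integrand (tau s z : C) : C :=
  (Cpow_from 0 z (s - 1) * F tau s z)%C.

Definition continuation_formula (tau : C) (r y : R) (s : C) : C :=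
  (2 * Ccos (RtoC PI / 2 * s)
   * (CGamma (1 - s) * Cexp (- (Ci * s * RtoC PI)) / (Ci * RtoC PI))
   * contour_int (integrand tau s) r y)%C.

Definition Gamma_pole (s : C) : Prop :=
  exists k : nat, (1 - s)%C = RtoC (- INR k).

Definition entire (f : C -> C) : Prop :=
  forall s, ex_derive (K := C_AbsRing) (V := C_NormedModule) f s.

(* Main.v *)
(** With [w = log z], the contour becomes two horizontal rays and a vertical
    segment, and the integrand becomes [g w = exp (s w) f (exp w)]; [hankel g r]
    is the resulting integral. It does not depend on [r], by Cauchy's theorem
    (primitives of holomorphic functions on convex domains), and is entire in
    [s]. Write [hk s] for its value at [f z = exp (- z)]. A differential equation
    in [om] turns [exp (- om z)] into [om ^ (- s) hk s], and differentiating
    [exp (- x (1 + z)) / (1 + z)] in [x] gives Hankel's formula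
    [Gamma (1 - s) hk s = 2 i PI exp (i PI s)]; the constant is the residue at
    [z = -1].

    The two terms of [F] are generating functions of [exp (- om z)] over the
    lattice points of two sectors, with weight one half on the
    boundary. Truncating them at [K] and integrating over the contour of radius
    [1 / K] costs [O(K ^ (2 - Re s))], so for [Re s > 2] the contour integral is
    [hk s / 2] times the sum of [om ^ (- s)] over the sectors; rotating the sectors
    to the whole plane produces the factor [2 cos (PI s / 2)] and the averaged
    values on the cut. Hence the continuation is [N s / hk s], with [N s] entire.
    The zeros of [hk] are the positive integers and are simple, and there [N]
    vanishes: at 1 by the cosine, at 2 by a residue, from 3 on because
    [hk s] times a finite sum converges to [N s]. At these integers the lattice
    sum is recovered from nearby [s], the partial sums being equicontinuous. *)

Require Import Defs.
From Stdlib Require Import Reals ZArith Lra Lia FunctionalExtensionality PropExtensionality ClassicalEpsilon.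
From Coquelicot Require Import Coquelicot.
Open Scope R_scope.

(** The function [hk] is 1 / Gamma(1 - s) up to a nowhere vanishing exponential and is entire by
    construction. This turns a formula with poles into a quotient of entire functions, and Gamma
    itself enters only through the product formula [CGamma_hk]. The squares of cosh and cos in the
    numerators give the edges of each sector weight one half: a diagonal lattice point belongs to
    two neighbouring sectors and collects two halves. They agree except on the cut, where they carry
    the two determinations of the argument. The radius 1 / K is the scale at which the two competing
    quantities balance: there the double pole of the kernel has size K ^ 2, while the truncation has
    order K ^ 2 terms whose exponents stay bounded. Cauchy's theorem is used as existence of
    primitives. Removability at the integers therefore rests on a second-order Taylor estimate,
    which is why the integrals are differentiated twice in s, and the residue at z = -1 is computed
    by subtracting an explicit periodic function. *)

Lemma Cmod_minus_sym (a b : C) : Cmod (a - b) = Cmod (b - a).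
Proof. rewrite <- Cmod_opp. f_equal. ring. Qed.

Lemma Cmod_triangle_minus (a b : C) : Cmod (a - b) <= Cmod a + Cmod b.
Proof. unfold Cminus. rewrite <- (Cmod_opp b). apply Cmod_triangle. Qed.

Lemma Cmod_reverse (a b : C) : Cmod a - Cmod b <= Cmod (a - b).
Proof.
  generalize (Cmod_triangle (a - b) b). replace (a - b + b)%C with a by ring. lra.
Qed.

Lemma Im_le_Cmod (c : C) : Rabs (Im c) <= Cmod c.
Proof. apply Rle_trans with (2 := Rmax_Cmod c). apply Rmax_r. Qed.

(** [i] embeds the domain ([R] or [C]) into [C], so that curves and complex
    functions share one calculus. *)
Definition deriv_at {T : Type} (i f : T -> C) (t : T) (l : C) : Prop :=
  forall eps, 0 < eps -> exists del, 0 < del /\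
    forall t', Cmod (i t' - i t) < del ->
      Cmod (f t' - f t - (i t' - i t) * l) <= eps * Cmod (i t' - i t).

Definition cont_at {T : Type} (i f : T -> C) (t : T) : Prop :=
  forall eps, 0 < eps -> exists del, 0 < del /\
    forall t', Cmod (i t' - i t) < del -> Cmod (f t' - f t) < eps.

Definition cid : C -> C := fun z => z.

(** * Continuity and derivatives along an embedding into the complex plane *)

Section Calculus.
Context {T : Type} (i : T -> C).

Lemma cont_const (c : C) t : cont_at i (fun _ => c) t.
Proof.
  intros e He; exists 1; split; [lra|]; intros t' _.
  replace (c - c)%C with (RtoC 0) by ring. rewrite Cmod_0. exact He.
Qed.

Lemma cont_incl t : cont_at i i t.
Proof. intros e He; exists e; auto. Qed.

Lemma cont_plus f g t :
  cont_at i f t -> cont_at i g t -> cont_at i (fun u => f u + g u)%C t.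
Proof.
  intros Hf Hg e He.
  destruct (Hf (e / 2)) as [d1 [D1 H1]]; [lra|].
  destruct (Hg (e / 2)) as [d2 [D2 H2]]; [lra|].
  exists (Rmin d1 d2); split; [now apply Rmin_pos|].
  intros t' Ht.
  assert (A := H1 t' (Rlt_le_trans _ _ _ Ht (Rmin_l _ _))).
  assert (B := H2 t' (Rlt_le_trans _ _ _ Ht (Rmin_r _ _))).
  replace (f t' + g t' - (f t + g t))%C with ((f t' - f t) + (g t' - g t))%C by ring.
  eapply Rle_lt_trans; [apply Cmod_triangle|]. lra.
Qed.

Lemma cont_mult f g t :
  cont_at i f t -> cont_at i g t -> cont_at i (fun u => f u * g u)%C t.
Proof.
  intros Hf Hg e He.
  set (A := Cmod (f t) + 1). set (B := Cmod (g t) + 1).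
  assert (HA : 1 <= A) by (unfold A; generalize (Cmod_ge_0 (f t)); lra).
  assert (HB : 1 <= B) by (unfold B; generalize (Cmod_ge_0 (g t)); lra).
  destruct (Hf (Rmin 1 (e / (2 * B)))) as [d1 [D1 H1]].
  { apply Rmin_pos; [lra|]. apply Rdiv_lt_0_compat; lra. }
  destruct (Hg (e / (2 * A))) as [d2 [D2 H2]]; [apply Rdiv_lt_0_compat; lra|].
  exists (Rmin d1 d2); split; [now apply Rmin_pos|].
  intros t' Ht.
  assert (K1 := H1 t' (Rlt_le_trans _ _ _ Ht (Rmin_l _ _))).
  assert (K2 := H2 t' (Rlt_le_trans _ _ _ Ht (Rmin_r _ _))).
  assert (K3 := Rlt_le_trans _ _ _ K1 (Rmin_l _ _)).
  assert (K4 := Rlt_le_trans _ _ _ K1 (Rmin_r _ _)).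
  replace (f t' * g t' - f t * g t)%C
    with (f t' * (g t' - g t) + (f t' - f t) * g t)%C by ring.
  eapply Rle_lt_trans; [apply Cmod_triangle|]. rewrite !Cmod_mult.
  assert (Cmod (f t') <= A).
  { unfold A. generalize (Cmod_triangle (f t' - f t) (f t)).
    replace (f t' - f t + f t)%C with (f t') by ring. lra. }
  apply Rlt_le_trans with (A * (e / (2 * A)) + e / (2 * B) * B).
  2:{ right. field. lra. }
  apply Rplus_lt_le_compat.
  - apply Rle_lt_trans with (A * Cmod (g t' - g t)).
    + apply Rmult_le_compat_r; [apply Cmod_ge_0|lra].
    + apply Rmult_lt_compat_l; lra.
  - assert (Cmod (g t) <= B) by (unfold B; lra).
    apply Rmult_le_compat; try apply Cmod_ge_0; lra.
Qed.

Lemma cont_comp (g : C -> C) f t :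
  cont_at cid g (f t) -> cont_at i f t -> cont_at i (fun u => g (f u)) t.
Proof.
  intros Hg Hf e He. destruct (Hg e He) as [d [D H]].
  destruct (Hf d D) as [d' [D' H']]. exists d'; split; auto.
  intros t' Ht. apply H. now apply H'.
Qed.

Lemma deriv_cont f t l : deriv_at i f t l -> cont_at i f t.
Proof.
  intros H e He. destruct (H 1) as [d [D Hd]]; [lra|].
  assert (P : 0 < Cmod l + 1) by (generalize (Cmod_ge_0 l); lra).
  exists (Rmin d (e / (Cmod l + 1))); split.
  { apply Rmin_pos; auto. now apply Rdiv_lt_0_compat. }
  intros t' Ht.
  assert (K1 := Hd t' (Rlt_le_trans _ _ _ Ht (Rmin_l _ _))).
  assert (K2 := Rlt_le_trans _ _ _ Ht (Rmin_r _ _)).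
  replace (f t' - f t)%C
    with ((f t' - f t - (i t' - i t) * l) + (i t' - i t) * l)%C by ring.
  eapply Rle_lt_trans; [apply Cmod_triangle|]. rewrite (Cmod_mult (i t' - i t)).
  apply Rle_lt_trans with (Cmod (i t' - i t) * (Cmod l + 1)); [lra|].
  apply Rlt_le_trans with (e / (Cmod l + 1) * (Cmod l + 1)).
  - apply Rmult_lt_compat_r; lra.
  - right. field. lra.
Qed.

Lemma deriv_const (c : C) t : deriv_at i (fun _ => c) t 0.
Proof.
  intros e He; exists 1; split; [lra|]; intros t' _.
  replace (c - c - (i t' - i t) * 0)%C with (RtoC 0) by ring. rewrite Cmod_0.
  apply Rmult_le_pos; [lra|apply Cmod_ge_0].
Qed.

Lemma deriv_incl t : deriv_at i i t 1.
Proof.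
  intros e He; exists 1; split; [lra|]; intros t' _.
  replace (i t' - i t - (i t' - i t) * 1)%C with (RtoC 0) by ring. rewrite Cmod_0.
  apply Rmult_le_pos; [lra|apply Cmod_ge_0].
Qed.

Lemma deriv_eq f t l l' : deriv_at i f t l -> l = l' -> deriv_at i f t l'.
Proof. now intros H <-. Qed.

Lemma deriv_plus f g t l m :
  deriv_at i f t l -> deriv_at i g t m ->
  deriv_at i (fun u => f u + g u)%C t (l + m).
Proof.
  intros Hf Hg e He.
  destruct (Hf (e / 2)) as [d1 [D1 H1]]; [lra|].
  destruct (Hg (e / 2)) as [d2 [D2 H2]]; [lra|].
  exists (Rmin d1 d2); split; [now apply Rmin_pos|].
  intros t' Ht.
  assert (A := H1 t' (Rlt_le_trans _ _ _ Ht (Rmin_l _ _))).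
  assert (B := H2 t' (Rlt_le_trans _ _ _ Ht (Rmin_r _ _))).
  replace (f t' + g t' - (f t + g t) - (i t' - i t) * (l + m))%C
    with ((f t' - f t - (i t' - i t) * l) + (g t' - g t - (i t' - i t) * m))%C by ring.
  eapply Rle_trans; [apply Cmod_triangle|]. lra.
Qed.

Lemma deriv_comp (g : C -> C) f t l m :
  deriv_at cid g (f t) m -> deriv_at i f t l ->
  deriv_at i (fun u => g (f u)) t (m * l).
Proof.
  intros Hg Hf e He.
  set (L := Cmod l + 1). assert (HL : 1 <= L) by (unfold L; generalize (Cmod_ge_0 l); lra).
  set (M := Cmod m + 1). assert (HM : 1 <= M) by (unfold M; generalize (Cmod_ge_0 m); lra).
  destruct (Hg (e / (2 * L))) as [d1 [D1 H1]]; [apply Rdiv_lt_0_compat; lra|].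
  destruct (deriv_cont _ _ _ Hf d1 D1) as [d2 [D2 H2]].
  destruct (Hf (Rmin 1 (e / (2 * M)))) as [d3 [D3 H3]].
  { apply Rmin_pos; [lra|]. apply Rdiv_lt_0_compat; lra. }
  exists (Rmin d2 d3); split; [now apply Rmin_pos|].
  intros t' Ht.
  assert (A := H2 t' (Rlt_le_trans _ _ _ Ht (Rmin_l _ _))).
  assert (B := H3 t' (Rlt_le_trans _ _ _ Ht (Rmin_r _ _))).
  specialize (H1 (f t') A). unfold cid in H1.
  set (dt := (i t' - i t)%C) in *. set (df := (f t' - f t)%C) in *.
  assert (Q := Cmod_ge_0 dt).
  assert (B1 : Cmod (df - dt * l) <= 1 * Cmod dt).
  { eapply Rle_trans; [exact B|]. apply Rmult_le_compat_r; [easy|apply Rmin_l]. }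
  assert (B2 : Cmod (df - dt * l) <= e / (2 * M) * Cmod dt).
  { eapply Rle_trans; [exact B|]. apply Rmult_le_compat_r; [easy|apply Rmin_r]. }
  assert (B3 : Cmod df <= L * Cmod dt).
  { replace df with ((df - dt * l) + dt * l)%C by ring.
    eapply Rle_trans; [apply Cmod_triangle|]. rewrite (Cmod_mult dt l). unfold L; lra. }
  replace (g (f t') - g (f t) - dt * (m * l))%C
    with ((g (f t') - g (f t) - df * m) + m * (df - dt * l))%C by ring.
  eapply Rle_trans; [apply Cmod_triangle|]. rewrite (Cmod_mult m).
  apply Rle_trans with (e / (2 * L) * (L * Cmod dt) + M * (e / (2 * M) * Cmod dt)).
  2:{ right. field. lra. }
  apply Rplus_le_compat.
  - eapply Rle_trans; [exact H1|]. apply Rmult_le_compat_l; [|easy].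
    left; apply Rdiv_lt_0_compat; lra.
  - assert (Cmod m <= M) by (unfold M; lra).
    apply Rmult_le_compat; try apply Cmod_ge_0; lra.
Qed.

End Calculus.

Lemma deriv_square (z : C) : deriv_at cid (fun w => w * w)%C z (2 * z).
Proof.
  intros e He; exists e; split; auto. unfold cid. intros w Hw.
  replace (w * w - z * z - (w - z) * (2 * z))%C with ((w - z) * (w - z))%C by ring.
  rewrite Cmod_mult. apply Rmult_le_compat_r; [apply Cmod_ge_0|lra].
Qed.

Lemma deriv_scal {T} (i : T -> C) f t c l :
  deriv_at i f t l -> deriv_at i (fun u => c * f u)%C t (c * l).
Proof.
  intro H. apply (deriv_comp i (fun w => c * w)%C); auto.
  intros e He; exists 1; split; [lra|]. unfold cid; intros w _.
  replace (c * w - c * f t - (w - f t) * c)%C with (RtoC 0) by ring.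
  rewrite Cmod_0. apply Rmult_le_pos; [lra|apply Cmod_ge_0].
Qed.

Lemma deriv_ext {T} (i : T -> C) f g t l :
  (forall u, f u = g u) -> deriv_at i f t l -> deriv_at i g t l.
Proof.
  intros E H e He. destruct (H e He) as [d [D Hd]]. exists d; split; auto.
  intros t' Ht. rewrite <- !E. auto.
Qed.

Lemma cont_ext {T} (i : T -> C) f g t :
  (forall u, f u = g u) -> cont_at i f t -> cont_at i g t.
Proof.
  intros E H e He. destruct (H e He) as [d [D Hd]]. exists d; split; auto.
  intros t' Ht. rewrite <- !E. auto.
Qed.

Lemma deriv_opp {T} (i : T -> C) f t l :
  deriv_at i f t l -> deriv_at i (fun u => - f u)%C t (- l).
Proof.
  intro H. apply deriv_ext with (fun u => (-1) * f u)%C; [intro; ring|].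
  eapply deriv_eq; [apply deriv_scal, H|ring].
Qed.

Lemma deriv_minus {T} (i : T -> C) f g t l m :
  deriv_at i f t l -> deriv_at i g t m ->
  deriv_at i (fun u => f u - g u)%C t (l - m).
Proof. intros Hf Hg. apply deriv_plus; [easy|now apply deriv_opp]. Qed.

(** Polarization: f g = ((f + g)^2 - f^2 - g^2) / 2 reduces the product rule to the chain rule for
    squaring. *)
Lemma deriv_mult {T} (i : T -> C) f g t l m :
  deriv_at i f t l -> deriv_at i g t m ->
  deriv_at i (fun u => f u * g u)%C t (l * g t + f t * m).
Proof.
  intros Hf Hg.
  assert (Two : RtoC 2 <> 0) by (intro H; apply RtoC_inj in H; lra).
  apply deriv_ext with (fun u => / 2 * ((f u + g u) * (f u + g u)
     - f u * f u - g u * g u))%C.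
  { intro u. now field. }
  eapply deriv_eq.
  - apply deriv_scal. apply deriv_minus; [apply deriv_minus|].
    + apply (deriv_comp i (fun w => w * w)%C (fun u => f u + g u)%C);
        [apply deriv_square|apply deriv_plus; eassumption].
    + apply (deriv_comp i (fun w => w * w)%C f); [apply deriv_square|eassumption].
    + apply (deriv_comp i (fun w => w * w)%C g); [apply deriv_square|eassumption].
  - now field.
Qed.

Lemma deriv_Cinv (z : C) : z <> 0 -> deriv_at cid Cinv z (- (/ (z * z))).
Proof.
  intros Hz e He. assert (P := proj1 (Cmod_gt_0 z) Hz). set (r := Cmod z) in *.
  (* Staying within r / 2 of z keeps |w| above r / 2. The error |w - z|^2 / (r^2 |w|) is then at
     most 2 |w - z|^2 / r^3, which explains the second bound. *)
  exists (Rmin (r / 2) (e * (r * r * r) / 2)); split.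
  { apply Rmin_pos; [lra|]. repeat apply Rmult_lt_0_compat; lra. }
  unfold cid; intros w Hw.
  assert (K1 := Rlt_le_trans _ _ _ Hw (Rmin_l _ _)).
  assert (K2 := Rlt_le_trans _ _ _ Hw (Rmin_r _ _)).
  assert (W : r / 2 < Cmod w).
  { generalize (Cmod_reverse z w). rewrite Cmod_minus_sym. fold r. lra. }
  assert (Hw0 : w <> 0). { apply Cmod_gt_0. lra. }
  replace (/ w - / z - (w - z) * - / (z * z))%C
    with ((w - z) * ((w - z) * / (z * z * w)))%C by (field; auto).
  rewrite !Cmod_mult, Cmod_inv.
  2:{ apply Cmult_neq_0; [apply Cmult_neq_0|]; auto. }
  rewrite !Cmod_mult. fold r. rewrite Rmult_comm.
  apply Rmult_le_compat_r; [apply Cmod_ge_0|].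
  apply Rle_trans with (e * (r * r * r) / 2 * / (r * r * (r / 2))).
  2:{ right. field. lra. }
  apply Rmult_le_compat; try apply Cmod_ge_0; try lra.
  - left; apply Rinv_0_lt_compat. repeat apply Rmult_lt_0_compat; lra.
  - apply Rinv_le_contravar.
    + repeat apply Rmult_lt_0_compat; lra.
    + apply Rmult_le_compat_l; [|lra]. apply Rmult_le_pos; lra.
Qed.

Lemma deriv_inv {T} (i f : T -> C) t (l : C) :
  f t <> 0 -> deriv_at i f t l ->
  deriv_at i (fun u => / f u)%C t (- (l / (f t * f t))).
Proof.
  intros N H. eapply deriv_eq.
  - apply (deriv_comp i Cinv); [now apply deriv_Cinv|eassumption].
  - now field.
Qed.

Lemma cont_opp {T} (i : T -> C) f t :
  cont_at i f t -> cont_at i (fun u => - f u)%C t.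
Proof.
  intro H. apply cont_ext with (fun u => (-1) * f u)%C; [intro; ring|].
  apply cont_mult; auto. apply cont_const.
Qed.

Lemma cont_minus {T} (i : T -> C) f g t :
  cont_at i f t -> cont_at i g t -> cont_at i (fun u => f u - g u)%C t.
Proof. intros. apply cont_plus; auto. now apply cont_opp. Qed.

Lemma cont_inv {T} (i f : T -> C) t :
  f t <> 0 -> cont_at i f t -> cont_at i (fun u => / f u)%C t.
Proof.
  intros N H. apply (cont_comp i Cinv); auto.
  eapply deriv_cont. now apply deriv_Cinv.
Qed.

(** ** Link with Coquelicot *)

Lemma deriv_at_is_derive (f : C -> C) z l :
  deriv_at cid f z l -> is_derive (K := C_AbsRing) (V := C_NormedModule) f z l.
Proof.
  intro H. split; [apply is_linear_scal_l|].
  (* [is_derive] quantifies over all limits x of the filter at z; uniqueness of limits leaves only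
     z. *)
  intros x Hx. apply (@is_filter_lim_locally_unique _ (AbsRing_NormedModule C_AbsRing)) in Hx. subst x.
  intros eps. destruct (H (pos eps) (cond_pos eps)) as [d [D Hd]].
  exists (mkposreal _ D). intros y Hy. apply (Hd y). exact Hy.
Qed.

Lemma deriv_curve_is_derive (f : R -> C) t l :
  deriv_at RtoC f t l -> is_derive (K := R_AbsRing) (V := C_R_NormedModule) f t l.
Proof.
  intro H. split; [apply is_linear_scal_l|].
  intros x Hx. apply (@is_filter_lim_locally_unique _ (AbsRing_NormedModule R_AbsRing)) in Hx. subst x.
  intros eps. destruct (H (pos eps) (cond_pos eps)) as [d [D Hd]].
  exists (mkposreal _ D). intros y Hy. change (Rabs (y - t) < d) in Hy.
  specialize (Hd y). rewrite <- RtoC_minus, Cmod_R in Hd. specialize (Hd Hy).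
  eapply Rle_trans; [|exact Hd].
  rewrite <- Cmod_norm. right. apply f_equal. apply injective_projections; simpl;
    unfold minus, plus, opp, scal, mult; simpl; unfold mult; simpl; ring.
Qed.

Lemma deriv_real (f : R -> R) t l :
  is_derive f t l -> deriv_at RtoC (fun u => RtoC (f u)) t (RtoC l).
Proof.
  intros [_ H] eps He. specialize (H t (fun P HP => HP) (mkposreal eps He)).
  destruct H as [d Hd]. exists d; split; [apply cond_pos|].
  intros y Hy. rewrite <- RtoC_minus, Cmod_R in Hy.
  rewrite <- !RtoC_minus, <- RtoC_mult, <- RtoC_minus, !Cmod_R.
  exact (Hd y Hy).
Qed.

Lemma deriv_pair (f g : R -> R) t l m :
  is_derive f t l -> is_derive g t m ->
  deriv_at RtoC (fun u => (f u, g u)) t (l, m).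
Proof.
  intros Hf Hg.
  apply deriv_ext with (fun u => RtoC (f u) + Ci * RtoC (g u))%C.
  { intro u. apply injective_projections; simpl; ring. }
  eapply deriv_eq.
  - apply deriv_plus; [|apply deriv_scal]; apply deriv_real; eassumption.
  - apply injective_projections; simpl; ring.
Qed.

Lemma cont_curve_continuous (f : R -> C) t :
  cont_at RtoC f t -> continuous (T := R_UniformSpace) (U := C_UniformSpace) f t.
Proof.
  intro H. intros P HP. apply locally_C in HP. destruct HP as [e He].
  destruct (H (pos e) (cond_pos e)) as [d [D Hd]].
  exists (mkposreal _ D). intros y Hy. apply He. apply Hd.
  rewrite <- RtoC_minus, Cmod_R. exact Hy.
Qed.

Lemma cont_real (f : R -> R) t :
  continuous f t -> cont_at RtoC (fun u => RtoC (f u)) t.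
Proof.
  intros H e He.
  destruct (H (ball (f t) e)) as [d Hd].
  { now exists (mkposreal _ He). }
  exists d; split; [apply cond_pos|]. intros y Hy.
  rewrite <- RtoC_minus, Cmod_R in Hy. rewrite <- RtoC_minus, Cmod_R. exact (Hd y Hy).
Qed.

Lemma cont_Cmod (f : R -> C) t :
  cont_at RtoC f t -> continuous (fun u => Cmod (f u)) t.
Proof.
  intro H. intros P [e He]. destruct (H e (cond_pos e)) as [d [D Hd]].
  exists (mkposreal _ D). intros y Hy. apply He.
  assert (K : Cmod (f y - f t) < e).
  { apply Hd. rewrite <- RtoC_minus, Cmod_R. exact Hy. }
  change (Rabs (Cmod (f y) - Cmod (f t)) < e).
  generalize (Cmod_reverse (f y) (f t)) (Cmod_reverse (f t) (f y)).
  rewrite (Cmod_minus_sym (f t)). intros. apply Rabs_def1; lra.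
Qed.

(** ** Integrals of complex-valued functions of a real variable *)

Definition is_int (f : R -> C) (a b : R) (l : C) : Prop :=
  is_RInt (V := C_R_NormedModule) f a b l.

Definition int (f : R -> C) (a b : R) : C :=
  RInt (V := C_R_CompleteNormedModule) f a b.

Lemma is_int_unique f a b l : is_int f a b l -> int f a b = l.
Proof. apply (is_RInt_unique (V := C_R_CompleteNormedModule)). Qed.

Lemma int_correct f a b :
  a <= b -> (forall t, a <= t <= b -> cont_at RtoC f t) -> is_int f a b (int f a b).
Proof.
  intros Hab H. apply (RInt_correct (V := C_R_CompleteNormedModule)).
  apply (ex_RInt_continuous (V := C_R_CompleteNormedModule)).
  rewrite Rmin_left, Rmax_right by easy. intros z Hz.
  now apply cont_curve_continuous, H.
Qed.

Lemma is_int_ext f g a b l :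
  a <= b -> (forall t, a < t < b -> f t = g t) -> is_int f a b l -> is_int g a b l.
Proof.
  intros Hab H. apply is_RInt_ext. now rewrite Rmin_left, Rmax_right.
Qed.

Lemma is_int_plus f g a b l m :
  is_int f a b l -> is_int g a b m -> is_int (fun t => f t + g t)%C a b (l + m)%C.
Proof. apply (is_RInt_plus (V := C_R_NormedModule)). Qed.

(** The values live in C as a real normed module, where c is not a scalar, so the product is
    integrated by real and imaginary parts. *)
Lemma is_int_scal f a b l (c : C) :
  is_int f a b l -> is_int (fun t => c * f t)%C a b (c * l)%C.
Proof.
  intro H.
  assert (H1 := is_RInt_fct_extend_fst (U := R_NormedModule) (V := R_NormedModule) _ _ _ _ H).
  assert (H2 := is_RInt_fct_extend_snd (U := R_NormedModule) (V := R_NormedModule) _ _ _ _ H).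
  apply (is_RInt_fct_extend_pair (U := R_NormedModule) (V := R_NormedModule)).
  - apply (is_RInt_minus (V := R_NormedModule)
      (fun t => fst c * fst (f t)) (fun t => snd c * snd (f t)));
      now apply (is_RInt_scal (V := R_NormedModule)).
  - apply (is_RInt_plus (V := R_NormedModule)
      (fun t => fst c * snd (f t)) (fun t => snd c * fst (f t)));
      now apply (is_RInt_scal (V := R_NormedModule)).
Qed.

Lemma is_int_Chasles f a b c l m :
  is_int f a b l -> is_int f b c m -> is_int f a c (l + m)%C.
Proof. apply (is_RInt_Chasles (V := C_R_NormedModule)). Qed.

Lemma is_int_le f (g : R -> R) a b l m :
  a <= b -> (forall t, a <= t <= b -> Cmod (f t) <= g t) ->
  is_int f a b l -> is_RInt g a b m -> Cmod l <= m.
Proof.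
  intros Hab H Hf Hg. rewrite Cmod_norm.
  apply (norm_RInt_le (V := C_R_NormedModule) f g a b); auto.
  intros t Ht. rewrite <- Cmod_norm. auto.
Qed.

Lemma is_int_bound f a b l M :
  a <= b -> (forall t, a <= t <= b -> Cmod (f t) <= M) ->
  is_int f a b l -> Cmod l <= (b - a) * M.
Proof.
  intros Hab H Hf. apply (is_int_le f (fun _ => M) a b); auto.
  apply (is_RInt_const (V := R_NormedModule)).
Qed.

Lemma is_int_deriv F f a b :
  a <= b -> (forall t, a <= t <= b -> deriv_at RtoC F t (f t)) ->
  (forall t, a <= t <= b -> cont_at RtoC f t) -> is_int f a b (F b - F a)%C.
Proof.
  intros Hab H Hc. apply (is_RInt_derive (V := C_R_CompleteNormedModule));
    rewrite Rmin_left, Rmax_right by easy; intros t Ht.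
  - now apply deriv_curve_is_derive, H.
  - now apply cont_curve_continuous, Hc.
Qed.

Lemma cont_bounded (f : R -> C) a b :
  a <= b -> (forall t, a <= t <= b -> cont_at RtoC f t) ->
  exists M, forall t, a <= t <= b -> Cmod (f t) <= M.
Proof.
  intros Hab H.
  destruct (continuity_ab_maj (fun t => Cmod (f t)) a b Hab) as [x [Hx _]].
  - intros t Ht. apply continuity_pt_filterlim. now apply cont_Cmod, H.
  - now exists (Cmod (f x)).
Qed.

Lemma is_int_const (c : C) a b :
  a <= b -> is_int (fun _ => c) a b ((RtoC b - RtoC a) * c)%C.
Proof.
  intro Hab. replace ((b - a) * c)%C with (RtoC b * c - RtoC a * c)%C by ring.
  apply (is_int_deriv (fun t => RtoC t * c)%C); auto.
  - intros t _. eapply deriv_eq; [apply deriv_mult; [apply deriv_incl|apply deriv_const]|].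
    cbv beta; ring.
  - intros. apply cont_const.
Qed.

Lemma deriv_bound (F f : R -> C) a b M :
  a <= b -> (forall t, a <= t <= b -> deriv_at RtoC F t (f t)) ->
  (forall t, a <= t <= b -> cont_at RtoC f t) ->
  (forall t, a <= t <= b -> Cmod (f t) <= M) ->
  Cmod (F b - F a) <= (b - a) * M.
Proof.
  intros. apply (is_int_bound f); auto. now apply is_int_deriv.
Qed.

Lemma deriv_zero_const (F : R -> C) a b :
  a <= b -> (forall t, a <= t <= b -> deriv_at RtoC F t 0) -> F b = F a.
Proof.
  intros Hab H.
  assert (E : Cmod (F b - F a) <= (b - a) * 0).
  { apply deriv_bound with (fun _ => RtoC 0); auto.
    - intros. apply cont_const.
    - intros. rewrite Cmod_0. lra. }
  assert (E' : (F b - F a)%C = 0).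
  { apply Cmod_eq_0. generalize (Cmod_ge_0 (F b - F a)). lra. }
  replace (F b) with (F b - F a + F a)%C by ring. rewrite E'. ring.
Qed.

(** ** The complex exponential *)

Lemma Cexp_plus a b : Cexp (a + b) = (Cexp a * Cexp b)%C.
Proof.
  unfold Cexp, Re, Im. apply injective_projections; simpl; rewrite exp_plus, cos_plus, sin_plus; ring.
Qed.

Lemma Cexp_0 : Cexp 0 = 1.
Proof.
  unfold Cexp. apply injective_projections; simpl; rewrite exp_0, cos_0, sin_0; ring.
Qed.

Lemma Cexp_opp_mult a : (Cexp (- a) * Cexp a)%C = 1.
Proof. rewrite <- Cexp_plus, <- Cexp_0. f_equal. ring. Qed.

Lemma Cexp_neq_0 a : Cexp a <> 0.
Proof.
  intro E. generalize (Cexp_opp_mult a). rewrite E, Cmult_0_r.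
  intro H. apply RtoC_inj in H. lra.
Qed.

Lemma Cexp_opp a : Cexp (- a) = (/ Cexp a)%C.
Proof.
  assert (N := Cexp_neq_0 a).
  replace (Cexp (- a)) with (Cexp (- a) * Cexp a * / Cexp a)%C by (now field).
  rewrite Cexp_opp_mult. ring.
Qed.

Lemma Cexp_minus a b : Cexp (a - b) = (Cexp a / Cexp b)%C.
Proof. unfold Cminus. now rewrite Cexp_plus, Cexp_opp. Qed.

Lemma Cmod_Cexp a : Cmod (Cexp a) = exp (Re a).
Proof.
  unfold Cexp. rewrite Cmod_mult, Cmod_R, Rabs_pos_eq by (left; apply exp_pos).
  unfold Cmod; simpl. replace (_ + _) with 1.
  - rewrite sqrt_1. ring.
  - generalize (sin2_cos2 (Im a)). unfold Rsqr. simpl. intro; lra.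
Qed.

Lemma Cexp_real x : Cexp (RtoC x) = RtoC (exp x).
Proof.
  unfold Cexp. apply injective_projections; simpl; rewrite cos_0, sin_0; ring.
Qed.

Lemma Cexp_Ci (y : R) : Cexp (Ci * RtoC y) = (cos y, sin y).
Proof.
  unfold Cexp. replace (Re (Ci * RtoC y)) with 0 by (simpl; ring).
  replace (Im (Ci * RtoC y)) with y by (simpl; ring).
  rewrite exp_0. ring.
Qed.

Lemma Cexp_2PI : Cexp (Ci * RtoC (2 * PI)) = 1.
Proof. rewrite Cexp_Ci, cos_2PI, sin_2PI. reflexivity. Qed.

Lemma Cexp_PI : Cexp (Ci * RtoC PI) = (-1)%C.
Proof.
  rewrite Cexp_Ci, cos_PI, sin_PI. apply injective_projections; simpl; ring.
Qed.

(** The exponential is differentiated first along real lines, in coordinates. Integrating along the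
    segment from 0 to h then gives the Taylor bounds, and these give the complex derivative in
    [deriv_Cexp]. *)
Lemma deriv_Cexp_line (h : C) (t : R) :
  deriv_at RtoC (fun u => Cexp (RtoC u * h)) t (h * Cexp (RtoC t * h)).
Proof.
  destruct h as [x y].
  apply deriv_ext with (fun u => (exp (u * x) * cos (u * y), exp (u * x) * sin (u * y))).
  { intro u. unfold Cexp. apply injective_projections; simpl;
      replace (u * x - 0 * y) with (u * x) by ring;
      replace (u * y + 0 * x) with (u * y) by ring; ring. }
  eapply deriv_eq.
  - apply deriv_pair; auto_derive; auto; reflexivity.
  - unfold Cexp. apply injective_projections; simpl;
      replace (t * x - 0 * y) with (t * x) by ring;
      replace (t * y + 0 * x) with (t * y) by ring; ring.
Qed.

Lemma exp_le (x y : R) : x <= y -> exp x <= exp y.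
Proof. intros [H|H]; [left; now apply exp_increasing|rewrite H; apply Rle_refl]. Qed.

Lemma exp_le_1 (x : R) : x <= 0 -> exp x <= 1.
Proof. rewrite <- exp_0. apply exp_le. Qed.

Lemma Cexp_line_le (h : C) t : 0 <= t <= 1 -> Cmod (Cexp (RtoC t * h)) <= exp (Cmod h).
Proof.
  intro Ht. rewrite Cmod_Cexp.
  apply exp_le. eapply Rle_trans; [apply Rle_abs|].
  eapply Rle_trans; [apply re_le_Cmod|]. rewrite Cmod_mult, Cmod_R, Rabs_pos_eq by lra.
  rewrite <- (Rmult_1_l (Cmod h)) at 2. apply Rmult_le_compat_r; [apply Cmod_ge_0|lra].
Qed.

Lemma Cexp_m1_le h : Cmod (Cexp h - 1) <= Cmod h * exp (Cmod h).
Proof.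
  generalize (deriv_bound (fun u => Cexp (RtoC u * h)) (fun u => h * Cexp (RtoC u * h))%C
    0 1 (Cmod h * exp (Cmod h))).
  replace (RtoC 1 * h)%C with h by ring. replace (RtoC 0 * h)%C with (RtoC 0) by ring.
  rewrite Cexp_0. intro H.
  replace (Cmod h * exp (Cmod h)) with ((1 - 0) * (Cmod h * exp (Cmod h))) by ring.
  apply H; [lra| | |].
  - intros; apply deriv_Cexp_line.
  - intros. apply cont_mult; [apply cont_const|]. eapply deriv_cont, deriv_Cexp_line.
  - intros. rewrite Cmod_mult. apply Rmult_le_compat_l; [apply Cmod_ge_0|now apply Cexp_line_le].
Qed.

Lemma Cexp_m1_line_le h t :
  0 <= t <= 1 -> Cmod (Cexp (RtoC t * h) - 1) <= Cmod h * exp (Cmod h).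
Proof.
  intro Ht. eapply Rle_trans; [apply Cexp_m1_le|].
  assert (E : Cmod (RtoC t * h) <= Cmod h).
  { rewrite Cmod_mult, Cmod_R, Rabs_pos_eq by lra.
    rewrite <- (Rmult_1_l (Cmod h)) at 2. apply Rmult_le_compat_r; [apply Cmod_ge_0|lra]. }
  apply Rmult_le_compat; auto; try apply Cmod_ge_0; [left; apply exp_pos|].
  now apply exp_le.
Qed.

Lemma Cexp_taylor2 h : Cmod (Cexp h - 1 - h) <= Cmod h ^ 2 * exp (Cmod h).
Proof.
  generalize (deriv_bound (fun u => Cexp (RtoC u * h) - RtoC u * h)%C
    (fun u => h * (Cexp (RtoC u * h) - 1))%C 0 1 (Cmod h ^ 2 * exp (Cmod h))).
  replace (RtoC 1 * h)%C with h by ring. replace (RtoC 0 * h)%C with (RtoC 0) by ring.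
  rewrite Cexp_0. intro H.
  replace (Cexp h - 1 - h)%C with (Cexp h - h - (1 - 0))%C by ring.
  replace (Cmod h ^ 2 * exp (Cmod h)) with ((1 - 0) * (Cmod h ^ 2 * exp (Cmod h))) by ring.
  apply H; [lra| | |].
  - intros. eapply deriv_eq; [apply deriv_minus; [apply deriv_Cexp_line|]|].
    + apply deriv_ext with (fun u => h * RtoC u)%C; [intro; ring|].
      apply deriv_scal, deriv_incl.
    + ring.
  - intros. apply cont_mult; [apply cont_const|]. apply cont_minus; [|apply cont_const].
    eapply deriv_cont, deriv_Cexp_line.
  - intros. rewrite Cmod_mult. replace (Cmod h ^ 2 * exp (Cmod h))
      with (Cmod h * (Cmod h * exp (Cmod h))) by ring.
    apply Rmult_le_compat_l; [apply Cmod_ge_0|now apply Cexp_m1_line_le].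
Qed.

Lemma deriv_Cexp z : deriv_at cid Cexp z (Cexp z).
Proof.
  assert (P := proj1 (Cmod_gt_0 _) (Cexp_neq_0 z)). set (r := Cmod (Cexp z)) in *.
  assert (Q := exp_pos 1).
  intros e He. exists (Rmin 1 (e / (r * exp 1))); split.
  { apply Rmin_pos; [lra|]. apply Rdiv_lt_0_compat; auto. now apply Rmult_lt_0_compat. }
  unfold cid. intros w Hw.
  assert (K1 := Rlt_le_trans _ _ _ Hw (Rmin_l _ _)).
  assert (K2 := Rlt_le_trans _ _ _ Hw (Rmin_r _ _)).
  replace (Cexp w) with (Cexp z * Cexp (w - z))%C.
  2:{ rewrite <- Cexp_plus. f_equal. ring. }
  replace (Cexp z * Cexp (w - z) - Cexp z - (w - z) * Cexp z)%C
    with (Cexp z * (Cexp (w - z) - 1 - (w - z)))%C by ring.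
  rewrite Cmod_mult. fold r. set (h := (w - z)%C) in *.
  assert (H0 := Cmod_ge_0 h).
  apply Rle_trans with (r * (Cmod h * Cmod h * exp 1)).
  - apply Rmult_le_compat_l; [lra|]. eapply Rle_trans; [apply Cexp_taylor2|].
    replace (Cmod h ^ 2) with (Cmod h * Cmod h) by ring.
    apply Rmult_le_compat_l; [now apply Rmult_le_pos|]. apply exp_le. lra.
  - replace (r * (Cmod h * Cmod h * exp 1)) with (Cmod h * (r * exp 1) * Cmod h) by ring.
    apply Rmult_le_compat_r; auto.
    apply Rle_trans with (e / (r * exp 1) * (r * exp 1)).
    + apply Rmult_le_compat_r; [apply Rmult_le_pos; lra|lra].
    + right. field. lra.
Qed.

Lemma deriv_exp {T} (i f : T -> C) t l :
  deriv_at i f t l -> deriv_at i (fun u => Cexp (f u)) t (Cexp (f t) * l).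
Proof. intro H. apply (deriv_comp i Cexp); [apply deriv_Cexp|easy]. Qed.

Lemma cont_exp {T} (i f : T -> C) t :
  cont_at i f t -> cont_at i (fun u => Cexp (f u)) t.
Proof. intro H. apply (cont_comp i Cexp); auto. eapply deriv_cont, deriv_Cexp. Qed.

(** ** Improper integrals *)

(** Continuity on the whole ray is part of the notion: it guarantees that each [int f a b] is a true
    integral and not the default value of a total function. *)
Definition is_tail (f : R -> C) (a : R) (l : C) : Prop :=
  (forall t, a <= t -> cont_at RtoC f t) /\
  (forall eps, 0 < eps -> exists B, a <= B /\
     forall b, B <= b -> Cmod (int f a b - l) < eps).

Definition tail (f : R -> C) (a : R) : C :=
  RInt_gen (V := C_R_CompleteNormedModule) f (at_point a) (Rbar_locally p_infty).

Lemma is_tail_int f a l b :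
  is_tail f a l -> a <= b -> is_int f a b (int f a b).
Proof. intros [H _] Hb. apply int_correct; auto. intros; apply H; lra. Qed.

Lemma is_tail_RInt_gen f a l :
  is_tail f a l ->
  is_RInt_gen (V := C_R_NormedModule) f (at_point a) (Rbar_locally p_infty) l.
Proof.
  intro T. intros P HP. apply locally_C in HP. destruct HP as [e He].
  destruct (proj2 T e (cond_pos e)) as [B [HB H]].
  apply Filter_prod with (fun x => x = a) (fun b => B < b).
  - reflexivity.
  - now exists B.
  - intros x b -> Hb. simpl. exists (int f a b); split.
    + eapply is_tail_int; [exact T|lra].
    + apply He. apply H. lra.
Qed.

Lemma is_tail_tail f a l : is_tail f a l -> tail f a = l.
Proof.
  intro H. unfold tail.
  apply (is_RInt_gen_unique (V := C_R_CompleteNormedModule)).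
  now apply is_tail_RInt_gen.
Qed.

Lemma is_tail_ext f g a l :
  (forall t, f t = g t) -> is_tail f a l -> is_tail g a l.
Proof.
  intros E [H1 H2]. split.
  - intros t Ht. apply cont_ext with f; auto.
  - intros e He. destruct (H2 e He) as [B [HB H]]. exists B; split; auto.
    intros b Hb. replace (int g a b) with (int f a b); auto.
    symmetry. apply is_int_unique. apply is_int_ext with f; auto; [lra|].
    apply int_correct; [lra|]. intros; apply H1; lra.
Qed.

Lemma is_tail_plus f g a l m :
  is_tail f a l -> is_tail g a m -> is_tail (fun t => f t + g t)%C a (l + m).
Proof.
  intros Hf Hg. split.
  - intros t Ht. apply cont_plus; [apply Hf|apply Hg]; auto.
  - intros e He. destruct (proj2 Hf (e / 2)) as [B1 [HB1 H1]]; [lra|].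
    destruct (proj2 Hg (e / 2)) as [B2 [HB2 H2]]; [lra|].
    exists (Rmax B1 B2); split; [apply Rle_trans with (2 := Rmax_l _ _); lra|].
    intros b Hb.
    assert (A1 : B1 <= b) by (apply Rle_trans with (1 := Rmax_l B1 B2); lra).
    assert (A2 : B2 <= b) by (apply Rle_trans with (1 := Rmax_r B1 B2); lra).
    rewrite (is_int_unique _ _ _ (int f a b + int g a b)%C).
    2:{ apply is_int_plus; eapply is_tail_int; eauto; lra. }
    replace (int f a b + int g a b - (l + m))%C
      with ((int f a b - l) + (int g a b - m))%C by ring.
    eapply Rle_lt_trans; [apply Cmod_triangle|].
    specialize (H1 b A1). specialize (H2 b A2). lra.
Qed.

Lemma is_tail_scal f a l (c : C) :
  is_tail f a l -> is_tail (fun t => c * f t)%C a (c * l).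
Proof.
  intros Hf. split.
  - intros t Ht. apply cont_mult; [apply cont_const|now apply Hf].
  - intros e He. assert (P : 0 < Cmod c + 1) by (generalize (Cmod_ge_0 c); lra).
    destruct (proj2 Hf (e / (Cmod c + 1))) as [B [HB H]]; [now apply Rdiv_lt_0_compat|].
    exists B; split; auto. intros b Hb.
    rewrite (is_int_unique _ _ _ (c * int f a b)%C).
    2:{ apply is_int_scal. eapply is_tail_int; eauto; lra. }
    replace (c * int f a b - c * l)%C with (c * (int f a b - l))%C by ring.
    rewrite Cmod_mult. specialize (H b Hb).
    apply Rle_lt_trans with ((Cmod c + 1) * Cmod (int f a b - l)).
    { apply Rmult_le_compat_r; [apply Cmod_ge_0|lra]. }
    apply Rlt_le_trans with ((Cmod c + 1) * (e / (Cmod c + 1))).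
    + apply Rmult_lt_compat_l; lra.
    + right. field. lra.
Qed.

Lemma is_tail_Chasles f a b l :
  a <= b -> (forall t, a <= t <= b -> cont_at RtoC f t) ->
  is_tail f b l -> is_tail f a (int f a b + l).
Proof.
  intros Hab Hc Hf. split.
  - intros t Ht. destruct (Rle_dec t b); [apply Hc; lra|]. apply Hf; lra.
  - intros e He. destruct (proj2 Hf e He) as [B [HB H]]. exists B; split; [lra|].
    intros x Hx. rewrite (is_int_unique f a x (int f a b + int f b x)%C).
    2:{ apply is_int_Chasles with b; [now apply int_correct|].
        eapply is_tail_int; eauto; lra. }
    replace (int f a b + int f b x - (int f a b + l))%C with (int f b x - l)%C by ring.
    now apply H.
Qed.

Lemma is_tail_deriv F f a L :
  (forall t, a <= t -> deriv_at RtoC F t (f t)) ->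
  (forall t, a <= t -> cont_at RtoC f t) ->
  (forall eps, 0 < eps -> exists B, a <= B /\ forall b, B <= b -> Cmod (F b - L) < eps) ->
  is_tail f a (L - F a).
Proof.
  intros HF Hc HL. split; auto. intros e He.
  destruct (HL e He) as [B [HB H]]. exists B; split; auto. intros b Hb.
  rewrite (is_int_unique f a b (F b - F a)%C).
  2:{ apply is_int_deriv; [lra| |]; intros; [apply HF|apply Hc]; lra. }
  replace (F b - F a - (L - F a))%C with (F b - L)%C by ring. auto.
Qed.

Lemma RInt_exp_decay c a b M :
  0 < c -> is_RInt (fun t => M * exp (- c * t)) a b
    (M / c * exp (- c * a) - M / c * exp (- c * b)).
Proof.
  intro Hc.
  replace (M / c * exp (- c * a) - M / c * exp (- c * b))
    with (minus (- (M / c) * exp (- c * b)) (- (M / c) * exp (- c * a)))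
    by (unfold minus, plus, opp; simpl; ring).
  apply (is_RInt_derive (V := R_CompleteNormedModule)
           (fun t => - (M / c) * exp (- c * t)) (fun t => M * exp (- c * t))).
  - intros t _. auto_derive; auto. field. lra.
  - intros t _. apply (ex_derive_continuous (fun t => M * exp (- c * t))).
    auto_derive; auto.
Qed.

Lemma exp_decay_small M c eps :
  0 < c -> 0 < eps -> exists B, 0 <= B /\ forall t, B <= t -> M * exp (- c * t) < eps.
Proof.
  intros Hc He.
  (* From exp(c t) >= 1 + c t > c t it is enough that eps c t >= |M|. *)
  exists (Rmax 0 (Rabs M / (eps * c))). split; [apply Rmax_l|]. intros t Ht.
  assert (T0 : 0 <= t) by (apply Rle_trans with (1 := Rmax_l _ _) (2 := Ht)).
  assert (T1 : Rabs M / (eps * c) <= t) by (apply Rle_trans with (1 := Rmax_r _ _) (2 := Ht)).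
  assert (P := exp_pos (c * t)).
  replace (- c * t) with (- (c * t)) by ring. rewrite exp_Ropp.
  apply Rmult_lt_reg_r with (exp (c * t)); auto.
  rewrite Rmult_assoc, Rinv_l, Rmult_1_r by lra.
  assert (Q := exp_ineq1_le (c * t)).
  apply Rle_lt_trans with (Rabs M); [apply Rle_abs|].
  apply Rle_lt_trans with (eps * (c * t)).
  - replace (Rabs M) with (eps * c * (Rabs M / (eps * c))) by (field; lra).
    rewrite <- Rmult_assoc. apply Rmult_le_compat_l; [|easy].
    apply Rmult_le_pos; lra.
  - apply Rmult_lt_compat_l; lra.
Qed.

(** Cauchy's criterion: two partial integrals differ by at most the corresponding piece of the
    integral of M exp(-c t). The bound on the limit is the same estimate started at a. *)
Lemma tail_ex f a M c :
  0 < c -> (forall t, a <= t -> cont_at RtoC f t) ->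
  (forall t, a <= t -> Cmod (f t) <= M * exp (- c * t)) ->
  is_tail f a (tail f a) /\ Cmod (tail f a) <= M / c * exp (- c * a).
Proof.
  intros Hc Hf Hb.
  assert (I : forall x y, a <= x -> x <= y ->
    Cmod (int f a y - int f a x) <= M / c * exp (- c * x) - M / c * exp (- c * y)).
  { intros x y Hx Hy.
    replace (int f a y) with (int f a x + int f x y)%C.
    2:{ symmetry. apply is_int_unique. apply is_int_Chasles with x;
        apply int_correct; try lra; intros; apply Hf; lra. }
    replace (int f a x + int f x y - int f a x)%C with (int f x y) by ring.
    apply is_int_le with f (fun t => M * exp (- c * t)) x y; auto.
    - intros; apply Hb; lra.
    - apply int_correct; auto. intros; apply Hf; lra.
    - now apply RInt_exp_decay. }
  assert (M0 : 0 <= M).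
  { apply Rmult_le_reg_r with (exp (- c * a)); [apply exp_pos|].
    rewrite Rmult_0_l. apply Rle_trans with (Cmod (f a)); [apply Cmod_ge_0|].
    apply Hb; lra. }
  assert (Mc : 0 <= M / c) by (apply Rdiv_le_0_compat; lra).
  assert (EX : exists l, is_tail f a l).
  { destruct (proj1 (filterlim_locally_cauchy (U := C_R_CompleteNormedModule)
       (F := Rbar_locally p_infty) (fun b => int f a b))) as [l Hl].
    - intros eps. destruct (exp_decay_small (M / c) c eps Hc (cond_pos eps)) as [B [HB HB']].
      exists (fun b => Rmax a B < b). split; [now exists (Rmax a B)|].
      assert (W : forall u v, Rmax a B < u -> u <= v -> Cmod (int f a v - int f a u) < eps).
      { intros u v Hu Huv.
        assert (a < u) by (apply Rle_lt_trans with (1 := Rmax_l a B); lra).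
        assert (B < u) by (apply Rle_lt_trans with (1 := Rmax_r a B); lra).
        eapply Rle_lt_trans; [apply I; lra|].
        assert (0 <= M / c * exp (- c * v)).
        { apply Rmult_le_pos; auto. left; apply exp_pos. }
        specialize (HB' u). lra. }
      intros u v Hu Hv.
      assert (W2 : Cmod (int f a v - int f a u) < eps).
      { destruct (Rle_dec u v) as [L|L]; [now apply W|].
        rewrite Cmod_minus_sym. apply W; auto; lra. }
      split.
      + eapply Rle_lt_trans; [|exact W2].
        apply Rle_trans with (2 := Rmax_Cmod _). apply Rmax_l.
      + eapply Rle_lt_trans; [|exact W2].
        apply Rle_trans with (2 := Rmax_Cmod _). apply Rmax_r.
    - exists l. split; auto. intros e He.
      assert (L : locally l (fun w : C_UniformSpace => Cmod (w - l)%C < e)).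
      { apply locally_C. exists (mkposreal _ He). intros y Hy. exact Hy. }
      destruct (Hl _ L) as [B HB]. exists (Rmax a (B + 1)); split; [apply Rmax_l|].
      intros b Hb'. apply HB. generalize (Rmax_r a (B + 1)). lra. }
  destruct EX as [l Hl]. rewrite (is_tail_tail _ _ _ Hl). split; auto.
  apply le_epsilon. intros e He. destruct (proj2 Hl e He) as [B [HB H]].
  specialize (H B (Rle_refl _)). specialize (I a B (Rle_refl _) HB).
  assert (Z : int f a a = 0).
  { apply is_int_unique. apply (is_RInt_point (V := C_R_NormedModule)). }
  rewrite Z in I.
  assert (0 <= M / c * exp (- c * B)).
  { apply Rmult_le_pos; auto. left; apply exp_pos. }
  replace l with (int f a B - 0 - (int f a B - l))%C by ring.
  eapply Rle_trans; [apply Cmod_triangle_minus|]. lra.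
Qed.

(** [RInt_gen] picks its value by description, so integrands equal on the ray have the same [tail]
    even without convergence: the predicates being described coincide. *)
Lemma tail_ext_on f g a : (forall t, a <= t -> f t = g t) -> tail f a = tail g a.
Proof.
  intro E. unfold tail, RInt_gen. apply (f_equal (@iota C_R_CompleteNormedModule)).
  apply functional_extensionality. intro l.
  apply propositional_extensionality. split; intro H.
  - eapply is_RInt_gen_ext; [|exact H].
    apply Filter_prod with (fun x => x = a) (fun b => a < b); [easy|now exists a|].
    intros x b -> Hb t. simpl. rewrite Rmin_left by lra. intros; apply E; lra.
  - eapply is_RInt_gen_ext; [|exact H].
    apply Filter_prod with (fun x => x = a) (fun b => a < b); [easy|now exists a|].
    intros x b -> Hb t. simpl. rewrite Rmin_left by lra. intros; symmetry; apply E; lra.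
Qed.

Lemma int_ext_on f g a b : a <= b -> (forall t, a < t < b -> f t = g t) -> int f a b = int g a b.
Proof.
  intros Hab H. apply (RInt_ext (V := C_R_CompleteNormedModule)).
  now rewrite Rmin_left, Rmax_right.
Qed.

Global Opaque int tail.

(** ** Primitives of holomorphic functions on convex domains *)

Lemma cont_Re (z : C) : cont_at cid (fun p => RtoC (Re p)) z.
Proof.
  intros e He; exists e; split; auto. unfold cid. intros w Hw.
  rewrite <- RtoC_minus, Cmod_R. eapply Rle_lt_trans; [|exact Hw].
  exact (re_le_Cmod (w - z)).
Qed.

Lemma cont_Im (z : C) : cont_at cid (fun p => RtoC (Im p)) z.
Proof.
  intros e He; exists e; split; auto. unfold cid. intros w Hw.
  rewrite <- RtoC_minus, Cmod_R. eapply Rle_lt_trans; [|exact Hw].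
  exact (Im_le_Cmod (w - z)).
Qed.

(** Heine's theorem, applied to real and imaginary parts. The displacement is in the first variable,
    the parameter in a differentiation under the integral sign. *)
Lemma rectangle_uniform (f : C -> C) a b c d :
  (forall x y, a <= x <= b -> c <= y <= d -> cont_at cid f (x, y)) ->
  forall eps, 0 < eps -> exists del, 0 < del /\
  forall x y x', a <= x <= b -> c <= y <= d -> a <= x' <= b ->
    Rabs (x' - x) < del -> Cmod (f (x', y) - f (x, y)) < eps.
Proof.
  intros H eps He.
  assert (W : forall (p : C -> R), (forall z, Rabs (p z) <= Cmod z) ->
    (forall z w, p (z - w)%C = p z - p w) ->
    exists del, 0 < del /\ forall x y x', a <= x <= b -> c <= y <= d -> a <= x' <= b ->
    Rabs (x' - x) < del -> Rabs (p (f (x', y) - f (x, y))%C) < eps / 2).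
  { intros p Hp Hlin. assert (He2 : 0 < eps / 2) by lra.
    destruct (uniform_continuity_2d (fun x y => p (f (x, y))) a b c d) with (eps := mkposreal _ He2)
      as [del Hd].
    - intros x y Hx Hy e. destruct (H x y Hx Hy e (cond_pos e)) as [dd [D Hdd]].
      assert (P : 0 < dd / 2) by lra. exists (mkposreal _ P). simpl. intros u v Hu Hv.
      rewrite <- Hlin. eapply Rle_lt_trans; [apply Hp|]. apply Hdd. unfold cid.
      replace ((u, v) - (x, y))%C with (RtoC (u - x) + Ci * RtoC (v - y))%C
        by (apply injective_projections; simpl; ring).
      eapply Rle_lt_trans; [apply Cmod_triangle|].
      rewrite Cmod_mult, Cmod_Ci, !Cmod_R. lra.
    - exists del; split; [apply cond_pos|]. intros x y x' Hx Hy Hx' Hd'.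
      rewrite Hlin. apply Hd; auto. rewrite Rminus_diag, Rabs_R0. apply cond_pos. }
  destruct (W Re re_le_Cmod) as [d1 [D1 H1]]; [reflexivity|].
  destruct (W Im Im_le_Cmod) as [d2 [D2 H2]]; [reflexivity|].
  exists (Rmin d1 d2); split; [now apply Rmin_pos|]. intros x y x' Hx Hy Hx' Hd.
  specialize (H1 x y x' Hx Hy Hx' (Rlt_le_trans _ _ _ Hd (Rmin_l _ _))).
  specialize (H2 x y x' Hx Hy Hx' (Rlt_le_trans _ _ _ Hd (Rmin_r _ _))).
  set (z := (f (x', y) - f (x, y))%C) in *.
  replace z with (RtoC (Re z) + Ci * RtoC (Im z))%C
    by (destruct z; apply injective_projections; simpl; ring).
  eapply Rle_lt_trans; [apply Cmod_triangle|].
  rewrite Cmod_mult, Cmod_Ci, !Cmod_R. lra.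
Qed.

Lemma cont_slice (f : C -> C) x y :
  cont_at cid f (x, y) -> cont_at RtoC (fun t => f (x, t)) y.
Proof.
  intros H e He. destruct (H e He) as [d [D Hd]]. exists d; split; auto.
  intros t Ht. apply Hd. unfold cid.
  replace ((x, t) - (x, y))%C with (Ci * (t - y))%C
    by (apply injective_projections; simpl; ring).
  now rewrite Cmod_mult, Cmod_Ci, Rmult_1_l.
Qed.

(** Differentiation under the integral sign; a complex number (u, t) merely packs the parameter and
    the integration variable. The mean value bound is applied to k(v, t) - v k'(u0, t), whose
    v-derivative is uniformly small in t. *)
Lemma deriv_int_param (k k' : C -> C) u0 r a b :
  0 < r -> a <= b ->
  (forall u t, u0 - r <= u <= u0 + r -> a <= t <= b ->
     cont_at cid k (u, t) /\ cont_at cid k' (u, t) /\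
     deriv_at RtoC (fun v => k (v, t)) u (k' (u, t))) ->
  deriv_at RtoC (fun u => int (fun t => k (u, t)) a b) u0 (int (fun t => k' (u0, t)) a b).
Proof.
  intros Hr Hab H e He.
  (* The added 1 keeps the quotient meaningful when a = b. *)
  assert (Q : 0 < e / (b - a + 1)) by (apply Rdiv_lt_0_compat; lra).
  destruct (rectangle_uniform k' (u0 - r) (u0 + r) a b) with (eps := e / (b - a + 1))
    as [del [D Hd]]; auto.
  { intros x y Hx Hy. now apply H. }
  exists (Rmin r del); split; [now apply Rmin_pos|]. intros u Hu.
  rewrite <- RtoC_minus, Cmod_R in Hu.
  assert (K1 := Rlt_le_trans _ _ _ Hu (Rmin_l _ _)).
  assert (K2 := Rlt_le_trans _ _ _ Hu (Rmin_r _ _)).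
  assert (K1' : u0 - r <= u <= u0 + r) by (apply Rabs_lt_between in K1; lra).
  assert (I : is_int (fun t => k (u, t) + (- (1)) * k (u0, t)
      + (- (RtoC u - RtoC u0)) * k' (u0, t))%C a b
     (int (fun t => k (u, t)) a b + (- (1)) * int (fun t => k (u0, t)) a b
       + (- (RtoC u - RtoC u0)) * int (fun t => k' (u0, t)) a b)%C).
  { apply is_int_plus; [apply is_int_plus; [|apply is_int_scal]|apply is_int_scal];
      (apply int_correct; [exact Hab|]); intros t Ht; apply cont_slice; apply H; lra. }
  replace (int (fun t => k (u, t)) a b - int (fun t => k (u0, t)) a b -
    (u - u0) * int (fun t => k' (u0, t)) a b)%C
    with (int (fun t => k (u, t)) a b + (- (1)) * int (fun t => k (u0, t)) a b
       + (- (RtoC u - RtoC u0)) * int (fun t => k' (u0, t)) a b)%C by ring.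
  assert (EU : Cmod (RtoC u - RtoC u0) = Rabs (u - u0))
    by (rewrite <- RtoC_minus; apply Cmod_R).
  rewrite EU.
  apply Rle_trans with ((b - a) * (e / (b - a + 1) * Rabs (u - u0))).
  2:{ rewrite <- Rmult_assoc. apply Rmult_le_compat_r; [apply Rabs_pos|].
      apply Rle_trans with ((b - a + 1) * (e / (b - a + 1))).
      - apply Rmult_le_compat_r; lra.
      - right; field; lra. }
  eapply is_int_bound; [exact Hab| |exact I].
  intros t Ht.
  assert (Hu0 : u0 - r <= u0 <= u0 + r) by lra.
  destruct (Rle_dec u0 u) as [L|L].
  - generalize (deriv_bound (fun v => k (v, t) - RtoC v * k' (u0, t))%C
      (fun v => k' (v, t) - k' (u0, t))%C u0 u (e / (b - a + 1)) L). intro G.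
    replace (k (u, t) + - (1) * k (u0, t) + - (u - u0) * k' (u0, t))%C
      with (k (u, t) - u * k' (u0, t) - (k (u0, t) - u0 * k' (u0, t)))%C by ring.
    rewrite (Rabs_pos_eq (u - u0)), Rmult_comm by lra. apply G.
    + intros v Hv. apply deriv_minus; [apply H; auto; lra|].
      eapply deriv_eq; [apply deriv_mult; [apply deriv_incl|apply deriv_const]|cbv beta; ring].
    + intros v Hv. apply cont_minus; [|apply cont_const].
      apply (cont_comp RtoC k' (fun v => (v, t))); [apply H; auto; lra|].
      intros e' He'; exists e'; split; auto. intros v' Hv'.
      replace ((v', t) - (v, t))%C with (v' - v)%C; [easy|].
      apply injective_projections; simpl; ring.
    + intros v Hv. left. apply Hd; auto; try lra. rewrite Rabs_pos_eq by lra.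
      rewrite Rabs_pos_eq in K2 by lra. lra.
  - generalize (deriv_bound (fun v => k (v, t) - RtoC v * k' (u0, t))%C
      (fun v => k' (v, t) - k' (u0, t))%C u u0 (e / (b - a + 1))). intro G.
    rewrite <- Cmod_opp.
    replace (- (k (u, t) + - (1) * k (u0, t) + - (u - u0) * k' (u0, t)))%C
      with (k (u0, t) - u0 * k' (u0, t) - (k (u, t) - u * k' (u0, t)))%C by ring.
    rewrite Rabs_minus_sym, (Rabs_pos_eq (u0 - u)), Rmult_comm by lra. apply G; [lra| | |].
    + intros v Hv. apply deriv_minus; [apply H; auto; lra|].
      eapply deriv_eq; [apply deriv_mult; [apply deriv_incl|apply deriv_const]|cbv beta; ring].
    + intros v Hv. apply cont_minus; [|apply cont_const].
      apply (cont_comp RtoC k' (fun v => (v, t))); [apply H; auto; lra|].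
      intros e' He'; exists e'; split; auto. intros v' Hv'.
      replace ((v', t) - (v, t))%C with (v' - v)%C; [easy|].
      apply injective_projections; simpl; ring.
    + intros v Hv. left. apply Hd; auto; try lra. rewrite Rabs_minus_sym, Rabs_pos_eq by lra.
      rewrite Rabs_minus_sym, Rabs_pos_eq in K2 by lra. lra.
Qed.

(** The derivative is required to be continuous: this permits differentiation under the integral
    sign in [holo_primitive], in place of Goursat's subdivision argument. *)
Definition holo (D : C -> Prop) (f : C -> C) : Prop :=
  exists f', forall z, D z -> deriv_at cid f z (f' z) /\ cont_at cid f' z.

Definition opened (D : C -> Prop) : Prop :=
  forall z, D z -> exists r, 0 < r /\ forall w, Cmod (w - z) < r -> D w.

Definition convex (D : C -> Prop) : Prop :=
  forall z w t, D z -> D w -> 0 <= t <= 1 -> D (z + RtoC t * (w - z))%C.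

Lemma holo_deriv_ex D f z : holo D f -> D z -> exists l, deriv_at cid f z l.
Proof. intros [f' H] Hz. exists (f' z). now apply H. Qed.

Lemma holo_cont D f z : holo D f -> D z -> cont_at cid f z.
Proof. intros [f' H] Hz. eapply deriv_cont. now apply H. Qed.

(** The primitive at z is the integral over the segment from c to z. Its increment from z to z + h
    is the integral over the segment between them, that is, Cauchy's theorem for the triangle c, z,
    z + h. This is proved by sliding the endpoint along z + u h and differentiating in u. *)
Theorem holo_primitive D f c :
  opened D -> convex D -> D c -> holo D f ->
  exists P, forall z, D z -> deriv_at cid P z (f z).
Proof.
  intros HO HC Hc [f' Hf].
  exists (fun z => (z - c) * int (fun t => f (c + RtoC t * (z - c))) 0 1)%C.
  (* The margin 1 on both sides of [0, 1] is the neighbourhood that [deriv_int_param] asks for at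
     the end values u = 0 and u = 1. *)
  assert (Key : forall z h, (forall u, -1 <= u <= 2 -> D (z + RtoC u * h)%C) ->
    ((z + h - c) * int (fun t => f (c + RtoC t * (z + h - c))) 0 1
     - (z - c) * int (fun t => f (c + RtoC t * (z - c))) 0 1
     = h * int (fun u => f (z + RtoC u * h)) 0 1)%C).
  { intros z h HD.
    set (v := fun p : C => (z - c + RtoC (Re p) * h)%C).
    set (pt := fun p : C => (c + RtoC (Im p) * v p)%C).
    set (k := fun p : C => (v p * f (pt p))%C).
    set (k' := fun p : C => (h * f (pt p) + v p * (RtoC (Im p) * h * f' (pt p)))%C).
    assert (Dpt : forall u t, -1 <= u <= 2 -> 0 <= t <= 1 -> D (pt (u, t))).
    { intros u t Hu Ht. unfold pt, v. simpl.
      replace (z - c + RtoC u * h)%C with ((z + RtoC u * h) - c)%C by ring.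
      apply HC; auto. }
    assert (cv : forall p, cont_at cid v p).
    { intro p. unfold v. apply cont_plus; [apply cont_const|].
      apply cont_mult; [apply cont_Re|apply cont_const]. }
    assert (cpt : forall p, cont_at cid pt p).
    { intro p. unfold pt. apply cont_plus; [apply cont_const|].
      apply cont_mult; [apply cont_Im|apply cv]. }
    assert (DP : forall u0, 0 <= u0 <= 1 ->
      deriv_at RtoC (fun u => int (fun t => k (u, t)) 0 1) u0
        (h * f (z + RtoC u0 * h))%C).
    { intros u0 Hu0.
      replace (h * f (z + RtoC u0 * h))%C with (int (fun t => k' (u0, t)) 0 1).
      - apply deriv_int_param with 1; try lra. intros u t Hu Ht.
        assert (Hd : D (pt (u, t))) by (apply Dpt; lra).
        destruct (Hf _ Hd) as [F1 F2].
        assert (F3 := deriv_cont _ _ _ _ F1).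
        repeat split.
        + unfold k. apply cont_mult; auto. apply (cont_comp cid f pt); auto.
        + unfold k'. apply cont_plus.
          * apply cont_mult; [apply cont_const|]. apply (cont_comp cid f pt); auto.
          * apply cont_mult; auto. apply cont_mult.
            -- apply cont_mult; [apply cont_Im|apply cont_const].
            -- apply (cont_comp cid f' pt); auto.
        + assert (dv : deriv_at RtoC (fun x => v (x, t)) u h).
          { unfold v; simpl. eapply deriv_eq.
            - apply deriv_plus; [apply deriv_const|].
              apply deriv_mult; [apply deriv_incl|apply deriv_const].
            - cbv beta; ring. }
          unfold k. eapply deriv_eq.
          * apply deriv_mult; [exact dv|].
            apply (deriv_comp RtoC f (fun x => pt (x, t))); [exact F1|].
            unfold pt. simpl. apply deriv_plus; [apply deriv_const|].
            apply deriv_scal. exact dv.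
          * unfold k'. simpl. ring.
      - apply is_int_unique.
        replace (h * f (z + RtoC u0 * h))%C
          with ((fun t => h * (RtoC t * f (pt (u0, t)))) 1
               - (fun t => h * (RtoC t * f (pt (u0, t)))) 0)%C.
        2:{ unfold pt, v; simpl.
            replace (c + 1 * (z - c + u0 * h))%C with (z + u0 * h)%C by ring. ring. }
        (* The u-derivative of the integrand is exact in t: it is the t-derivative of h t f(c + t
           v). Hence its integral over [0, 1] is the single endpoint value h f(z + u0 h). *)
        apply (is_int_deriv (fun t => h * (RtoC t * f (pt (u0, t))))%C
                 (fun t => k' (u0, t)) 0 1); [lra| |].
        + intros t Ht. assert (Hd : D (pt (u0, t))) by (apply Dpt; lra).
          destruct (Hf _ Hd) as [F1 F2].
          eapply deriv_eq.
          * apply deriv_scal. apply deriv_mult; [apply deriv_incl|].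
            apply (deriv_comp RtoC f (fun x => pt (u0, x))); [exact F1|].
            unfold pt. simpl. apply deriv_plus; [apply deriv_const|].
            apply deriv_mult; [apply deriv_incl|].
            apply (deriv_const RtoC (z - c + RtoC u0 * h)%C).
          * unfold k', v. simpl. ring.
        + intros t Ht. apply cont_slice.
          assert (Hd : D (pt (u0, t))) by (apply Dpt; lra).
          destruct (Hf _ Hd) as [F1 F2]. assert (F3 := deriv_cont _ _ _ _ F1).
          unfold k'. apply cont_plus.
          * apply cont_mult; [apply cont_const|]. apply (cont_comp cid f pt); auto.
          * apply cont_mult; auto. apply cont_mult.
            -- apply cont_mult; [apply cont_Im|apply cont_const].
            -- apply (cont_comp cid f' pt); auto. }
    assert (ci : forall u, 0 <= u <= 1 -> cont_at RtoC (fun u => f (z + RtoC u * h)%C) u).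
    { intros u Hu. apply (cont_comp RtoC f (fun u => z + RtoC u * h)%C).
      - eapply deriv_cont. apply Hf, HD; lra.
      - apply cont_plus; [apply cont_const|].
        apply cont_mult; [apply cont_incl|apply cont_const]. }
    assert (E := is_int_deriv _ _ 0 1 Rle_0_1 DP).
    assert (E2 : is_int (fun u => h * f (z + RtoC u * h))%C 0 1
                  (h * int (fun u => f (z + RtoC u * h)) 0 1)%C).
    { apply is_int_scal, int_correct; [lra|auto]. }
    assert (E3 := E (fun u Hu => cont_mult RtoC (fun _ => h) _ u (cont_const RtoC h u) (ci u Hu))).
    cbv beta in E3.
    rewrite <- (is_int_unique _ _ _ _ E2), (is_int_unique _ _ _ _ E3).
    assert (M : forall u, -1 <= u <= 2 -> int (fun t => k (u, t)) 0 1
       = ((z - c + RtoC u * h) * int (fun t => f (c + RtoC t * (z - c + RtoC u * h))) 0 1)%C).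
    { intros u Hu. apply is_int_unique. apply is_int_scal. apply int_correct; [lra|].
      intros t Ht. apply (cont_comp RtoC f (fun t => c + RtoC t * (z - c + RtoC u * h))%C).
      - eapply deriv_cont. apply Hf. exact (Dpt u t Hu Ht).
      - apply cont_plus; [apply cont_const|].
        apply cont_mult; [apply cont_incl|apply cont_const]. }
    rewrite !M by lra.
    replace (z - c + RtoC 1 * h)%C with (z + h - c)%C by ring.
    replace (z - c + RtoC 0 * h)%C with (z - c)%C by ring. reflexivity. }
  intros z Hz e He.
  destruct (HO z Hz) as [r [Hr Hr']].
  assert (Cf := deriv_cont _ _ _ _ (proj1 (Hf z Hz))).
  destruct (Cf e He) as [d [D1 Hd]].
  exists (Rmin (r / 2) d); split; [apply Rmin_pos; lra|].
  unfold cid. intros w Hw.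
  assert (K1 := Rlt_le_trans _ _ _ Hw (Rmin_l _ _)).
  assert (K2 := Rlt_le_trans _ _ _ Hw (Rmin_r _ _)).
  set (h := (w - z)%C) in *. replace w with (z + h)%C by (unfold h; ring).
  assert (HD : forall u, -1 <= u <= 2 -> D (z + RtoC u * h)%C).
  { intros u Hu. apply Hr'. replace (z + u * h - z)%C with (u * h)%C by ring.
    rewrite Cmod_mult, Cmod_R. apply Rle_lt_trans with (2 * Cmod h); [|lra].
    apply Rmult_le_compat_r; [apply Cmod_ge_0|]. apply Rabs_le; lra. }
  rewrite Key by exact HD.
  replace (h * int (fun u => f (z + u * h)) 0 1 - h * f z)%C
    with (h * (int (fun u => f (z + u * h)) 0 1 - f z))%C by ring.
  rewrite Cmod_mult, Rmult_comm. apply Rmult_le_compat_r; [apply Cmod_ge_0|].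
  assert (I : is_int (fun u => f (z + RtoC u * h) + - f z)%C 0 1
    (int (fun u => f (z + RtoC u * h)) 0 1 + - f z)%C).
  { apply is_int_plus.
    - apply int_correct; [lra|]. intros u Hu.
      apply (cont_comp RtoC f (fun u => z + RtoC u * h)%C).
      + eapply deriv_cont. apply Hf, HD; lra.
      + apply cont_plus; [apply cont_const|].
        apply cont_mult; [apply cont_incl|apply cont_const].
    - assert (IC := is_int_const (- f z)%C 0 1 Rle_0_1).
      replace ((1 - 0) * - f z)%C with (- f z)%C in IC by ring. exact IC. }
  replace e with ((1 - 0) * e) by ring.
  eapply is_int_bound; [lra| |exact I]. intros u Hu. left. apply Hd. unfold cid.
  replace (z + u * h - z)%C with (u * h)%C by ring.
  rewrite Cmod_mult, Cmod_R, Rabs_pos_eq by lra.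
  apply Rle_lt_trans with (1 * Cmod h); [|lra].
  apply Rmult_le_compat_r; [apply Cmod_ge_0|lra].
Qed.

(** ** Integrals depending exponentially on a parameter *)

Lemma square_le_exp x : 0 <= x -> x ^ 2 <= 4 * exp x.
Proof.
  intro Hx. replace (exp x) with (exp (x / 2) * exp (x / 2)).
  2:{ rewrite <- exp_plus. f_equal. field. }
  assert (H := exp_ineq1_le (x / 2)).
  replace (x ^ 2) with (4 * ((x / 2) * (x / 2))) by field.
  apply Rmult_le_compat_l; [lra|]. apply Rmult_le_compat; lra.
Qed.

Lemma deriv_quadratic (f : C -> C) l K d :
  0 < d -> (forall h, Cmod h < d -> Cmod (f h - f 0 - h * l) <= K * Cmod h ^ 2) ->
  deriv_at cid f 0 l.
Proof.
  intros Hd H e He.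
  assert (P : 0 < Rabs K + 1) by (generalize (Rabs_pos K); lra).
  exists (Rmin d (e / (Rabs K + 1))); split.
  { apply Rmin_pos; auto. now apply Rdiv_lt_0_compat. }
  unfold cid. intros h Hh. replace (h - 0)%C with h in * by ring.
  assert (K1 := Rlt_le_trans _ _ _ Hh (Rmin_l _ _)).
  assert (K2 := Rlt_le_trans _ _ _ Hh (Rmin_r _ _)).
  assert (Q := Cmod_ge_0 h).
  eapply Rle_trans; [now apply H|].
  replace (K * Cmod h ^ 2) with (K * Cmod h * Cmod h) by ring.
  apply Rmult_le_compat_r; auto.
  apply Rle_trans with ((Rabs K + 1) * Cmod h).
  - apply Rmult_le_compat_r; auto. generalize (Rle_abs K); lra.
  - apply Rle_trans with ((Rabs K + 1) * (e / (Rabs K + 1))).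
    + apply Rmult_le_compat_l; lra.
    + right; field; lra.
Qed.

Lemma Cexp_mult_le (h q : C) : Cmod (Cexp (h * q)) <= exp (Cmod h * Cmod q).
Proof.
  rewrite Cmod_Cexp, <- Cmod_mult. apply exp_le.
  eapply Rle_trans; [apply Rle_abs|apply re_le_Cmod].
Qed.

(** The hypothesis leaves a margin eta in the decay. Since |h| < eta / 2, one half of it absorbs
    exp(|h q|) and the other half absorbs the factor |q|^2 of the Taylor remainder. *)
Lemma tail_exp_deriv q V a eta M c :
  0 < eta -> 0 < c ->
  (forall t, a <= t -> cont_at RtoC q t) -> (forall t, a <= t -> cont_at RtoC V t) ->
  (forall t, a <= t -> Cmod (V t) * exp (eta * Cmod (q t)) <= M * exp (- c * t)) ->
  deriv_at cid (fun h => tail (fun t => Cexp (h * q t) * V t)%C a) 0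
    (tail (fun t => q t * V t)%C a).
Proof.
  intros He Hc cq cV Hb.
  (* The bound (eta x / 2)^2 <= 4 exp(eta x / 2) of [square_le_exp] reads x^2 <= (16 / eta^2)
     exp(eta x / 2). *)
  apply deriv_quadratic with (K := 16 / eta ^ 2 * M / c * exp (- c * a)) (d := eta / 2); [lra|].
  intros h Hh.
  assert (T1 : forall k, Cmod k < eta / 2 ->
    is_tail (fun t => Cexp (k * q t) * V t)%C a (tail (fun t => Cexp (k * q t) * V t)%C a)).
  { intros k Hk. apply (tail_ex _ _ M c Hc).
    - intros t Ht. apply cont_mult; auto. apply cont_exp.
      apply cont_mult; [apply cont_const|auto].
    - intros t Ht. eapply Rle_trans; [|now apply Hb].
      rewrite Cmod_mult, Rmult_comm. apply Rmult_le_compat_l; [apply Cmod_ge_0|].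
      eapply Rle_trans; [apply Cexp_mult_le|]. apply exp_le.
      apply Rmult_le_compat_r; [apply Cmod_ge_0|lra]. }
  assert (T2 : is_tail (fun t => q t * V t)%C a (tail (fun t => q t * V t)%C a)).
  { apply (tail_ex _ _ (M / eta) c Hc).
    - intros t Ht. apply cont_mult; auto.
    - intros t Ht. rewrite Cmod_mult.
      replace (M / eta * exp (- c * t)) with (/ eta * (M * exp (- c * t))) by (field; lra).
      apply Rle_trans with (/ eta * (Cmod (V t) * exp (eta * Cmod (q t)))).
      2:{ apply Rmult_le_compat_l; [left; now apply Rinv_0_lt_compat|auto]. }
      rewrite (Rmult_comm (Cmod (q t))).
      replace (/ eta * (Cmod (V t) * exp (eta * Cmod (q t))))
        with (Cmod (V t) * (/ eta * exp (eta * Cmod (q t)))) by ring.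
      apply Rmult_le_compat_l; [apply Cmod_ge_0|].
      apply Rmult_le_reg_l with eta; auto.
      rewrite <- Rmult_assoc, Rinv_r, Rmult_1_l by lra.
      generalize (exp_ineq1_le (eta * Cmod (q t))). lra. }
  assert (T0 := T1 0). rewrite Cmod_0 in T0.
  assert (TT := is_tail_plus _ _ _ _ _ (is_tail_plus _ _ _ _ _ (T1 h Hh)
    (is_tail_scal _ _ _ (-1)%C (T0 ltac:(lra)))) (is_tail_scal _ _ _ (- h)%C T2)).
  set (A1 := tail (fun t => Cexp (h * q t) * V t)%C a) in *.
  set (A0 := tail (fun t => Cexp (0 * q t) * V t)%C a) in *.
  set (A2 := tail (fun t => q t * V t)%C a) in *.
  replace (A1 - A0 - h * A2)%C with (A1 + -1 * A0 + - h * A2)%C by ring.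
  rewrite <- (is_tail_tail _ _ _ TT).
  replace (16 / eta ^ 2 * M / c * exp (- c * a) * Cmod h ^ 2)
    with (16 / eta ^ 2 * M * Cmod h ^ 2 / c * exp (- c * a)) by (field; lra).
  apply tail_ex; auto; [apply TT|].
  intros t Ht. cbv beta.
  replace (Cexp (h * q t) * V t + -1 * (Cexp (0 * q t) * V t) + - h * (q t * V t))%C
    with ((Cexp (h * q t) - 1 - h * q t) * V t)%C.
  2:{ replace (0 * q t)%C with (RtoC 0) by ring. rewrite Cexp_0. ring. }
  rewrite Cmod_mult.
  apply Rle_trans with (16 / eta ^ 2 * Cmod h ^ 2 * (Cmod (V t) * exp (eta * Cmod (q t)))).
  2:{ replace (16 / eta ^ 2 * M * Cmod h ^ 2 * exp (- c * t))
        with (16 / eta ^ 2 * Cmod h ^ 2 * (M * exp (- c * t))) by ring.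
      apply Rmult_le_compat_l; [|auto].
      apply Rmult_le_pos; [|apply pow2_ge_0]. apply Rdiv_le_0_compat; [lra|].
      apply pow_lt; lra. }
  rewrite Rmult_comm.
  replace (16 / eta ^ 2 * Cmod h ^ 2 * (Cmod (V t) * exp (eta * Cmod (q t))))
    with (Cmod (V t) * (16 / eta ^ 2 * Cmod h ^ 2 * exp (eta * Cmod (q t)))) by ring.
  apply Rmult_le_compat_l; [apply Cmod_ge_0|].
  eapply Rle_trans; [apply Cexp_taylor2|]. rewrite !Cmod_mult.
  set (x := Cmod (q t)). assert (X : 0 <= x) by apply Cmod_ge_0.
  set (y := Cmod h) in *. assert (Y : 0 <= y) by apply Cmod_ge_0.
  assert (S := square_le_exp (eta / 2 * x) ltac:(apply Rmult_le_pos; lra)).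
  replace (eta * x) with (eta / 2 * x + eta / 2 * x) by field. rewrite exp_plus.
  replace (16 / eta ^ 2 * y ^ 2 * (exp (eta / 2 * x) * exp (eta / 2 * x)))
    with (y ^ 2 * (4 / eta ^ 2 * (4 * exp (eta / 2 * x))) * exp (eta / 2 * x)) by (field; lra).
  apply Rmult_le_compat.
  - apply pow2_ge_0.
  - left; apply exp_pos.
  - replace ((y * x) ^ 2) with (y ^ 2 * (4 / eta ^ 2 * (eta / 2 * x) ^ 2)) by (field; lra).
    apply Rmult_le_compat_l; [apply pow2_ge_0|]. apply Rmult_le_compat_l; [|exact S].
    apply Rdiv_le_0_compat; [lra|]. apply pow_lt; lra.
  - apply exp_le. apply Rmult_le_compat_r; lra.
Qed.

Lemma int_exp_deriv q V a b :
  a <= b -> (forall t, a <= t <= b -> cont_at RtoC q t) ->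
  (forall t, a <= t <= b -> cont_at RtoC V t) ->
  deriv_at cid (fun h => int (fun t => Cexp (h * q t) * V t)%C a b) 0
    (int (fun t => q t * V t)%C a b).
Proof.
  intros Hab cq cV.
  destruct (cont_bounded q a b Hab cq) as [Q HQ].
  destruct (cont_bounded V a b Hab cV) as [W HW].
  apply deriv_quadratic with (K := (b - a) * (Q ^ 2 * exp Q * W)) (d := 1); [lra|].
  intros h Hh.
  assert (I : forall k, is_int (fun t => Cexp (k * q t) * V t)%C a b
     (int (fun t => Cexp (k * q t) * V t)%C a b)).
  { intro k. apply int_correct; auto. intros t Ht. apply cont_mult; auto. apply cont_exp.
    apply cont_mult; [apply cont_const|auto]. }
  assert (I2 : is_int (fun t => q t * V t)%C a b (int (fun t => q t * V t)%C a b)).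
  { apply int_correct; auto. intros t Ht. apply cont_mult; auto. }
  assert (TT := is_int_plus _ _ _ _ _ _ (is_int_plus _ _ _ _ _ _ (I h)
    (is_int_scal _ _ _ _ (-1)%C (I 0))) (is_int_scal _ _ _ _ (- h)%C I2)).
  set (A1 := int (fun t => Cexp (h * q t) * V t)%C a b) in *.
  set (A0 := int (fun t => Cexp (0 * q t) * V t)%C a b) in *.
  set (A2 := int (fun t => q t * V t)%C a b) in *.
  replace (A1 - A0 - h * A2)%C with (A1 + -1 * A0 + - h * A2)%C by ring.
  rewrite Rmult_assoc. eapply is_int_bound; [auto| |exact TT].
  intros t Ht. cbv beta.
  replace (Cexp (h * q t) * V t + -1 * (Cexp (0 * q t) * V t) + - h * (q t * V t))%C
    with ((Cexp (h * q t) - 1 - h * q t) * V t)%C.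
  2:{ replace (0 * q t)%C with (RtoC 0) by ring. rewrite Cexp_0. ring. }
  rewrite Cmod_mult.
  specialize (HQ t Ht). specialize (HW t Ht).
  set (x := Cmod (q t)) in *. assert (X : 0 <= x) by apply Cmod_ge_0.
  set (y := Cmod h) in *. assert (Y : 0 <= y) by apply Cmod_ge_0.
  replace (Q ^ 2 * exp Q * W * y ^ 2) with ((y ^ 2 * Q ^ 2) * exp Q * W) by ring.
  apply Rmult_le_compat; auto; try apply Cmod_ge_0.
  eapply Rle_trans; [apply Cexp_taylor2|]. rewrite !Cmod_mult. fold x y.
  apply Rmult_le_compat.
  - apply pow2_ge_0.
  - left; apply exp_pos.
  - rewrite Rpow_mult_distr. apply Rmult_le_compat_l; [apply pow2_ge_0|].
    apply pow_incr; lra.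
  - apply exp_le. apply Rle_trans with (1 * x); [|lra].
    apply Rmult_le_compat_r; lra.
Qed.

(** ** The Hankel contour in the logarithmic coordinate *)

(** The integrand of g(w) dw on the line Im w = v, parametrized by x = exp(Re w); the division by x
    is dw / dx. *)
Definition kray (g : C -> C) (v x : R) : C := (g (RtoC (ln x) + Ci * RtoC v) / RtoC x)%C.
Definition karc (g : C -> C) (r phi : R) : C := g (RtoC (ln r) + Ci * RtoC phi)%C.

(* With w = log z, this is the integral of g(log z) dz / z along the ray
   arg z = 2 PI outwards, minus that along arg z = 0, plus that along the
   circle of radius r. *)
Definition hankel (g : C -> C) (r : R) : C :=
  (tail (kray g (2 * PI)) r - tail (kray g 0) r + Ci * int (karc g r) 0 (2 * PI))%C.

Definition on_ray (r : R) (w : C) : Prop :=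
  exists x v, r <= x /\ (v = 0 \/ v = 2 * PI) /\ w = (RtoC (ln x) + Ci * RtoC v)%C.
Definition on_circ (r : R) (w : C) : Prop :=
  exists phi, 0 <= phi <= 2 * PI /\ w = (RtoC (ln r) + Ci * RtoC phi)%C.

(** The decay is exponential in |z| = exp(Re w), hence doubly exponential in the logarithmic
    coordinate. *)
Definition ray_decay (g : C -> C) (r : R) : Prop :=
  exists M c, 0 < c /\ forall w, on_ray r w -> Cmod (g w) <= M * exp (- c * exp (Re w)).

Definition admits (g : C -> C) (r : R) : Prop :=
  0 < r /\ (forall w, on_ray r w -> cont_at cid g w) /\
  (forall w, on_circ r w -> cont_at cid g w) /\ ray_decay g r.

Lemma PI2_pos : 0 <= 2 * PI.
Proof. generalize PI_RGT_0; lra. Qed.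

Lemma deriv_ln x : 0 < x -> deriv_at RtoC (fun x => RtoC (ln x)) x (/ RtoC x).
Proof.
  intro Hx. rewrite <- RtoC_inv by lra. apply deriv_real. auto_derive; auto. ring.
Qed.

Lemma deriv_ray v x :
  0 < x -> deriv_at RtoC (fun x => RtoC (ln x) + Ci * RtoC v)%C x (/ RtoC x).
Proof.
  intro Hx. eapply deriv_eq; [apply deriv_plus; [now apply deriv_ln|apply deriv_const]|].
  cbv beta; ring.
Qed.

Lemma deriv_vert (u : C) v : deriv_at RtoC (fun v => u + Ci * RtoC v)%C v Ci.
Proof.
  eapply deriv_eq.
  - apply deriv_plus; [apply deriv_const|]. apply deriv_scal, deriv_incl.
  - cbv beta; ring.
Qed.

Lemma kray_cont g v x :
  0 < x -> cont_at cid g (RtoC (ln x) + Ci * RtoC v)%C -> cont_at RtoC (kray g v) x.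
Proof.
  intros Hx Hg. unfold kray. apply cont_mult.
  - apply (cont_comp RtoC g (fun x => RtoC (ln x) + Ci * RtoC v)%C); auto.
    eapply deriv_cont. now apply deriv_ray.
  - apply cont_inv; [|apply cont_incl]. intro E. apply RtoC_inj in E. lra.
Qed.

Lemma karc_cont g r v :
  cont_at cid g (RtoC (ln r) + Ci * RtoC v)%C -> cont_at RtoC (karc g r) v.
Proof.
  intros Hg. unfold karc.
  apply (cont_comp RtoC g (fun v => RtoC (ln r) + Ci * RtoC v)%C); auto.
  eapply deriv_cont, deriv_vert.
Qed.

Lemma Re_log x v : Re (RtoC (ln x) + Ci * RtoC v) = ln x.
Proof. simpl; ring. Qed.
Lemma Im_log x v : Im (RtoC (ln x) + Ci * RtoC v) = v.
Proof. simpl; ring. Qed.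

Lemma Cexp_log x v :
  0 < x -> Cexp (RtoC (ln x) + Ci * RtoC v) = (RtoC x * (cos v, sin v))%C.
Proof. intro Hx. now rewrite Cexp_plus, Cexp_real, exp_ln, Cexp_Ci. Qed.

Lemma ray_bound_int (g : C -> C) r M c :
  0 < r -> (forall w, on_ray r w -> Cmod (g w) <= M * exp (- c * exp (Re w))) ->
  forall v, v = 0 \/ v = 2 * PI -> forall t, r <= t ->
    Cmod (kray g v t) <= M / r * exp (- c * t).
Proof.
  intros Hr H v Hv t Ht.
  assert (B := H (RtoC (ln t) + Ci * RtoC v)%C ltac:(exists t, v; auto)).
  rewrite Re_log, exp_ln in B by lra. unfold kray.
  assert (N : RtoC t <> 0) by (intro E; apply RtoC_inj in E; lra).
  rewrite Cmod_div by auto. rewrite Cmod_R, Rabs_pos_eq by lra.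
  apply Rle_trans with (M * exp (- c * t) / t).
  - apply Rmult_le_compat_r; [left; apply Rinv_0_lt_compat; lra|auto].
  - replace (M / r * exp (- c * t)) with (M * exp (- c * t) / r) by (field; lra).
    apply Rmult_le_compat_l.
    + eapply Rle_trans; [apply Cmod_ge_0|exact B].
    + apply Rinv_le_contravar; lra.
Qed.

Lemma admits_tail g r v :
  admits g r -> v = 0 \/ v = 2 * PI -> is_tail (kray g v) r (tail (kray g v) r).
Proof.
  intros [Hr [H1 [H2 [M [c [Hc HM]]]]]] Hv.
  apply (tail_ex (kray g v) r (M / r) c Hc).
  - intros t Ht. apply kray_cont; [lra|]. apply H1. now exists t, v.
  - apply ray_bound_int; auto.
Qed.

Lemma admits_int g r :
  admits g r -> is_int (karc g r) 0 (2 * PI) (int (karc g r) 0 (2 * PI)).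
Proof.
  intros [Hr [H1 [H2 _]]]. apply int_correct; [apply PI2_pos|].
  intros t Ht. apply karc_cont, H2. now exists t.
Qed.

Lemma admits_plus f g r : admits f r -> admits g r -> admits (fun w => f w + g w)%C r.
Proof.
  intros [Hr [F1 [F2 [M [c [Hc HM]]]]]] [_ [G1 [G2 [M' [c' [Hc' HM']]]]]].
  split; [|split; [|split]]; auto.
  - intros; apply cont_plus; auto.
  - intros; apply cont_plus; auto.
  - exists (Rabs M + Rabs M'), (Rmin c c'). split; [now apply Rmin_pos|].
    intros w Hw. eapply Rle_trans; [apply Cmod_triangle|].
    rewrite Rmult_plus_distr_r. assert (P := exp_pos (Re w)).
    assert (A : forall N d, Rmin c c' <= d ->
       N * exp (- d * exp (Re w)) <= Rabs N * exp (- Rmin c c' * exp (Re w))).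
    { intros N d Hd. eapply Rle_trans.
      - apply Rmult_le_compat_r; [left; apply exp_pos|apply Rle_abs].
      - apply Rmult_le_compat_l; [apply Rabs_pos|]. apply exp_le.
        apply Rmult_le_compat_r; lra. }
    apply Rplus_le_compat.
    + eapply Rle_trans; [now apply HM|]. apply A, Rmin_l.
    + eapply Rle_trans; [now apply HM'|]. apply A, Rmin_r.
Qed.

(** The class of multipliers that [ray_decay] absorbs; it contains the powers z^s = exp(s w) and log
    z = w. *)
Definition subexp (q : C -> C) (r : R) : Prop :=
  forall eps, 0 < eps -> exists M, forall w, on_ray r w ->
    Cmod (q w) <= M * exp (eps * exp (Re w)).

Lemma admits_mult q g r :
  (forall w, on_ray r w -> cont_at cid q w) -> (forall w, on_circ r w -> cont_at cid q w) ->
  subexp q r -> admits g r -> admits (fun w => q w * g w)%C r.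
Proof.
  intros Q1 Q2 Q3 [Hr [F1 [F2 [M [c [Hc HM]]]]]].
  split; [|split; [|split]]; auto.
  - intros; apply cont_mult; auto.
  - intros; apply cont_mult; auto.
  - destruct (Q3 (c / 2)) as [N HN]; [lra|].
    exists (N * M), (c / 2); split; [lra|]. intros w Hw. rewrite Cmod_mult.
    replace (N * M * exp (- (c / 2) * exp (Re w)))
      with ((N * exp (c / 2 * exp (Re w))) * (M * exp (- c * exp (Re w)))).
    2:{ replace (- (c / 2) * exp (Re w)) with (c / 2 * exp (Re w) + - c * exp (Re w)) by field.
        rewrite exp_plus. ring. }
    apply Rmult_le_compat; auto; apply Cmod_ge_0.
Qed.

Lemma subexp_const c r : subexp (fun _ => c) r.
Proof.
  intros e He. exists (Cmod c). intros w _.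
  rewrite <- (Rmult_1_r (Cmod c)) at 1. apply Rmult_le_compat_l; [apply Cmod_ge_0|].
  rewrite <- exp_0. apply exp_le. apply Rmult_le_pos; [lra|left; apply exp_pos].
Qed.

Lemma admits_scal c g r : admits g r -> admits (fun w => c * g w)%C r.
Proof.
  apply (admits_mult (fun _ => c)); try (intros; apply cont_const). apply subexp_const.
Qed.

Lemma hankel_plus f g r :
  admits f r -> admits g r ->
  hankel (fun w => f w + g w)%C r = (hankel f r + hankel g r)%C.
Proof.
  intros Hf Hg. unfold hankel.
  assert (T : forall v, v = 0 \/ v = 2 * PI -> tail (kray (fun w => f w + g w)%C v) r
     = (tail (kray f v) r + tail (kray g v) r)%C).
  { intros v Hv. apply is_tail_tail.
    apply is_tail_ext with (fun t => kray f v t + kray g v t)%C.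
    - intro t. unfold kray, Cdiv. ring.
    - apply is_tail_plus; now apply admits_tail. }
  rewrite !T by auto.
  replace (int (karc (fun w => f w + g w)%C r) 0 (2 * PI))
    with (int (karc f r) 0 (2 * PI) + int (karc g r) 0 (2 * PI))%C.
  - ring.
  - symmetry. apply is_int_unique. apply is_int_plus; now apply admits_int.
Qed.

Lemma hankel_scal c g r :
  admits g r -> hankel (fun w => c * g w)%C r = (c * hankel g r)%C.
Proof.
  intros Hg. unfold hankel.
  assert (T : forall v, v = 0 \/ v = 2 * PI -> tail (kray (fun w => c * g w)%C v) r
     = (c * tail (kray g v) r)%C).
  { intros v Hv. apply is_tail_tail.
    apply is_tail_ext with (fun t => c * kray g v t)%C.
    - intro t. unfold kray, Cdiv. ring.
    - apply is_tail_scal; now apply admits_tail. }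
  rewrite !T by auto.
  replace (int (karc (fun w => c * g w)%C r) 0 (2 * PI))
    with (c * int (karc g r) 0 (2 * PI))%C.
  - ring.
  - symmetry. apply is_int_unique. apply is_int_scal; now apply admits_int.
Qed.

Lemma hankel_ext f g r : (forall w, f w = g w) -> hankel f r = hankel g r.
Proof. intro E. f_equal. now apply functional_extensionality. Qed.

Lemma hankel_ext_on f g r :
  (forall w, on_ray r w -> f w = g w) -> (forall w, on_circ r w -> f w = g w) ->
  hankel f r = hankel g r.
Proof.
  intros E1 E2. unfold hankel.
  assert (T : forall v, v = 0 \/ v = 2 * PI -> tail (kray f v) r = tail (kray g v) r).
  { intros v Hv. apply tail_ext_on. intros t Ht. unfold kray. rewrite E1; auto.
    now exists t, v. }
  rewrite !T by auto.
  replace (int (karc f r) 0 (2 * PI)) with (int (karc g r) 0 (2 * PI)); auto.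
  apply int_ext_on; [apply PI2_pos|]. intros t Ht. unfold karc. symmetry. apply E2.
  exists t. split; auto; lra.
Qed.

Lemma admits_ext f g r : (forall w, f w = g w) -> admits f r -> admits g r.
Proof. intros E H. replace g with f; auto. now apply functional_extensionality. Qed.

Lemma hankel_bound g r M c B :
  admits g r -> 0 < c ->
  (forall w, on_ray r w -> Cmod (g w) <= M * exp (- c * exp (Re w))) ->
  (forall w, on_circ r w -> Cmod (g w) <= B) ->
  Cmod (hankel g r) <= 2 * (M / r / c * exp (- c * r)) + 2 * PI * B.
Proof.
  intros Hg Hc HM HB. assert (Hr := proj1 Hg). unfold hankel.
  assert (T : forall v, v = 0 \/ v = 2 * PI ->
    Cmod (tail (kray g v) r) <= M / r / c * exp (- c * r)).
  { intros v Hv. apply tail_ex; auto.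
    - intros t Ht. now apply (proj1 (admits_tail g r v Hg Hv)).
    - now apply ray_bound_int. }
  eapply Rle_trans; [apply Cmod_triangle|]. apply Rplus_le_compat.
  - eapply Rle_trans; [apply Cmod_triangle_minus|].
    generalize (T 0 (or_introl eq_refl)) (T (2 * PI) (or_intror eq_refl)). lra.
  - rewrite Cmod_mult, Cmod_Ci, Rmult_1_l.
    replace (2 * PI * B) with ((2 * PI - 0) * B) by ring.
    eapply is_int_bound; [apply PI2_pos| |now apply admits_int].
    intros t Ht. apply HB. now exists t.
Qed.

Lemma hankel_exp_deriv q g r eta :
  0 < eta -> admits g r ->
  (forall w, on_ray r w -> cont_at cid q w) -> (forall w, on_circ r w -> cont_at cid q w) ->
  ray_decay (fun w => RtoC (exp (eta * Cmod (q w))) * g w)%C r ->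
  deriv_at cid (fun h => hankel (fun w => Cexp (h * q w) * g w)%C r) 0
    (hankel (fun w => q w * g w)%C r).
Proof.
  intros He Hg Q1 Q2 [M [c [Hc HM]]]. assert (Hr := proj1 Hg).
  assert (T : forall v, v = 0 \/ v = 2 * PI ->
    deriv_at cid (fun h => tail (kray (fun w => Cexp (h * q w) * g w)%C v) r) 0
      (tail (kray (fun w => q w * g w)%C v) r)).
  { intros v Hv.
    apply deriv_ext with (fun h => tail (fun t =>
       Cexp (h * q (RtoC (ln t) + Ci * RtoC v)) * kray g v t)%C r).
    { intro h. f_equal. apply functional_extensionality. intro t. unfold kray, Cdiv. ring. }
    replace (kray (fun w => q w * g w)%C v) with (fun t =>
       q (RtoC (ln t) + Ci * RtoC v)%C * kray g v t)%C.
    2:{ apply functional_extensionality. intro t. unfold kray, Cdiv. ring. }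
    apply (tail_exp_deriv (fun t => q (RtoC (ln t) + Ci * RtoC v)%C) (kray g v) r eta
             (M / r) c); auto.
    - intros t Ht. apply (cont_comp RtoC q (fun x => RtoC (ln x) + Ci * RtoC v)%C).
      + apply Q1. now exists t, v.
      + eapply deriv_cont, deriv_ray. lra.
    - intros t Ht. apply kray_cont; [lra|]. apply (proj1 (proj2 Hg)). now exists t, v.
    - intros t Ht. eapply Rle_trans; [|apply (ray_bound_int _ _ _ _ Hr HM v Hv t Ht)].
      unfold kray. unfold Cdiv. rewrite !Cmod_mult, Cmod_R, Rabs_pos_eq by (left; apply exp_pos).
      right; ring. }
  assert (I : deriv_at cid (fun h => int (karc (fun w => Cexp (h * q w) * g w)%C r) 0 (2 * PI)) 0
     (int (karc (fun w => q w * g w)%C r) 0 (2 * PI))).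
  { unfold karc.
    apply (int_exp_deriv (fun t => q (RtoC (ln r) + Ci * RtoC t)%C) (karc g r));
      [apply PI2_pos| |].
    - intros t Ht. apply (karc_cont q). apply Q2. now exists t.
    - intros t Ht. apply karc_cont. apply (proj1 (proj2 (proj2 Hg))). now exists t. }
  unfold hankel. apply deriv_plus; [apply deriv_minus; apply T; auto|].
  now apply deriv_scal.
Qed.

(** The contour runs from infinity to infinity. The primitive Q vanishes at both ends, and its
    values at the two corners on the circle cancel between the rays and the circle. *)
Lemma hankel_exact Q g r :
  admits g r ->
  (forall w, on_ray r w -> deriv_at cid Q w (g w)) ->
  (forall w, on_circ r w -> deriv_at cid Q w (g w)) ->
  ray_decay Q r -> hankel g r = 0.
Proof.
  intros Hg Q1 Q2 [M [c [Hc HM]]]. assert (Hr := proj1 Hg). unfold hankel.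
  assert (T : forall v, v = 0 \/ v = 2 * PI ->
    tail (kray g v) r = (0 - Q (RtoC (ln r) + Ci * RtoC v))%C).
  { intros v Hv. apply is_tail_tail.
    apply (is_tail_deriv (fun x => Q (RtoC (ln x) + Ci * RtoC v)%C)).
    - intros t Ht. eapply deriv_eq.
      + apply (deriv_comp RtoC Q (fun x => RtoC (ln x) + Ci * RtoC v)%C).
        * apply Q1. now exists t, v.
        * apply deriv_ray. lra.
      + reflexivity.
    - now apply (proj1 (admits_tail g r v Hg Hv)).
    - intros e He. destruct (exp_decay_small M c e Hc He) as [B [HB HB']].
      exists (Rmax r B); split; [apply Rmax_l|]. intros b Hb.
      assert (r <= b) by (apply Rle_trans with (1 := Rmax_l r B) (2 := Hb)).
      assert (B <= b) by (apply Rle_trans with (1 := Rmax_r r B) (2 := Hb)).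
      replace (Q (ln b + Ci * v) - 0)%C with (Q (ln b + Ci * v))%C by ring.
      eapply Rle_lt_trans; [apply HM; now exists b, v|].
      rewrite Re_log, exp_ln by lra. auto. }
  rewrite !T by auto.
  assert (I : is_int (fun t => Ci * karc g r t)%C 0 (2 * PI)
     (Q (RtoC (ln r) + Ci * RtoC (2 * PI)) - Q (RtoC (ln r) + Ci * RtoC 0))%C).
  { apply (is_int_deriv (fun t => Q (RtoC (ln r) + Ci * RtoC t)%C)); [apply PI2_pos| |].
    - intros t Ht. eapply deriv_eq.
      + apply (deriv_comp RtoC Q (fun x => RtoC (ln r) + Ci * RtoC x)%C).
        * apply Q2. now exists t.
        * apply deriv_vert.
      + unfold karc. ring.
    - intros t Ht. apply cont_mult; [apply cont_const|]. apply karc_cont.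
      apply (proj1 (proj2 (proj2 Hg))). now exists t. }
  rewrite <- (is_int_unique _ _ _ _ (is_int_scal _ _ _ _ Ci (admits_int g r Hg))).
  rewrite (is_int_unique _ _ _ _ I). ring.
Qed.

(* The rectangle is [ln r1, ln r2] x [0, 2 PI], traversed clockwise. *)
Definition boundary (g : C -> C) (r1 r2 : R) : C :=
  (int (kray g (2 * PI)) r1 r2 - int (kray g 0) r1 r2
   + Ci * int (karc g r1) 0 (2 * PI) - Ci * int (karc g r2) 0 (2 * PI))%C.

Definition in_rect (r1 r2 : R) (w : C) : Prop :=
  ln r1 <= Re w <= ln r2 /\ 0 <= Im w <= 2 * PI.

Lemma boundary_holo D g r1 r2 :
  0 < r1 -> r1 <= r2 -> opened D -> convex D -> holo D g ->
  (forall w, in_rect r1 r2 w -> D w) -> boundary g r1 r2 = 0.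
Proof.
  intros H1 H2 HO HC Hg HD.
  assert (P2 := PI2_pos).
  assert (L : forall x, r1 <= x <= r2 -> ln r1 <= ln x <= ln r2).
  { intros x Hx. split; apply ln_le; lra. }
  assert (RD : forall x v, r1 <= x <= r2 -> 0 <= v <= 2 * PI ->
    D (RtoC (ln x) + Ci * RtoC v)%C).
  { intros x v Hx Hv. apply HD. split; [rewrite Re_log|rewrite Im_log]; auto. }
  destruct (holo_primitive D g (RtoC (ln r1) + Ci * RtoC 0)%C HO HC) as [P HP]; auto.
  { apply RD; lra. }
  assert (I : forall v, 0 <= v <= 2 * PI -> is_int (kray g v) r1 r2
    (P (RtoC (ln r2) + Ci * RtoC v) - P (RtoC (ln r1) + Ci * RtoC v))%C).
  { intros v Hv. apply (is_int_deriv (fun x => P (RtoC (ln x) + Ci * RtoC v)%C)); auto.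
    - intros t Ht. eapply deriv_eq.
      + apply (deriv_comp RtoC P (fun x => RtoC (ln x) + Ci * RtoC v)%C).
        * now apply HP, RD.
        * apply deriv_ray; lra.
      + reflexivity.
    - intros t Ht. apply kray_cont; [lra|]. eapply holo_cont; [exact Hg|now apply RD]. }
  assert (J : forall x, r1 <= x <= r2 -> is_int (fun t => Ci * karc g x t)%C 0 (2 * PI)
    (P (RtoC (ln x) + Ci * RtoC (2 * PI)) - P (RtoC (ln x) + Ci * RtoC 0))%C).
  { intros x Hx. apply (is_int_deriv (fun t => P (RtoC (ln x) + Ci * RtoC t)%C)); auto.
    - intros t Ht. eapply deriv_eq.
      + apply (deriv_comp RtoC P (fun t => RtoC (ln x) + Ci * RtoC t)%C).
        * now apply HP, RD.
        * apply deriv_vert.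
      + unfold karc. ring.
    - intros t Ht. apply cont_mult; [apply cont_const|].
      apply karc_cont. eapply holo_cont; [exact Hg|now apply RD]. }
  assert (K : forall x, r1 <= x <= r2 -> (Ci * int (karc g x) 0 (2 * PI)
    = P (RtoC (ln x) + Ci * RtoC (2 * PI)) - P (RtoC (ln x) + Ci * RtoC 0))%C).
  { intros x Hx. rewrite <- (is_int_unique _ _ _ _ (J x Hx)).
    symmetry. apply is_int_unique. apply is_int_scal, int_correct; auto.
    intros t Ht. apply karc_cont. eapply holo_cont; [exact Hg|now apply RD]. }
  unfold boundary. rewrite !K by lra.
  rewrite (is_int_unique _ _ _ _ (I 0 ltac:(lra))).
  rewrite (is_int_unique _ _ _ _ (I (2 * PI) ltac:(lra))). ring.
Qed.

Lemma admits_larger g r1 r2 :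
  admits g r1 -> r1 <= r2 -> (forall w, on_circ r2 w -> cont_at cid g w) -> admits g r2.
Proof.
  intros [Hr [F1 [F2 [M [c [Hc HM]]]]]] H12 HC.
  assert (S : forall w, on_ray r2 w -> on_ray r1 w).
  { intros w [x [v [Hx H]]]. exists x, v. split; [lra|auto]. }
  split; [lra|split; [|split]]; auto. exists M, c; auto.
Qed.

Lemma hankel_boundary g r1 r2 :
  r1 <= r2 -> admits g r1 -> admits g r2 ->
  hankel g r1 = (hankel g r2 + boundary g r1 r2)%C.
Proof.
  intros H12 G1 G2. unfold hankel, boundary.
  assert (T : forall v, v = 0 \/ v = 2 * PI ->
     tail (kray g v) r1 = (int (kray g v) r1 r2 + tail (kray g v) r2)%C).
  { intros v Hv. apply is_tail_tail. apply is_tail_Chasles; auto.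
    - intros t Ht. apply (proj1 (admits_tail g r1 v G1 Hv)). lra.
    - now apply admits_tail. }
  rewrite !T by auto. ring.
Qed.

Definition strip (a b : R) (w : C) : Prop := a < Re w < b.

Lemma strip_opened a b : opened (strip a b).
Proof.
  intros z [H1 H2]. exists (Rmin (Re z - a) (b - Re z)). split; [apply Rmin_pos; lra|].
  intros w Hw. assert (K := re_le_Cmod (w - z)). change (Re (w - z)) with (Re w - Re z) in K.
  assert (K1 := Rlt_le_trans _ _ _ Hw (Rmin_l _ _)).
  assert (K2 := Rlt_le_trans _ _ _ Hw (Rmin_r _ _)).
  assert (K3 : Rabs (Re w - Re z) < Re z - a) by lra.
  assert (K4 : Rabs (Re w - Re z) < b - Re z) by lra.
  apply Rabs_lt_between in K3. apply Rabs_lt_between in K4. unfold strip. lra.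
Qed.

Lemma segment_between a b t : 0 <= t <= 1 ->
  forall lo hi, lo < a < hi -> lo < b < hi -> lo < a + t * (b - a) < hi.
Proof.
  intros Ht lo hi Ha Hb. replace (a + t * (b - a)) with ((1 - t) * a + t * b) by ring.
  destruct (Rle_lt_or_eq_dec 0 t (proj1 Ht)) as [T|T].
  - split.
    + apply Rlt_le_trans with ((1 - t) * lo + t * b).
      * apply Rle_lt_trans with ((1 - t) * lo + t * lo); [right; ring|].
        apply Rplus_lt_compat_l, Rmult_lt_compat_l; lra.
      * apply Rplus_le_compat_r, Rmult_le_compat_l; lra.
    + apply Rle_lt_trans with ((1 - t) * hi + t * b).
      * apply Rplus_le_compat_r, Rmult_le_compat_l; lra.
      * apply Rlt_le_trans with ((1 - t) * hi + t * hi); [|right; ring].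
        apply Rplus_lt_compat_l, Rmult_lt_compat_l; lra.
  - subst t. lra.
Qed.

Lemma strip_convex a b : convex (strip a b).
Proof.
  intros z w t Hz Hw Ht. unfold strip in *.
  replace (Re (z + t * (w - z))) with (Re z + t * (Re w - Re z)) by (unfold Re; simpl; ring).
  now apply segment_between.
Qed.

Lemma hankel_radius g a b r1 r2 :
  r1 <= r2 -> admits g r1 -> a < ln r1 -> ln r2 < b -> holo (strip a b) g ->
  admits g r2 /\ hankel g r1 = hankel g r2.
Proof.
  intros H12 G1 Ha Hb Hg. assert (Hr := proj1 G1).
  assert (G2 : admits g r2).
  { apply admits_larger with r1; auto. intros w [phi [_ ->]]. eapply holo_cont; [exact Hg|].
    unfold strip. rewrite Re_log. assert (ln r1 <= ln r2) by (apply ln_le; lra). lra. }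
  split; auto. rewrite (hankel_boundary g r1 r2) by auto.
  rewrite (boundary_holo (strip a b)); auto.
  - ring.
  - apply strip_opened.
  - apply strip_convex.
  - intros w [Hw _]. unfold strip; lra.
Qed.

(** ** Closure properties of holomorphic functions *)

Lemma holo_sub (D D' : C -> Prop) f : (forall z, D z -> D' z) -> holo D' f -> holo D f.
Proof. intros H [f' Hf]. exists f'. auto. Qed.

Lemma holo_ext D f g : (forall z, f z = g z) -> holo D f -> holo D g.
Proof. intros E H. replace g with f; auto. now apply functional_extensionality. Qed.

Lemma holo_const D c : holo D (fun _ => c).
Proof. exists (fun _ => RtoC 0). intros z _. split; [apply deriv_const|apply cont_const]. Qed.

Lemma holo_id D : holo D (fun z => z).
Proof. exists (fun _ => RtoC 1). intros z _. split; [apply (deriv_incl cid)|apply cont_const]. Qed.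

Lemma holo_plus D f g : holo D f -> holo D g -> holo D (fun z => f z + g z)%C.
Proof.
  intros [f' Hf] [g' Hg]. exists (fun z => f' z + g' z)%C. intros z Hz.
  split; [apply deriv_plus; [now apply Hf|now apply Hg]|apply cont_plus; [now apply Hf|now apply Hg]].
Qed.

Lemma holo_mult D f g : holo D f -> holo D g -> holo D (fun z => f z * g z)%C.
Proof.
  intros Hf0 Hg0. assert (cf := fun z => holo_cont D f z Hf0). assert (cg := fun z => holo_cont D g z Hg0).
  destruct Hf0 as [f' Hf]. destruct Hg0 as [g' Hg].
  exists (fun z => f' z * g z + f z * g' z)%C. intros z Hz.
  split; [apply deriv_mult; [now apply Hf|now apply Hg]|].
  apply cont_plus; apply cont_mult; auto; [now apply Hf|now apply Hg].
Qed.

Lemma holo_opp D f : holo D f -> holo D (fun z => - f z)%C.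
Proof.
  intro H. apply holo_ext with (fun z => (-1) * f z)%C; [intro; ring|].
  apply holo_mult; [apply holo_const|easy].
Qed.

Lemma holo_minus D f g : holo D f -> holo D g -> holo D (fun z => f z - g z)%C.
Proof. intros. apply holo_plus; [easy|now apply holo_opp]. Qed.

Lemma holo_comp D D' (g f : C -> C) :
  holo D' g -> holo D f -> (forall z, D z -> D' (f z)) -> holo D (fun z => g (f z)).
Proof.
  intros Hg0 Hf0 HD. assert (cf := fun z => holo_cont D f z Hf0).
  destruct Hf0 as [f' Hf]. destruct Hg0 as [g' Hg].
  exists (fun z => g' (f z) * f' z)%C. intros z Hz. split.
  - apply (deriv_comp cid g f); [now apply Hg, HD|now apply Hf].
  - apply cont_mult; [|now apply Hf]. apply (cont_comp cid g' f); auto. now apply Hg, HD.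
Qed.

Lemma holo_Cexp D : holo D Cexp.
Proof. exists Cexp. intros z _. split; [apply deriv_Cexp|eapply deriv_cont, deriv_Cexp]. Qed.

Lemma holo_exp D f : holo D f -> holo D (fun z => Cexp (f z)).
Proof. intro H. apply (holo_comp D (fun _ => True) Cexp); auto. apply holo_Cexp. Qed.

Lemma holo_inv D (f : C -> C) :
  holo D f -> (forall z, D z -> f z <> 0) -> holo D (fun z => / f z)%C.
Proof.
  intros Hf Hn. apply (holo_comp D (fun z => z <> 0) Cinv f); auto.
  exists (fun z => - (/ (z * z)))%C. intros z Hz. split; [now apply deriv_Cinv|].
  apply cont_opp, cont_inv; [now apply Cmult_neq_0|].
  apply cont_mult; apply (cont_incl cid).
Qed.

Lemma holo_div D (f g : C -> C) :
  holo D f -> holo D g -> (forall z, D z -> g z <> 0) -> holo D (fun z => f z / g z)%C.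
Proof. intros. apply holo_mult; [easy|now apply holo_inv]. Qed.

Lemma deriv_shift f z l : deriv_at cid (fun h => f (z + h)%C) 0 l -> deriv_at cid f z l.
Proof.
  intros H e He. destruct (H e He) as [d [D Hd]]. exists d; split; auto. unfold cid in *.
  intros w Hw. specialize (Hd (w - z)%C). replace (w - z - 0)%C with (w - z)%C in Hd by ring.
  specialize (Hd Hw). replace (z + (w - z))%C with w in Hd by ring.
  now replace (z + 0)%C with z in Hd by ring.
Qed.

(** ** The logarithm on the right half-plane *)

Lemma cont_real_comp {T} (i : T -> C) (p : R -> R) (u : T -> R) t :
  continuous p (u t) -> cont_at i (fun x => RtoC (u x)) t ->
  cont_at i (fun x => RtoC (p (u x))) t.
Proof.
  intros Hp Hu e He.
  destruct (Hp (ball (p (u t)) e)) as [d Hd]; [now exists (mkposreal _ He)|].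
  destruct (Hu d (cond_pos d)) as [d' [D' H']]. exists d'; split; auto.
  intros t' Ht'. rewrite <- RtoC_minus, Cmod_R. apply Hd.
  specialize (H' t' Ht'). now rewrite <- RtoC_minus, Cmod_R in H'.
Qed.

Lemma cont_at_Cmod {T} (i f : T -> C) t :
  cont_at i f t -> cont_at i (fun x => RtoC (Cmod (f x))) t.
Proof.
  intros H e He. destruct (H e He) as [d [D Hd]]. exists d; split; auto.
  intros t' Ht'. specialize (Hd t' Ht'). rewrite <- RtoC_minus, Cmod_R.
  generalize (Cmod_reverse (f t') (f t)) (Cmod_reverse (f t) (f t')).
  rewrite (Cmod_minus_sym (f t)). intros. apply Rabs_def1; lra.
Qed.

Definition plog (z : C) : C := (ln (Cmod z), atan (Im z / Re z)).

Lemma Re_pos_neq_0 (z : C) : 0 < Re z -> z <> 0.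
Proof. intros H E. rewrite E in H. simpl in H. lra. Qed.

Lemma Cexp_plog z : 0 < Re z -> Cexp (plog z) = z.
Proof.
  intro Hz. assert (N := Re_pos_neq_0 z Hz). apply Cmod_gt_0 in N.
  unfold plog, Cexp. simpl Re. simpl Im. rewrite exp_ln by easy.
  assert (S : sqrt (1 + (Im z / Re z) ^ 2) = Cmod z / Re z).
  { unfold Cmod. rewrite <- (sqrt_pow2 (Re z)) at 2 by lra.
    rewrite <- sqrt_div_alt by (apply pow_lt; lra). f_equal.
    unfold Re, Im in *. field. lra. }
  rewrite cos_atan, sin_atan, !Rsqr_pow2, S. destruct z as [x y]. unfold Re, Im in *. simpl fst in *; simpl snd in *.
  apply injective_projections; simpl; field; lra.
Qed.

Lemma cont_plog z : 0 < Re z -> cont_at cid plog z.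
Proof.
  intro Hz. assert (N := Re_pos_neq_0 z Hz). apply Cmod_gt_0 in N.
  apply cont_ext with (fun z => RtoC (ln (Cmod z)) + Ci * RtoC (atan (Im z / Re z)))%C.
  { intro u. unfold plog. apply injective_projections; simpl; ring. }
  apply cont_plus; [|apply cont_mult; [apply cont_const|]].
  - apply (cont_real_comp cid ln Cmod).
    + apply (ex_derive_continuous ln). auto_derive. easy.
    + apply (cont_at_Cmod cid cid). apply (cont_incl cid).
  - apply (cont_real_comp cid atan (fun z => Im z / Re z)).
    + apply (ex_derive_continuous atan). auto_derive. easy.
    + assert (Q : cont_at cid (fun z => RtoC (Im z) * / RtoC (Re z))%C z).
      { apply cont_mult; [apply cont_Im|]. apply cont_inv; [|apply cont_Re].
        intro E. apply RtoC_inj in E. lra. }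
      intros e He. destruct (Q e He) as [d [D Hd]].
      exists (Rmin d (Re z)). split; [now apply Rmin_pos|]. intros w Hw.
      assert (K1 := Rlt_le_trans _ _ _ Hw (Rmin_l _ _)).
      assert (K2 := Rlt_le_trans _ _ _ Hw (Rmin_r _ _)).
      specialize (Hd w K1).
      assert (W : 0 < Re w).
      { unfold cid in K2. assert (K := re_le_Cmod (w - z)).
        change (Re (w - z)) with (Re w - Re z) in K.
        assert (K3 : Rabs (Re w - Re z) < Re z) by lra.
        apply Rabs_lt_between in K3. lra. }
      unfold Rdiv. rewrite !RtoC_mult, !RtoC_inv by lra. exact Hd.
Qed.

Lemma deriv_local_inverse (f g : C -> C) (z l : C) :
  l <> 0 -> deriv_at cid f (g z) l -> cont_at cid g z ->
  (exists r, 0 < r /\ forall w, Cmod (w - z) < r -> f (g w) = w) ->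
  deriv_at cid g z (/ l).
Proof.
  intros Nl Hf Hg [r [Hr Hinv]] e He.
  assert (P := proj1 (Cmod_gt_0 l) Nl). set (m := Cmod l) in *.
  (* The bound m / 2 yields |g w - g z| <= 2 |w - z| / m. The second bound, multiplied by this and
     divided by m, leaves exactly e |w - z|. *)
  destruct (Hf (Rmin (m / 2) (e * (m * m) / 2))) as [d1 [D1 H1]].
  { apply Rmin_pos; [lra|]. repeat apply Rmult_lt_0_compat; lra. }
  destruct (Hg d1 D1) as [d2 [D2 H2]].
  exists (Rmin r d2); split; [now apply Rmin_pos|]. intros w Hw.
  assert (K1 := Rlt_le_trans _ _ _ Hw (Rmin_l _ _)).
  assert (K2 := Rlt_le_trans _ _ _ Hw (Rmin_r _ _)).
  specialize (H1 (g w) (H2 w K2)). unfold cid in *.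
  rewrite (Hinv w K1), (Hinv z) in H1.
  2:{ replace (z - z)%C with (RtoC 0) by ring. now rewrite Cmod_0. }
  set (dg := (g w - g z)%C) in *. set (dz := (w - z)%C) in *.
  assert (G0 := Cmod_ge_0 dg). assert (Z0 := Cmod_ge_0 dz).
  assert (B1 : Cmod (dz - dg * l) <= m / 2 * Cmod dg).
  { eapply Rle_trans; [exact H1|]. apply Rmult_le_compat_r; [easy|apply Rmin_l]. }
  assert (B2 : Cmod (dz - dg * l) <= e * (m * m) / 2 * Cmod dg).
  { eapply Rle_trans; [exact H1|]. apply Rmult_le_compat_r; [easy|apply Rmin_r]. }
  assert (B3 : Cmod dg * m <= 2 * Cmod dz).
  { assert (T := Cmod_reverse (dg * l) dz). rewrite Cmod_minus_sym, Cmod_mult in T.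
    fold m in T. lra. }
  replace (dg - dz * / l)%C with ((- (dz - dg * l)) * / l)%C by (field; auto).
  rewrite Cmod_mult, Cmod_opp, Cmod_inv by auto. fold m.
  apply Rmult_le_reg_r with m; auto. rewrite Rmult_assoc, Rinv_l, Rmult_1_r by lra.
  eapply Rle_trans; [exact B2|].
  replace (e * (m * m) / 2 * Cmod dg) with (e * m / 2 * (Cmod dg * m)) by field.
  apply Rle_trans with (e * m / 2 * (2 * Cmod dz)).
  - apply Rmult_le_compat_l; [|easy]. apply Rmult_le_pos; [|lra]. apply Rmult_le_pos; lra.
  - right; field.
Qed.

Definition right_half (z : C) : Prop := 0 < Re z.

Lemma right_half_opened : opened right_half.
Proof.
  intros z Hz. exists (Re z). split; auto. intros w Hw.
  assert (K := re_le_Cmod (w - z)). change (Re (w - z)) with (Re w - Re z) in K.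
  assert (K3 : Rabs (Re w - Re z) < Re z) by lra.
  apply Rabs_lt_between in K3. unfold right_half. lra.
Qed.

Lemma deriv_plog z : 0 < Re z -> deriv_at cid plog z (/ z).
Proof.
  intro Hz. apply (deriv_local_inverse Cexp).
  - now apply Re_pos_neq_0.
  - eapply deriv_eq; [apply deriv_Cexp|now apply Cexp_plog].
  - now apply cont_plog.
  - destruct (right_half_opened z Hz) as [r [Hr H]]. exists r; split; auto.
    intros w Hw. apply Cexp_plog. now apply H.
Qed.

Lemma holo_plog : holo right_half plog.
Proof.
  exists Cinv. intros z Hz. split; [now apply deriv_plog|].
  apply (cont_inv cid cid); [now apply Re_pos_neq_0|apply (cont_incl cid)].
Qed.

(** ** The entire function [(exp v - 1) / v] *)

Definition expq (v : C) : C := int (fun t => Cexp (v * RtoC t)) 0 1.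

Lemma cont_Cexp_line (v : C) t : cont_at RtoC (fun t => Cexp (v * RtoC t)) t.
Proof. apply cont_exp, cont_mult; [apply cont_const|apply cont_incl]. Qed.

Lemma expq_spec v : (v * expq v)%C = (Cexp v - 1)%C.
Proof.
  unfold expq.
  assert (I : is_int (fun t => v * Cexp (v * RtoC t))%C 0 1
    ((fun t => Cexp (v * RtoC t)) 1 - (fun t => Cexp (v * RtoC t)) 0)%C).
  { apply (is_int_deriv (fun t => Cexp (v * RtoC t))); [lra| |].
    - intros t _. eapply deriv_eq.
      + apply deriv_exp, deriv_scal, deriv_incl.
      + cbv beta. ring.
    - intros. apply cont_mult; [apply cont_const|apply cont_Cexp_line]. }
  cbv beta in I. replace (v * RtoC 1)%C with v in I by ring.
  replace (v * RtoC 0)%C with (RtoC 0) in I by ring. rewrite Cexp_0 in I.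
  rewrite <- (is_int_unique _ _ _ _ I). symmetry. apply is_int_unique, is_int_scal.
  apply int_correct; [lra|]. intros; apply cont_Cexp_line.
Qed.

Lemma expq_0 : expq 0 = 1.
Proof.
  unfold expq. apply is_int_unique. assert (H := is_int_const 1 0 1 Rle_0_1).
  replace ((1 - 0) * 1)%C with (RtoC 1) in H by ring.
  eapply is_int_ext; [lra| |exact H]. intros t _. cbv beta.
  replace (0 * t)%C with (RtoC 0) by ring. now rewrite Cexp_0.
Qed.

Lemma moment_deriv (W : R -> C) v :
  (forall t, 0 <= t <= 1 -> cont_at RtoC W t) ->
  deriv_at cid (fun v => int (fun t => Cexp (v * RtoC t) * W t)%C 0 1) v
    (int (fun t => Cexp (v * RtoC t) * (RtoC t * W t))%C 0 1).
Proof.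
  intro HW. apply deriv_shift.
  apply deriv_ext with (fun h => int (fun t => Cexp (h * RtoC t) * (Cexp (v * RtoC t) * W t))%C 0 1).
  { intro h. f_equal. apply functional_extensionality. intro t.
    rewrite Cmult_assoc, <- Cexp_plus. do 2 f_equal. ring. }
  eapply deriv_eq.
  - apply int_exp_deriv; [lra| |].
    + intros. apply cont_incl.
    + intros. apply cont_mult; [apply cont_Cexp_line|auto].
  - f_equal. apply functional_extensionality. intro t. ring.
Qed.

Lemma holo_expq D : holo D expq.
Proof.
  exists (fun v => int (fun t => Cexp (v * RtoC t) * (RtoC t * 1))%C 0 1). intros v _.
  split.
  - apply deriv_ext with (fun v => int (fun t => Cexp (v * RtoC t) * 1)%C 0 1).
    { intro u. unfold expq. f_equal. apply functional_extensionality. intro t. ring. }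
    apply moment_deriv. intros; apply cont_const.
  - eapply deriv_cont. apply (moment_deriv (fun t => RtoC t * 1)%C).
    intros. apply cont_mult; [apply cont_incl|apply cont_const].
Qed.

Lemma Cexp_eq_1 v : Cexp v = 1 -> exists k : Z, v = (2 * RtoC PI * Ci * RtoC (IZR k))%C.
Proof.
  intro H. assert (M : exp (Re v) = 1).
  { rewrite <- Cmod_Cexp, H. apply Cmod_1. }
  assert (Rv : Re v = 0).
  { rewrite <- (ln_exp (Re v)), M. apply ln_1. }
  assert (Cv : cos (Im v) = 1).
  { assert (E : Re (Cexp v) = 1) by now rewrite H.
    unfold Cexp in E. rewrite M in E. simpl in E. lra. }
  (* By the half-angle formula cos y = 1 becomes sin(y / 2) = 0, which gives y = 2 k PI. *)
  assert (S : sin (Im v / 2) = 0).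
  { replace (Im v) with (2 * (Im v / 2)) in Cv by field. rewrite cos_2a_sin in Cv. nra. }
  destruct (sin_eq_0_0 _ S) as [k Hk]. exists k.
  destruct v as [x y]. simpl in *. apply injective_projections; simpl; [lra|].
  assert (y = 2 * (IZR k * PI)) by lra. rewrite H0. ring.
Qed.

(** The zeros of [expq] are the nonzero multiples of 2 i PI. Factoring exp v - 1 as v [expq] v thus
    isolates the simple zero at 0 and makes the cofactor invertible in the open strip of half-width
    2 PI. *)
Lemma expq_neq_0 v : Rabs (Im v) < 2 * PI -> expq v <> 0.
Proof.
  intros Hv E. assert (S := expq_spec v). rewrite E in S.
  assert (X : Cexp v = 1).
  { replace (Cexp v) with ((Cexp v - 1) + 1)%C by ring. rewrite <- S. ring. }
  destruct (Cexp_eq_1 v X) as [k Hk].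
  assert (k = 0%Z).
  { rewrite Hk in Hv.
    replace (Im (2 * PI * Ci * IZR k)) with (2 * PI * IZR k) in Hv by (simpl; ring).
    assert (P := PI_RGT_0). rewrite Rabs_mult, (Rabs_pos_eq (2 * PI)) in Hv by lra.
    assert (Rabs (IZR k) < 1).
    { apply Rmult_lt_reg_l with (2 * PI); lra. }
    apply Rabs_lt_between in H. destruct H as [H1 H2].
    apply lt_IZR in H2. apply (lt_IZR (-1)) in H1. lia. }
  subst k. rewrite Hk in E. replace (2 * PI * Ci * 0)%C with (RtoC 0) in E by ring.
  rewrite expq_0 in E. apply RtoC_inj in E. lra.
Qed.

(** ** Growth along the rays *)

Lemma exp_ln_subexp N eps r :
  0 <= N -> 0 < eps -> 0 < r ->
  exists M, forall x, r <= x -> exp (N * Rabs (ln x)) <= M * exp (eps * x).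
Proof.
  intros HN He Hr. set (K := N + 1). assert (HK : 0 < K) by (unfold K; lra).
  (* The ray may start below 1, where ln is negative; on it |ln x| <= ln x + 2 L. *)
  set (L := Rmax 0 (- ln r)).
  exists (exp (K * (2 * L + Rabs (ln (K / eps))))). intros x Hx.
  rewrite <- exp_plus. apply exp_le.
  assert (L0 : 0 <= L) by apply Rmax_l. assert (L1 : - ln r <= L) by apply Rmax_r.
  assert (Hl : ln r <= ln x) by (apply ln_le; lra).
  assert (A : Rabs (ln x) <= ln x + 2 * L).
  { unfold Rabs. destruct (Rcase_abs (ln x)); lra. }
  (* The inequality ln t <= t at t = eps x / K trades the logarithm for a small multiple of x. *)
  assert (B : ln x <= eps * x / K + ln (K / eps)).
  { assert (Q : 0 < eps * x / K) by (apply Rdiv_lt_0_compat; [apply Rmult_lt_0_compat|]; lra).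
    assert (Q2 : 0 < K / eps) by (apply Rdiv_lt_0_compat; lra).
    replace x with (eps * x / K * (K / eps)) at 1 by (field; lra).
    rewrite ln_mult by auto.
    assert (T := exp_ineq1_le (ln (eps * x / K))). rewrite exp_ln in T by auto. lra. }
  apply Rle_trans with (K * Rabs (ln x)).
  { apply Rmult_le_compat_r; [apply Rabs_pos|unfold K; lra]. }
  apply Rle_trans with (K * (eps * x / K + Rabs (ln (K / eps)) + 2 * L)).
  - apply Rmult_le_compat_l; [lra|]. generalize (Rle_abs (ln (K / eps))). lra.
  - right. field. lra.
Qed.

Lemma subexp_exp_norm N r : 0 <= N -> 0 < r -> subexp (fun w => RtoC (exp (N * Cmod w))) r.
Proof.
  intros HN Hr eps He. destruct (exp_ln_subexp N eps r HN He Hr) as [M HM].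
  exists (exp (N * (2 * PI)) * M). intros w [x [v [Hx [Hv ->]]]].
  rewrite Cmod_R, Rabs_pos_eq by (left; apply exp_pos). rewrite Re_log, exp_ln by lra.
  rewrite Rmult_assoc. apply Rle_trans with (exp (N * (2 * PI)) * exp (N * Rabs (ln x))).
  - rewrite <- exp_plus. apply exp_le. rewrite <- Rmult_plus_distr_l.
    apply Rmult_le_compat_l; auto. rewrite Rplus_comm.
    eapply Rle_trans; [apply Cmod_triangle|]. rewrite Cmod_mult, Cmod_Ci, !Cmod_R, Rmult_1_l.
    apply Rplus_le_compat_l. assert (P := PI2_pos).
    destruct Hv as [->| ->]; [rewrite Rabs_R0|rewrite Rabs_pos_eq]; lra.
  - apply Rmult_le_compat_l; [left; apply exp_pos|auto].
Qed.

Lemma subexp_le (p q : C -> C) r :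
  (forall w, on_ray r w -> Cmod (q w) <= Cmod (p w)) -> subexp p r -> subexp q r.
Proof.
  intros H Hp e He. destruct (Hp e He) as [M HM]. exists M. intros w Hw.
  eapply Rle_trans; [now apply H|auto].
Qed.

Lemma subexp_exp s r : 0 < r -> subexp (fun w => Cexp (s * w)) r.
Proof.
  intro Hr. apply subexp_le with (2 := subexp_exp_norm (Cmod s) r (Cmod_ge_0 s) Hr).
  intros w _. rewrite Cmod_R, Rabs_pos_eq by (left; apply exp_pos). apply Cexp_mult_le.
Qed.

Lemma subexp_id r : 0 < r -> subexp (fun w => w) r.
Proof.
  intro Hr. apply subexp_le with (2 := subexp_exp_norm 1 r Rle_0_1 Hr).
  intros w _. rewrite Cmod_R, Rabs_pos_eq by (left; apply exp_pos). rewrite Rmult_1_l.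
  generalize (exp_ineq1_le (Cmod w)). lra.
Qed.

Lemma cont_lin (s w : C) : cont_at cid (fun w => s * w)%C w.
Proof. apply cont_mult; [apply cont_const|apply (cont_incl cid)]. Qed.

Lemma admits_exp s g r : admits g r -> admits (fun w => Cexp (s * w) * g w)%C r.
Proof.
  intro Hg. apply (admits_mult (fun w => Cexp (s * w)) g); auto;
    try (intros; apply cont_exp, cont_lin). apply subexp_exp, Hg.
Qed.

Lemma admits_id g r : admits g r -> admits (fun w => w * g w)%C r.
Proof.
  intro Hg. apply (admits_mult (fun w => w) g); auto;
    try (intros; apply (cont_incl cid)). apply subexp_id, Hg.
Qed.

(** The derivative in s is again an integral of this form, with g replaced by w g, so the lemma can
    be applied repeatedly. The growth of exp(|w|) is only polynomial in |z| on the rays and is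
    absorbed by the decay of g. *)
Lemma hankel_deriv_s g r s :
  admits g r ->
  deriv_at cid (fun s => hankel (fun w => Cexp (s * w) * g w)%C r) s
    (hankel (fun w => Cexp (s * w) * (w * g w))%C r).
Proof.
  intros Hg. assert (Hr := proj1 Hg). apply deriv_shift.
  apply deriv_ext with (fun h => hankel (fun w => Cexp (h * w) * (Cexp (s * w) * g w))%C r).
  { intro h. apply hankel_ext. intro w.
    rewrite Cmult_assoc, <- Cexp_plus. do 2 f_equal. ring. }
  eapply deriv_eq.
  - apply (hankel_exp_deriv (fun w => w) _ r 1); [lra| | | |].
    + now apply admits_exp.
    + intros; apply (cont_incl cid).
    + intros; apply (cont_incl cid).
    + apply (admits_mult (fun w => RtoC (exp (1 * Cmod w))) (fun w => Cexp (s * w) * g w)%C).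
      * intros w _. apply (cont_real_comp cid exp (fun w => 1 * Cmod w)).
        -- apply (ex_derive_continuous exp). auto_derive; auto.
        -- apply cont_ext with (fun w => 1 * RtoC (Cmod w))%C.
           { intro u. now rewrite RtoC_mult. }
           apply cont_mult; [apply cont_const|].
           apply (cont_at_Cmod cid cid), (cont_incl cid).
      * intros w _. apply (cont_real_comp cid exp (fun w => 1 * Cmod w)).
        -- apply (ex_derive_continuous exp). auto_derive; auto.
        -- apply cont_ext with (fun w => 1 * RtoC (Cmod w))%C.
           { intro u. now rewrite RtoC_mult. }
           apply cont_mult; [apply cont_const|].
           apply (cont_at_Cmod cid cid), (cont_incl cid).
      * apply subexp_exp_norm; auto; lra.
      * now apply admits_exp.
  - apply hankel_ext. intro w. ring.
Qed.

(** ** The integrals of [z ^ (s - 1) exp (- om z)] *)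

Lemma Cexp_ray r w : 0 < r -> on_ray r w -> Cexp w = RtoC (exp (Re w)) /\ r <= exp (Re w).
Proof.
  intros Hr [x [v [Hx [Hv ->]]]]. rewrite Cexp_log, Re_log, exp_ln by lra. split; auto.
  destruct Hv as [->| ->].
  - rewrite cos_0, sin_0. apply injective_projections; simpl; ring.
  - rewrite cos_2PI, sin_2PI. apply injective_projections; simpl; ring.
Qed.

Lemma Cexp_circ r w : 0 < r -> on_circ r w -> Cmod (Cexp w) = r.
Proof.
  intros Hr [phi [_ ->]]. rewrite Cmod_Cexp, Re_log. now apply exp_ln.
Qed.

Lemma holo_gexp D s om : holo D (fun w => Cexp (s * w) * Cexp (- (om * Cexp w)))%C.
Proof.
  apply holo_mult.
  - apply holo_exp, holo_mult; [apply holo_const|apply holo_id].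
  - apply holo_exp, holo_opp, holo_mult; [apply holo_const|apply holo_Cexp].
Qed.

Lemma admits_exp_exp om r :
  0 < r -> 0 < Re om -> admits (fun w => Cexp (- (om * Cexp w))) r.
Proof.
  intros Hr Ho.
  assert (K : forall w, cont_at cid (fun w => Cexp (- (om * Cexp w))) w).
  { intro w. apply cont_exp, cont_opp, cont_mult; [apply cont_const|].
    apply cont_exp, (cont_incl cid). }
  split; [|split; [|split]]; auto.
  exists 1, (Re om). split; auto. intros w Hw. destruct (Cexp_ray r w Hr Hw) as [E _].
  rewrite E, Cmod_Cexp, Rmult_1_l. right. f_equal. simpl. unfold Re. ring.
Qed.

Lemma admits_gexp s om r :
  0 < r -> 0 < Re om -> admits (fun w => Cexp (s * w) * Cexp (- (om * Cexp w)))%C r.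
Proof. intros. apply admits_exp. now apply admits_exp_exp. Qed.

(** The contour integral of z^(s - 1) exp(-om z); the radius 1 is a normalization, by
    [hexp_radius]. *)
Definition hexp (s om : C) : C :=
  hankel (fun w => Cexp (s * w) * Cexp (- (om * Cexp w)))%C 1.

Lemma holo_radius g r r' :
  0 < r -> 0 < r' -> (forall D, holo D g) -> (forall r, 0 < r -> admits g r) ->
  hankel g r = hankel g r'.
Proof.
  intros Hr Hr' Hg Ha.
  destruct (Rle_dec r r') as [L|L].
  - apply (hankel_radius g (ln r - 1) (ln r' + 1)); auto; lra.
  - symmetry. apply (hankel_radius g (ln r' - 1) (ln r + 1)); auto; lra.
Qed.

Lemma hexp_radius s om r :
  0 < r -> 0 < Re om ->
  hankel (fun w => Cexp (s * w) * Cexp (- (om * Cexp w)))%C r = hexp s om.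
Proof.
  intros Hr Ho. apply holo_radius; auto; [lra| |].
  - intro D. apply holo_gexp.
  - intros. now apply admits_gexp.
Qed.

(** Integration by parts: the w-derivative of exp(s w - om exp w) is exact and its primitive decays,
    so its contour integral is 0. *)
Lemma hexp_succ s om : 0 < Re om -> (s * hexp s om = om * hexp (s + 1) om)%C.
Proof.
  intro Ho. unfold hexp.
  assert (A1 := admits_scal s _ 1 (admits_gexp s om 1 Rlt_0_1 Ho)).
  assert (A2 := admits_scal (- om)%C _ 1 (admits_gexp (s + 1) om 1 Rlt_0_1 Ho)).
  assert (Z : hankel (fun w => s * (Cexp (s * w) * Cexp (- (om * Cexp w)))
     + - om * (Cexp ((s + 1) * w) * Cexp (- (om * Cexp w))))%C 1 = 0).
  { assert (Dq : forall w, deriv_at cid (fun w => Cexp (s * w) * Cexp (- (om * Cexp w)))%C w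
       (s * (Cexp (s * w) * Cexp (- (om * Cexp w)))
         + - om * (Cexp ((s + 1) * w) * Cexp (- (om * Cexp w))))%C).
    { intro w. eapply deriv_eq.
      - apply deriv_mult.
        + apply deriv_exp, deriv_scal, (deriv_incl cid).
        + apply deriv_exp, deriv_opp, deriv_scal, deriv_exp, (deriv_incl cid).
      - cbv beta. replace ((s + 1) * w)%C with (s * w + w)%C by ring.
        rewrite Cexp_plus. unfold cid. ring. }
    apply (hankel_exact (fun w => Cexp (s * w) * Cexp (- (om * Cexp w)))%C).
    - now apply admits_plus.
    - auto.
    - auto.
    - apply (admits_gexp s om 1); auto. lra. }
  rewrite hankel_plus in Z by auto.
  rewrite !hankel_scal in Z by (apply admits_gexp; auto; lra).
  change (hankel _ 1) with (hexp s om) in Z at 1.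
  change (hankel _ 1) with (hexp (s + 1) om) in Z.
  fold (hexp s om) (hexp (s + 1) om).
  set (a := hexp s om) in *. set (b := hexp (s + 1) om) in *.
  replace (s * a)%C with ((s * a + - om * b) + om * b)%C by ring. rewrite Z. ring.
Qed.

Lemma hexp_deriv_om s om :
  0 < Re om -> deriv_at cid (hexp s) om (- hexp (s + 1) om).
Proof.
  intro Ho. apply deriv_shift. unfold hexp.
  apply deriv_ext with (fun h => hankel (fun w => Cexp (h * - Cexp w)
     * (Cexp (s * w) * Cexp (- (om * Cexp w))))%C 1).
  { intro h. apply hankel_ext. intro w.
    replace (- ((om + h) * Cexp w))%C with (h * - Cexp w + - (om * Cexp w))%C by ring.
    rewrite Cexp_plus. ring. }
  assert (cE : forall w, cont_at cid (fun w => - Cexp w)%C w).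
  { intro w. apply cont_opp, cont_exp, (cont_incl cid). }
  eapply deriv_eq.
  (* On the rays z is a positive real, so the extra factor exp(|z| Re om / 2) merely replaces om by
     om - Re om / 2, which still has positive real part. *)
  - apply (hankel_exp_deriv (fun w => - Cexp w)%C _ 1 (Re om / 2)); auto; [lra| |].
    + apply admits_gexp; auto; lra.
    + assert (Ho2 : 0 < Re (om - RtoC (Re om / 2))).
      { unfold Re in *; simpl; lra. }
      destruct (admits_gexp s _ 1 Rlt_0_1 Ho2) as [_ [_ [_ [M [c [Hc HM]]]]]].
      exists M, c; split; auto. intros w Hw. eapply Rle_trans; [|now apply HM].
      destruct (Cexp_ray 1 w Rlt_0_1 Hw) as [E _].
      rewrite !Cmod_mult, Cmod_R, Rabs_pos_eq by (left; apply exp_pos).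
      rewrite Cmod_opp, E, Cmod_R, Rabs_pos_eq by (left; apply exp_pos).
      right. rewrite (Rmult_comm (exp _)), Rmult_assoc. f_equal.
      rewrite !Cmod_Cexp, <- exp_plus. f_equal. unfold Re; simpl. field.
  - rewrite <- (hankel_ext (fun w => (-1) * (Cexp ((s + 1) * w) * Cexp (- (om * Cexp w))))%C).
    + rewrite hankel_scal by (apply admits_gexp; auto; lra). ring.
    + intro w. replace ((s + 1) * w)%C with (s * w + w)%C by ring. rewrite Cexp_plus. ring.
Qed.

(** Along the segment from 1 to om, which stays in the right half-plane, om^s [hexp] s om has
    derivative 0: [hexp_deriv_om] produces [hexp] (s + 1) om, and [hexp_succ] converts it back. *)
Theorem hexp_scale s om : 0 < Re om -> hexp s om = (Cexp (- (s * plog om)) * hexp s 1)%C.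
Proof.
  intro Ho.
  set (p := fun t : R => (1 + RtoC t * (om - 1))%C).
  assert (Rp : forall t, 0 <= t <= 1 -> 0 < Re (p t)).
  { intros t Ht. unfold p.
    replace (Re (1 + t * (om - 1))) with (1 + t * (Re om - 1)) by (unfold Re; simpl; ring).
    assert (H := segment_between 1 (Re om) t Ht 0 (Re om + 2)). lra. }
  assert (Dp : forall t, deriv_at RtoC p t (om - 1)%C).
  { intro t. unfold p. eapply deriv_eq.
    - apply deriv_plus; [apply deriv_const|].
      apply deriv_mult; [apply deriv_incl|apply deriv_const].
    - cbv beta. ring. }
  assert (C : (fun t => Cexp (s * plog (p t)) * hexp s (p t))%C 1
            = (fun t => Cexp (s * plog (p t)) * hexp s (p t))%C 0).
  { apply (deriv_zero_const (fun t => Cexp (s * plog (p t)) * hexp s (p t))%C); [lra|].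
    intros t Ht. assert (H := Rp t Ht). assert (N := Re_pos_neq_0 _ H). eapply deriv_eq.
    - apply deriv_mult.
      + apply deriv_exp, deriv_scal.
        apply (deriv_comp RtoC plog p); [now apply deriv_plog|apply Dp].
      + apply (deriv_comp RtoC (hexp s) p); [now apply hexp_deriv_om|apply Dp].
    - cbv beta.
      replace (hexp (s + 1) (p t)) with (/ p t * (s * hexp s (p t)))%C.
      + field. exact N.
      + rewrite hexp_succ by auto. field. exact N. }
  cbv beta in C. unfold p in C.
  replace (1 + 1 * (om - 1))%C with om in C by ring.
  replace (1 + 0 * (om - 1))%C with (RtoC 1) in C by ring.
  assert (L1 : plog 1 = 0).
  { unfold plog. rewrite Cmod_1, ln_1. simpl. rewrite Rdiv_0_l, atan_0. reflexivity. }
  rewrite L1 in C. replace (s * 0)%C with (RtoC 0) in C by ring. rewrite Cexp_0 in C.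
  replace (hexp s 1) with (1 * hexp s 1)%C by ring. rewrite <- C, Cmult_assoc, Cexp_opp_mult.
  ring.
Qed.

Definition hk (s : C) : C := hexp s 1.

Lemma hk_succ s : hk (s + 1) = (s * hk s)%C.
Proof. unfold hk. rewrite hexp_succ by (simpl; lra). ring. Qed.

Lemma hk_deriv_ex s : exists l, deriv_at cid hk s l.
Proof.
  eexists. unfold hk, hexp.
  apply (hankel_deriv_s (fun w => Cexp (- (1 * Cexp w))) 1 s).
  apply admits_exp_exp; simpl; lra.
Qed.

(** ** Hankel's formula for the Gamma function *)

Definition on_edges (r1 r2 : R) (w : C) : Prop :=
  (exists x v, r1 <= x <= r2 /\ (v = 0 \/ v = 2 * PI) /\
     w = (RtoC (ln x) + Ci * RtoC v)%C) \/ on_circ r1 w \/ on_circ r2 w.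

Lemma boundary_plus f g h r1 r2 :
  0 < r1 -> r1 <= r2 -> (forall w, on_edges r1 r2 w -> h w = (f w + g w)%C) ->
  (forall w, on_edges r1 r2 w -> cont_at cid f w) ->
  (forall w, on_edges r1 r2 w -> cont_at cid g w) ->
  boundary h r1 r2 = (boundary f r1 r2 + boundary g r1 r2)%C.
Proof.
  intros H1 H12 E Hf Hg.
  assert (T : forall v, v = 0 \/ v = 2 * PI ->
    int (kray h v) r1 r2 = (int (kray f v) r1 r2 + int (kray g v) r1 r2)%C).
  { intros v Hv. apply is_int_unique.
    assert (On : forall t, r1 <= t <= r2 -> on_edges r1 r2 (RtoC (ln t) + Ci * RtoC v)%C).
    { intros t Ht. left. now exists t, v. }
    apply is_int_ext with (fun t => kray f v t + kray g v t)%C; auto.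
    - intros t Ht. unfold kray. rewrite E by (apply On; lra). unfold Cdiv. ring.
    - apply is_int_plus; apply int_correct; auto; intros t Ht; apply kray_cont; try lra;
        [apply Hf|apply Hg]; now apply On. }
  assert (A : forall r, r = r1 \/ r = r2 -> int (karc h r) 0 (2 * PI)
    = (int (karc f r) 0 (2 * PI) + int (karc g r) 0 (2 * PI))%C).
  { intros r Hr. apply is_int_unique.
    assert (On : forall t, 0 <= t <= 2 * PI -> on_edges r1 r2 (RtoC (ln r) + Ci * RtoC t)%C).
    { intros t Ht. right. destruct Hr as [->| ->]; [left|right]; now exists t. }
    apply is_int_ext with (fun t => karc f r t + karc g r t)%C; [apply PI2_pos| |].
    - intros t Ht. unfold karc. rewrite E by (apply On; lra). ring.
    - apply is_int_plus; (apply int_correct; [apply PI2_pos|]); intros t Ht; apply karc_cont;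
        [apply Hf|apply Hg]; now apply On. }
  unfold boundary. rewrite !T, !A by auto. ring.
Qed.

Lemma edges_ray r1 r2 w :
  0 < r1 -> 0 < r2 -> on_edges r1 r2 w ->
  (exists x, r1 <= x <= r2 /\ Cexp w = RtoC x) \/ Cmod (Cexp w) = r1 \/ Cmod (Cexp w) = r2.
Proof.
  intros H1 H2 [[x [v [Hx [Hv ->]]]]|H].
  - left. exists x; split; auto.
    destruct (Cexp_ray x (RtoC (ln x) + Ci * RtoC v)%C) as [E _].
    + lra.
    + exists x, v. split; [lra|auto].
    + rewrite E, Re_log, exp_ln; [reflexivity|lra].
  - right. destruct H as [[p [Hp ->]]|[p [Hp ->]]]; rewrite Cmod_Cexp, Re_log.
    + left. now apply exp_ln.
    + right. now apply exp_ln.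
Qed.

Lemma one_plus_neq_0 (z : C) : Cmod z <> 1 -> (1 + z)%C <> 0.
Proof.
  intros H E. apply H. replace z with (- (1))%C.
  - now rewrite Cmod_opp, Cmod_1.
  - replace z with ((1 + z) - 1)%C by ring. rewrite E. ring.
Qed.

Lemma one_plus_pos_neq_0 (x : R) : 0 < x -> (1 + RtoC x)%C <> 0.
Proof. intros H E. rewrite <- RtoC_plus in E. apply RtoC_inj in E. lra. Qed.

Lemma holo_one_plus D :
  (forall w, D w -> (1 + Cexp w)%C <> 0) -> holo D (fun w => / (1 + Cexp w))%C.
Proof.
  intro H. apply holo_inv; auto. apply holo_plus; [apply holo_const|apply holo_Cexp].
Qed.

Lemma cont_one_plus w :
  (1 + Cexp w)%C <> 0 -> cont_at cid (fun w => / (1 + Cexp w))%C w.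
Proof.
  intro H. apply cont_inv; auto. apply cont_plus; [apply cont_const|].
  apply cont_exp, (cont_incl cid).
Qed.

(** The function 1 / (1 + exp w) has period 2 i PI, so the two horizontal sides of the rectangle
    cancel and Cauchy's theorem equates the two vertical ones. *)
Lemma arc_one_plus_const a b r1 r2 :
  0 < r1 -> r1 <= r2 -> a < ln r1 -> ln r2 < b ->
  (forall w, strip a b w -> (1 + Cexp w)%C <> 0) ->
  int (karc (fun w => / (1 + Cexp w))%C r1) 0 (2 * PI)
  = int (karc (fun w => / (1 + Cexp w))%C r2) 0 (2 * PI).
Proof.
  intros H1 H12 Ha Hb Hn.
  assert (Z := boundary_holo (strip a b) (fun w => / (1 + Cexp w))%C r1 r2 H1 H12
    (strip_opened a b) (strip_convex a b) (holo_one_plus _ Hn)).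
  assert (Z' := Z ltac:(intros w [Hw _]; unfold strip; lra)). clear Z. unfold boundary in Z'.
  replace (kray (fun w => / (1 + Cexp w))%C (2 * PI))
    with (kray (fun w => / (1 + Cexp w))%C 0) in Z'.
  2:{ apply functional_extensionality. intro t. unfold kray. do 3 f_equal.
      rewrite !Cexp_plus, Cexp_2PI. replace (Ci * 0)%C with (RtoC 0) by ring.
      now rewrite Cexp_0. }
  set (I := int (kray _ _) _ _) in Z'.
  set (J1 := int _ _ _) in Z' |- *. set (J2 := int _ _ _) in Z' |- *.
  assert (E : (Ci * (J1 - J2))%C = 0).
  { rewrite <- Z'. ring. }
  replace J1 with (J2 + (- Ci) * (Ci * (J1 - J2)))%C.
  - rewrite E. ring.
  - replace (J2 + - Ci * (Ci * (J1 - J2)))%C with (J2 + - (Ci * Ci) * (J1 - J2))%C by ring.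
    replace (Ci * Ci)%C with (RtoC (-1)).
    + apply injective_projections; simpl; ring.
    + apply injective_projections; simpl; ring.
Qed.

Lemma one_plus_lower (z : C) : 1 - Cmod z <= Cmod (1 + z).
Proof.
  generalize (Cmod_reverse 1 (- z)). rewrite Cmod_opp, Cmod_1.
  replace (1 - - z)%C with (1 + z)%C by ring. auto.
Qed.

Lemma Cmod_upper_one_plus (z : C) : Cmod z - 1 <= Cmod (1 + z).
Proof.
  generalize (Cmod_reverse z (- (1))). rewrite Cmod_opp, Cmod_1.
  replace (z - - (1))%C with (1 + z)%C by ring. auto.
Qed.

Lemma C_eq_eps (a b : C) : (forall eps, 0 < eps -> Cmod (a - b) <= eps) -> a = b.
Proof.
  intro H. replace a with ((a - b) + b)%C by ring.
  replace (a - b)%C with (RtoC 0); [ring|]. symmetry. apply Cmod_eq_0.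
  apply Rle_antisym; [|apply Cmod_ge_0]. apply le_epsilon. intros e He.
  rewrite Rplus_0_l. auto.
Qed.

Lemma karc_one_plus_int r : 0 < r -> r <> 1 ->
  is_int (karc (fun w => / (1 + Cexp w))%C r) 0 (2 * PI)
    (int (karc (fun w => / (1 + Cexp w))%C r) 0 (2 * PI)).
Proof.
  intros Hr H1. apply int_correct; [apply PI2_pos|]. intros t Ht.
  apply karc_cont, cont_one_plus, one_plus_neq_0.
  rewrite Cmod_Cexp, Re_log, exp_ln; auto.
Qed.

(** Inside the unit circle the integral is independent of the radius, and as the radius shrinks the
    integrand tends to 1 uniformly. The jump from this value to that of [arc_one_plus_large] is the
    residue at z = -1. *)
Lemma arc_one_plus_small r :
  0 < r < 1 -> int (karc (fun w => / (1 + Cexp w))%C r) 0 (2 * PI) = RtoC (2 * PI).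
Proof.
  intro Hr. apply C_eq_eps. intros eps He. assert (P := PI_RGT_0).
  (* With d <= 1 / 2 the factor |1 / (1 + z)| is at most 2, and 4 PI d <= eps bounds the integral of
     the difference. *)
  set (d := Rmin r (Rmin (1 / 2) (eps / (4 * PI)))).
  assert (D0 : 0 < d).
  { unfold d. repeat apply Rmin_pos; try lra. apply Rdiv_lt_0_compat; lra. }
  assert (D1 : d <= r) by apply Rmin_l.
  assert (D2 : d <= 1 / 2) by (eapply Rle_trans; [apply Rmin_r|apply Rmin_l]).
  assert (D3 : d <= eps / (4 * PI)) by (eapply Rle_trans; [apply Rmin_r|apply Rmin_r]).
  rewrite <- (arc_one_plus_const (ln d - 1) 0 d r); auto; try lra.
  2:{ rewrite <- ln_1. apply ln_increasing; lra. }
  2:{ intros w [_ Hw]. apply one_plus_neq_0. rewrite Cmod_Cexp.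
      assert (exp (Re w) < 1) by (rewrite <- exp_0; now apply exp_increasing). lra. }
  assert (I := is_int_plus _ _ _ _ _ _ (karc_one_plus_int d D0 ltac:(lra))
                 (is_int_const (- (1)) 0 (2 * PI) PI2_pos)).
  replace ((2 * PI)%R - 0)%C with (RtoC (2 * PI)) in I by ring.
  set (J := int _ _ _) in *.
  replace (J - (2 * PI)%R)%C with (J + (2 * PI)%R * - (1))%C by ring.
  apply Rle_trans with ((2 * PI - 0) * (2 * d)).
  2:{ apply Rle_trans with (4 * PI * (eps / (4 * PI))).
      - replace ((2 * PI - 0) * (2 * d)) with (4 * PI * d) by ring.
        apply Rmult_le_compat_l; lra.
      - right; field; lra. }
  eapply is_int_bound; [apply PI2_pos| |exact I].
  intros t Ht. cbv beta. unfold karc. set (z := Cexp _).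
  assert (Z : Cmod z = d) by (unfold z; rewrite Cmod_Cexp, Re_log, exp_ln; lra).
  assert (N : (1 + z)%C <> 0) by (apply one_plus_neq_0; lra).
  replace (/ (1 + z) + - (1))%C with (- z * / (1 + z))%C by (field; auto).
  rewrite Cmod_mult, Cmod_opp, Cmod_inv, Z by auto.
  assert (L := one_plus_lower z). rewrite Z in L.
  rewrite (Rmult_comm 2). apply Rmult_le_compat_l; [lra|].
  replace 2 with (/ (1 / 2)) by field. apply Rinv_le_contravar; lra.
Qed.

(** Outside the unit circle the radius may be sent to infinity, where the integrand tends to 0. *)
Lemma arc_one_plus_large r :
  1 < r -> int (karc (fun w => / (1 + Cexp w))%C r) 0 (2 * PI) = 0.
Proof.
  intro Hr. apply C_eq_eps. intros eps He. assert (P := PI_RGT_0).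
  set (d := Rmax r (1 + 2 * PI / eps)).
  assert (Q : 0 < 2 * PI / eps) by (apply Rdiv_lt_0_compat; lra).
  assert (D1 : r <= d) by apply Rmax_l.
  assert (D2 : 1 + 2 * PI / eps <= d) by apply Rmax_r.
  rewrite (arc_one_plus_const 0 (ln d + 1) r d); auto; try lra.
  2:{ rewrite <- ln_1. apply ln_increasing; lra. }
  2:{ intros w [Hw _]. apply one_plus_neq_0. rewrite Cmod_Cexp.
      assert (1 < exp (Re w)) by (rewrite <- exp_0; now apply exp_increasing). lra. }
  assert (I := karc_one_plus_int d ltac:(lra) ltac:(lra)).
  set (J := int _ _ _) in *. replace (J - 0)%C with J by ring.
  apply Rle_trans with ((2 * PI - 0) * (eps / (2 * PI))).
  2:{ right; field; lra. }
  eapply is_int_bound; [apply PI2_pos| |exact I].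
  intros t Ht. cbv beta. unfold karc. set (z := Cexp _).
  assert (Z : Cmod z = d) by (unfold z; rewrite Cmod_Cexp, Re_log, exp_ln; lra).
  assert (N : (1 + z)%C <> 0) by (apply one_plus_neq_0; lra).
  rewrite Cmod_inv by auto.
  assert (L := Cmod_upper_one_plus z). rewrite Z in L.
  replace (eps / (2 * PI)) with (/ (2 * PI / eps)) by (field; lra).
  apply Rinv_le_contravar; lra.
Qed.

(** In z = exp w this is z^s exp(-x (1 + z)) / (1 + z). Differentiation in x cancels the denominator
    and leaves -exp(-x) times the integrand of [hexp] s x, so its contour integral is a primitive,
    up to sign, of Euler's integrand times [hk] s. *)
Definition gker (s : C) (x : C) (w : C) : C :=
  (Cexp (s * w) * (Cexp (- (x * (1 + Cexp w))) * / (1 + Cexp w)))%C.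

Definition horizontal (a b : R) (w : C) : Prop := a < Im w < b.

Lemma horizontal_opened a b : opened (horizontal a b).
Proof.
  intros z [H1 H2]. exists (Rmin (Im z - a) (b - Im z)). split; [apply Rmin_pos; lra|].
  intros w Hw. assert (K := Im_le_Cmod (w - z)). change (Im (w - z)) with (Im w - Im z) in K.
  assert (K1 := Rlt_le_trans _ _ _ Hw (Rmin_l _ _)).
  assert (K2 := Rlt_le_trans _ _ _ Hw (Rmin_r _ _)).
  assert (K3 : Rabs (Im w - Im z) < Im z - a) by lra.
  assert (K4 : Rabs (Im w - Im z) < b - Im z) by lra.
  apply Rabs_lt_between in K3. apply Rabs_lt_between in K4. unfold horizontal. lra.
Qed.

Lemma horizontal_convex a b : convex (horizontal a b).
Proof.
  intros z w t Hz Hw Ht. unfold horizontal in *.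
  replace (Im (z + t * (w - z))) with (Im z + t * (Im w - Im z)) by (unfold Im; simpl; ring).
  now apply segment_between.
Qed.

(* The singularity of gker at w = i PI is removed by subtracting
   e^{i PI s} / (1 + e^w). *)
Lemma gker_boundary s x r1 r2 :
  0 < r1 < 1 -> 1 < r2 ->
  boundary (gker s x) r1 r2 = (2 * RtoC PI * Ci * Cexp (Ci * RtoC PI * s))%C.
Proof.
  intros H1 H2. assert (P := PI_RGT_0).
  set (v := fun w : C => (w - Ci * RtoC PI)%C).
  (* Centred at the pole w = i PI, 1 + exp w = -v [expq] v, and therefore exp(s w - x (1 + exp w)) =
     c exp(v eta). Subtracting c leaves c v eta [expq] (v eta), whose factor v cancels the zero of 1
     + exp w; the quotient is d. *)
  set (eta := fun w : C => (s + x * expq (v w))%C).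
  set (c := Cexp (Ci * RtoC PI * s)).
  set (d := fun w : C => (- (c * eta w * expq (v w * eta w)) * / expq (v w))%C).
  (* This strip is the largest horizontal one about i PI on which |Im v| < 2 PI, and it contains the
     whole rectangle 0 <= Im w <= 2 PI. *)
  assert (EN : forall w, horizontal (- PI) (3 * PI) w -> expq (v w) <> 0).
  { intros w Hw. apply expq_neq_0. unfold horizontal in Hw.
    replace (Im (v w)) with (Im w - PI) by (unfold v, Im; simpl; ring).
    apply Rabs_def1; lra. }
  assert (Hv : forall D, holo D v).
  { intro D. apply holo_minus; [apply holo_id|apply holo_const]. }
  assert (HE : forall D, holo D (fun w => expq (v w))).
  { intro D. apply (holo_comp D (fun _ => True) expq v); auto. apply holo_expq. }
  assert (Heta : forall D, holo D eta).
  { intro D. apply holo_plus; [apply holo_const|].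
    apply holo_mult; [apply holo_const|apply HE]. }
  assert (Hd : holo (horizontal (- PI) (3 * PI)) d).
  { apply holo_mult.
    - apply holo_opp, holo_mult; [apply holo_mult; [apply holo_const|apply Heta]|].
      apply (holo_comp _ (fun _ => True) expq (fun w => v w * eta w)%C); auto.
      + apply holo_expq.
      + apply holo_mult; [apply Hv|apply Heta].
    - apply holo_inv; [apply HE|exact EN]. }
  assert (Edge : forall w, on_edges r1 r2 w ->
     horizontal (- PI) (3 * PI) w /\ (1 + Cexp w)%C <> 0).
  { intros w Hw. split.
    - unfold horizontal.
      assert (A : 0 <= Im w <= 2 * PI).
      { destruct Hw as [[y [u [_ [Hu ->]]]]|[[p [Hp ->]]|[p [Hp ->]]]]; rewrite Im_log; lra. }
      lra.
    - destruct (edges_ray r1 r2 w) as [[y [Hy E]]|E]; try lra; auto.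
      + rewrite E. apply one_plus_pos_neq_0. lra.
      + apply one_plus_neq_0. lra. }
  assert (CC : forall w, on_edges r1 r2 w -> cont_at cid (fun w => c * / (1 + Cexp w))%C w).
  { intros w Hw. apply cont_mult; [apply cont_const|]. now apply cont_one_plus, Edge. }
  rewrite (boundary_plus d (fun w => c * / (1 + Cexp w))%C); auto; try lra.
  - rewrite (boundary_holo (horizontal (- PI) (3 * PI))); auto; try lra.
    2: apply horizontal_opened.
    2: apply horizontal_convex.
    2:{ intros w [_ Hw]. unfold horizontal. lra. }
    unfold boundary.
    replace (kray (fun w => c * / (1 + Cexp w))%C (2 * PI))
      with (kray (fun w => c * / (1 + Cexp w))%C 0).
    2:{ apply functional_extensionality. intro t. unfold kray. do 4 f_equal.
        rewrite !Cexp_plus, Cexp_2PI. replace (Ci * 0)%C with (RtoC 0) by ring.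
        now rewrite Cexp_0. }
    assert (S : forall r, 0 < r -> r <> 1 ->
      int (karc (fun w => c * / (1 + Cexp w))%C r) 0 (2 * PI)
      = (c * int (karc (fun w => / (1 + Cexp w))%C r) 0 (2 * PI))%C).
    { intros r Hr Hr'. apply is_int_unique. apply is_int_scal.
      now apply karc_one_plus_int. }
    rewrite !S by lra.
    rewrite arc_one_plus_small, arc_one_plus_large by lra.
    rewrite RtoC_mult. ring.
  - intros w Hw. destruct (Edge w Hw) as [Hh N].
    assert (EE : (1 + Cexp w)%C = (- (v w * expq (v w)))%C).
    { rewrite expq_spec. unfold v.
      replace (Cexp w) with (Cexp ((w - Ci * PI) + Ci * PI)) by (f_equal; ring).
      rewrite Cexp_plus, Cexp_PI. ring. }
    assert (Nv : v w <> 0).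
    { intro E. apply N. rewrite EE, E. ring. }
    assert (NE := EN w Hh).
    unfold gker.
    replace (Cexp (s * w) * (Cexp (- (x * (1 + Cexp w))) * / (1 + Cexp w)))%C
      with (c * (Cexp (v w * eta w) * / (1 + Cexp w)))%C.
    2:{ rewrite !Cmult_assoc. f_equal. unfold c. rewrite <- !Cexp_plus. f_equal.
        rewrite EE. unfold eta, v. ring. }
    replace (Cexp (v w * eta w)) with (v w * eta w * expq (v w * eta w) + 1)%C.
    2:{ rewrite expq_spec. ring. }
    unfold d. rewrite EE. field. auto.
  - intros w Hw. eapply holo_cont; [exact Hd|]. now apply Edge.
Qed.

Lemma gker_cont x w :
  (1 + Cexp w)%C <> 0 ->
  cont_at cid (fun w => Cexp (- (x * (1 + Cexp w))) * / (1 + Cexp w))%C w.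
Proof.
  intro N. apply cont_mult; [|now apply cont_one_plus].
  apply cont_exp, cont_opp, cont_mult; [apply cont_const|].
  apply cont_plus; [apply cont_const|]. apply cont_exp, (cont_incl cid).
Qed.

Lemma gker_ray x r w :
  0 < r -> 0 <= Re x -> on_ray r w ->
  (1 + Cexp w)%C <> 0 /\
  Cmod (Cexp (- (x * (1 + Cexp w))) * / (1 + Cexp w)) <=
    exp (- Re x) * exp (- Re x * exp (Re w)) / (1 + exp (Re w)).
Proof.
  intros Hr Hx Hw. destruct (Cexp_ray r w Hr Hw) as [E L]. rewrite E.
  set (u := exp (Re w)) in *. split; [apply one_plus_pos_neq_0; lra|].
  rewrite Cmod_mult, Cmod_Cexp, Cmod_inv by (apply one_plus_pos_neq_0; lra).
  rewrite <- RtoC_plus, Cmod_R, Rabs_pos_eq by lra.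
  right. unfold Rdiv. f_equal. rewrite <- exp_plus. f_equal. unfold Re; simpl. ring.
Qed.

Lemma admits_gker s x r : 0 < r -> r <> 1 -> 0 < Re x -> admits (gker s x) r.
Proof.
  intros Hr H1 Hx.
  apply (admits_exp s (fun w => Cexp (- (x * (1 + Cexp w))) * / (1 + Cexp w))%C).
  split; [|split; [|split]]; auto.
  - intros w Hw. apply gker_cont. eapply (gker_ray x); [exact Hr|lra|exact Hw].
  - intros w Hw. apply gker_cont, one_plus_neq_0. now rewrite (Cexp_circ r w).
  - exists 1, (Re x). split; auto. intros w Hw.
    eapply Rle_trans; [apply (gker_ray x r); auto; lra|].
    assert (U := exp_pos (Re w)).
    assert (exp (- Re x) <= 1) by (apply exp_le_1; lra).
    assert (P := exp_pos (- Re x * exp (Re w))).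
    unfold Rdiv. apply Rle_trans with (1 * exp (- Re x * exp (Re w)) * / 1).
    2:{ right; field. }
    apply Rmult_le_compat.
    + apply Rmult_le_pos; left; apply exp_pos.
    + left; apply Rinv_0_lt_compat; lra.
    + apply Rmult_le_compat_r; lra.
    + apply Rinv_le_contravar; lra.
Qed.

Lemma gker_deriv s x :
  0 < Re x ->
  deriv_at cid (fun x => hankel (gker s x) (1 / 2)) x (- (Cexp (- x) * hexp s x)).
Proof.
  intro Hx. apply deriv_shift.
  assert (N12 : 1 / 2 <> 1) by lra. assert (P12 : 0 < 1 / 2) by lra.
  apply deriv_ext with (fun h => hankel (fun w => Cexp (h * - (1 + Cexp w)) * gker s x w)%C (1 / 2)).
  { intro h. apply hankel_ext. intro w. unfold gker.
    replace (- ((x + h) * (1 + Cexp w)))%C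
      with (h * - (1 + Cexp w) + - (x * (1 + Cexp w)))%C by ring.
    rewrite Cexp_plus. ring. }
  assert (cE : forall w, cont_at cid (fun w => - (1 + Cexp w))%C w).
  { intro w. apply cont_opp, cont_plus; [apply cont_const|apply cont_exp, (cont_incl cid)]. }
  eapply deriv_eq.
  - apply (hankel_exp_deriv (fun w => - (1 + Cexp w))%C _ (1 / 2) (Re x / 2)); auto; [lra| |].
    + now apply admits_gker.
    + assert (Hx2 : 0 < Re (x - RtoC (Re x / 2))).
      { unfold Re in *; simpl; lra. }
      destruct (admits_gker s _ (1 / 2) P12 N12 Hx2) as [_ [_ [_ [M [c [Hc HM]]]]]].
      exists M, c; split; auto. intros w Hw. eapply Rle_trans; [|now apply HM].
      destruct (Cexp_ray (1 / 2) w P12 Hw) as [E L]. unfold gker.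
      rewrite !Cmod_mult, Cmod_R, Rabs_pos_eq by (left; apply exp_pos).
      rewrite Cmod_opp, E, <- RtoC_plus, Cmod_R, Rabs_pos_eq by lra.
      right. rewrite (Cmod_Cexp (- (x * _))), (Cmod_Cexp (- ((x - _) * _))).
      set (p := exp (Re w)) in *.
      replace (Re (- ((x - RtoC (Re x / 2)) * RtoC (1 + p))))
        with (Re x / 2 * (1 + p) + Re (- (x * RtoC (1 + p))))
        by (unfold Re; simpl; field).
      rewrite exp_plus. ring.
  - rewrite <- (hexp_radius s x (1 / 2)) by auto.
    replace (- (Cexp (- x) * hankel (fun w => Cexp (s * w) * Cexp (- (x * Cexp w))) (1 / 2)))%C
      with ((- Cexp (- x)) * hankel (fun w => Cexp (s * w) * Cexp (- (x * Cexp w))) (1 / 2))%C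
      by ring.
    rewrite <- hankel_scal by (now apply admits_gexp).
    assert (E : forall w, (1 + Cexp w)%C <> 0 -> (- (1 + Cexp w) * gker s x w =
      - Cexp (- x) * (Cexp (s * w) * Cexp (- (x * Cexp w))))%C).
    { intros w N. unfold gker.
      replace (- (x * (1 + Cexp w)))%C with (- x + - (x * Cexp w))%C by ring.
      rewrite (Cexp_plus (- x)). field. exact N. }
    apply hankel_ext_on; intros w Hw; apply E.
    + eapply (gker_ray x (1 / 2)); [lra|lra|exact Hw].
    + apply one_plus_neq_0. rewrite (Cexp_circ (1 / 2) w); auto; lra.
Qed.

Lemma Cexp_circ_bound s r w :
  on_circ r w -> Cmod (Cexp (s * w)) <= exp (Re s * ln r + 2 * PI * Rabs (Im s)).
Proof.
  intros [p [Hp ->]]. rewrite Cmod_Cexp. apply exp_le.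
  replace (Re (s * (ln r + Ci * p))) with (Re s * ln r + - (p * Im s))
    by (unfold Re, Im; simpl; ring).
  apply Rplus_le_compat_l. eapply Rle_trans; [apply Rle_abs|].
  rewrite Rabs_Ropp, Rabs_mult, (Rabs_pos_eq p) by lra.
  apply Rmult_le_compat_r; [apply Rabs_pos|lra].
Qed.

Lemma Cexp_ray_bound s r w :
  on_ray r w -> Cmod (Cexp (s * w)) <= exp (Re s * Re w + 2 * PI * Rabs (Im s)).
Proof.
  intros [x [v [Hx [Hv ->]]]]. rewrite Re_log, Cmod_Cexp. apply exp_le.
  replace (Re (s * (ln x + Ci * v))) with (Re s * ln x + - (v * Im s))
    by (unfold Re, Im; simpl; ring).
  apply Rplus_le_compat_l. eapply Rle_trans; [apply Rle_abs|].
  assert (P := PI2_pos).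
  rewrite Rabs_Ropp, Rabs_mult, (Rabs_pos_eq v) by lra.
  apply Rmult_le_compat_r; [apply Rabs_pos|lra].
Qed.

(** On the contour of radius 1 / 2, Re(1 + z) >= 1 / 2, so exp(-X (1 + z)) contributes a factor
    exp(-X / 2). *)
Lemma gker_at_infinity s :
  forall eps, 0 < eps -> exists B, 0 < B /\
    forall X, B <= X -> Cmod (hankel (gker s (RtoC X)) (1 / 2)) < eps.
Proof.
  intros eps He. assert (P12 : 0 < 1 / 2) by lra. assert (P := PI_RGT_0).
  assert (H1 : 0 < Re 1) by (simpl; lra).
  (* For X >= 1 the decay exp(-X |z|) on the rays is at most exp(-|z|), so the constants at om = 1
     serve for all X. *)
  destruct (admits_gexp s 1 (1 / 2) P12 H1) as [_ [_ [_ [M [c [Hc HM]]]]]].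
  assert (M0 : 0 <= M).
  { assert (O : on_ray (1 / 2) (RtoC (ln (1 / 2)) + Ci * RtoC 0)%C).
    { exists (1 / 2), 0. split; [lra|auto]. }
    assert (Q := Rle_trans _ _ _ (Cmod_ge_0 _) (HM _ O)).
    assert (E := exp_pos (- c * exp (Re (ln (1 / 2) + Ci * 0)))).
    apply Rmult_le_reg_r with (2 := eq_ind _ (fun z => z <= _) Q _ (eq_sym (Rmult_0_l _))).
    exact E. }
  set (S := exp (Re s * ln (1 / 2) + 2 * PI * Rabs (Im s))).
  set (K := 2 * (M / (1 / 2) / c) + 2 * PI * (S * 2)).
  destruct (exp_decay_small K (1 / 2) eps ltac:(lra) He) as [B [HB HB']].
  exists (Rmax 1 B); split; [apply Rlt_le_trans with 1; [lra|apply Rmax_l]|]. intros X HX.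
  assert (X1 : 1 <= X) by (apply Rle_trans with (1 := Rmax_l 1 B) (2 := HX)).
  assert (X2 : B <= X) by (apply Rle_trans with (1 := Rmax_r 1 B) (2 := HX)).
  eapply Rle_lt_trans; [|apply (HB' X X2)].
  assert (EX : exp (- X) <= exp (- (1 / 2) * X)) by (apply exp_le; lra).
  eapply Rle_trans.
  - apply (hankel_bound _ (1 / 2) (exp (- X) * M) c (S * (exp (- (1 / 2) * X) * 2))).
    + apply admits_gker; simpl; lra.
    + exact Hc.
    + intros w Hw. destruct (gker_ray (RtoC X) (1 / 2) w P12) as [N G]; auto; [simpl; lra|].
      unfold gker. rewrite Cmod_mult.
      specialize (HM w Hw). rewrite Cmod_mult in HM.
      destruct (Cexp_ray (1 / 2) w P12 Hw) as [E L].
      assert (HM' : Cmod (Cexp (- (1 * Cexp w))) = exp (- exp (Re w))).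
      { rewrite E, Cmod_Cexp. f_equal. simpl. ring. }
      rewrite HM' in HM. simpl Re in G.
      rewrite Rmult_assoc. eapply Rle_trans; [|apply Rmult_le_compat_l; [left; apply exp_pos|exact HM]].
      rewrite <- Rmult_assoc, (Rmult_comm (exp (- X))), Rmult_assoc.
      apply Rmult_le_compat_l; [apply Cmod_ge_0|]. eapply Rle_trans; [exact G|].
      unfold Rdiv. rewrite Rmult_assoc. apply Rmult_le_compat_l; [left; apply exp_pos|].
      rewrite <- (Rmult_1_r (exp (- exp (Re w)))). apply Rmult_le_compat.
      * left; apply exp_pos.
      * left; apply Rinv_0_lt_compat; lra.
      * apply exp_le. rewrite Ropp_mult_distr_l_reverse. apply Ropp_le_contravar.
        rewrite <- (Rmult_1_l (exp (Re w))) at 1. apply Rmult_le_compat_r; lra.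
      * rewrite <- Rinv_1. apply Rinv_le_contravar; lra.
    + intros w Hw. unfold gker. rewrite Cmod_mult.
      assert (Z := Cexp_circ (1 / 2) w P12 Hw).
      assert (N : (1 + Cexp w)%C <> 0) by (apply one_plus_neq_0; lra).
      apply Rmult_le_compat; try apply Cmod_ge_0; [now apply Cexp_circ_bound|].
      rewrite Cmod_mult. apply Rmult_le_compat; try apply Cmod_ge_0.
      * rewrite Cmod_Cexp. apply exp_le.
        assert (R1 : -(1 / 2) <= Re (Cexp w)).
        { assert (R := re_le_Cmod (Cexp w)). rewrite Z in R.
          apply Rabs_le_between in R. lra. }
        replace (Re (- (X * (1 + Cexp w)))) with (- (X * (1 + Re (Cexp w))))
          by (unfold Re; simpl; ring).
        rewrite Ropp_mult_distr_l_reverse. apply Ropp_le_contravar.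
        rewrite Rmult_comm. apply Rmult_le_compat_l; lra.
      * rewrite Cmod_inv by auto. assert (L := one_plus_lower (Cexp w)). rewrite Z in L.
        replace 2 with (/ (1 / 2)) by field. apply Rinv_le_contravar; lra.
  - assert (EC : exp (- c * (1 / 2)) <= 1) by (apply exp_le_1; lra).
    unfold K. rewrite Rmult_plus_distr_r. apply Rplus_le_compat; [|right; ring].
    replace (2 * (exp (- X) * M / (1 / 2) / c * exp (- c * (1 / 2))))
      with (2 * (M / (1 / 2) / c) * (exp (- X) * exp (- c * (1 / 2)))) by (field; lra).
    apply Rmult_le_compat_l.
    + apply Rmult_le_pos; [lra|]. apply Rdiv_le_0_compat; auto.
      apply Rdiv_le_0_compat; lra.
    + rewrite <- (Rmult_1_r (exp (- (1 / 2) * X))). apply Rmult_le_compat; auto;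
        left; apply exp_pos.
Qed.

(** Enlarging the radius from 1 / 2 to 1 / x crosses z = -1 and picks up the residue of
    [gker_boundary]. On the large contour x |z| is bounded on the circle and gives decay on the
    rays, so what remains is of order x^(1 - Re s); this is where Re s < 1 is used. *)
Lemma gker_at_zero s :
  Re s < 1 ->
  forall eps, 0 < eps -> exists d, 0 < d /\
    forall x, 0 < x < d ->
      Cmod (hankel (gker s (RtoC x)) (1 / 2) - 2 * RtoC PI * Ci * Cexp (Ci * RtoC PI * s)) < eps.
Proof.
  intros Hs eps He. assert (P := PI_RGT_0). assert (P12 : 0 < 1 / 2) by lra.
  set (A := exp (2 * PI * Rabs (Im s))).
  set (K := 2 * A * exp (-1) + 2 * PI * (A * (exp 1 * 2))).
  destruct (exp_decay_small K (1 - Re s) eps ltac:(lra) He) as [B [HB HB']].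
  (* Then ln(1 / x) > B + 1, which reaches the range of HB', and since B >= 0 the radius 1 / x is at
     least 2, well past the pole. *)
  exists (exp (- (B + 1))). split; [apply exp_pos|]. intros x Hx.
  set (r := / x).
  assert (Lr : B + 1 < ln r).
  { unfold r. rewrite ln_Rinv by lra.
    assert (ln x < - (B + 1)) by (rewrite <- (ln_exp (- (B + 1))); apply ln_increasing; lra).
    lra. }
  assert (r2 : 2 <= r).
  { unfold r. assert (x < 1 / 2).
    { apply Rlt_le_trans with (1 := proj2 Hx). rewrite exp_Ropp.
      replace (1 / 2) with (/ 2) by field. apply Rinv_le_contravar; [lra|].
      generalize (exp_ineq1_le (B + 1)). lra. }
    replace 2 with (/ (1 / 2)) by field. apply Rinv_le_contravar; lra. }
  assert (xr : x * r = 1) by (unfold r; field; lra).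
  assert (Rx : 0 < Re (RtoC x)) by (simpl; lra).
  assert (G1 := admits_gker s (RtoC x) (1 / 2) P12 ltac:(lra) Rx).
  assert (G2 := admits_gker s (RtoC x) r ltac:(lra) ltac:(lra) Rx).
  rewrite (hankel_boundary _ (1 / 2) r) by (auto; lra).
  rewrite gker_boundary by (try split; lra).
  replace (hankel (gker s x) r + 2 * PI * Ci * Cexp (Ci * PI * s) -
    2 * PI * Ci * Cexp (Ci * PI * s))%C with (hankel (gker s x) r) by ring.
  eapply Rle_lt_trans; [|apply (HB' (ln r)); lra].
  set (y := exp (- (1 - Re s) * ln r)).
  eapply Rle_trans.
  - apply (hankel_bound _ r (A * y) x (A * y * (exp 1 * 2))); [auto|lra| |].
    + intros w Hw. destruct (gker_ray (RtoC x) r w) as [N G]; auto; [lra|simpl; lra|].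
      destruct (Cexp_ray r w ltac:(lra) Hw) as [_ L]. set (u := exp (Re w)) in *.
      unfold gker. rewrite Cmod_mult. simpl Re in G.
      apply Rle_trans with (A * exp (Re s * Re w) * (exp (- x * u) * exp (- Re w))).
      * apply Rmult_le_compat; try apply Cmod_ge_0.
        -- eapply Rle_trans; [eapply Cexp_ray_bound; exact Hw|].
           unfold A. rewrite <- exp_plus. right. f_equal. ring.
        -- eapply Rle_trans; [exact G|]. unfold Rdiv. rewrite (exp_Ropp (Re w)). fold u.
           apply Rmult_le_compat.
           ++ apply Rmult_le_pos; left; apply exp_pos.
           ++ left; apply Rinv_0_lt_compat; lra.
           ++ rewrite <- (Rmult_1_l (exp (- x * u))) at 2.
              apply Rmult_le_compat_r; [left; apply exp_pos|].
              apply exp_le_1; lra.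
           ++ apply Rinv_le_contravar; lra.
      * replace (A * exp (Re s * Re w) * (exp (- x * u) * exp (- Re w)))
          with (A * (exp (Re s * Re w) * exp (- Re w)) * exp (- x * u)) by ring.
        apply Rmult_le_compat_r; [left; apply exp_pos|].
        apply Rmult_le_compat_l; [left; apply exp_pos|].
        rewrite <- exp_plus. unfold y. apply exp_le.
        assert (ln r <= Re w).
        { rewrite <- (ln_exp (Re w)). fold u. apply ln_le; lra. }
        replace (Re s * Re w + - Re w) with (- (1 - Re s) * Re w) by ring.
        apply Rmult_le_compat_neg_l; lra.
    + intros w Hw. assert (Z := Cexp_circ r w ltac:(lra) Hw).
      assert (N : (1 + Cexp w)%C <> 0) by (apply one_plus_neq_0; lra).
      unfold gker. rewrite !Cmod_mult, Cmod_inv by auto.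
      apply Rle_trans with (exp (Re s * ln r + 2 * PI * Rabs (Im s)) * (exp 1 * (2 * exp (- ln r)))).
      2:{ right. unfold A, y. rewrite exp_plus.
          replace (- (1 - Re s) * ln r) with (Re s * ln r + - ln r) by ring.
          rewrite exp_plus. ring. }
      apply Rmult_le_compat; try apply Cmod_ge_0; [| |apply Rmult_le_compat].
      * apply Rmult_le_pos; [apply Cmod_ge_0|]. left; apply Rinv_0_lt_compat.
        now apply Cmod_gt_0.
      * now apply Cexp_circ_bound.
      * apply Cmod_ge_0.
      * left; apply Rinv_0_lt_compat. now apply Cmod_gt_0.
      * rewrite Cmod_Cexp. apply exp_le.
        replace (Re (- (x * (1 + Cexp w)))) with (- x * (1 + Re (Cexp w)))
          by (unfold Re; simpl; ring).
        assert (R := re_le_Cmod (Cexp w)). rewrite Z in R. apply Rabs_le_between in R.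
        apply Rle_trans with (- x * (1 + - r)).
        -- apply Rmult_le_compat_neg_l; lra.
        -- replace (- x * (1 + - r)) with (x * r - x) by ring. lra.
      * rewrite exp_Ropp, exp_ln by lra.
        replace (2 * / r) with (/ (r / 2)) by (field; lra).
        assert (L := Cmod_upper_one_plus (Cexp w)). rewrite Z in L.
        apply Rinv_le_contravar; lra.
  - right. replace (- x * r) with (-1) by lra.
    replace (A * y / r / x) with (A * y).
    + unfold K. fold y. ring.
    + unfold r. field. lra.
Qed.

(** Euler's integrand t^(-s) exp(-t) for Gamma(1 - s), left in the shape to which
    [Gamma_integral (1 - s)] unfolds. *)
Definition euler (s : C) (t : R) : C :=
  (polar_pow t 0 (1 - s - 1) * RtoC (exp (- t)))%C.

Lemma plog_real t : 0 < t -> plog (RtoC t) = RtoC (ln t).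
Proof.
  intro Ht. unfold plog. rewrite Cmod_R, Rabs_pos_eq by lra. simpl.
  now rewrite Rdiv_0_l, atan_0.
Qed.

(** [hexp_scale] at a positive real: t^(-s) [hk] s = [hexp] s t. This identifies Euler's integrand
    with the derivative computed in [gker_deriv]. *)
Lemma euler_hexp s t : 0 < t -> (euler s t * hk s)%C = (Cexp (- RtoC t) * hexp s (RtoC t))%C.
Proof.
  intro Ht. rewrite (hexp_scale s t) by (simpl; lra). rewrite plog_real by auto.
  unfold euler, polar_pow, hk. rewrite <- RtoC_opp, Cexp_real.
  replace ((1 - s - 1) * (ln t + Ci * 0))%C with (- (s * ln t))%C by ring. ring.
Qed.

Lemma cont_euler s t : 0 < t -> cont_at RtoC (euler s) t.
Proof.
  intro Ht. unfold euler, polar_pow. apply cont_mult.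
  - apply cont_exp, cont_mult; [apply cont_const|]. apply cont_plus; [|apply cont_const].
    eapply deriv_cont. now apply deriv_ln.
  - apply (cont_real (fun t => exp (- t))).
    apply (ex_derive_continuous (fun t => exp (- t))). auto_derive; auto.
Qed.

Lemma euler_int s a b :
  0 < a -> a <= b ->
  (int (euler s) a b * hk s)%C
  = (hankel (gker s (RtoC a)) (1 / 2) - hankel (gker s (RtoC b)) (1 / 2))%C.
Proof.
  intros Ha Hab.
  assert (I : is_int (euler s) a b (int (euler s) a b)).
  { apply int_correct; auto. intros t Ht. apply cont_euler; lra. }
  assert (I1 := is_int_scal _ _ _ _ (hk s) I).
  assert (I2 : is_int (fun t => hk s * euler s t)%C a b
     ((fun t => - hankel (gker s (RtoC t)) (1 / 2)) b
      - (fun t => - hankel (gker s (RtoC t)) (1 / 2)) a)%C).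
  { apply (is_int_deriv (fun t => - hankel (gker s (RtoC t)) (1 / 2))%C); auto.
    - intros t Ht. eapply deriv_eq.
      + apply deriv_opp.
        apply (deriv_comp RtoC (fun x => hankel (gker s x) (1 / 2)) RtoC).
        * apply gker_deriv. simpl; lra.
        * apply deriv_incl.
      + rewrite (Cmult_comm (hk s)), euler_hexp by lra. ring.
    - intros t Ht. apply cont_mult; [apply cont_const|]. apply cont_euler; lra. }
  cbv beta in I2. rewrite Cmult_comm, <- (is_int_unique _ _ _ _ I1), (is_int_unique _ _ _ _ I2).
  ring.
Qed.

Definition hval (s : C) : C := (2 * RtoC PI * Ci * Cexp (Ci * RtoC PI * s))%C.

Lemma hval_neq_0 s : hval s <> 0.
Proof.
  unfold hval. assert (P := PI_RGT_0).
  assert (N : RtoC PI <> 0) by (intro E; apply RtoC_inj in E; lra).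
  assert (N2 : RtoC 2 <> 0) by (intro E; apply RtoC_inj in E; lra).
  assert (NI : Ci <> 0) by (apply Cmod_gt_0; rewrite Cmod_Ci; lra).
  apply Cmult_neq_0; [|apply Cexp_neq_0]. apply Cmult_neq_0; [|easy]. now apply Cmult_neq_0.
Qed.

Lemma euler_limits s :
  Re s < 1 -> forall eps, 0 < eps -> exists d B, 0 < d /\ d < B /\
    forall a b, 0 < a < d -> B <= b -> Cmod (int (euler s) a b * hk s - hval s) < eps.
Proof.
  intros Hs eps He.
  destruct (gker_at_zero s Hs (eps / 2)) as [d [D Hd]]; [lra|].
  destruct (gker_at_infinity s (eps / 2)) as [B [HB Hb]]; [lra|].
  exists d, (Rmax B (d + 1)).
  assert (M1 := Rmax_l B (d + 1)). assert (M2 := Rmax_r B (d + 1)).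
  split; [lra|split; [lra|]]. intros a b Ha Hb'.
  rewrite euler_int by lra. unfold hval.
  specialize (Hd a Ha). specialize (Hb b ltac:(lra)).
  set (x := hankel (gker s a) (1 / 2)) in *. set (y := hankel (gker s b) (1 / 2)) in *.
  set (z := (2 * PI * Ci * Cexp (Ci * PI * s))%C) in *.
  replace (x - y - z)%C with ((x - z) - y)%C by ring.
  eapply Rle_lt_trans; [apply Cmod_triangle_minus|]. lra.
Qed.

(** Euler's truncated integrals multiplied by [hk] s converge to [hval] s, which is not 0; this is
    impossible if [hk] s = 0. *)
Lemma hk_neq_0 s : Re s < 1 -> hk s <> 0.
Proof.
  intros Hs E. apply (hval_neq_0 s).
  assert (P := proj1 (Cmod_gt_0 _) (hval_neq_0 s)).
  destruct (euler_limits s Hs _ P) as [d [B [D [HB H]]]].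
  specialize (H (d / 2) B ltac:(lra) (Rle_refl _)). rewrite E in H.
  replace (int (euler s) (d / 2) B * 0 - hval s)%C with (- hval s)%C in H by ring.
  rewrite Cmod_opp in H. lra.
Qed.

Theorem Gamma_integral_hk s :
  Re s < 1 -> (Gamma_integral (1 - s) * hk s)%C = hval s.
Proof.
  intro Hs. assert (N := hk_neq_0 s Hs).
  assert (G : Gamma_integral (1 - s) = (hval s / hk s)%C).
  { unfold Gamma_integral. apply (is_RInt_gen_unique (V := C_R_CompleteNormedModule)).
    intros P HP. apply locally_C in HP. destruct HP as [e He].
    assert (Q := proj1 (Cmod_gt_0 _) N).
    assert (E0 : 0 < e * Cmod (hk s)) by (apply Rmult_lt_0_compat; auto; apply cond_pos).
    destruct (euler_limits s Hs _ E0) as [d [B [D [HB H]]]].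
    apply Filter_prod with (fun x => 0 < x < d) (fun b => B < b).
    - exists (mkposreal d D). intros y Hy Hy0. split; auto.
      change (Rabs (y - 0) < d) in Hy. rewrite Rminus_0_r, Rabs_pos_eq in Hy; lra.
    - now exists B.
    - intros a b Ha Hb. simpl. exists (int (euler s) a b). split.
      + apply int_correct; [lra|]. intros t Ht. apply cont_euler. lra.
      + apply He. change (Cmod (int (euler s) a b - hval s / hk s) < e).
        replace (int (euler s) a b - hval s / hk s)%C
          with ((int (euler s) a b * hk s - hval s) * / hk s)%C by (field; auto).
        rewrite Cmod_mult, Cmod_inv by auto.
        apply Rmult_lt_reg_r with (Cmod (hk s)); auto.
        rewrite Rmult_assoc, Rinv_l, Rmult_1_r by lra. apply H; lra. }
  rewrite G. field. exact N.
Qed.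

Lemma hval_minus_nat s n : hval (s - RtoC (INR n)) = ((-1) ^ n * hval s)%C.
Proof.
  induction n as [|n IH].
  - replace (s - INR 0)%C with s by (simpl; ring). simpl. ring.
  - rewrite S_INR, RtoC_plus.
    replace ((-1) ^ S n * hval s)%C with (-1 * ((-1) ^ n * hval s))%C by (simpl; ring).
    rewrite <- IH. unfold hval.
    replace (Ci * PI * (s - (INR n + 1)))%C with (Ci * PI * (s - INR n) - Ci * PI)%C by ring.
    rewrite Cexp_minus, Cexp_PI. field.
Qed.

(** Iterating [hk_succ] down from s gives (s - 1) ... (s - n) [hk] (s - n); writing the factors
    through 1 - s costs the sign. The zeros of [hk] at positive integers become visible here. *)
Lemma hk_rising s n :
  hk s = ((-1) ^ n * rising (1 - s) n * hk (s - RtoC (INR n)))%C.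
Proof.
  induction n as [|n IH].
  - replace (s - INR 0)%C with s by (simpl; ring). simpl. ring.
  - rewrite IH. replace (s - INR n)%C with ((s - INR (S n)) + 1)%C at 1
      by (rewrite S_INR, RtoC_plus; ring).
    rewrite hk_succ. simpl rising.
    rewrite S_INR, RtoC_plus. simpl Cpow. ring.
Qed.

Lemma rising_neq_0 s n : ~ Gamma_pole s -> rising (1 - s) n <> 0.
Proof.
  intro H. induction n as [|n IH]; simpl.
  - intro E. apply RtoC_inj in E. lra.
  - apply Cmult_neq_0; auto. intro E. apply H. exists n.
    rewrite RtoC_opp. replace (1 - s)%C with ((1 - s + INR n) - INR n)%C by ring.
    rewrite E. ring.
Qed.

(** Gamma is extended to the left by dividing by the rising product, and [hk] to the right by
    multiplying by the same product, so their product is unaffected. The sign (-1)^n of [hk_rising]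
    cancels that of [hval_minus_nat]. *)
Theorem CGamma_hk s : ~ Gamma_pole s -> (CGamma (1 - s) * hk s)%C = hval s.
Proof.
  intro Hp. unfold CGamma. set (n := Z.to_nat (up (- Re (1 - s)))).
  assert (Hn : Re s - 1 < INR n).
  { unfold n. destruct (archimed (- Re (1 - s))) as [A1 A2].
    replace (Re (1 - s)) with (1 - Re s) in * by (unfold Re; simpl; ring).
    destruct (Z_le_gt_dec 0 (up (- (1 - Re s)))) as [L|L].
    - rewrite INR_IZR_INZ, Z2Nat.id by auto. lra.
    - apply Rlt_le_trans with 0; [|apply pos_INR].
      assert (IZR (up (- (1 - Re s))) <= -1) by (apply IZR_le; lia). lra. }
  assert (Hs : Re (s - INR n) < 1) by (unfold Re in *; simpl; lra).
  assert (G := Gamma_integral_hk _ Hs). rewrite hval_minus_nat in G.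
  rewrite (hk_rising s n).
  replace (1 - s + INR n)%C with (1 - (s - INR n))%C by ring.
  assert (R := rising_neq_0 s n Hp).
  assert (S : ((-1) ^ n * (-1) ^ n)%C = 1).
  { clear. induction n; simpl; [ring|].
    replace (-1 * (-1) ^ n * (-1 * (-1) ^ n))%C with ((-1) ^ n * (-1) ^ n)%C by ring. exact IHn. }
  replace (Gamma_integral (1 - (s - INR n)) / rising (1 - s) n
     * ((-1) ^ n * rising (1 - s) n * hk (s - INR n)))%C
    with ((-1) ^ n * (Gamma_integral (1 - (s - INR n)) * hk (s - INR n)))%C
    by (field; auto).
  rewrite G, Cmult_assoc, S. ring.
Qed.

Lemma hk_neq_0_nonpole s : ~ Gamma_pole s -> hk s <> 0.
Proof.
  intros H E. apply (hval_neq_0 s). rewrite <- CGamma_hk, E by auto. ring.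
Qed.

(** ** The kernel and its expansion over a sector of the lattice *)

Definition denom (al be z : C) : C :=
  ((1 - Cexp (- ((al + be) * z))) * (1 - Cexp (- ((al - be) * z))))%C.
(** This is exp(-al z) cosh^2(be z / 2), expanded in exponentials. *)
Definition numer (al be z : C) : C :=
  ((Cexp (- ((al + be) * z)) + Cexp (- ((al - be) * z)) + 2 * Cexp (- (al * z))) / 4)%C.
(** Both terms of [F] are instances: (al, be) = (1, tau), and (-i tau, -i) because cos z = cosh(i
    z). *)
Definition fab (al be z : C) : C := (numer al be z / denom al be z)%C.

Lemma RtoC_neq (x y : R) : x <> y -> RtoC x <> RtoC y.
Proof. intros H E. apply H. now apply RtoC_inj. Qed.

Lemma F_fab tau s z :
  F tau s z = (Cexp (- (Ci * s * RtoC PI / 2)) * fab 1 tau z + fab (- (Ci * tau)) (- Ci) z)%C.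
Proof.
  assert (N2 : RtoC 2 <> 0) by (apply RtoC_neq; lra).
  assert (N4 : RtoC 4 <> 0) by (apply RtoC_neq; lra).
  assert (H : forall e v, (e * ((Cexp v + Cexp (- v)) / 2) ^ 2)%C
     = ((e * Cexp (2 * v) + e * Cexp (- (2 * v)) + 2 * e) / 4)%C).
  { intros e v. replace (2 * v)%C with (v + v)%C by ring.
    replace (- (v + v))%C with (- v + - v)%C by ring. rewrite !Cexp_plus, Cexp_opp.
    simpl. field. apply Cexp_neq_0. }
  unfold F, fab. f_equal.
  - rewrite <- Cmult_assoc. f_equal. unfold Cdiv at 1. rewrite Cmult_assoc.
    apply (f_equal2 (fun a b => (a * / b)%C)).
    + unfold Ccosh. rewrite H. unfold numer.
      replace (2 * (tau * z / 2))%C with (tau * z)%C by (field; auto).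
      replace (- ((1 + tau) * z))%C with (- z + - (tau * z))%C by ring.
      replace (- ((1 - tau) * z))%C with (- z + tau * z)%C by ring.
      replace (1 * z)%C with z by ring.
      rewrite !Cexp_plus. unfold Cdiv. ring.
    + unfold denom, Ccosh.
      replace (- (2 * z))%C with (- z + - z)%C by ring.
      replace (- ((1 + tau) * z))%C with (- z + - (tau * z))%C by ring.
      replace (- ((1 - tau) * z))%C with (- z + tau * z)%C by ring.
      rewrite !Cexp_plus, (Cexp_opp (tau * z)). field. apply Cexp_neq_0.
  - unfold Cdiv at 1. rewrite Cmult_assoc.
    apply (f_equal2 (fun a b => (a * / b)%C)).
    + unfold Ccos. rewrite H. unfold numer.
      replace (2 * (Ci * (z / 2)))%C with (Ci * z)%C by (field; auto).
      replace (- ((- (Ci * tau) + - Ci) * z))%C with (Ci * tau * z + Ci * z)%C by ring.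
      replace (- ((- (Ci * tau) - - Ci) * z))%C with (Ci * tau * z + - (Ci * z))%C by ring.
      replace (- (- (Ci * tau) * z))%C with (Ci * tau * z)%C by ring.
      rewrite !Cexp_plus. unfold Cdiv. ring.
    + unfold denom, Ccos.
      replace (2 * Ci * tau * z)%C with (Ci * tau * z + Ci * tau * z)%C by ring.
      replace (- ((- (Ci * tau) + - Ci) * z))%C with (Ci * tau * z + Ci * z)%C by ring.
      replace (- ((- (Ci * tau) - - Ci) * z))%C with (Ci * tau * z + - (Ci * z))%C by ring.
      rewrite !Cexp_plus, (Cexp_opp (Ci * z)). field. apply Cexp_neq_0.
Qed.

(** Adding the terms in pairs n, -n makes the passage from a square to the next larger one a single
    unfolding. *)
Fixpoint zsum (m : nat) (f : Z -> C) : C :=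
  match m with
  | O => f 0%Z
  | S k => (zsum k f + (f (Z.of_nat m) + f (- Z.of_nat m)%Z))%C
  end.

(* Sum over |n| <= m in which the two extreme terms are halved. *)
Definition hsum (m : nat) (f : Z -> C) : C :=
  match m with
  | O => 0
  | S k => (zsum k f + (f (Z.of_nat m) + f (- Z.of_nat m)%Z) / 2)%C
  end.

(** Four rotated copies of this sector cover the square without its centre, the half weights making
    up for the shared diagonals. *)
Fixpoint ssum (K : nat) (f : Z -> Z -> C) : C :=
  match K with
  | O => 0
  | S k => (ssum k f + hsum (S k) (f (Z.of_nat (S k))))%C
  end.

Lemma zsum_ext m f g : (forall n, (Z.abs n <= Z.of_nat m)%Z -> f n = g n) -> zsum m f = zsum m g.
Proof.
  intro H. induction m as [|m IH]; [simpl; apply H; lia|].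
  cbn [zsum]. rewrite IH by (intros; apply H; lia). now rewrite !H by lia.
Qed.

Lemma zsum_scal m c f : zsum m (fun n => c * f n)%C = (c * zsum m f)%C.
Proof. induction m as [|m IH]; [reflexivity|]. cbn [zsum]. rewrite IH. ring. Qed.

Lemma hsum_scal m c f : hsum m (fun n => c * f n)%C = (c * hsum m f)%C.
Proof.
  destruct m as [|m]; [unfold hsum; ring|]. unfold hsum. rewrite zsum_scal.
  field.
Qed.

Lemma ssum_scal K c f : ssum K (fun m n => c * f m n)%C = (c * ssum K f)%C.
Proof.
  induction K as [|K IH]; [simpl; ring|]. cbn [ssum]. rewrite IH, hsum_scal. ring.
Qed.

Lemma zsum_bound m f B :
  (forall n, (Z.abs n <= Z.of_nat m)%Z -> Cmod (f n) <= B) ->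
  Cmod (zsum m f) <= (2 * INR m + 1) * B.
Proof.
  intro H. induction m as [|m IH].
  - simpl. generalize (H 0%Z ltac:(lia)). lra.
  - cbn [zsum]. rewrite S_INR. eapply Rle_trans; [apply Cmod_triangle|].
    assert (I := IH ltac:(intros; apply H; lia)).
    assert (H1 := H (Z.of_nat (S m)) ltac:(lia)). assert (H2 := H (- Z.of_nat (S m))%Z ltac:(lia)).
    assert (T := Cmod_triangle (f (Z.of_nat (S m))) (f (- Z.of_nat (S m))%Z)). lra.
Qed.

Lemma hsum_bound m f B :
  (forall n, (Z.abs n <= Z.of_nat m)%Z -> Cmod (f n) <= B) ->
  Cmod (hsum m f) <= 2 * INR m * B.
Proof.
  intro H. destruct m as [|m]; [unfold hsum; rewrite Cmod_0; simpl; lra|]. unfold hsum.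
  rewrite S_INR. eapply Rle_trans; [apply Cmod_triangle|].
  assert (I := zsum_bound m f B ltac:(intros; apply H; lia)).
  assert (H1 := H (Z.of_nat (S m)) ltac:(lia)). assert (H2 := H (- Z.of_nat (S m))%Z ltac:(lia)).
  assert (T := Cmod_triangle (f (Z.of_nat (S m))) (f (- Z.of_nat (S m))%Z)).
  rewrite Cmod_div, Cmod_R, Rabs_pos_eq by (try apply RtoC_neq; lra). lra.
Qed.

(** * Column sums of a sector and the recurrence behind the generating function *)

Section Sigma.
Context (q qi : C) (Hq : (q * qi)%C = 1).

Definition delta (m : nat) : C := ((q ^ m + qi ^ m) / 2)%C.
(** The closed form is the sum of q^n over |n| <= m with the two end terms halved (see [hsum_lexp]).
    Passing to the next column completes the old end terms and adds two new halves, whence the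
    increment. *)
Fixpoint sigma (m : nat) : C :=
  match m with O => 0 | S k => (sigma k + (delta (S k) + delta k))%C end.

Lemma delta_rec m : (delta (S (S m)) = (q + qi) * delta (S m) - delta m)%C.
Proof.
  unfold delta. simpl Cpow.
  replace (q * (q * q ^ m) + qi * (qi * qi ^ m))%C
    with ((q + qi) * (q * q ^ m + qi * qi ^ m) - (q * qi) * (q ^ m + qi ^ m))%C by ring.
  rewrite Hq. field.
Qed.

(** A sequence with this recurrence has a generating function in x with denominator 1 - x (q + 1/q)
    + x^2, the denominator of the kernel. *)
Lemma sigma_rec m : (sigma (S (S m)) = (q + qi) * sigma (S m) - sigma m)%C.
Proof.
  assert (N2 : RtoC 2 <> 0) by (apply RtoC_neq; lra).
  assert (D0 : delta 0 = 1) by (unfold delta; simpl; field; auto).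
  assert (D1 : (2 * delta 1 = q + qi)%C) by (unfold delta; simpl; field; auto).
  induction m as [|m IH].
  - cbn [sigma]. rewrite (delta_rec 0), D0, <- D1. ring.
  - assert (A0 : sigma (S m) = (sigma m + (delta (S m) + delta m))%C) by reflexivity.
    assert (A1 : sigma (S (S m)) = (sigma (S m) + (delta (S (S m)) + delta (S m)))%C)
      by reflexivity.
    change (sigma (S (S (S m))))
      with (sigma (S (S m)) + (delta (S (S (S m))) + delta (S (S m))))%C.
    rewrite IH at 1. rewrite A1, A0, (delta_rec (S m)), (delta_rec m). ring.
Qed.

Context (x : C).

(* Telescoping form of the expansion of 1 / (1 - x (q + 1/q) + x^2). *)
Lemma sigma_telescope K (S_ : nat -> C) :
  S_ O = 0 -> (forall k, S_ (S k) = (S_ k + x ^ (S k) * sigma (S k))%C) ->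
  ((1 - x * (q + qi) + x * x) * S_ K
   = x * sigma 1 - x ^ (S K) * sigma (S K) + x ^ (S (S K)) * sigma K)%C.
Proof.
  intros H0 HS. induction K as [|K IH].
  - rewrite H0. simpl. ring.
  - rewrite HS.
    replace ((1 - x * (q + qi) + x * x) * (S_ K + x ^ S K * sigma (S K)))%C
      with ((1 - x * (q + qi) + x * x) * S_ K
            + (1 - x * (q + qi) + x * x) * (x ^ S K * sigma (S K)))%C by ring.
    rewrite IH, (sigma_rec K). simpl Cpow. ring.
Qed.

Context (p : R) (H1 : Cmod x <= p).
Context (H2 : Cmod (x * q) <= p) (H3 : Cmod (x * qi) <= p).

(** Since x^k q^m = (x q)^m x^(k - m), the growth of q^m is paid for by powers of x as long as m <=
    k. *)
Lemma delta_bound m k : (m <= k)%nat -> Cmod (x ^ k * delta m) <= p ^ k.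
Proof.
  intro Hm. unfold delta.
  assert (Y : forall y, Cmod (x * y) <= p -> Cmod (x ^ k * y ^ m) <= p ^ k).
  { intros y Hy. replace k with (m + (k - m))%nat by lia.
    replace (x ^ (m + (k - m)) * y ^ m)%C with ((x * y) ^ m * x ^ (k - m))%C.
    - rewrite Cmod_mult, !Cmod_pow, pow_add.
      apply Rmult_le_compat; try (apply pow_le, Cmod_ge_0);
        apply pow_incr; split; auto using Cmod_ge_0.
    - rewrite Cpow_add_r, Cpow_mult_l. ring. }
  replace (x ^ k * ((q ^ m + qi ^ m) / 2))%C
    with ((x ^ k * q ^ m + x ^ k * qi ^ m) / 2)%C by field.
  rewrite Cmod_div, Cmod_R, Rabs_pos_eq by (try apply RtoC_neq; lra).
  assert (T := Cmod_triangle (x ^ k * q ^ m) (x ^ k * qi ^ m)).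
  assert (A := Y q H2). assert (B := Y qi H3). lra.
Qed.

Lemma sigma_bound m k : (m <= k)%nat -> Cmod (x ^ k * sigma m) <= 2 * INR m * p ^ k.
Proof.
  induction m as [|m IH]; intro Hm.
  - simpl sigma. rewrite Cmult_0_r, Cmod_0. simpl. lra.
  - cbn [sigma]. rewrite S_INR.
    replace (x ^ k * (sigma m + (delta (S m) + delta m)))%C
      with (x ^ k * sigma m + (x ^ k * delta (S m) + x ^ k * delta m))%C by ring.
    eapply Rle_trans; [apply Cmod_triangle|].
    assert (T := Cmod_triangle (x ^ k * delta (S m)) (x ^ k * delta m)).
    assert (A := delta_bound (S m) k Hm). assert (B := delta_bound m k ltac:(lia)).
    specialize (IH ltac:(lia)). lra.
Qed.

(** The two boundary terms are regrouped so that the factor K appears multiplied by |1 - x|, which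
    is of order t on the ray. Bounding them separately would lose a factor K at t = 1 / K, hence one
    unit in the admissible range of Re s. *)
Lemma sigma_remainder_bound K :
  Cmod (x ^ (S K) * sigma (S K) - x ^ (S (S K)) * sigma K)
  <= p ^ (S K) * (2 + Cmod (1 - x) * (2 * INR K)).
Proof.
  replace (x ^ S K * sigma (S K) - x ^ S (S K) * sigma K)%C
    with ((x ^ S K * delta (S K) + x ^ S K * delta K) + (1 - x) * (x ^ S K * sigma K))%C.
  2:{ cbn [sigma]. simpl Cpow. ring. }
  eapply Rle_trans; [apply Cmod_triangle|]. rewrite (Cmod_mult (1 - x)).
  assert (T := Cmod_triangle (x ^ S K * delta (S K)) (x ^ S K * delta K)).
  assert (A := delta_bound (S K) (S K) (le_n _)). assert (B := delta_bound K (S K) ltac:(lia)).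
  assert (D := sigma_bound K (S K) ltac:(lia)).
  apply Rle_trans with (2 * p ^ S K + Cmod (1 - x) * (2 * INR K * p ^ S K)).
  - apply Rplus_le_compat; [lra|]. apply Rmult_le_compat_l; [apply Cmod_ge_0|exact D].
  - right; ring.
Qed.

End Sigma.

Lemma Cexp_nat_mult n v : Cexp (RtoC (INR n) * v) = (Cexp v ^ n)%C.
Proof.
  induction n as [|n IH].
  - simpl. rewrite Cmult_0_l. apply Cexp_0.
  - rewrite S_INR, RtoC_plus. replace ((INR n + 1) * v)%C with (v + INR n * v)%C by ring.
    rewrite Cexp_plus, IH. reflexivity.
Qed.

Definition lexp (al be z : C) (m n : Z) : C :=
  Cexp (- ((RtoC (IZR m) * al + RtoC (IZR n) * be) * z)).

Lemma hsum_lexp al be z m :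
  hsum m (lexp al be z (Z.of_nat m))
  = (Cexp (- (al * z)) ^ m * sigma (Cexp (- (be * z))) (Cexp (be * z)) m)%C.
Proof.
  set (q := Cexp (- (be * z))). set (qi := Cexp (be * z)). set (x := Cexp (- (al * z))).
  assert (L : forall M k, lexp al be z (Z.of_nat M) (Z.of_nat k) = (x ^ M * q ^ k)%C).
  { intros M k. unfold lexp, x, q. rewrite <- !INR_IZR_INZ, <- !Cexp_nat_mult, <- Cexp_plus.
    f_equal. ring. }
  assert (L' : forall M k, lexp al be z (Z.of_nat M) (- Z.of_nat k) = (x ^ M * qi ^ k)%C).
  { intros M k. unfold lexp, x, qi. rewrite opp_IZR, <- !INR_IZR_INZ.
    rewrite <- !Cexp_nat_mult, <- Cexp_plus, RtoC_opp.
    f_equal. ring. }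
  assert (N2 : RtoC 2 <> 0) by (apply RtoC_neq; lra).
  assert (Zs : forall M k, zsum k (lexp al be z (Z.of_nat M))
     = (x ^ M * (sigma q qi k + delta q qi k))%C).
  { intros M k. induction k as [|k IH].
    - change (zsum 0 _) with (lexp al be z (Z.of_nat M) (Z.of_nat 0)).
      cbn [sigma]. rewrite (L M O). unfold delta. simpl. field; auto.
    - cbn [zsum sigma]. rewrite IH, L, L'. unfold delta. field; auto. }
  destruct m as [|m].
  - unfold hsum. simpl. ring.
  - unfold hsum. rewrite Zs, L, L'. cbn [sigma]. unfold delta. field; auto.
Qed.

Definition fpart (al be : C) (K : nat) (z : C) : C := (/ 2 * ssum K (lexp al be z))%C.

(** The numerator is half of x [sigma] 1, the initial term of the telescoped identity, so dividing
    by the denominator leaves its two final terms. The same half is the factor in [fpart]. *)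
Lemma fab_remainder al be K z :
  denom al be z <> 0 ->
  let x := Cexp (- (al * z)) in
  let sg := sigma (Cexp (- (be * z))) (Cexp (be * z)) in
  (fab al be z - fpart al be K z
   = / 2 * ((x ^ (S K) * sg (S K) - x ^ (S (S K)) * sg K) / denom al be z))%C.
Proof.
  intros N x sg.
  assert (N2 : RtoC 2 <> 0) by (apply RtoC_neq; lra).
  assert (N4 : RtoC 4 <> 0) by (apply RtoC_neq; lra).
  set (q := Cexp (- (be * z))) in *. set (qi := Cexp (be * z)) in *.
  assert (Hq : (q * qi)%C = 1) by apply Cexp_opp_mult.
  assert (T := sigma_telescope q qi Hq x K (fun k => ssum k (lexp al be z)) eq_refl).
  cbv beta in T.
  assert (T' := T ltac:(intro k; cbn [ssum]; now rewrite hsum_lexp)). clear T.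
  assert (E : (1 - x * (q + qi) + x * x)%C = denom al be z).
  { unfold denom.
    replace (- ((al + be) * z))%C with (- (al * z) + - (be * z))%C by ring.
    replace (- ((al - be) * z))%C with (- (al * z) + be * z)%C by ring.
    rewrite !Cexp_plus. fold x q qi.
    replace ((1 - x * q) * (1 - x * qi))%C with (1 - x * (q + qi) + x * x * (q * qi))%C by ring.
    rewrite Hq. ring. }
  assert (E' : numer al be z = (/ 2 * (x * sigma q qi 1))%C).
  { unfold numer.
    replace (- ((al + be) * z))%C with (- (al * z) + - (be * z))%C by ring.
    replace (- ((al - be) * z))%C with (- (al * z) + be * z)%C by ring.
    rewrite !Cexp_plus. fold x q qi. simpl sigma. unfold delta. simpl. field; auto. }
  rewrite E in T'. unfold fab, fpart. rewrite E'.
  replace (ssum K (lexp al be z)) with (denom al be z * ssum K (lexp al be z) / denom al be z)%C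
    by (field; auto).
  rewrite T'. fold sg. field; auto.
Qed.

(** * Zeros and decay of the kernel *)

Definition sector (al be : C) (c : R) : Prop :=
  0 < c /\ c <= Re (al + be) /\ c <= Re (al - be).

(** The zeros of [denom] nearest to the origin, apart from 0, have modulus 2 PI / |al + be| or 2 PI
    / |al - be|; r stays below both. *)
Definition small (al be : C) (r : R) : Prop :=
  0 < r /\ r * Cmod (al + be) < 2 * PI /\ r * Cmod (al - be) < 2 * PI.

Lemma small_le al be r r' : small al be r -> 0 < r' -> r' <= r -> small al be r'.
Proof.
  intros [H0 [H1 H2]] Hr' H. split; [auto|split].
  - eapply Rle_lt_trans; [|exact H1]. apply Rmult_le_compat_r; [apply Cmod_ge_0|auto].
  - eapply Rle_lt_trans; [|exact H2]. apply Rmult_le_compat_r; [apply Cmod_ge_0|auto].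
Qed.

Lemma sector_neq_0 al be c : sector al be c -> (al + be)%C <> 0 /\ (al - be)%C <> 0.
Proof. intros [H0 [H1 H2]]. split; apply Re_pos_neq_0; lra. Qed.

Lemma one_minus_exp_neq_0 (g z : C) :
  g <> 0 -> z <> 0 -> Cmod z * Cmod g < 2 * PI -> (1 - Cexp (- (g * z)))%C <> 0.
Proof.
  intros Hg Hz H E.
  assert (X : Cexp (- (g * z)) = 1).
  { replace (Cexp (- (g * z))) with (1 - (1 - Cexp (- (g * z))))%C by ring. rewrite E. ring. }
  assert (S := expq_spec (- (g * z))). rewrite X in S.
  assert (N : expq (- (g * z)) <> 0).
  { apply expq_neq_0. eapply Rle_lt_trans; [apply Im_le_Cmod|].
    rewrite Cmod_opp, Cmod_mult, Rmult_comm. exact H. }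
  replace (1 - 1)%C with (RtoC 0) in S by ring.
  apply (Cmult_neq_0 (- (g * z)) (expq (- (g * z)))); auto.
  replace (- (g * z))%C with ((-1) * (g * z))%C by ring.
  apply Cmult_neq_0; [apply RtoC_neq; lra|]. now apply Cmult_neq_0.
Qed.

Lemma denom_neq_0_small al be c r (z : C) :
  sector al be c -> small al be r -> z <> 0 -> Cmod z <= r -> denom al be z <> 0.
Proof.
  intros Hs [H0 [H1 H2]] Hz Hr. destruct (sector_neq_0 al be c Hs) as [N1 N2].
  apply Cmult_neq_0; apply one_minus_exp_neq_0; auto.
  - eapply Rle_lt_trans; [|exact H1]. apply Rmult_le_compat_r; [apply Cmod_ge_0|auto].
  - eapply Rle_lt_trans; [|exact H2]. apply Rmult_le_compat_r; [apply Cmod_ge_0|auto].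
Qed.

Lemma one_minus_exp_ray g c t :
  0 < c -> c <= Re g -> 0 < t ->
  Cmod (Cexp (- (g * RtoC t))) <= exp (- c * t) /\
  1 - exp (- c * t) <= Cmod (1 - Cexp (- (g * RtoC t))).
Proof.
  intros Hc Hg Ht.
  assert (B : Cmod (Cexp (- (g * RtoC t))) <= exp (- c * t)).
  { rewrite Cmod_Cexp. apply exp_le. unfold Re in *. simpl.
    apply Rle_trans with (- fst g * t); [right; ring|]. apply Rmult_le_compat_r; lra. }
  split; auto.
  generalize (Cmod_reverse 1 (Cexp (- (g * RtoC t)))). rewrite Cmod_1. lra.
Qed.

Lemma denom_ray al be c t :
  sector al be c -> 0 < t ->
  0 < (1 - exp (- c * t)) ^ 2 <= Cmod (denom al be (RtoC t)).
Proof.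
  intros [H0 [H1 H2]] Ht.
  destruct (one_minus_exp_ray _ c t H0 H1 Ht) as [_ A].
  destruct (one_minus_exp_ray _ c t H0 H2 Ht) as [_ B].
  assert (E : 0 < 1 - exp (- c * t)).
  { assert (exp (- c * t) < 1); [|lra]. rewrite <- exp_0. apply exp_increasing.
    assert (0 < c * t) by (now apply Rmult_lt_0_compat). lra. }
  split; [now apply pow_lt|]. unfold denom. rewrite Cmod_mult.
  replace ((1 - exp (- c * t)) ^ 2) with ((1 - exp (- c * t)) * (1 - exp (- c * t))) by ring.
  apply Rmult_le_compat; lra.
Qed.

Lemma Re_sector al be c : sector al be c -> c <= Re al.
Proof. intros [H0 [H1 H2]]. unfold Re in *. simpl in *. lra. Qed.

Lemma numer_ray al be c t :
  sector al be c -> 0 < t -> Cmod (numer al be (RtoC t)) <= exp (- c * t).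
Proof.
  intros Hs Ht. assert (Ha := Re_sector _ _ _ Hs). destruct Hs as [H0 [H1 H2]].
  destruct (one_minus_exp_ray _ c t H0 H1 Ht) as [A _].
  destruct (one_minus_exp_ray _ c t H0 H2 Ht) as [B _].
  destruct (one_minus_exp_ray _ c t H0 Ha Ht) as [D _].
  unfold numer. rewrite Cmod_div, Cmod_R, Rabs_pos_eq by (try apply RtoC_neq; lra).
  assert (T1 := Cmod_triangle (Cexp (- ((al + be) * t)) + Cexp (- ((al - be) * t)))
     (2 * Cexp (- (al * t)))).
  assert (T2 := Cmod_triangle (Cexp (- ((al + be) * t))) (Cexp (- ((al - be) * t)))).
  rewrite (Cmod_mult 2), Cmod_R, Rabs_pos_eq in T1 by lra. lra.
Qed.

Lemma holo_lin_exp D g : holo D (fun z => Cexp (- (g * z))).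
Proof. apply holo_exp, holo_opp, holo_mult; [apply holo_const|apply holo_id]. Qed.

Lemma holo_denom D al be : holo D (denom al be).
Proof.
  apply holo_mult; (apply holo_minus; [apply holo_const|apply holo_lin_exp]).
Qed.

Lemma holo_numer D al be : holo D (numer al be).
Proof.
  unfold numer. apply holo_ext with (fun z => (Cexp (- ((al + be) * z)) + Cexp (- ((al - be) * z))
    + 2 * Cexp (- (al * z))) * / 4)%C; [reflexivity|].
  apply holo_mult; [|apply holo_const].
  apply holo_plus; [apply holo_plus; apply holo_lin_exp|].
  apply holo_mult; [apply holo_const|apply holo_lin_exp].
Qed.

Lemma holo_fab D al be : (forall z, D z -> denom al be z <> 0) -> holo D (fab al be).
Proof. intro H. apply holo_div; auto using holo_numer, holo_denom. Qed.

Lemma denom_ray_neq_0 al be c t : sector al be c -> 0 < t -> denom al be (RtoC t) <> 0.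
Proof. intros Hs Ht. apply Cmod_gt_0. destruct (denom_ray al be c t Hs Ht). lra. Qed.

Lemma cont_fab_exp al be w :
  denom al be (Cexp w) <> 0 -> cont_at cid (fun w => fab al be (Cexp w)) w.
Proof.
  intro H. apply (cont_comp cid (fab al be) Cexp).
  - eapply (holo_cont (fun z => denom al be z <> 0)); auto. apply holo_fab; auto.
  - eapply deriv_cont, deriv_Cexp.
Qed.

Lemma fab_ray_decay al be c r :
  sector al be c -> 0 < r -> ray_decay (fun w => fab al be (Cexp w)) r.
Proof.
  intros Hs Hr. assert (Hc := proj1 Hs).
  exists (/ (1 - exp (- c * r)) ^ 2), c. split; auto. intros w Hw.
  destruct (Cexp_ray r w Hr Hw) as [E L]. rewrite E. set (u := exp (Re w)) in *.
  assert (U : 0 < u) by lra.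
  destruct (denom_ray al be c u Hs U) as [D1 D2]. destruct (denom_ray al be c r Hs Hr) as [D3 _].
  unfold fab. rewrite Cmod_div by (now apply denom_ray_neq_0 with c).
  unfold Rdiv. rewrite Rmult_comm. apply Rmult_le_compat.
  - left. apply Rinv_0_lt_compat. lra.
  - apply Cmod_ge_0.
  - apply Rinv_le_contravar; auto. apply Rle_trans with (2 := D2).
    assert (exp (- c * r) < 1).
    { rewrite <- exp_0. apply exp_increasing.
      assert (0 < c * r) by (now apply Rmult_lt_0_compat). lra. }
    apply pow_incr. split; [lra|].
    assert (exp (- c * u) <= exp (- c * r)); [|lra].
    apply exp_le. apply Rmult_le_compat_neg_l; lra.
  - now apply numer_ray.
Qed.

Lemma admits_fab al be c r :
  sector al be c -> small al be r -> admits (fun w => fab al be (Cexp w)) r.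
Proof.
  intros Hs Hm. assert (Hr := proj1 Hm). split; [|split; [|split]]; auto.
  - intros w Hw. apply cont_fab_exp. destruct (Cexp_ray r w Hr Hw) as [E L]. rewrite E.
    apply denom_ray_neq_0 with c; auto. lra.
  - intros w Hw. apply cont_fab_exp. apply denom_neq_0_small with c r; auto.
    + apply Cexp_neq_0.
    + rewrite (Cexp_circ r w); auto; lra.
  - now apply fab_ray_decay with c.
Qed.

Definition hfab (al be s : C) (r : R) : C :=
  hankel (fun w => Cexp (s * w) * fab al be (Cexp w))%C r.

Lemma hfab_radius al be c s r r' :
  sector al be c -> small al be r -> 0 < r' -> r' <= r -> hfab al be s r' = hfab al be s r.
Proof.
  intros Hs Hm Hr' H.
  destruct Hm as [H0 [H1 H2]]. destruct (sector_neq_0 al be c Hs) as [N1 N2].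
  assert (P1 := proj1 (Cmod_gt_0 _) N1). assert (P2 := proj1 (Cmod_gt_0 _) N2).
  (* This is the modulus of the nearest nonzero zero of [denom]; the midpoint of r and m leaves room
     for an open strip containing the circle of radius r. *)
  set (m := Rmin (2 * PI / Cmod (al + be)) (2 * PI / Cmod (al - be))).
  assert (M : r < m).
  { unfold m. apply Rmin_glb_lt.
    - apply Rmult_lt_reg_r with (Cmod (al + be)); auto. unfold Rdiv.
      rewrite Rmult_assoc, Rinv_l; lra.
    - apply Rmult_lt_reg_r with (Cmod (al - be)); auto. unfold Rdiv.
      rewrite Rmult_assoc, Rinv_l; lra. }
  apply (hankel_radius _ (ln r' - 1) (ln ((r + m) / 2))); auto.
  - apply admits_exp. apply admits_fab with c; auto. apply small_le with r; auto. now split.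
  - lra.
  - apply ln_increasing; lra.
  - apply holo_mult.
    + apply holo_exp, holo_mult; [apply holo_const|apply holo_id].
    + apply (holo_comp _ (fun z => denom al be z <> 0) (fab al be) Cexp).
      * apply holo_fab; auto.
      * apply holo_Cexp.
      * intros w [_ Hw]. apply denom_neq_0_small with c ((r + m) / 2); auto.
        -- split; [lra|].
           assert (M1 : m <= 2 * PI / Cmod (al + be)) by apply Rmin_l.
           assert (M2 : m <= 2 * PI / Cmod (al - be)) by apply Rmin_r.
           split.
           ++ apply Rlt_le_trans with (2 * PI / Cmod (al + be) * Cmod (al + be)).
              ** apply Rmult_lt_compat_r; lra.
              ** right; field; lra.
           ++ apply Rlt_le_trans with (2 * PI / Cmod (al - be) * Cmod (al - be)).
              ** apply Rmult_lt_compat_r; lra.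
              ** right; field; lra.
        -- apply Cexp_neq_0.
        -- rewrite Cmod_Cexp. apply Rlt_le.
           rewrite <- (exp_ln ((r + m) / 2)) by lra. now apply exp_increasing.
Qed.

Lemma hfab_deriv al be c r s :
  sector al be c -> small al be r ->
  deriv_at cid (fun s => hfab al be s r) s
    (hankel (fun w => Cexp (s * w) * (w * fab al be (Cexp w)))%C r).
Proof. intros Hs Hm. apply hankel_deriv_s. now apply admits_fab with c. Qed.

(** The first derivative has one more factor w, which the decay still absorbs, so [hankel_deriv_s]
    applies once more. The second derivative serves the removal of singularities. *)
Lemma hfab_deriv2 al be c r s :
  sector al be c -> small al be r -> exists l,
  deriv_at cid (fun s => hankel (fun w => Cexp (s * w) * (w * fab al be (Cexp w)))%C r) s l.
Proof.
  intros Hs Hm. eexists. apply hankel_deriv_s. apply admits_id. now apply admits_fab with c.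
Qed.

(** ** Behaviour at the origin *)

Definition gab (al be z : C) : C :=
  (numer al be z / ((al + be) * (al - be) * (expq (- ((al + be) * z)) * expq (- ((al - be) * z)))))%C.

Lemma gab_den_neq_0 al be c r z :
  sector al be c -> small al be r -> Cmod z <= r ->
  ((al + be) * (al - be) * (expq (- ((al + be) * z)) * expq (- ((al - be) * z))))%C <> 0.
Proof.
  intros Hs [H0 [H1 H2]] Hr. destruct (sector_neq_0 al be c Hs) as [N1 N2].
  assert (Q : forall g, r * Cmod g < 2 * PI -> expq (- (g * z)) <> 0).
  { intros g Hg. apply expq_neq_0. eapply Rle_lt_trans; [apply Im_le_Cmod|].
    rewrite Cmod_opp, Cmod_mult, Rmult_comm. eapply Rle_lt_trans; [|exact Hg].
    apply Rmult_le_compat_r; [apply Cmod_ge_0|auto]. }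
  apply Cmult_neq_0; [now apply Cmult_neq_0|]. apply Cmult_neq_0; auto.
Qed.

(** Each factor 1 - exp(-g z) is g z [expq] (-g z), so [gab] is z^2 [fab] continued through its
    double pole at 0. *)
Lemma fab_gab al be c r (z : C) :
  sector al be c -> small al be r -> z <> 0 -> Cmod z <= r ->
  fab al be z = (gab al be z / (z * z))%C.
Proof.
  intros Hs Hm Hz Hr.
  assert (N := gab_den_neq_0 al be c r z Hs Hm Hr).
  assert (D : denom al be z = ((al + be) * (al - be)
     * (expq (- ((al + be) * z)) * expq (- ((al - be) * z))) * (z * z))%C).
  { assert (E : forall g, (1 - Cexp (- (g * z)))%C = (g * z * expq (- (g * z)))%C).
    { intro g. replace (1 - Cexp (- (g * z)))%C with (- (Cexp (- (g * z)) - 1))%C by ring.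
      rewrite <- expq_spec. ring. }
    unfold denom. rewrite !E. ring. }
  unfold fab, gab. rewrite D. set (e := (_ * _ * (_ * _))%C) in N |- *. field. auto.
Qed.

Lemma cont_gab_0 al be c r :
  sector al be c -> small al be r -> cont_at cid (gab al be) 0.
Proof.
  intros Hs Hm.
  assert (N := gab_den_neq_0 al be c r 0 Hs Hm ltac:(rewrite Cmod_0; left; apply Hm)).
  assert (Q : forall g, cont_at cid (fun z => expq (- (g * z))) 0).
  { intro g. apply (holo_cont (fun _ => True)); auto.
    apply (holo_comp _ (fun _ => True) expq (fun z => - (g * z))%C); auto.
    - apply holo_expq.
    - apply holo_opp, holo_mult; [apply holo_const|apply holo_id]. }
  unfold gab. apply cont_mult.
  - apply (holo_cont (fun _ => True)); auto. apply holo_numer.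
  - apply cont_inv; auto. apply cont_mult; [apply cont_const|]. apply cont_mult; apply Q.
Qed.

Lemma gab_0 al be : gab al be 0 = (/ ((al + be) * (al - be)))%C.
Proof.
  unfold gab, numer. replace (- ((al + be) * 0))%C with (RtoC 0) by ring.
  replace (- ((al - be) * 0))%C with (RtoC 0) by ring.
  replace (- (al * 0))%C with (RtoC 0) by ring. rewrite Cexp_0, expq_0.
  replace ((1 + 1 + 2 * 1) / 4)%C with (RtoC 1) by field.
  replace ((al + be) * (al - be) * (1 * 1))%C with ((al + be) * (al - be))%C by ring.
  unfold Cdiv. ring.
Qed.

Lemma fab_bound_origin al be c r :
  sector al be c -> small al be r -> exists d B, 0 < d /\ d <= r /\ 0 <= B /\
    forall z : C, z <> 0 -> Cmod z < d -> Cmod (fab al be z) <= B / Cmod z ^ 2.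
Proof.
  intros Hs Hm. destruct (cont_gab_0 al be c r Hs Hm 1 Rlt_0_1) as [d [D Hd]].
  assert (Hr := proj1 Hm).
  exists (Rmin d r), (Cmod (gab al be 0) + 1). split; [now apply Rmin_pos|].
  split; [apply Rmin_r|]. split; [generalize (Cmod_ge_0 (gab al be 0)); lra|].
  intros z Hz Hzd.
  assert (K1 := Rlt_le_trans _ _ _ Hzd (Rmin_l _ _)).
  assert (K2 := Rlt_le_trans _ _ _ Hzd (Rmin_r _ _)).
  rewrite (fab_gab al be c r) by (auto; lra).
  assert (N : (z * z)%C <> 0) by (now apply Cmult_neq_0).
  rewrite Cmod_div by auto. rewrite Cmod_mult.
  replace (Cmod z ^ 2) with (Cmod z * Cmod z) by ring.
  unfold cid in Hd. specialize (Hd z). replace (z - 0)%C with z in Hd by ring.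
  specialize (Hd K1). apply Cmod_gt_0 in Hz.
  apply Rmult_le_compat_r; [left; apply Rinv_0_lt_compat; now apply Rmult_lt_0_compat|].
  assert (T := Cmod_reverse (gab al be z) (gab al be 0)). lra.
Qed.

(** At s = 2 the power is single valued, so the two rays cancel and the circle remains. Shrinking it
    gives 2 i PI times the value of z^2 [fab] at 0. *)
Lemma hfab_2 al be c r :
  sector al be c -> small al be r ->
  hfab al be 2 r = (2 * RtoC PI * Ci / ((al + be) * (al - be)))%C.
Proof.
  intros Hs Hm. apply C_eq_eps. intros eps He. assert (P := PI_RGT_0).
  assert (He2 : 0 < eps / (2 * PI)) by (apply Rdiv_lt_0_compat; lra).
  destruct (cont_gab_0 al be c r Hs Hm _ He2) as [d [D Hd]].
  assert (Hr := proj1 Hm). set (r' := Rmin (d / 2) r).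
  assert (R0 : 0 < r') by (apply Rmin_pos; lra).
  assert (R1 : r' <= d / 2) by apply Rmin_l. assert (R2 : r' <= r) by apply Rmin_r.
  rewrite <- (hfab_radius al be c 2 r r') by auto.
  assert (Hm' := small_le al be r r' Hm R0 R2).
  assert (A := admits_exp 2 _ r' (admits_fab al be c r' Hs Hm')).
  unfold hfab, hankel.
  replace (kray (fun w => Cexp (2 * w) * fab al be (Cexp w))%C (2 * PI))
    with (kray (fun w => Cexp (2 * w) * fab al be (Cexp w))%C 0).
  2:{ apply functional_extensionality. intro t. unfold kray. f_equal.
      assert (E : Cexp (RtoC (ln t) + Ci * RtoC 0) = Cexp (RtoC (ln t) + Ci * RtoC (2 * PI))).
      { rewrite !Cexp_plus, Cexp_2PI. replace (Ci * 0)%C with (RtoC 0) by ring.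
        now rewrite Cexp_0. }
      assert (T : forall v, Cexp (2 * v) = (Cexp v * Cexp v)%C).
      { intro v. rewrite <- Cexp_plus. f_equal. ring. }
      rewrite !T, E. reflexivity. }
  set (I := int (karc _ _) _ _).
  replace (tail (kray (fun w => Cexp (2 * w) * fab al be (Cexp w)) 0) r' -
    tail (kray (fun w => Cexp (2 * w) * fab al be (Cexp w)) 0) r' + Ci * I -
    2 * PI * Ci / ((al + be) * (al - be)))%C
    with (Ci * (I + ((2 * PI)%R - 0) * - gab al be 0))%C.
  2:{ rewrite gab_0, RtoC_mult. unfold Cdiv. ring. }
  rewrite Cmod_mult, Cmod_Ci, Rmult_1_l.
  assert (J := is_int_plus _ _ _ _ _ _ (admits_int _ _ A)
     (is_int_const (- gab al be 0) 0 (2 * PI) PI2_pos)).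
  apply Rle_trans with ((2 * PI - 0) * (eps / (2 * PI))); [|right; field; lra].
  eapply is_int_bound; [apply PI2_pos| |exact J].
  intros t Ht. cbv beta. unfold karc.
  assert (Z := Cexp_circ r' (RtoC (ln r') + Ci * RtoC t)%C R0 ltac:(now exists t)).
  set (w := (RtoC (ln r') + Ci * RtoC t)%C) in *. set (z := Cexp w) in *.
  assert (Nz : z <> 0) by apply Cexp_neq_0.
  replace (Cexp (2 * w)) with (z * z)%C.
  2:{ unfold z. rewrite <- Cexp_plus. f_equal. ring. }
  rewrite (fab_gab al be c r) by (auto; lra).
  replace (z * z * (gab al be z / (z * z)) + - gab al be 0)%C with (gab al be z - gab al be 0)%C
    by (field; auto).
  left. apply Hd. unfold cid. replace (z - 0)%C with z by ring. lra.
Qed.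

(** ** From the contour integral to the lattice sum *)

Definition has_hankel (r : R) (f : C -> C) (l : C) : Prop := admits f r /\ hankel f r = l.

Lemma has_hankel_plus r f g l m :
  has_hankel r f l -> has_hankel r g m -> has_hankel r (fun w => f w + g w)%C (l + m)%C.
Proof.
  intros [F1 F2] [G1 G2]. split; [now apply admits_plus|].
  rewrite hankel_plus by auto. now rewrite F2, G2.
Qed.

Lemma has_hankel_scal r c f l : has_hankel r f l -> has_hankel r (fun w => c * f w)%C (c * l)%C.
Proof.
  intros [F1 F2]. split; [now apply admits_scal|]. rewrite hankel_scal by auto. now rewrite F2.
Qed.

Lemma has_hankel_zsum r m (f : Z -> C -> C) l :
  (forall n, (Z.abs n <= Z.of_nat m)%Z -> has_hankel r (f n) (l n)) ->
  has_hankel r (fun w => zsum m (fun n => f n w)) (zsum m l).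
Proof.
  intro H. induction m as [|m IH]; [apply (H 0%Z); lia|].
  cbn [zsum]. apply has_hankel_plus; [apply IH; intros; apply H; lia|].
  apply has_hankel_plus; apply H; lia.
Qed.

Lemma has_hankel_hsum r m (f : Z -> C -> C) l :
  (1 <= m)%nat ->
  (forall n, (Z.abs n <= Z.of_nat m)%Z -> has_hankel r (f n) (l n)) ->
  has_hankel r (fun w => hsum m (fun n => f n w)) (hsum m l).
Proof.
  intros Hm H. destruct m as [|m]; [lia|]. unfold hsum.
  apply has_hankel_plus; [apply has_hankel_zsum; intros; apply H; lia|].
  replace ((l (Z.of_nat (S m)) + l (- Z.of_nat (S m))%Z) / 2)%C
    with (/ 2 * (l (Z.of_nat (S m)) + l (- Z.of_nat (S m))%Z))%C by (unfold Cdiv; ring).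
  replace (fun w => ((f (Z.of_nat (S m)) w + f (- Z.of_nat (S m))%Z w) / 2)%C)
    with (fun w => (/ 2 * (f (Z.of_nat (S m)) w + f (- Z.of_nat (S m))%Z w))%C)
    by (apply functional_extensionality; intro; unfold Cdiv; ring).
  apply has_hankel_scal, has_hankel_plus; apply H; lia.
Qed.

Lemma has_hankel_ssum r K (f : Z -> Z -> C -> C) l :
  (1 <= K)%nat ->
  (forall m n, (1 <= m <= Z.of_nat K)%Z -> (Z.abs n <= m)%Z -> has_hankel r (f m n) (l m n)) ->
  has_hankel r (fun w => ssum K (fun m n => f m n w)) (ssum K l).
Proof.
  intros HK H. induction K as [|K IH]; [lia|].
  assert (Hh : has_hankel r (fun w => hsum (S K) (fun n => f (Z.of_nat (S K)) n w))
     (hsum (S K) (l (Z.of_nat (S K))))).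
  { apply (has_hankel_hsum r (S K) (f (Z.of_nat (S K)))); [lia|]. intros; apply H; lia. }
  destruct K as [|K].
  - replace (ssum 1 l) with (hsum 1 (l (Z.of_nat 1))) by (cbn [ssum]; ring).
    replace (fun w => ssum 1 (fun m n => f m n w))
      with (fun w => hsum 1 (fun n => f (Z.of_nat 1) n w)).
    2:{ apply functional_extensionality; intro w. cbn [ssum]. ring. }
    exact Hh.
  - cbn [ssum] in *. apply has_hankel_plus; [|exact Hh].
    apply IH; [lia|]. intros; apply H; lia.
Qed.

Definition lat (al be : C) (m n : Z) : C := (RtoC (IZR m) * al + RtoC (IZR n) * be)%C.

(** Writing m al + n be as a nonnegative combination of al + be and al - be shows what [sector]
    provides: the whole sector lies in the right half-plane, with real part growing linearly in
    m. *)
Lemma Re_lat al be c m n :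
  sector al be c -> (Z.abs n <= m)%Z -> c * IZR m <= Re (lat al be m n).
Proof.
  intros [H0 [H1 H2]] Hn.
  assert (A : 0 <= IZR (m + n)) by (apply IZR_le; lia).
  assert (B : 0 <= IZR (m - n)) by (apply IZR_le; lia).
  rewrite plus_IZR in A. rewrite minus_IZR in B.
  unfold lat, Re in *. simpl in *.
  assert (X := Rmult_le_compat_l _ _ _ A H1). assert (Y := Rmult_le_compat_l _ _ _ B H2). lra.
Qed.

Lemma Re_lat_pos al be c m n :
  sector al be c -> (1 <= m)%Z -> (Z.abs n <= m)%Z -> 0 < Re (lat al be m n).
Proof.
  intros Hs Hm Hn. apply Rlt_le_trans with (2 := Re_lat al be c m n Hs Hn).
  apply Rmult_lt_0_compat; [apply Hs|]. apply IZR_lt. lia.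
Qed.

(** The power (m al + n be)^(-s) in the principal determination, the one that [hexp_scale]
    supplies. *)
Definition lpow (al be s : C) (m n : Z) : C := Cexp (- (s * plog (lat al be m n))).

Lemma hankel_fpart al be c s K r :
  sector al be c -> 0 < r -> (1 <= K)%nat ->
  has_hankel r (fun w => Cexp (s * w) * fpart al be K (Cexp w))%C
    (/ 2 * (hk s * ssum K (lpow al be s)))%C.
Proof.
  intros Hs Hr HK.
  replace (fun w => (Cexp (s * w) * fpart al be K (Cexp w))%C)
    with (fun w => (/ 2 * ssum K (fun m n => Cexp (s * w) * lexp al be (Cexp w) m n))%C).
  2:{ apply functional_extensionality. intro w. unfold fpart. rewrite ssum_scal. ring. }
  rewrite <- ssum_scal. apply has_hankel_scal.
  apply (has_hankel_ssum r K (fun m n w => Cexp (s * w) * lexp al be (Cexp w) m n)%C); auto.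
  intros m n Hm Hn. assert (P := Re_lat_pos al be c m n Hs ltac:(lia) Hn).
  unfold lexp, lpow. fold (lat al be m n). split.
  - now apply admits_gexp.
  - rewrite hexp_radius by auto. rewrite hexp_scale by auto. unfold hk. ring.
Qed.

Lemma Cexp_m1_neg h : Re h <= 0 -> Cmod (1 - Cexp h) <= Cmod h.
Proof.
  intro Hh. rewrite Cmod_minus_sym.
  generalize (deriv_bound (fun u => Cexp (RtoC u * h)) (fun u => h * Cexp (RtoC u * h))%C
    0 1 (Cmod h)).
  replace (RtoC 1 * h)%C with h by ring. replace (RtoC 0 * h)%C with (RtoC 0) by ring.
  rewrite Cexp_0. intro H. replace (Cmod h) with ((1 - 0) * Cmod h) by ring.
  apply H; [lra| | |].
  - intros; apply deriv_Cexp_line.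
  - intros. apply cont_mult; [apply cont_const|]. eapply deriv_cont, deriv_Cexp_line.
  - intros t Ht. rewrite Cmod_mult, Cmod_Cexp.
    assert (E : exp (Re (t * h)) <= 1).
    { apply exp_le_1. replace (Re (t * h)) with (t * Re h) by (unfold Re; simpl; ring).
      assert (0 <= t * - Re h) by (apply Rmult_le_pos; lra). lra. }
    rewrite <- (Rmult_1_r (Cmod h)) at 2. apply Rmult_le_compat_l; [apply Cmod_ge_0|auto].
Qed.

(** Everything is expressed in K t >= 1: the double zero of the denominator becomes the factor K^2,
    and the boundary terms of the telescoped sum become exponential decay in K t. *)
Lemma remainder_ray al be c K t :
  sector al be c -> (2 <= K)%nat -> / INR K <= t ->
  Cmod (fab al be (RtoC t) - fpart al be K (RtoC t))
  <= (1 + Cmod al) / c ^ 2 * INR K ^ 2 * exp (- (c / 2) * (INR K * t)).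
Proof.
  intros Hs HK Ht. assert (K2 : 2 <= INR K) by (apply (le_INR 2); lia).
  assert (T0 : 0 < t) by (apply Rlt_le_trans with (2 := Ht); apply Rinv_0_lt_compat; lra).
  assert (Y : 1 <= INR K * t).
  { apply Rle_trans with (INR K * / INR K); [right; field; lra|]. apply Rmult_le_compat_l; lra. }
  assert (Ha := Re_sector _ _ _ Hs).
  assert (N := denom_ray_neq_0 al be c t Hs T0).
  destruct (denom_ray al be c t Hs T0) as [D1 D2].
  destruct Hs as [H0 [H1 H2]].
  destruct (one_minus_exp_ray _ c t H0 H1 T0) as [A1 _].
  destruct (one_minus_exp_ray _ c t H0 H2 T0) as [A2 _].
  destruct (one_minus_exp_ray _ c t H0 Ha T0) as [A3 _].
  rewrite (fab_remainder al be K t N).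
  set (x := Cexp (- (al * t))) in *. set (q := Cexp (- (be * t))). set (qi := Cexp (be * t)).
  set (p := exp (- c * t)) in *.
  assert (P0 : 0 < p) by apply exp_pos.
  assert (B := sigma_remainder_bound q qi x p A3).
  assert (XQ : (x * q)%C = Cexp (- ((al + be) * t))).
  { unfold x, q. rewrite <- Cexp_plus. f_equal. ring. }
  assert (XQI : (x * qi)%C = Cexp (- ((al - be) * t))).
  { unfold x, qi. rewrite <- Cexp_plus. f_equal. ring. }
  rewrite XQ, XQI in B. specialize (B A1 A2 K).
  assert (X1 : Cmod (1 - x) <= Cmod al * t).
  { unfold x. eapply Rle_trans; [apply Cexp_m1_neg|].
    - unfold Re in *. simpl. apply Rle_trans with (- (fst al * t)); [right; ring|].
      assert (0 <= fst al * t) by (apply Rmult_le_pos; lra). lra.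
    - rewrite Cmod_opp, Cmod_mult, Cmod_R, Rabs_pos_eq by lra. lra. }
  rewrite Cmod_mult, Cmod_div, Cmod_inv, Cmod_R, Rabs_pos_eq
    by (try apply RtoC_neq; auto; lra).
  set (R_ := Cmod (_ - _)) in *.
  (* This lower bound keeps the exact order of vanishing at t = 0 and costs exp(2 c t) in the
     quotient. The factor p^(K + 1) absorbs it, because K - 1 >= K / 2 for K >= 2. *)
  assert (L : c * t * exp (- (c * t)) <= 1 - p).
  { unfold p. replace (- c * t) with (- (c * t)) by ring.
    assert (E := exp_ineq1_le (c * t)).
    assert (Q : exp (- (c * t)) * exp (c * t) = 1).
    { rewrite <- exp_plus. replace (- (c * t) + c * t) with 0 by ring. apply exp_0. }
    assert (PP := exp_pos (- (c * t))). nra. }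
  assert (CT : 0 < c * t) by (now apply Rmult_lt_0_compat).
  assert (E2 : exp (- (c * t)) * exp (- (c * t)) = exp (- 2 * (c * t))).
  { rewrite <- exp_plus. f_equal. ring. }
  assert (L2 : (c * t) ^ 2 * exp (- 2 * (c * t)) <= Cmod (denom al be t)).
  { apply Rle_trans with (2 := D2). rewrite <- E2.
    replace ((c * t) ^ 2 * (exp (- (c * t)) * exp (- (c * t))))
      with ((c * t * exp (- (c * t))) ^ 2) by ring.
    apply pow_incr. split; [|exact L]. apply Rmult_le_pos; [lra|left; apply exp_pos]. }
  assert (PE := exp_pos (- 2 * (c * t))).
  assert (PD : 0 < (c * t) ^ 2 * exp (- 2 * (c * t))).
  { apply Rmult_lt_0_compat; auto. now apply pow_lt. }
  assert (Pk : p ^ S K = exp (- (c * t) * (INR K + 1))).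
  { unfold p. rewrite <- (S_INR K). clear. induction (S K) as [|n IH].
    - simpl. rewrite Rmult_0_r, exp_0. reflexivity.
    - rewrite S_INR. simpl pow. rewrite IH, <- exp_plus. f_equal. ring. }
  assert (RB : R_ <= p ^ S K * (2 * (1 + Cmod al) * (INR K * t))).
  { eapply Rle_trans; [exact B|]. apply Rmult_le_compat_l; [apply pow_le; lra|].
    assert (0 <= Cmod al) by apply Cmod_ge_0.
    assert (Cmod (1 - x) * (2 * INR K) <= Cmod al * t * (2 * INR K)).
    { apply Rmult_le_compat_r; lra. }
    nra. }
  apply Rle_trans with (/ 2 * (p ^ S K * (2 * (1 + Cmod al) * (INR K * t))
     / ((c * t) ^ 2 * exp (- 2 * (c * t))))).
  { apply Rmult_le_compat_l; [lra|]. unfold Rdiv. apply Rmult_le_compat; auto.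
    - unfold R_. apply Cmod_ge_0.
    - left. apply Rinv_0_lt_compat. lra.
    - apply Rinv_le_contravar; auto. }
  rewrite Pk.
  replace (/ 2 * (exp (- (c * t) * (INR K + 1)) * (2 * (1 + Cmod al) * (INR K * t)) /
    ((c * t) ^ 2 * exp (- 2 * (c * t)))))
    with ((1 + Cmod al) / c ^ 2 * INR K ^ 2 * (exp (- (c * t) * (INR K + 1))
      * / exp (- 2 * (c * t)) * / (INR K * t))).
  2:{ field. split; [apply Rgt_not_eq, exp_pos|split; lra]. }
  apply Rmult_le_compat_l.
  { apply Rmult_le_pos; [|apply pow2_ge_0]. apply Rdiv_le_0_compat.
    - generalize (Cmod_ge_0 al); lra.
    - now apply pow_lt. }
  rewrite <- exp_Ropp, <- exp_plus.
  rewrite <- (Rmult_1_r (exp (- (c / 2) * (INR K * t)))).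
  apply Rmult_le_compat.
  - left; apply exp_pos.
  - left; apply Rinv_0_lt_compat; lra.
  - apply exp_le. nra.
  - rewrite <- Rinv_1. apply Rinv_le_contravar; lra.
Qed.

(** At |z| = 1 / K every exponent is at most |al| + |be| in modulus, so the bound only counts the
    terms of the sector. *)
Lemma fpart_circle al be K z :
  (1 <= K)%nat -> Cmod z = / INR K ->
  Cmod (fpart al be K z) <= INR K ^ 2 * exp (Cmod al + Cmod be).
Proof.
  intros HK Hz. assert (K1 : 1 <= INR K) by (apply (le_INR 1); lia).
  unfold fpart. rewrite Cmod_mult, Cmod_inv, Cmod_R, Rabs_pos_eq by (try apply RtoC_neq; lra).
  set (B := exp (Cmod al + Cmod be)).
  assert (H : forall J, (J <= K)%nat ->
    Cmod (ssum J (lexp al be z)) <= INR J * (2 * INR K * B)).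
  { induction J as [|J IH]; intro HJ.
    - simpl. rewrite Cmod_0. lra.
    - cbn [ssum]. rewrite S_INR. eapply Rle_trans; [apply Cmod_triangle|].
      specialize (IH ltac:(lia)).
      assert (Hh : Cmod (hsum (S J) (lexp al be z (Z.of_nat (S J)))) <= 2 * INR (S J) * B).
      { apply hsum_bound. intros n Hn. unfold lexp, B.
        rewrite Cmod_Cexp. apply exp_le. eapply Rle_trans; [apply Rle_abs|].
        eapply Rle_trans; [apply re_le_Cmod|]. rewrite Cmod_opp, Cmod_mult, Hz.
        assert (HJ1 : IZR (Z.of_nat (S J)) <= INR K).
        { rewrite <- INR_IZR_INZ. apply le_INR. lia. }
        assert (HJ0 : 0 <= IZR (Z.of_nat (S J))) by (apply IZR_le; lia).
        assert (Hn' : Rabs (IZR n) <= INR K).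
        { rewrite <- abs_IZR. apply Rle_trans with (2 := HJ1). now apply IZR_le. }
        apply Rmult_le_reg_r with (INR K); [lra|].
        rewrite Rmult_assoc, Rinv_l, Rmult_1_r by lra.
        eapply Rle_trans; [apply Cmod_triangle|]. rewrite !Cmod_mult, !Cmod_R.
        rewrite (Rabs_pos_eq _ HJ0), Rmult_plus_distr_r.
        rewrite (Rmult_comm (Cmod al)), (Rmult_comm (Cmod be)).
        apply Rplus_le_compat; apply Rmult_le_compat_r; auto using Cmod_ge_0. }
      assert (HJ2 : INR (S J) <= INR K) by (apply le_INR; lia).
      assert (PB : 0 < B) by apply exp_pos.
      assert (2 * INR (S J) * B <= 2 * INR K * B) by (apply Rmult_le_compat_r; lra).
      lra. }
  specialize (H K (le_n K)). apply Rle_trans with (/ 2 * (INR K * (2 * INR K * B))).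
  - apply Rmult_le_compat_l; lra.
  - right. field.
Qed.

(** The radius is moved to 1 / K, which does not change the integral. There |z|^(Re s) contributes
    K^(-Re s) and the remainder K^2, on the circle as well as, in the variable K u, on the rays. *)
Theorem hfab_lattice al be c r s :
  sector al be c -> small al be r -> 2 < Re s ->
  forall eps, 0 < eps -> exists N, forall K, (N <= K)%nat ->
    Cmod (hfab al be s r - / 2 * (hk s * ssum K (lpow al be s))) < eps.
Proof.
  intros Hs Hm Hre eps He. assert (Hc := proj1 Hs). assert (P := PI_RGT_0).
  destruct (fab_bound_origin al be c r Hs Hm) as [d [B [D0 [D1 [B0 HB]]]]].
  (* The factor (K u)^(Re s), with K u >= 1, is traded for exp(c K u / 4), half of the decay in
     [remainder_ray]; the other half remains for integration. *)
  destruct (exp_ln_subexp (Re s) (c / 4) 1 ltac:(lra) ltac:(lra) Rlt_0_1) as [C1 HC1].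
  set (A := exp (2 * PI * Rabs (Im s))).
  set (A0 := (1 + Cmod al) / c ^ 2).
  set (Tot := 2 * (A * C1 * A0 * (4 / c)) + 2 * PI * (A * (B + exp (Cmod al + Cmod be)))).
  destruct (exp_decay_small Tot (Re s - 2) eps ltac:(lra) He) as [L [HL HL']].
  destruct (nfloor_ex (Rmax (exp L) (/ d)) ltac:(apply Rle_trans with (2 := Rmax_l _ _); left; apply exp_pos))
    as [N [_ HN]].
  exists (N + 2)%nat. intros K HK.
  assert (K2 : 2 <= INR K) by (apply (le_INR 2); lia).
  assert (KN : INR N + 1 <= INR K) by (rewrite <- S_INR; apply le_INR; lia).
  assert (KL : exp L < INR K).
  { apply Rle_lt_trans with (1 := Rmax_l _ (/ d)). lra. }
  assert (Kd : / d < INR K).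
  { apply Rle_lt_trans with (1 := Rmax_r (exp L) _). lra. }
  set (k := / INR K). assert (k0 : 0 < k) by (apply Rinv_0_lt_compat; lra).
  assert (kd : k < d).
  { unfold k. rewrite <- (Rinv_inv d). apply Rinv_lt_contravar; auto.
    apply Rmult_lt_0_compat; [now apply Rinv_0_lt_compat|lra]. }
  assert (lnk : ln k = - ln (INR K)) by (unfold k; apply ln_Rinv; lra).
  rewrite <- (hfab_radius al be c s r k) by (auto; lra).
  assert (Hm' := small_le al be r k Hm k0 ltac:(lra)).
  destruct (hankel_fpart al be c s K k Hs k0 ltac:(lia)) as [F1 F2].
  assert (G1 := admits_exp s _ k (admits_fab al be c k Hs Hm')).
  assert (G2 := admits_plus _ _ k G1 (admits_scal (-1)%C _ k F1)).
  assert (E : (hfab al be s k - / 2 * (hk s * ssum K (lpow al be s)))%C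
    = hankel (fun w => Cexp (s * w) * fab al be (Cexp w)
               + (-1) * (Cexp (s * w) * fpart al be K (Cexp w)))%C k).
  { rewrite hankel_plus, hankel_scal by (auto using admits_scal). rewrite F2. unfold hfab. ring. }
  rewrite E. clear E.
  set (y := exp (- (Re s - 2) * ln (INR K))).
  assert (KK : INR K = exp (ln (INR K))) by (symmetry; apply exp_ln; lra).
  assert (Ky : exp (- Re s * ln (INR K)) * INR K ^ 2 = y).
  { unfold y. rewrite KK at 2. simpl. rewrite Rmult_1_r, <- !exp_plus. f_equal. ring. }
  apply Rle_lt_trans with (Tot * y).
  2:{ apply HL'. rewrite <- (ln_exp L). apply ln_le; [apply exp_pos|lra]. }
  assert (Pos : 0 <= A * C1 * A0 * y).
  { assert (0 <= C1).
    { assert (Q := Rle_trans _ _ _ (Rlt_le _ _ (exp_pos _)) (HC1 1 (Rle_refl _))).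
      assert (PP := exp_pos (c / 4 * 1)). nra. }
    assert (0 <= A0).
    { unfold A0. apply Rdiv_le_0_compat; [generalize (Cmod_ge_0 al); lra|now apply pow_lt]. }
    apply Rmult_le_pos; [|left; apply exp_pos]. apply Rmult_le_pos; auto.
    apply Rmult_le_pos; auto. left; apply exp_pos. }
  eapply Rle_trans.
  (* The 1 / r of the ray bound is K and the decay rate is c K / 4, so K cancels and the rays
     contribute a constant times y = K^(2 - Re s). *)
  - apply (hankel_bound _ k (A * C1 * A0 * y) (c / 4 * INR K)
             (A * (B + exp (Cmod al + Cmod be)) * y)); auto.
    + apply Rmult_lt_0_compat; lra.
    + intros w Hw. destruct (Cexp_ray k w k0 Hw) as [Ew Lw].
      replace (Cexp (s * w) * fab al be (Cexp w)
               + (-1) * (Cexp (s * w) * fpart al be K (Cexp w)))%C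
        with (Cexp (s * w) * (fab al be (Cexp w) - fpart al be K (Cexp w)))%C by ring.
      rewrite Cmod_mult, Ew. assert (RR := remainder_ray al be c K (exp (Re w)) Hs ltac:(lia) Lw).
      set (u := exp (Re w)) in *. assert (U : 0 < u) by apply exp_pos.
      assert (Y1 : 1 <= INR K * u).
      { apply Rle_trans with (INR K * k); [right; unfold k; field; lra|].
        apply Rmult_le_compat_l; lra. }
      assert (Sw : Cmod (Cexp (s * w)) <= A * (exp (- Re s * ln (INR K))
                     * (C1 * exp (c / 4 * (INR K * u))))).
      { eapply Rle_trans; [eapply Cexp_ray_bound; exact Hw|].
        replace (Re w) with (- ln (INR K) + ln (INR K * u)).
        2:{ rewrite ln_mult by lra. unfold u. rewrite ln_exp. ring. }
        replace (Re s * (- ln (INR K) + ln (INR K * u)) + 2 * PI * Rabs (Im s))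
          with (2 * PI * Rabs (Im s) + (- Re s * ln (INR K) + Re s * ln (INR K * u))) by ring.
        rewrite !exp_plus. apply Rmult_le_compat_l; [left; apply exp_pos|].
        apply Rmult_le_compat_l; [left; apply exp_pos|].
        eapply Rle_trans; [|now apply HC1]. apply exp_le. apply Rmult_le_compat_l; [lra|].
        apply Rle_abs. }
      eapply Rle_trans.
      { apply Rmult_le_compat; [apply Cmod_ge_0|apply Cmod_ge_0|exact Sw|exact RR]. }
      fold A0. rewrite <- Ky.
      replace (- (c / 4 * INR K) * u)
        with (c / 4 * (INR K * u) + - (c / 2) * (INR K * u)) by field.
      rewrite exp_plus. right. ring.
    + intros w Hw. assert (Z := Cexp_circ k w k0 Hw).
      replace (Cexp (s * w) * fab al be (Cexp w)
               + (-1) * (Cexp (s * w) * fpart al be K (Cexp w)))%C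
        with (Cexp (s * w) * (fab al be (Cexp w) - fpart al be K (Cexp w)))%C by ring.
      rewrite Cmod_mult.
      replace (A * (B + exp (Cmod al + Cmod be)) * y)
        with (exp (- Re s * ln (INR K)) * A * ((B + exp (Cmod al + Cmod be)) * INR K ^ 2))
        by (rewrite <- Ky; ring).
      apply Rmult_le_compat; try apply Cmod_ge_0.
      * eapply Rle_trans; [eapply Cexp_circ_bound; exact Hw|].
        rewrite lnk, exp_plus. unfold A.
        replace (Re s * - ln (INR K)) with (- Re s * ln (INR K)) by ring. lra.
      * eapply Rle_trans; [apply Cmod_triangle_minus|]. rewrite Rmult_plus_distr_r.
        apply Rplus_le_compat.
        -- eapply Rle_trans; [apply HB; [apply Cexp_neq_0|lra]|]. rewrite Z. unfold k.
           right. field. lra.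
        -- rewrite (Rmult_comm (exp (Cmod al + Cmod be))). apply fpart_circle; [lia|exact Z].
  - unfold Tot. rewrite Rmult_plus_distr_r. apply Rplus_le_compat; [|right; ring].
    replace (A * C1 * A0 * y / k / (c / 4 * INR K)) with (A * C1 * A0 * y * (4 / c)).
    2:{ unfold k. field. split; lra. }
    assert (E1 : exp (- (c / 4 * INR K) * k) <= 1).
    { apply exp_le_1. assert (0 <= c / 4 * INR K * k); [|lra].
      apply Rmult_le_pos; [|lra]. apply Rmult_le_pos; lra. }
    assert (C4 : 0 <= 4 / c) by (apply Rdiv_le_0_compat; lra).
    assert (Q : 0 <= A * C1 * A0 * y * (4 / c)) by (now apply Rmult_le_pos).
    assert (A * C1 * A0 * y * (4 / c) * exp (- (c / 4 * INR K) * k)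
      <= A * C1 * A0 * y * (4 / c) * 1) by (apply Rmult_le_compat_l; auto).
    lra.
Qed.

(** ** The lattice sum over squares *)

Lemma sum_n_zsum (f : Z -> C) K :
  sum_n (fun i => f (Z.of_nat i - Z.of_nat K)%Z) (2 * K) = zsum K f.
Proof.
  assert (Sh : forall (a : nat -> C) n, sum_n a (S n) = (a O + sum_n (fun k => a (S k)) n)%C).
  { intros a n. induction n as [|n IH].
    - rewrite sum_Sn, !sum_O. reflexivity.
    - rewrite sum_Sn, IH, (sum_Sn (fun k => a (S k))). unfold plus; simpl.
      change (a O + sum_n (fun k => a (S k)) n + a (S (S n))
        = a O + (sum_n (fun k => a (S k)) n + a (S (S n))))%C. ring. }
  induction K as [|K IH].
  - simpl. rewrite sum_O. reflexivity.
  - replace (2 * S K)%nat with (S (S (2 * K))) by lia.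
    rewrite Sh, sum_Sn. cbn [zsum]. rewrite <- IH.
    rewrite (sum_n_ext _ (fun i => f (Z.of_nat i - Z.of_nat K)%Z))
      by (intro i; f_equal; lia).
    replace (Z.of_nat (S (S (2 * K))) - Z.of_nat (S K))%Z with (Z.of_nat (S K)) by lia.
    replace (Z.of_nat 0 - Z.of_nat (S K))%Z with (- Z.of_nat (S K))%Z by lia.
    set (a := sum_n _ _).
    change (f (- Z.of_nat (S K))%Z + (a + f (Z.of_nat (S K)))
      = a + (f (Z.of_nat (S K)) + f (- Z.of_nat (S K))%Z))%C. ring.
Qed.

Lemma zsum_plus m f g : zsum m (fun n => f n + g n)%C = (zsum m f + zsum m g)%C.
Proof. induction m as [|m IH]; [reflexivity|]. cbn [zsum]. rewrite IH. ring. Qed.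

Lemma zsum_opp m f : zsum m (fun n => f (- n)%Z) = zsum m f.
Proof.
  induction m as [|m IH]; [reflexivity|]. cbn [zsum]. rewrite IH.
  rewrite Z.opp_involutive. ring.
Qed.

Lemma hsum_opp m f : hsum m (fun n => f (- n)%Z) = hsum m f.
Proof.
  destruct m as [|m]; [reflexivity|]. unfold hsum. rewrite zsum_opp, Z.opp_involutive.
  unfold Cdiv. ring.
Qed.

Lemma square_sum_zsum tau s K :
  square_sum tau s K = zsum K (fun m => zsum K (lattice_term tau s m)).
Proof.
  unfold square_sum. rewrite <- (sum_n_zsum (fun m => zsum K (lattice_term tau s m)) K).
  apply sum_n_ext. intro i. apply (sum_n_zsum (lattice_term tau s (Z.of_nat i - Z.of_nat K))).
Qed.

(* Adding one shell of the square: each corner is shared by two sides. *)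
Lemma square_shell (t : Z -> Z -> C) K (right_ left_ up down : Z -> C) :
  let M := Z.of_nat (S K) in
  (forall n, (Z.abs n <= Z.of_nat K)%Z ->
     t M n = right_ n /\ t (- M)%Z n = left_ n /\ t n M = up n /\ t n (- M)%Z = down n) ->
  t M M = ((right_ M + up M) / 2)%C ->
  t M (- M)%Z = ((right_ (- M)%Z + down M) / 2)%C ->
  t (- M)%Z M = ((left_ M + up (- M)%Z) / 2)%C ->
  t (- M)%Z (- M)%Z = ((left_ (- M)%Z + down (- M)%Z) / 2)%C ->
  zsum (S K) (fun m => zsum (S K) (t m))
  = (zsum K (fun m => zsum K (t m)) + (hsum (S K) right_ + hsum (S K) left_)
     + (hsum (S K) up + hsum (S K) down))%C.
Proof.
  intros M HI C1 C2 C3 C4. cbn [zsum hsum]. fold M.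
  rewrite (zsum_plus K), (zsum_plus K). rewrite C1, C2, C3, C4.
  rewrite (zsum_ext K (t M) right_) by (intros; apply HI; auto).
  rewrite (zsum_ext K (t (- M)%Z) left_) by (intros; apply HI; auto).
  rewrite (zsum_ext K (fun n => t n M) up) by (intros; apply HI; auto).
  rewrite (zsum_ext K (fun n => t n (- M)%Z) down) by (intros; apply HI; auto).
  field.
Qed.

(** ** Arguments of lattice points *)

Lemma Arg_Cexp v : - PI < Im v <= PI -> Arg (Cexp v) = Im v.
Proof.
  intros Hv. unfold Arg.
  assert (E := exp_pos (Re v)).
  assert (R : Re (Cexp v) / Cmod (Cexp v) = cos (Im v)).
  { rewrite Cmod_Cexp. unfold Cexp. simpl. field. lra. }
  assert (I : Im (Cexp v) = exp (Re v) * sin (Im v)).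
  { unfold Cexp. simpl. ring. }
  (* The end value Im v = PI has sine 0 and falls into the first branch, in accordance with the
     range of [Arg]. *)
  rewrite R, I. destruct (Rle_dec 0 (exp (Re v) * sin (Im v))) as [L|L].
  - apply acos_cos. split; [|lra].
    destruct (Rle_dec 0 (Im v)) as [H|H]; auto. exfalso.
    assert (sin (Im v) < 0) by (apply sin_lt_0_var; lra). nra.
  - rewrite <- cos_neg, acos_cos; [ring|].
    destruct (Rle_dec 0 (Im v)) as [H|H]; [|lra]. exfalso. apply L.
    apply Rmult_le_pos; [lra|]. apply sin_ge_0; lra.
Qed.

Lemma Cexp_2PI_shift v : Cexp (v - Ci * RtoC (2 * PI)) = Cexp v.
Proof. rewrite Cexp_minus, Cexp_2PI. field. Qed.

(** The upper end theta + 2 PI is included: a principal argument equal to theta fails the strict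
    test in [arg_from] and is shifted by 2 PI. *)
Lemma arg_from_Cexp theta v :
  - PI < theta <= 0 -> theta < Im v <= theta + 2 * PI -> arg_from theta (Cexp v) = Im v.
Proof.
  intros Ht Hv. unfold arg_from.
  destruct (Rle_dec (Im v) PI) as [H|H].
  - rewrite Arg_Cexp by lra. destruct (Rlt_dec theta (Im v)); lra.
  - rewrite <- Cexp_2PI_shift.
    assert (E : Im (v - Ci * RtoC (2 * PI)) = Im v - 2 * PI) by (unfold Im; simpl; ring).
    rewrite Arg_Cexp; rewrite E; [|lra].
    destruct (Rlt_dec theta (Im v - 2 * PI)); lra.
Qed.

Lemma inv_polar_pow v s : (/ polar_pow (Cmod (Cexp v)) (Im v) s)%C = Cexp (- (s * v)).
Proof.
  unfold polar_pow. rewrite <- Cexp_opp, Cmod_Cexp, ln_exp. do 2 f_equal.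
  destruct v as [a b]. simpl. f_equal. apply injective_projections; simpl; ring.
Qed.

Section Lattice.
Context (tau s : C).
Context (Hlo : - (1 / 2) < Re tau) (Hhi : Re tau <= 1 / 2) (Him : 0 < Im tau).

(** The argument of 1 + tau, hence the direction opposite to the cut. *)
Definition phi1 : R := atan (Im tau / (1 + Re tau)).

Lemma phi1_bounds : 0 < phi1 < PI / 2.
Proof.
  unfold phi1. split.
  - rewrite <- atan_0. apply atan_increasing. apply Rdiv_lt_0_compat; lra.
  - apply atan_bound.
Qed.

(** Here the bounds on Re tau enter: they give 1 + Re tau > 1 / 2 and 1 - Re tau >= 1 / 2. *)
Lemma sector_right : sector 1 tau (1 / 2).
Proof. unfold sector, Re in *. simpl. lra. Qed.

Lemma sector_up : sector (- (Ci * tau)) (- Ci) (Im tau).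
Proof. unfold sector, Re, Im in *. simpl. lra. Qed.

Definition point (m n : Z) : C := (RtoC (IZR m) + RtoC (IZR n) * tau)%C.

Lemma lat_right m n : lat 1 tau m n = point m n.
Proof. unfold lat, point. ring. Qed.

(** The upper sector is turned by a quarter into the right half-plane, where principal powers are
    available. This is why the second term of [F] has generators -i tau and -i, and why m and n
    exchange roles. *)
Lemma lat_up m n : (Ci * lat (- (Ci * tau)) (- Ci) m n)%C = point n m.
Proof.
  unfold lat, point. replace (Ci * (IZR m * - (Ci * tau) + IZR n * - Ci))%C
    with (- (Ci * Ci) * (IZR n + IZR m * tau))%C by ring.
  replace (Ci * Ci)%C with (RtoC (-1)) by (apply injective_projections; simpl; ring).
  rewrite <- RtoC_opp. replace (- -1) with 1 by ring. ring.
Qed.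

Lemma Im_plog_right m n :
  Im (plog (lat 1 tau m n)) = atan (IZR n * Im tau / (IZR m + IZR n * Re tau)).
Proof.
  rewrite lat_right. unfold plog. simpl. f_equal. unfold point, Re, Im. simpl. apply f_equal2; ring.
Qed.

Lemma Im_plog_up m n :
  Im (plog (lat (- (Ci * tau)) (- Ci) m n))
  = atan (- (IZR n + IZR m * Re tau) / (IZR m * Im tau)).
Proof.
  unfold plog. simpl. f_equal. unfold lat, Re, Im. simpl. apply f_equal2; ring.
Qed.

Lemma cut_angle_phi1 : cut_angle tau = phi1 - PI.
Proof.
  assert (B := phi1_bounds). unfold cut_angle.
  assert (E : (- 1 - tau)%C = Cexp (plog (lat 1 tau 1 1) - Ci * RtoC PI)).
  { rewrite Cexp_minus, Cexp_PI, Cexp_plog.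
    - rewrite lat_right. unfold point. field.
    - apply (Re_lat_pos 1 tau (1 / 2)); [apply sector_right|lia|lia]. }
  assert (I : Im (plog (lat 1 tau 1 1) - Ci * RtoC PI) = phi1 - PI).
  { replace (Im (plog (lat 1 tau 1 1) - Ci * RtoC PI)) with (Im (plog (lat 1 tau 1 1)) - PI)
      by (unfold Im; simpl; ring).
    rewrite Im_plog_right. unfold phi1. do 2 f_equal. apply f_equal2; ring. }
  rewrite E, Arg_Cexp; rewrite I; [reflexivity|lra].
Qed.

(** It reduces the four sides of the square to one task: exhibit a logarithm of the lattice point
    whose imaginary part lies in the window above the cut. *)
Lemma lattice_term_Cexp m n v :
  (m <> 0 \/ n <> 0)%Z -> ~ (m = n /\ (m < 0)%Z) -> point m n = Cexp v ->
  cut_angle tau < Im v <= cut_angle tau + 2 * PI ->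
  lattice_term tau s m n = Cexp (- (s * v)).
Proof.
  intros H0 H1 E Hv. unfold lattice_term. cbv zeta. fold (point m n).
  assert (B := phi1_bounds). assert (T := cut_angle_phi1).
  destruct ((m =? 0)%Z && (n =? 0)%Z)%bool eqn:E1.
  { apply Bool.andb_true_iff in E1. rewrite !Z.eqb_eq in E1. lia. }
  destruct ((m =? n)%Z && (m <? 0)%Z)%bool eqn:E2.
  { apply Bool.andb_true_iff in E2. rewrite Z.eqb_eq, Z.ltb_lt in E2. lia. }
  unfold Cpow_from. rewrite E, arg_from_Cexp by (auto; lra). apply inv_polar_pow.
Qed.

Lemma term_right m n :
  (1 <= m)%Z -> (Z.abs n <= m)%Z -> lattice_term tau s m n = lpow 1 tau s m n.
Proof.
  intros Hm Hn. unfold lpow. assert (B := phi1_bounds). assert (T := cut_angle_phi1).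
  apply lattice_term_Cexp; [lia|lia| |].
  - rewrite Cexp_plog; [now rewrite lat_right|].
    apply (Re_lat_pos 1 tau (1 / 2)); auto. apply sector_right.
  - rewrite Im_plog_right. set (x := IZR n * Im tau / _).
    assert (A := atan_bound x). lra.
Qed.

Lemma Cexp_PI2 : Cexp (Ci * RtoC (PI / 2)) = Ci.
Proof. rewrite Cexp_Ci, cos_PI2, sin_PI2. reflexivity. Qed.

Lemma term_up m n :
  (1 <= m)%Z -> (Z.abs n <= m)%Z ->
  lattice_term tau s n m = (Cexp (- (Ci * RtoC (PI / 2) * s)) * lpow (- (Ci * tau)) (- Ci) s m n)%C.
Proof.
  intros Hm Hn. unfold lpow. assert (B := phi1_bounds). assert (T := cut_angle_phi1).
  rewrite <- Cexp_plus.
  set (l := plog (lat (- (Ci * tau)) (- Ci) m n)).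
  replace (- (Ci * (PI / 2)%R * s) + - (s * l))%C with (- (s * (Ci * RtoC (PI / 2) + l)))%C by ring.
  apply lattice_term_Cexp; [lia|lia| |].
  - rewrite Cexp_plus, Cexp_PI2. unfold l. rewrite Cexp_plog; [now rewrite lat_up|].
    apply (Re_lat_pos _ _ (Im tau)); auto. apply sector_up.
  - replace (Im (Ci * RtoC (PI / 2) + l)) with (PI / 2 + Im l) by (unfold Im; simpl; ring).
    unfold l. rewrite Im_plog_up. set (x := - _ / _).
    assert (A := atan_bound x). lra.
Qed.

Lemma term_left m n :
  (1 <= m)%Z -> (Z.abs n <= m)%Z -> n <> (- m)%Z ->
  lattice_term tau s (- m) n = (Cexp (- (Ci * RtoC PI * s)) * lpow 1 tau s m (- n))%C.
Proof.
  intros Hm Hn Hc. unfold lpow. assert (B := phi1_bounds). assert (T := cut_angle_phi1).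
  rewrite <- Cexp_plus.
  assert (Rp : 0 < Re (lat 1 tau m (- n))).
  { apply (Re_lat_pos 1 tau (1 / 2)); [apply sector_right|lia|lia]. }
  set (l := plog (lat 1 tau m (- n))).
  replace (- (Ci * PI * s) + - (s * l))%C with (- (s * (Ci * RtoC PI + l)))%C by ring.
  apply lattice_term_Cexp; [lia|lia| |].
  - rewrite Cexp_plus, Cexp_PI. unfold l. rewrite Cexp_plog by auto.
    rewrite lat_right. unfold point. rewrite !opp_IZR, !RtoC_opp. ring.
  - replace (Im (Ci * RtoC PI + l)) with (PI + Im l) by (unfold Im; simpl; ring).
    assert (A : - (PI / 2) < Im l <= phi1); [|lra].
    unfold l. rewrite Im_plog_right.
    split; [set (x := IZR (- n) * _ / _); assert (A := atan_bound x); lra|].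
    unfold phi1.
    assert (D : 0 < IZR m + IZR (- n) * Re tau).
    { rewrite lat_right in Rp. unfold point, Re in *. simpl in Rp. simpl. lra. }
    (* Among the points m + n' tau with n' <= m the slope is largest at n' = m, where it is that of
       1 + tau. So a half turn does not pass beyond the upper lip of the cut. *)
    assert (Q : IZR (- n) * Im tau / (IZR m + IZR (- n) * Re tau) <= Im tau / (1 + Re tau)).
    { assert (Hnm : IZR (- n) <= IZR m) by (apply IZR_le; lia).
      apply Rmult_le_reg_r with (1 + Re tau); [lra|].
      replace (Im tau / (1 + Re tau) * (1 + Re tau)) with (Im tau) by (field; lra).
      apply Rmult_le_reg_r with (IZR m + IZR (- n) * Re tau); auto.
      replace (IZR (- n) * Im tau / (IZR m + IZR (- n) * Re tau) * (1 + Re tau) *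
        (IZR m + IZR (- n) * Re tau)) with (Im tau * (IZR (- n) * (1 + Re tau))) by (field; lra).
      apply Rmult_le_compat_l; lra. }
    destruct Q as [Q|Q]; [left; now apply atan_increasing|rewrite Q; lra].
Qed.

(** The direction of 1 + tau as seen from the turned sector; it allows arguments computed there to
    be compared with the cut. *)
Lemma phi1_complement : phi1 - PI / 2 = atan (- (1 + Re tau) / Im tau).
Proof.
  unfold phi1. replace (- (1 + Re tau) / Im tau) with (- / (Im tau / (1 + Re tau))) by (field; lra).
  rewrite atan_opp, atan_inv by (apply Rdiv_lt_0_compat; lra). ring.
Qed.

Lemma term_down m n :
  (1 <= m)%Z -> (Z.abs n <= m)%Z -> n <> (- m)%Z ->
  lattice_term tau s n (- m)
  = (Cexp (Ci * RtoC (PI / 2) * s) * lpow (- (Ci * tau)) (- Ci) s m (- n))%C.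
Proof.
  intros Hm Hn Hc. unfold lpow. assert (B := phi1_bounds). assert (T := cut_angle_phi1).
  rewrite <- Cexp_plus.
  set (l := plog (lat (- (Ci * tau)) (- Ci) m (- n))).
  replace (Ci * (PI / 2)%R * s + - (s * l))%C with (- (s * (l - Ci * RtoC (PI / 2))))%C by ring.
  apply lattice_term_Cexp; [lia|lia| |].
  - rewrite Cexp_minus, Cexp_PI2. unfold l. rewrite Cexp_plog.
    + assert (NI : Ci <> 0) by (apply Cmod_gt_0; rewrite Cmod_Ci; lra).
      assert (I2 : (Ci * Ci)%C = RtoC (-1)) by (apply injective_projections; simpl; ring).
      replace (lat (- (Ci * tau)) (- Ci) m (- n) / Ci)%C
        with (Ci * lat (- (Ci * tau)) (- Ci) m (- n) / (Ci * Ci))%C by (field; auto).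
      rewrite lat_up, I2. unfold point. rewrite !opp_IZR, !RtoC_opp. field.

    + apply (Re_lat_pos _ _ (Im tau)); [apply sector_up|lia|lia].
  - replace (Im (l - Ci * RtoC (PI / 2))) with (Im l - PI / 2) by (unfold Im; simpl; ring).
    assert (A : phi1 - PI / 2 < Im l < PI / 2); [|lra].
    unfold l. rewrite Im_plog_up. split; [|apply atan_bound].
    rewrite phi1_complement. apply atan_increasing.
    assert (M : 0 < IZR m) by (apply IZR_lt; lia).
    assert (Hnm : IZR (- n) < IZR m) by (apply IZR_lt; lia).
    apply Rmult_lt_reg_r with (IZR m * Im tau); [now apply Rmult_lt_0_compat|].
    replace (- (1 + Re tau) / Im tau * (IZR m * Im tau)) with (- (1 + Re tau) * IZR m)
      by (field; lra).
    replace (- (IZR (- n) + IZR m * Re tau) / (IZR m * Im tau) * (IZR m * Im tau))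
      with (- (IZR (- n) + IZR m * Re tau)) by (field; lra). lra.
Qed.

(** The left and the lower sector meet along the cut. The determination of the left one is theta + 2
    PI and that of the lower one is theta, so their two half weights produce precisely the
    prescribed average. *)
Lemma term_cut m :
  (1 <= m)%Z ->
  lattice_term tau s (- m) (- m)
  = ((Cexp (- (Ci * RtoC PI * s)) * lpow 1 tau s m m
      + Cexp (Ci * RtoC (PI / 2) * s) * lpow (- (Ci * tau)) (- Ci) s m m) / 2)%C.
Proof.
  intro Hm. assert (B := phi1_bounds). assert (T := cut_angle_phi1).
  assert (M : 0 < IZR m) by (apply IZR_lt; lia).
  unfold lattice_term. cbv zeta. fold (point (- m) (- m)).
  destruct ((- m =? 0)%Z && (- m =? 0)%Z)%bool eqn:E1.
  { apply Bool.andb_true_iff in E1. rewrite !Z.eqb_eq in E1. lia. }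
  destruct ((- m =? - m)%Z && (- m <? 0)%Z)%bool eqn:E2.
  2:{ apply Bool.andb_false_iff in E2. rewrite Z.eqb_neq, Z.ltb_ge in E2. lia. }
  f_equal. rewrite Cplus_comm. unfold lpow. rewrite <- !Cexp_plus.
  assert (A1 : Im (plog (lat 1 tau m m)) = phi1).
  { rewrite Im_plog_right. unfold phi1. f_equal. field. split; [lra|].
    replace (IZR m + IZR m * Re tau) with (IZR m * (1 + Re tau)) by ring.
    apply Rgt_not_eq, Rmult_lt_0_compat; lra. }
  assert (A2 : Im (plog (lat (- (Ci * tau)) (- Ci) m m)) = phi1 - PI / 2).
  { rewrite Im_plog_up, phi1_complement. f_equal. field. lra. }
  assert (P1 : Cexp (plog (lat 1 tau m m)) = point m m).
  { rewrite Cexp_plog, lat_right; auto.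
    apply (Re_lat_pos 1 tau (1 / 2)); [apply sector_right|lia|lia]. }
  assert (P2 : Cexp (plog (lat (- (Ci * tau)) (- Ci) m m)) = lat (- (Ci * tau)) (- Ci) m m).
  { rewrite Cexp_plog; auto.
    apply (Re_lat_pos _ _ (Im tau)); [apply sector_up|lia|lia]. }
  assert (W : Cmod (point (- m) (- m)) = Cmod (point m m)).
  { rewrite <- (Cmod_opp (point m m)). f_equal. unfold point. rewrite !opp_IZR, !RtoC_opp. ring. }
  f_equal.
  - set (l := plog (lat 1 tau m m)) in *.
    replace (- (Ci * PI * s) + - (s * l))%C with (- (s * (Ci * RtoC PI + l)))%C by ring.
    rewrite <- inv_polar_pow.
    replace (Im (Ci * RtoC PI + l)) with (PI + Im l) by (unfold Im; simpl; ring).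
    rewrite A1, T, W. f_equal. f_equal; [|ring].
    rewrite <- P1, !Cmod_Cexp. f_equal. unfold Re; simpl; ring.
  - set (l := plog (lat (- (Ci * tau)) (- Ci) m m)) in *.
    replace (Ci * (PI / 2)%R * s + - (s * l))%C with (- (s * (l - Ci * RtoC (PI / 2))))%C by ring.
    rewrite <- inv_polar_pow.
    replace (Im (l - Ci * RtoC (PI / 2))) with (Im l - PI / 2) by (unfold Im; simpl; ring).
    rewrite A2, T, W. f_equal. f_equal; [|lra].
    rewrite <- lat_up, <- P2, Cmod_mult, Cmod_Ci, !Cmod_Cexp, Rmult_1_l. f_equal.
    unfold Re; simpl; ring.
Qed.

Lemma Ccos_Cexp :
  (2 * Ccos (RtoC PI / 2 * s))%C
  = (Cexp (Ci * RtoC (PI / 2) * s) + Cexp (- (Ci * RtoC (PI / 2) * s)))%C.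
Proof.
  unfold Ccos.
  replace (Ci * (RtoC PI / 2 * s))%C with (Ci * RtoC (PI / 2) * s)%C.
  - field.
  - rewrite RtoC_div by lra. field.
Qed.

(** With e = exp(i PI s / 2) and e' its inverse, the right and left sectors carry 1 and e'^2, the
    upper and lower ones e' and e. Since 1 = e e', the factor e + e' = 2 cos(PI s / 2) splits off
    both pairs. *)
Lemma square_sum_sectors K :
  square_sum tau s K
  = (2 * Ccos (RtoC PI / 2 * s)
     * (Cexp (- (Ci * RtoC (PI / 2) * s)) * ssum K (lpow 1 tau s)
        + ssum K (lpow (- (Ci * tau)) (- Ci) s)))%C.
Proof.
  rewrite square_sum_zsum, Ccos_Cexp.
  set (e := Cexp (Ci * RtoC (PI / 2) * s)). set (e' := Cexp (- (Ci * RtoC (PI / 2) * s))).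
  assert (Ee : (e * e')%C = 1).
  { unfold e, e'. rewrite Cmult_comm. apply Cexp_opp_mult. }
  assert (Ep : Cexp (- (Ci * RtoC PI * s)) = (e' * e')%C).
  { unfold e'. rewrite <- Cexp_plus. f_equal.
    replace (RtoC PI) with (RtoC (PI / 2) + RtoC (PI / 2))%C by (rewrite <- RtoC_plus; f_equal; field).
    ring. }
  induction K as [|K IH].
  - cbn [zsum ssum]. unfold lattice_term. simpl. ring.
  - set (M := Z.of_nat (S K)). assert (HM : (1 <= M)%Z) by lia.
    set (Rr := lpow 1 tau s M). set (Uu := lpow (- (Ci * tau)) (- Ci) s M).
    assert (TR : forall n, (Z.abs n <= M)%Z -> Rr n = lattice_term tau s M n).
    { intros n Hn. symmetry. now apply term_right. }
    assert (TU : forall n, (Z.abs n <= M)%Z -> (e' * Uu n)%C = lattice_term tau s n M).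
    { intros n Hn. symmetry. now apply term_up. }
    assert (TL : forall n, (Z.abs n <= M)%Z -> n <> (- M)%Z ->
      (e' * e' * Rr (- n)%Z)%C = lattice_term tau s (- M) n).
    { intros n Hn Hc. rewrite <- Ep. symmetry. now apply term_left. }
    assert (TD : forall n, (Z.abs n <= M)%Z -> n <> (- M)%Z ->
      (e * Uu (- n)%Z)%C = lattice_term tau s n (- M)).
    { intros n Hn Hc. symmetry. now apply term_down. }
    rewrite (square_shell _ K Rr (fun n => e' * e' * Rr (- n)%Z)%C (fun n => e' * Uu n)%C
       (fun n => e * Uu (- n)%Z)%C).
    + rewrite IH. cbn [ssum]. fold M. fold Rr. fold Uu.
      rewrite (hsum_scal (S K) (e' * e') (fun n => Rr (- n)%Z)), (hsum_opp (S K) Rr).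
      rewrite (hsum_scal (S K) e (fun n => Uu (- n)%Z)), (hsum_opp (S K) Uu).
      rewrite (hsum_scal (S K) e' Uu).
      set (a := ssum K _). set (b := ssum K _). set (x := hsum _ Rr). set (y := hsum _ Uu).
      replace ((e + e') * (e' * (a + x) + (b + y)))%C
        with ((e + e') * (e' * a + b) + ((e * e') * x + e' * e' * x) + (e' * y + e * y))%C by ring.
      rewrite Ee. ring.
    + intros n Hn. fold M. rewrite TR, TL, TU, TD by lia. auto.
    + fold M. rewrite TR, TU by lia. field.
    + fold M. rewrite TR, TD by lia. field.
    + fold M. rewrite TL, TU by lia. field.
    + fold M. rewrite Z.opp_involutive, <- Ep. apply term_cut. lia.
Qed.

End Lattice.

(** ** Uniform continuity in [s] of the partial lattice sums *)

Lemma power_telescope eps m :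
  0 < eps -> (1 <= m)%nat ->
  exp (- (1 + eps) * ln (INR (S m)))
  <= / eps * (exp (- eps * ln (INR m)) - exp (- eps * ln (INR (S m)))).
Proof.
  intros He Hm. assert (M : 1 <= INR m) by (apply (le_INR 1); auto).
  rewrite S_INR. set (x := INR m) in *.
  set (u := exp (- eps * ln (x + 1))). assert (U : 0 < u) by apply exp_pos.
  assert (E1 : exp (- (1 + eps) * ln (x + 1)) = u * / (x + 1)).
  { unfold u. rewrite <- (exp_ln (x + 1)) at 3 by lra. rewrite <- exp_Ropp, <- exp_plus.
    f_equal. ring. }
  (* Together with exp y >= 1 + y this is the integral test for the sum of m^(-1 - eps), in
     telescoping form. *)
  assert (L : / (x + 1) <= ln (x + 1) - ln x).
  { assert (Q := exp_ineq1_le (ln x + - ln (x + 1))).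
    rewrite exp_plus, exp_Ropp, !exp_ln in Q by lra.
    replace (x * / (x + 1)) with (1 - / (x + 1)) in Q by (field; lra). lra. }
  assert (E2 : exp (- eps * ln x) = u * exp (eps * (ln (x + 1) - ln x))).
  { unfold u. rewrite <- exp_plus. f_equal. ring. }
  assert (Q := exp_ineq1_le (eps * (ln (x + 1) - ln x))).
  rewrite E1, E2.
  replace (/ eps * (u * exp (eps * (ln (x + 1) - ln x)) - u))
    with (u * (/ eps * (exp (eps * (ln (x + 1) - ln x)) - 1))) by ring.
  apply Rmult_le_compat_l; [lra|].
  apply Rle_trans with (/ eps * (eps * (ln (x + 1) - ln x))).
  - replace (/ eps * (eps * (ln (x + 1) - ln x))) with (ln (x + 1) - ln x) by (field; lra). auto.
  - apply Rmult_le_compat_l; [left; now apply Rinv_0_lt_compat|lra].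
Qed.

(** Column m has total weight 2 m, so summands of size m^(-2 - eps) give a column of size m^(-1 -
    eps). The bound is uniform in K. *)
Lemma ssum_bound f B eps K :
  0 < eps -> 0 <= B ->
  (forall m n, (1 <= m)%Z -> (Z.abs n <= m)%Z ->
     Cmod (f m n) <= B * exp (- (2 + eps) * ln (IZR m))) ->
  Cmod (ssum K f) <= 2 * B * (1 + / eps).
Proof.
  intros He HB H.
  assert (Ie : 0 < / eps) by now apply Rinv_0_lt_compat.
  assert (Hm : forall m, Cmod (hsum (S m) (f (Z.of_nat (S m))))
     <= 2 * B * exp (- (1 + eps) * ln (INR (S m)))).
  { intro m. assert (M : 0 < INR (S m)) by (apply lt_0_INR; lia).
    eapply Rle_trans.
    - apply (hsum_bound (S m) _ (B * exp (- (2 + eps) * ln (INR (S m))))).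
      intros n Hn. rewrite INR_IZR_INZ. apply H; lia.
    - right. replace (exp (- (1 + eps) * ln (INR (S m))))
        with (INR (S m) * exp (- (2 + eps) * ln (INR (S m)))).
      + ring.
      + rewrite <- (exp_ln (INR (S m))) at 1 by auto. rewrite <- exp_plus. f_equal. ring. }
  destruct K as [|K].
  - simpl. rewrite Cmod_0. apply Rmult_le_pos; lra.
  - assert (P : 0 <= / eps * exp (- eps * ln (INR (S K)))).
    { apply Rmult_le_pos; [lra|left; apply exp_pos]. }
    (* The negative telescoping term is kept in the statement so that the induction closes; it is
       dropped at the end. *)
    assert (G' : Cmod (ssum (S K) f) <= 2 * B * (1 + / eps - / eps * exp (- eps * ln (INR (S K))))).
    { clear P. induction K as [|K IH].
      - cbn [ssum]. replace (0 + hsum 1 (f (Z.of_nat 1)))%C with (hsum 1 (f (Z.of_nat 1))) by ring.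
        eapply Rle_trans; [apply Hm|]. simpl INR. rewrite ln_1, !Rmult_0_r, exp_0. right; ring.
      - change (ssum (S (S K)) f) with (ssum (S K) f + hsum (S (S K)) (f (Z.of_nat (S (S K)))))%C.
        eapply Rle_trans; [apply Cmod_triangle|].
        assert (T := power_telescope eps (S K) He ltac:(lia)).
        specialize (Hm (S K)).
        assert (2 * B * exp (- (1 + eps) * ln (INR (S (S K)))) <= 2 * B *
          (/ eps * (exp (- eps * ln (INR (S K))) - exp (- eps * ln (INR (S (S K))))))).
        { apply Rmult_le_compat_l; lra. }
        lra. }
    eapply Rle_trans; [exact G'|]. apply Rmult_le_compat_l; lra.
Qed.

Lemma ssum_minus K f g : (ssum K f - ssum K g)%C = ssum K (fun m n => f m n + (-1) * g m n)%C.
Proof.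
  assert (Hp : forall m f g, hsum m (fun n => f n + g n)%C = (hsum m f + hsum m g)%C).
  { intros m f0 g0. destruct m as [|m]; unfold hsum; [ring|].
    rewrite zsum_plus. unfold Cdiv. ring. }
  induction K as [|K IH]; [simpl; ring|]. cbn [ssum]. rewrite <- IH.
  rewrite (Hp (S K) (f (Z.of_nat (S K))) (fun n => -1 * g (Z.of_nat (S K)) n)%C), hsum_scal. ring.
Qed.

Lemma Im_plog_bound w : Rabs (Im (plog w)) <= PI.
Proof.
  assert (A := atan_bound (Im w / Re w)). assert (P := PI_RGT_0).
  change (Im (plog w)) with (atan (Im w / Re w)). apply Rabs_le. split; lra.
Qed.

(** In a sector |m al + n be| is comparable to m, so its logarithm is ln m up to a bounded error. *)
Lemma plog_lat al be c : sector al be c -> exists D, 0 <= D /\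
  forall m n, (1 <= m)%Z -> (Z.abs n <= m)%Z ->
    Rabs (Re (plog (lat al be m n)) - ln (IZR m)) <= D /\
    Cmod (plog (lat al be m n)) <= ln (IZR m) + D.
Proof.
  intro Hs. assert (Hc := proj1 Hs). assert (P := PI_RGT_0).
  set (W := Cmod al + Cmod be + 1).
  exists (Rabs (ln c) + Rabs (ln W) + PI). split.
  { generalize (Rabs_pos (ln c)) (Rabs_pos (ln W)). lra. }
  intros m n Hm Hn.
  assert (M : 1 <= IZR m) by (apply IZR_le; lia).
  set (w := lat al be m n).
  assert (L1 : c * IZR m <= Cmod w).
  { eapply Rle_trans; [now apply (Re_lat al be c m n)|].
    eapply Rle_trans; [apply Rle_abs|apply re_le_Cmod]. }
  assert (L2 : Cmod w <= W * IZR m).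
  { unfold w, lat. eapply Rle_trans; [apply Cmod_triangle|].
    rewrite !Cmod_mult, !Cmod_R, (Rabs_pos_eq (IZR m)) by lra.
    assert (Rabs (IZR n) <= IZR m) by (rewrite <- abs_IZR; now apply IZR_le).
    assert (Rabs (IZR n) * Cmod be <= IZR m * Cmod be)
      by (apply Rmult_le_compat_r; auto using Cmod_ge_0).
    unfold W. nra. }
  assert (CM : 0 < c * IZR m) by (apply Rmult_lt_0_compat; lra).
  assert (W1 : 0 < W) by (unfold W; generalize (Cmod_ge_0 al) (Cmod_ge_0 be); lra).
  assert (L3 : ln c + ln (IZR m) <= ln (Cmod w)).
  { rewrite <- ln_mult by lra. apply ln_le; auto. }
  assert (L4 : ln (Cmod w) <= ln W + ln (IZR m)).
  { rewrite <- ln_mult by lra. apply ln_le; lra. }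
  assert (A1 := Rle_abs (ln W)). assert (A2 := Rle_abs (- ln c)). rewrite Rabs_Ropp in A2.
  assert (A3 := Rabs_pos (ln W)). assert (A4 := Rabs_pos (ln c)).
  assert (LM : 0 <= ln (IZR m)) by (rewrite <- ln_1; apply ln_le; lra).
  split.
  - simpl. apply Rabs_le. split; lra.
  - set (l := plog w).
    replace l with (RtoC (Re l) + Ci * RtoC (Im l))%C
      by (destruct l; apply injective_projections; simpl; ring).
    eapply Rle_trans; [apply Cmod_triangle|].
    rewrite Cmod_mult, Cmod_Ci, !Cmod_R, Rmult_1_l.
    assert (B1 := Im_plog_bound w). fold l in B1.
    assert (B2 : Rabs (Re l) <= ln (IZR m) + (Rabs (ln c) + Rabs (ln W)))
      by (change (Re l) with (ln (Cmod w)); apply Rabs_le; split; lra).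
    lra.
Qed.

Lemma lpow_bound al be c s : sector al be c -> 2 < Re s -> exists B, 0 <= B /\
  forall m n, (1 <= m)%Z -> (Z.abs n <= m)%Z ->
    Cmod (lpow al be s m n) <= B * exp (- Re s * ln (IZR m)).
Proof.
  intros Hs Hre. destruct (plog_lat al be c Hs) as [D [HD H]].
  exists (exp (Re s * D + PI * Rabs (Im s))). split; [left; apply exp_pos|].
  intros m n Hm Hn. destruct (H m n Hm Hn) as [H1 _].
  unfold lpow. rewrite Cmod_Cexp, <- exp_plus. apply exp_le.
  set (l := plog _) in *.
  replace (Re (- (s * l))) with (- (Re s * Re l) + Im s * Im l) by (unfold Re, Im; simpl; ring).
  apply Rabs_le_between in H1.
  assert (Re s * (ln (IZR m) - D) <= Re s * Re l) by (apply Rmult_le_compat_l; lra).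
  assert (Im s * Im l <= PI * Rabs (Im s)).
  { eapply Rle_trans; [apply Rle_abs|]. rewrite Rabs_mult, Rmult_comm.
    apply Rmult_le_compat_r; [apply Rabs_pos|]. apply Im_plog_bound. }
  lra.
Qed.

(** Changing s by h multiplies a term by exp(-h log om), which differs from 1 by at most |h| |log
    om| exp(|h log om|). This is |h| times a small power of m and still leaves a convergent sum. *)
Lemma ssum_lpow_lipschitz al be c s : sector al be c -> 2 < Re s ->
  exists B d, 0 < d /\ 0 <= B /\ forall K,
    Cmod (ssum K (lpow al be s)) <= B /\
    forall h, Cmod h < d ->
      Cmod (ssum K (lpow al be (s + h)) - ssum K (lpow al be s)) <= B * Cmod h.
Proof.
  intros Hs Hre. destruct (lpow_bound al be c s Hs Hre) as [B1 [HB1 H1]].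
  destruct (plog_lat al be c Hs) as [D [HD H2]].
  set (e := Re s - 2). assert (He : 0 < e) by (unfold e; lra).
  (* The factor |log om| and the factor exp(|h log om|) each cost a power m^d; together they use
     half of the excess e = Re s - 2. *)
  set (d := e / 4). set (B2 := B1 * (/ d * exp (2 * d * D))).
  assert (Hd : 0 < d) by (unfold d; lra).
  assert (Id : 0 < / d) by now apply Rinv_0_lt_compat.
  assert (HB2 : 0 <= B2).
  { unfold B2. apply Rmult_le_pos; auto. apply Rmult_le_pos; [lra|left; apply exp_pos]. }
  set (T1 := 2 * B1 * (1 + / e)). set (T2 := 2 * B2 * (1 + / (e / 2))).
  assert (Ie : 0 < / e) by now apply Rinv_0_lt_compat.
  assert (Ie2 : 0 < / (e / 2)) by (apply Rinv_0_lt_compat; lra).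
  assert (HT1 : 0 <= T1) by (unfold T1; apply Rmult_le_pos; lra).
  assert (HT2 : 0 <= T2) by (unfold T2; apply Rmult_le_pos; lra).
  exists (T1 + T2), d. split; [auto|split; [lra|]]. intro K. split.
  - apply Rle_trans with T1; [|lra]. apply ssum_bound; auto.
    intros m n Hm Hn. replace (2 + e) with (Re s) by (unfold e; ring). auto.
  - intros h Hh. rewrite ssum_minus.
    apply Rle_trans with (T2 * Cmod h).
    2:{ apply Rmult_le_compat_r; [apply Cmod_ge_0|lra]. }
    replace (T2 * Cmod h) with (2 * (B2 * Cmod h) * (1 + / (e / 2))) by (unfold T2; ring).
    apply ssum_bound; [lra|apply Rmult_le_pos; auto using Cmod_ge_0|].
    intros m n Hm Hn. destruct (H2 m n Hm Hn) as [_ L].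
    assert (M : 1 <= IZR m) by (apply IZR_le; lia).
    unfold lpow at 1.
    replace (Cexp (- ((s + h) * plog (lat al be m n))))
      with (lpow al be s m n * Cexp (- (h * plog (lat al be m n))))%C.
    2:{ unfold lpow. rewrite <- Cexp_plus. f_equal. ring. }
    set (l := plog (lat al be m n)) in *.
    replace (lpow al be s m n * Cexp (- (h * l)) + -1 * lpow al be s m n)%C
      with (lpow al be s m n * (Cexp (- (h * l)) - 1))%C by ring.
    rewrite Cmod_mult.
    assert (X : Cmod (Cexp (- (h * l)) - 1) <= Cmod h * (/ d * exp (2 * d * (ln (IZR m) + D)))).
    { eapply Rle_trans; [apply Cexp_m1_le|]. rewrite Cmod_opp, Cmod_mult, Rmult_assoc.
      apply Rmult_le_compat_l; [apply Cmod_ge_0|].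
      set (y := Cmod l) in *. assert (Y : 0 <= y) by apply Cmod_ge_0.
      apply Rle_trans with (/ d * exp (d * y) * exp (d * y)).
      - apply Rmult_le_compat; auto; [left; apply exp_pos| |].
        + apply Rmult_le_reg_l with d; auto. rewrite <- Rmult_assoc, Rinv_r, Rmult_1_l by lra.
          generalize (exp_ineq1_le (d * y)). lra.
        + apply exp_le. apply Rmult_le_compat_r; lra.
      - rewrite Rmult_assoc, <- exp_plus. apply Rmult_le_compat_l; [lra|].
        apply exp_le. replace (d * y + d * y) with (2 * d * y) by ring.
        apply Rmult_le_compat_l; lra. }
    eapply Rle_trans.
    { apply Rmult_le_compat; [apply Cmod_ge_0|apply Cmod_ge_0|now apply H1|exact X]. }
    right. unfold B2.
    replace (- (2 + e / 2) * ln (IZR m)) with (- Re s * ln (IZR m) + 2 * d * ln (IZR m))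
      by (unfold d, e; field).
    rewrite Rmult_plus_distr_l, !exp_plus. ring.
Qed.

(** Equicontinuity at s, with boundedness of the values at s added so that the notion is stable
    under products. *)
Definition ucont (F : nat -> C -> C) (s : C) : Prop :=
  (exists B, forall K, Cmod (F K s) <= B) /\
  forall eps, 0 < eps -> exists d, 0 < d /\ forall K s', Cmod (s' - s) < d ->
    Cmod (F K s' - F K s) < eps.

Lemma ucont_const f s : cont_at cid f s -> ucont (fun _ => f) s.
Proof.
  intro H. split; [now exists (Cmod (f s))|]. intros e He.
  destruct (H e He) as [d [D Hd]]. exists d; split; auto.
Qed.

Lemma ucont_plus F G s : ucont F s -> ucont G s -> ucont (fun K s => F K s + G K s)%C s.
Proof.
  intros [[B1 H1] F1] [[B2 H2] G1]. split.
  - exists (B1 + B2). intro K. eapply Rle_trans; [apply Cmod_triangle|].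
    generalize (H1 K) (H2 K). lra.
  - intros e He. destruct (F1 (e / 2)) as [d1 [D1 K1]]; [lra|].
    destruct (G1 (e / 2)) as [d2 [D2 K2]]; [lra|].
    exists (Rmin d1 d2); split; [now apply Rmin_pos|]. intros K s' Hs'.
    assert (A := K1 K s' (Rlt_le_trans _ _ _ Hs' (Rmin_l _ _))).
    assert (B := K2 K s' (Rlt_le_trans _ _ _ Hs' (Rmin_r _ _))).
    replace (F K s' + G K s' - (F K s + G K s))%C
      with ((F K s' - F K s) + (G K s' - G K s))%C by ring.
    eapply Rle_lt_trans; [apply Cmod_triangle|]. lra.
Qed.

Lemma ucont_mult F G s : ucont F s -> ucont G s -> ucont (fun K s => F K s * G K s)%C s.
Proof.
  intros [[B1 H1] F1] [[B2 H2] G1].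
  assert (P1 : 0 <= B1) by (eapply Rle_trans; [apply Cmod_ge_0|apply (H1 O)]).
  assert (P2 : 0 <= B2) by (eapply Rle_trans; [apply Cmod_ge_0|apply (H2 O)]).
  split.
  - exists (B1 * B2). intro K. rewrite Cmod_mult.
    apply Rmult_le_compat; auto using Cmod_ge_0.
  - intros e He.
    destruct (F1 (Rmin 1 (e / (2 * (B2 + 1))))) as [d1 [D1 K1]].
    { apply Rmin_pos; [lra|]. apply Rdiv_lt_0_compat; lra. }
    destruct (G1 (e / (2 * (B1 + 1)))) as [d2 [D2 K2]]; [apply Rdiv_lt_0_compat; lra|].
    exists (Rmin d1 d2); split; [now apply Rmin_pos|]. intros K s' Hs'.
    assert (A := K1 K s' (Rlt_le_trans _ _ _ Hs' (Rmin_l _ _))).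
    assert (B := K2 K s' (Rlt_le_trans _ _ _ Hs' (Rmin_r _ _))).
    assert (A1 := Rlt_le_trans _ _ _ A (Rmin_l _ _)).
    assert (A2 := Rlt_le_trans _ _ _ A (Rmin_r _ _)).
    replace (F K s' * G K s' - F K s * G K s)%C
      with (F K s' * (G K s' - G K s) + (F K s' - F K s) * G K s)%C by ring.
    eapply Rle_lt_trans; [apply Cmod_triangle|]. rewrite !Cmod_mult.
    assert (FB : Cmod (F K s') <= B1 + 1).
    { replace (F K s') with ((F K s' - F K s) + F K s)%C by ring.
      eapply Rle_trans; [apply Cmod_triangle|]. generalize (H1 K). lra. }
    apply Rlt_le_trans with ((B1 + 1) * (e / (2 * (B1 + 1))) + e / (2 * (B2 + 1)) * (B2 + 1)).
    2:{ right. field. lra. }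
    apply Rplus_lt_le_compat.
    + apply Rle_lt_trans with ((B1 + 1) * Cmod (G K s' - G K s)).
      * apply Rmult_le_compat_r; [apply Cmod_ge_0|auto].
      * apply Rmult_lt_compat_l; lra.
    + specialize (H2 K). apply Rmult_le_compat; try apply Cmod_ge_0; lra.
Qed.

Lemma ucont_ssum al be c s :
  sector al be c -> 2 < Re s -> ucont (fun K s => ssum K (lpow al be s)) s.
Proof.
  intros Hs Hre. destruct (ssum_lpow_lipschitz al be c s Hs Hre) as [B [d [D [HB H]]]].
  split.
  - exists B. intro K. apply H.
  - intros e He. exists (Rmin d (e / (B + 1))). split.
    { apply Rmin_pos; auto. apply Rdiv_lt_0_compat; lra. }
    intros K s' Hs'.
    assert (K1 := Rlt_le_trans _ _ _ Hs' (Rmin_l _ _)).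
    assert (K2 := Rlt_le_trans _ _ _ Hs' (Rmin_r _ _)).
    replace s' with (s + (s' - s))%C by ring.
    eapply Rle_lt_trans; [now apply H|].
    apply Rle_lt_trans with ((B + 1) * Cmod (s' - s)).
    + apply Rmult_le_compat_r; [apply Cmod_ge_0|lra].
    + apply Rlt_le_trans with ((B + 1) * (e / (B + 1))).
      * apply Rmult_lt_compat_l; lra.
      * right; field; lra.
Qed.

Lemma holo_Ccos_s D : holo D (fun s => 2 * Ccos (RtoC PI / 2 * s))%C.
Proof.
  apply holo_ext with (fun s => Cexp (Ci * RtoC (PI / 2) * s) + Cexp (- (Ci * RtoC (PI / 2) * s)))%C.
  - intro s. symmetry. apply Ccos_Cexp.
  - apply holo_plus; apply holo_exp; [|apply holo_opp];
      (apply holo_mult; [apply holo_const|apply holo_id]).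
Qed.

Lemma ucont_square_sum tau s :
  - (1 / 2) < Re tau -> Re tau <= 1 / 2 -> 0 < Im tau -> 2 < Re s ->
  ucont (fun K s => square_sum tau s K) s.
Proof.
  intros H1 H2 H3 Hre.
  replace (fun K s => square_sum tau s K) with (fun K s =>
    2 * Ccos (RtoC PI / 2 * s)
     * (Cexp (- (Ci * RtoC (PI / 2) * s)) * ssum K (lpow 1 tau s)
        + ssum K (lpow (- (Ci * tau)) (- Ci) s)))%C.
  2:{ apply functional_extensionality; intro K. apply functional_extensionality; intro s'.
      symmetry. now apply square_sum_sectors. }
  apply (ucont_mult (fun _ s => 2 * Ccos (RtoC PI / 2 * s))%C).
  - apply ucont_const. apply (holo_cont (fun _ => True)); auto. apply holo_Ccos_s.
  - apply ucont_plus.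
    + apply (ucont_mult (fun _ s => Cexp (- (Ci * RtoC (PI / 2) * s)))).
      * apply ucont_const. apply (holo_cont (fun _ => True)); auto.
        apply holo_exp, holo_opp, holo_mult; [apply holo_const|apply holo_id].
      * apply (ucont_ssum 1 tau (1 / 2)); auto. now apply sector_right.
    + apply (ucont_ssum _ _ (Im tau)); auto. now apply sector_up.
Qed.

(** ** The contour integral as a Hankel integral *)

Lemma is_tail_RInt_gen_ext f g a l :
  (forall t, a <= t -> g t = f t) -> is_tail f a l ->
  is_RInt_gen (V := C_R_NormedModule) g (at_point a) (Rbar_locally p_infty) l.
Proof.
  intros E H. eapply is_RInt_gen_ext; [|apply is_tail_RInt_gen; exact H].
  apply Filter_prod with (fun x => x = a) (fun b => a < b); [easy|now exists a|].
  intros x b -> Hb t. simpl. rewrite Rmin_left by lra. intros; symmetry; apply E; lra.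
Qed.

Lemma Cpow_from_0_Cexp v s : 0 < Im v <= 2 * PI -> Cpow_from 0 (Cexp v) s = Cexp (s * v).
Proof.
  intro Hv. assert (P := PI_RGT_0). unfold Cpow_from.
  rewrite arg_from_Cexp by lra. unfold polar_pow. rewrite Cmod_Cexp, ln_exp.
  do 2 f_equal. destruct v as [a b]. apply injective_projections; simpl; ring.
Qed.

(** A convex domain containing the positive axis, both legs of the contour and the small pieces of
    the circle between them; for suitable h it avoids the zeros of the denominators. *)
Definition half_strip (h : R) (z : C) : Prop := 0 < Re z /\ Rabs (Im z) < h.

Lemma half_strip_opened h : opened (half_strip h).
Proof.
  intros z [H1 H2]. destruct (right_half_opened z H1) as [r1 [R1 K1]].
  assert (Hz : horizontal (- h) h z) by (unfold horizontal; apply Rabs_lt_between in H2; lra).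
  destruct (horizontal_opened (- h) h z Hz) as [r2 [R2 K2]].
  exists (Rmin r1 r2); split; [now apply Rmin_pos|]. intros w Hw. split.
  - apply K1. apply Rlt_le_trans with (1 := Hw), Rmin_l.
  - assert (Q : horizontal (- h) h w) by (apply K2; apply Rlt_le_trans with (1 := Hw), Rmin_r).
    unfold horizontal in Q. apply Rabs_def1; lra.
Qed.

Lemma half_strip_convex h : convex (half_strip h).
Proof.
  intros z w t [H1 H2] [H3 H4] Ht. split.
  - replace (Re (z + t * (w - z))) with (Re z + t * (Re w - Re z)) by (unfold Re; simpl; ring).
    assert (Q := segment_between (Re z) (Re w) t Ht 0 (Rmax (Re z) (Re w) + 1)).
    generalize (Rmax_l (Re z) (Re w)) (Rmax_r (Re z) (Re w)). intros. lra.
  - apply Rabs_lt_between in H2. apply Rabs_lt_between in H4.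
    assert (Q : horizontal (- h) h (z + t * (w - z))) by (apply horizontal_convex; auto).
    unfold horizontal in Q. apply Rabs_def1; lra.
Qed.

(** The principal z^(s - 1). It agrees with the power cut along the positive axis just above that
    axis, and differs from it just below by the monodromy factor exp(2 i PI s). *)
Definition ppow (s z : C) : C := Cexp ((s - 1) * plog z).

Lemma ppow_growth s y eps :
  0 <= y -> 0 < eps -> exists M, 0 <= M /\ forall x t, 1 <= x -> Rabs t <= y ->
    Cmod (ppow s (RtoC x + Ci * RtoC t)) <= M * exp (eps * x).
Proof.
  intros Hy He.
  destruct (exp_ln_subexp (Cmod (s - 1)) eps 1 (Cmod_ge_0 _) He Rlt_0_1) as [M HM].
  assert (M0 : 0 <= M).
  { assert (Q := Rle_trans _ _ _ (Rlt_le _ _ (exp_pos _)) (HM 1 (Rle_refl _))).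
    assert (PP := exp_pos (eps * 1)). nra. }
  exists (M * exp (eps * y) * exp (Cmod (s - 1) * PI)). split.
  { apply Rmult_le_pos; [apply Rmult_le_pos; auto|]; left; apply exp_pos. }
  intros x t Hx Ht. unfold ppow. eapply Rle_trans; [apply Cexp_mult_le|].
  set (z := (RtoC x + Ci * RtoC t)%C). set (N := Cmod (s - 1)) in *.
  assert (HN : 0 <= N) by apply Cmod_ge_0.
  assert (Z1 : 1 <= Cmod z).
  { apply Rle_trans with (1 := Hx). apply Rle_trans with (2 := re_le_Cmod z).
    replace (Re z) with x by (unfold z, Re; simpl; ring). apply Rle_abs. }
  assert (Z2 : Cmod z <= x + y).
  { unfold z. eapply Rle_trans; [apply Cmod_triangle|].
    rewrite Cmod_mult, Cmod_Ci, !Cmod_R, Rmult_1_l, (Rabs_pos_eq x) by lra. lra. }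
  assert (Lz : Cmod (plog z) <= Rabs (ln (x + y)) + PI).
  { set (l := plog z). replace l with (RtoC (Re l) + Ci * RtoC (Im l))%C
      by (destruct l; apply injective_projections; simpl; ring).
    eapply Rle_trans; [apply Cmod_triangle|].
    rewrite Cmod_mult, Cmod_Ci, !Cmod_R, Rmult_1_l.
    apply Rplus_le_compat; [|apply Im_plog_bound].
    change (Re l) with (ln (Cmod z)).
    assert (0 <= ln (Cmod z)) by (rewrite <- ln_1; apply ln_le; lra).
    assert (ln (Cmod z) <= ln (x + y)) by (apply ln_le; lra).
    rewrite !Rabs_pos_eq; lra. }
  apply Rle_trans with (exp (N * Rabs (ln (x + y))) * exp (N * PI)).
  - rewrite <- exp_plus. apply exp_le. rewrite <- Rmult_plus_distr_l.
    now apply Rmult_le_compat_l.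
  - replace (M * exp (eps * y) * exp (N * PI) * exp (eps * x))
      with (M * (exp (eps * y) * exp (eps * x)) * exp (N * PI)) by ring.
    rewrite <- (exp_plus (eps * y)). apply Rmult_le_compat_r; [left; apply exp_pos|].
    replace (eps * y + eps * x) with (eps * (x + y)) by ring. apply HM. lra.
Qed.

(** The legs at heights y and -y are moved onto the positive axis. With the principal power the
    integrand has a primitive P on the half-strip, so each leg, together with its piece of the
    circle, is a difference of values of P with the same limit at infinity; the lower side carries
    the monodromy factor. *)
Lemma contour_hankel (Phi : C -> C) (s : C) r y h M c X0 :
  0 < y -> y < r -> y < h -> 0 < c ->
  holo (half_strip h) Phi ->
  (forall x t, X0 <= x -> Rabs t <= y -> Cmod (Phi (RtoC x + Ci * RtoC t)%C) <= M * exp (- c * x)) ->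
  admits (fun w => Cexp (s * w) * Phi (Cexp w))%C r ->
  let f := fun z => (Cpow_from 0 z (s - 1) * Phi z)%C in
  ex_contour_int f r y /\
  contour_int f r y = hankel (fun w => Cexp (s * w) * Phi (Cexp w))%C r.
Proof.
  intros Hy Hyr Hyh Hc HPhi Hdec Hadm f. assert (Pi := PI_RGT_0).
  set (g := fun w => (Cexp (s * w) * Phi (Cexp w))%C) in *.
  set (f0 := fun z => (ppow s z * Phi z)%C).
  set (kap := Cexp (s * (Ci * RtoC (2 * PI)))).
  set (D := half_strip h).
  assert (Hf0 : holo D f0).
  { apply holo_mult; auto. apply holo_exp, holo_mult; [apply holo_const|].
    apply holo_sub with right_half; [now intros z [Hz _]|apply holo_plog]. }
  assert (Dline : forall x t, 0 < x -> Rabs t <= y -> D (RtoC x + Ci * RtoC t)%C).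
  { intros x t Hx Ht. split.
    - replace (Re (x + Ci * t)) with x by (unfold Re; simpl; ring). auto.
    - replace (Im (x + Ci * t)) with t by (unfold Im; simpl; ring). lra. }
  destruct (holo_primitive D f0 (RtoC 1 + Ci * RtoC 0)%C (half_strip_opened h)
    (half_strip_convex h)) as [P HP]; auto.
  { apply Dline; [lra|]. rewrite Rabs_R0. lra. }
  assert (Hsmall : forall eps, 0 < eps -> exists B, 1 <= B /\ forall x t, B <= x -> Rabs t <= y ->
     Cmod (f0 (RtoC x + Ci * RtoC t)%C) <= eps).
  { intros eps He. destruct (ppow_growth s y (c / 2)) as [N [N0 HN]]; [lra|lra|].
    destruct (exp_decay_small (N * M) (c / 2) eps) as [B [HB HB']]; [lra|lra|].
    exists (Rmax 1 (Rmax X0 B)). split; [apply Rmax_l|]. intros x t Hx Ht.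
    assert (x1 : 1 <= x) by (apply Rle_trans with (1 := Rmax_l _ _) (2 := Hx)).
    assert (x2 : Rmax X0 B <= x) by (apply Rle_trans with (1 := Rmax_r _ _) (2 := Hx)).
    assert (x3 : X0 <= x) by (apply Rle_trans with (1 := Rmax_l _ _) (2 := x2)).
    assert (x4 : B <= x) by (apply Rle_trans with (1 := Rmax_r _ _) (2 := x2)).
    unfold f0. rewrite Cmod_mult.
    apply Rle_trans with (N * exp (c / 2 * x) * (M * exp (- c * x))).
    - apply Rmult_le_compat; auto; apply Cmod_ge_0.
    - replace (N * exp (c / 2 * x) * (M * exp (- c * x)))
        with (N * M * (exp (c / 2 * x) * exp (- c * x))) by ring.
      rewrite <- exp_plus. replace (c / 2 * x + - c * x) with (- (c / 2) * x) by field.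
      left. auto. }
  assert (Cline : forall x t, 0 < x -> Rabs t <= y -> cont_at cid f0 (RtoC x + Ci * RtoC t)%C).
  { intros x t Hx Ht. apply (holo_cont D); auto. }
  (* The vertical segments at abscissa x contribute nothing as x grows, so P has the same limit
     along every horizontal line of the half-strip. *)
  assert (Hvert : forall t, Rabs t <= y -> forall eps, 0 < eps -> exists B, 1 <= B /\
     forall x, B <= x -> Cmod (P (RtoC x + Ci * RtoC t)%C - P (RtoC x)) <= eps).
  { intros t Ht eps He. destruct (Hsmall (eps / y)) as [B [HB HB']]; [now apply Rdiv_lt_0_compat|].
    exists B; split; auto. intros x Hx.
    assert (S1 : forall u, 0 <= u <= 1 -> Rabs (u * t) <= y).
    { intros u Hu. rewrite Rabs_mult, (Rabs_pos_eq u) by lra.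
      apply Rle_trans with (1 * Rabs t); [|lra]. apply Rmult_le_compat_r; [apply Rabs_pos|lra]. }
    assert (Q := deriv_bound (fun u => P (RtoC x + Ci * RtoC (u * t))%C)
       (fun u => f0 (RtoC x + Ci * RtoC (u * t)) * (Ci * RtoC t))%C 0 1 eps Rle_0_1).
    cbv beta in Q. rewrite Rmult_1_l, Rmult_0_l in Q.
    replace (x + Ci * 0)%C with (RtoC x) in Q by ring.
    replace ((1 - 0) * eps) with eps in Q by ring.
    assert (Dl : forall u, deriv_at RtoC (fun u => RtoC x + Ci * RtoC (u * t))%C u (Ci * RtoC t)%C).
    { intro u. apply deriv_ext with (fun u => RtoC x + (Ci * RtoC t) * RtoC u)%C.
      { intro v. rewrite RtoC_mult. ring. }
      eapply deriv_eq; [apply deriv_plus; [apply deriv_const|apply deriv_scal, deriv_incl]|].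
      cbv beta; ring. }
    apply Q; clear Q.
    - intros u Hu. apply (deriv_comp RtoC P (fun u => RtoC x + Ci * RtoC (u * t))%C).
      + apply HP, Dline; [lra|auto].
      + apply Dl.
    - intros u Hu. apply cont_mult; [|apply cont_const].
      apply (cont_comp RtoC f0 (fun u => RtoC x + Ci * RtoC (u * t))%C).
      + apply Cline; [lra|auto].
      + eapply deriv_cont, Dl.
    - intros u Hu. rewrite !Cmod_mult, Cmod_Ci, Cmod_R, Rmult_1_l.
      apply Rle_trans with (eps / y * y); [|right; field; lra].
      apply Rmult_le_compat; auto using Cmod_ge_0, Rabs_pos. }
  assert (Hr : 0 < r) by lra.
  (* Along the rays the Hankel integrand is f0, up to the constant kap. *)
  assert (K0 : forall x, 0 < x -> kray g 0 x = f0 (RtoC x)).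
  { intros x Hx. unfold kray, g, f0, ppow. replace (Ci * 0)%C with (RtoC 0) by ring.
    rewrite Cplus_0_r, plog_real, Cexp_real, exp_ln by auto.
    replace ((s - 1) * ln x)%C with (s * ln x - ln x)%C by ring.
    rewrite Cexp_minus, (Cexp_real (ln x)), exp_ln by auto. unfold Cdiv. ring. }
  assert (K2 : forall x, 0 < x -> kray g (2 * PI) x = (kap * f0 (RtoC x))%C).
  { intros x Hx. rewrite <- K0 by auto. unfold kray, g, kap.
    replace (Ci * 0)%C with (RtoC 0) by ring. rewrite Cplus_0_r.
    rewrite Cmult_plus_distr_l, !Cexp_plus, Cexp_2PI. rewrite Cmult_1_r. unfold Cdiv. ring. }
  assert (T0 := admits_tail g r 0 Hadm (or_introl eq_refl)).
  set (T := tail (kray g 0) r) in *.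
  assert (T2 : tail (kray g (2 * PI)) r = (kap * T)%C).
  { rewrite <- (is_tail_tail _ _ _ (is_tail_scal _ _ _ kap T0)).
    apply tail_ext_on. intros t Ht. rewrite K2, K0 by lra. reflexivity. }
  (* The limit of P at infinity, read off from the convergent integral along the positive axis. *)
  set (L := (P (RtoC r) + T)%C).
  assert (HL : forall eps, 0 < eps -> exists B, r <= B /\ forall x, B <= x -> Cmod (P (RtoC x) - L) < eps).
  { intros eps He. destruct (proj2 T0 eps He) as [B [HB HB']]. exists B; split; auto.
    intros x Hx. specialize (HB' x Hx).
    replace (P x - L)%C with (P x - P r - T)%C by (unfold L; ring).
    replace (P x - P r)%C with (int (kray g 0) r x); auto.
    apply is_int_unique. apply (is_int_deriv (fun x => P (RtoC x))); [lra| |].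
    - intros t Ht. rewrite K0 by lra. eapply deriv_eq.
      + apply (deriv_comp RtoC P RtoC); [|apply deriv_incl]. apply HP.
        replace (RtoC t) with (RtoC t + Ci * RtoC 0)%C by ring. apply Dline; [lra|].
        rewrite Rabs_R0; lra.
      + ring.
    - intros t Ht. apply (proj1 T0). lra. }
  set (x0 := sqrt (r ^ 2 - y ^ 2)). set (phi0 := asin (y / r)).
  assert (X0p : 0 < x0).
  { apply sqrt_lt_R0. assert (y * y < r * r) by (apply Rmult_le_0_lt_compat; lra). simpl; lra. }
  assert (yr : 0 < y / r < 1).
  { split; [now apply Rdiv_lt_0_compat|]. apply Rmult_lt_reg_r with r; auto.
    unfold Rdiv. rewrite Rmult_assoc, Rinv_l; lra. }
  assert (Sphi : r * sin phi0 = y).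
  { unfold phi0. rewrite sin_asin by lra. field. lra. }
  assert (Cphi : r * cos phi0 = x0).
  { unfold phi0, x0. rewrite cos_asin by lra.
    rewrite <- (sqrt_pow2 r) at 1 by lra. rewrite <- sqrt_mult_alt by apply pow2_ge_0.
    f_equal. unfold Rsqr. field. lra. }
  assert (Bphi : 0 < phi0 < PI / 2).
  { assert (Q := asin_bound_lt (y / r) ltac:(lra)). fold phi0 in Q. split; [|lra].
    destruct (Rlt_dec 0 phi0) as [H0|H0]; auto. exfalso.
    assert (S0 : 0 <= sin (- phi0)) by (apply sin_ge_0; lra). rewrite sin_neg in S0. nra. }
  assert (Tleg : forall t, Rabs t <= y ->
    is_tail (fun x => f0 (RtoC x + Ci * RtoC t)%C) x0 (L - P (RtoC x0 + Ci * RtoC t))%C).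
  { intros t Ht. apply (is_tail_deriv (fun x => P (RtoC x + Ci * RtoC t)%C)).
    - intros x Hx. eapply deriv_eq.
      + apply (deriv_comp RtoC P (fun x => RtoC x + Ci * RtoC t)%C).
        * apply HP, Dline; [lra|auto].
        * apply deriv_plus; [apply deriv_incl|apply deriv_const].
      + ring.
    - intros x Hx. apply (cont_comp RtoC f0 (fun x => RtoC x + Ci * RtoC t)%C).
      + apply Cline; [lra|auto].
      + apply cont_plus; [apply cont_incl|apply cont_const].
    - intros eps He. destruct (HL (eps / 2)) as [B1 [HB1 HB1']]; [lra|].
      destruct (Hvert t Ht (eps / 4)) as [B2 [HB2 HB2']]; [lra|].
      exists (Rmax x0 (Rmax B1 B2)). split; [apply Rmax_l|]. intros b Hb.
      assert (b2 : Rmax B1 B2 <= b) by (apply Rle_trans with (1 := Rmax_r _ _) (2 := Hb)).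
      assert (b3 : B1 <= b) by (apply Rle_trans with (1 := Rmax_l _ _) (2 := b2)).
      assert (b4 : B2 <= b) by (apply Rle_trans with (1 := Rmax_r _ _) (2 := b2)).
      replace (P (b + Ci * t) - L)%C with ((P (b + Ci * t) - P b) + (P b - L))%C by ring.
      eapply Rle_lt_trans; [apply Cmod_triangle|].
      specialize (HB1' b b3). specialize (HB2' b b4). lra. }
  assert (Legs : forall x, x0 <= x ->
     upper_leg f y x = f0 (RtoC x + Ci * RtoC y)%C /\
     lower_leg f y x = (kap * f0 (RtoC x + Ci * RtoC (- y)))%C).
  { intros x Hx.
    assert (R1 : forall t, Re (RtoC x + Ci * RtoC t) = x) by (intro; unfold Re; simpl; ring).
    assert (I1 : forall t, Im (RtoC x + Ci * RtoC t) = t) by (intro; unfold Im; simpl; ring).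
    assert (E1 : forall t, (x, t) = (RtoC x + Ci * RtoC t)%C)
      by (intro; apply injective_projections; simpl; ring).
    assert (Ip : forall t, Im (plog (RtoC x + Ci * RtoC t)) = atan (t / x)).
    { intro t. change (Im (plog (RtoC x + Ci * RtoC t)))
        with (atan (Im (RtoC x + Ci * RtoC t) / Re (RtoC x + Ci * RtoC t))).
      now rewrite R1, I1. }
    assert (Pp : forall t, Cexp (plog (RtoC x + Ci * RtoC t)) = (RtoC x + Ci * RtoC t)%C).
    { intro t. apply Cexp_plog. rewrite R1. lra. }
    assert (A1 := atan_bound (y / x)).
    assert (A2 : 0 < atan (y / x)).
    { rewrite <- atan_0. apply atan_increasing. apply Rdiv_lt_0_compat; lra. }
    split.
    - unfold upper_leg, f, f0, ppow. rewrite E1. f_equal.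
      rewrite <- (Pp y) at 1. apply Cpow_from_0_Cexp. rewrite Ip. lra.
    - unfold lower_leg, f, f0, ppow. rewrite E1, Cmult_assoc. f_equal.
      assert (Pm := Pp (- y)). assert (Im_ := Ip (- y)).
      set (l := plog (RtoC x + Ci * RtoC (- y))) in *.
      assert (Ez : Cexp (l + Ci * RtoC (2 * PI)) = (RtoC x + Ci * RtoC (- y))%C)
        by (rewrite Cexp_plus, Cexp_2PI, Pm; ring).
      rewrite <- Ez.
      assert (Ip' : Im (l + Ci * RtoC (2 * PI)) = - atan (y / x) + 2 * PI).
      { rewrite <- atan_opp. replace (- (y / x)) with (- y / x) by (field; lra).
        rewrite <- Im_. unfold Im; simpl; ring. }
      rewrite Cpow_from_0_Cexp by (rewrite Ip'; lra).
      rewrite Cmult_plus_distr_l, Cexp_plus. unfold kap.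
      replace ((s - 1) * (Ci * (2 * PI)%R))%C with (s * (Ci * (2 * PI)%R) - Ci * (2 * PI)%R)%C by ring.
      rewrite Cexp_2PI_shift. ring. }
  assert (GU : is_RInt_gen (V := C_R_NormedModule) (upper_leg f y) (at_point x0)
      (Rbar_locally p_infty) (L - P (RtoC x0 + Ci * RtoC y))%C).
  { eapply is_tail_RInt_gen_ext; [|apply Tleg; rewrite Rabs_pos_eq; lra].
    intros x Hx. exact (proj1 (Legs x Hx)). }
  assert (GL : is_RInt_gen (V := C_R_NormedModule) (lower_leg f y) (at_point x0)
      (Rbar_locally p_infty) (kap * (L - P (RtoC x0 + Ci * RtoC (- y))))%C).
  { eapply is_tail_RInt_gen_ext;
      [|apply is_tail_scal, (Tleg (- y)); rewrite Rabs_Ropp, Rabs_pos_eq; lra].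
    intros x Hx. exact (proj2 (Legs x Hx)). }
  assert (cg : forall t, 0 <= t <= 2 * PI -> cont_at RtoC (fun t => Ci * karc g r t)%C t).
  { intros t Ht. apply cont_mult; [apply cont_const|]. apply karc_cont.
    apply (proj1 (proj2 (proj2 Hadm))). now exists t. }
  assert (Ecirc : forall t, (RtoC r * (cos t, sin t))%C = Cexp (RtoC (ln r) + Ci * RtoC t))
    by (intro t; rewrite Cexp_log; auto).
  assert (Garc : is_int (arc f r) phi0 (2 * PI - phi0)
     (int (fun t => Ci * karc g r t)%C phi0 (2 * PI - phi0))).
  { eapply is_int_ext; [lra| |apply int_correct; [lra|intros; apply cg; lra]].
    intros t Ht. unfold arc, karc, f, g. rewrite Ecirc.
    set (w := (RtoC (ln r) + Ci * RtoC t)%C).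
    rewrite Cpow_from_0_Cexp by (unfold w; rewrite Im_log; lra).
    replace (Cexp (s * w)) with (Cexp ((s - 1) * w) * Cexp w)%C
      by (rewrite <- Cexp_plus; f_equal; ring).
    replace (Ci * RtoC r * (cos t, sin t))%C with (Ci * (RtoC r * (cos t, sin t)))%C by ring.
    rewrite Ecirc. fold w. ring. }
  (* The two missing ends of the circle lie in the half-strip. *)
  assert (Dcirc : forall t, Rabs t <= phi0 ->
    exists x v, 0 < x /\ Rabs v <= y /\ Cexp (RtoC (ln r) + Ci * RtoC t) = (RtoC x + Ci * RtoC v)%C
      /\ plog (RtoC x + Ci * RtoC v) = (RtoC (ln r) + Ci * RtoC t)%C).
  { intros t Ht. apply Rabs_le_between in Ht. exists (r * cos t), (r * sin t).
    assert (C0 : 0 < cos t) by (apply cos_gt_0; lra).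
    assert (E : (RtoC (r * cos t) + Ci * RtoC (r * sin t))%C = Cexp (RtoC (ln r) + Ci * RtoC t)).
    { rewrite <- Ecirc. apply injective_projections; simpl; ring. }
    split; [now apply Rmult_lt_0_compat|split; [|split; [now rewrite E|]]].
    - rewrite Rabs_mult, (Rabs_pos_eq r), <- Sphi by lra. apply Rmult_le_compat_l; [lra|].
      apply Rabs_le. rewrite <- sin_neg. split; apply sin_incr_1; lra.
    - set (z := (RtoC (r * cos t) + Ci * RtoC (r * sin t))%C) in *.
      assert (Rz : Re z = r * cos t) by (unfold z, Re; simpl; ring).
      assert (Iz : Im z = r * sin t) by (unfold z, Im; simpl; ring).
      unfold plog. rewrite Rz, Iz, E, Cmod_Cexp, Re_log, exp_ln by auto.
      replace (r * sin t / (r * cos t)) with (tan t) by (unfold tan; field; lra).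
      rewrite atan_tan by lra. apply injective_projections; simpl; ring. }
  assert (Gend : forall a b, - phi0 <= a -> a <= b -> b <= phi0 ->
    is_int (fun t => Ci * karc g r t)%C a b
      (P (Cexp (RtoC (ln r) + Ci * RtoC b)) - P (Cexp (RtoC (ln r) + Ci * RtoC a)))%C).
  { intros a b Ha Hab Hb.
    assert (Dt : forall t, a <= t <= b ->
       deriv_at RtoC (fun t => P (Cexp (RtoC (ln r) + Ci * RtoC t))) t (Ci * karc g r t)%C
       /\ cont_at RtoC (fun t => Ci * karc g r t)%C t).
    { intros t Ht. destruct (Dcirc t ltac:(apply Rabs_le; lra)) as [x [v [Hx [Hv [Ez El]]]]].
      set (z := (RtoC x + Ci * RtoC v)%C) in *.
      assert (Dz : D z) by (apply Dline; auto). split.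
      - eapply deriv_eq.
        + apply (deriv_comp RtoC P (fun t => Cexp (RtoC (ln r) + Ci * RtoC t))).
          * rewrite Ez. now apply HP.
          * apply deriv_exp, deriv_vert.
        + unfold karc, g. set (w := (RtoC (ln r) + Ci * RtoC t)%C) in *.
          unfold f0, ppow. rewrite El.
          replace (Cexp (s * w)) with (Cexp ((s - 1) * w) * Cexp w)%C
            by (rewrite <- Cexp_plus; f_equal; ring).
          rewrite Ez. ring.
      - apply cont_mult; [apply cont_const|]. apply karc_cont. unfold g.
        set (w := (RtoC (ln r) + Ci * RtoC t)%C) in *. apply cont_mult.
        + apply cont_exp, cont_lin.
        + apply (cont_comp cid Phi Cexp).
          * rewrite Ez. now apply (holo_cont D).
          * eapply deriv_cont, deriv_Cexp. }
    apply (is_int_deriv (fun t => P (Cexp (RtoC (ln r) + Ci * RtoC t)))); auto; intros; now apply Dt. }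
  assert (Eup : Cexp (RtoC (ln r) + Ci * RtoC phi0) = (RtoC x0 + Ci * RtoC y)%C).
  { rewrite <- Ecirc, <- Sphi, <- Cphi. apply injective_projections; simpl; ring. }
  assert (Edn : Cexp (RtoC (ln r) + Ci * RtoC (- phi0)) = (RtoC x0 + Ci * RtoC (- y))%C).
  { rewrite <- Ecirc, cos_neg, sin_neg, <- Sphi, <- Cphi.
    apply injective_projections; simpl; ring. }
  assert (Ez : Cexp (RtoC (ln r) + Ci * RtoC 0) = RtoC r).
  { rewrite <- Ecirc, cos_0, sin_0. apply injective_projections; simpl; ring. }
  assert (J1 := Gend 0 phi0 ltac:(lra) ltac:(lra) ltac:(lra)). rewrite Eup, Ez in J1.
  assert (J3' := Gend (- phi0) 0 ltac:(lra) ltac:(lra) ltac:(lra)). rewrite Edn, Ez in J3'.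
  (* The piece of the circle just before angle 2 PI is the piece just before angle 0, shifted by a
     full turn, which multiplies the integrand by kap. *)
  assert (J3 : is_int (fun t => Ci * karc g r t)%C (2 * PI - phi0) (2 * PI)
     (kap * (P (RtoC r) - P (RtoC x0 + Ci * RtoC (- y))))%C).
  { apply is_int_ext with (fun t => kap * (Ci * karc g r (t - 2 * PI)))%C; [lra| |].
    - intros t Ht. unfold karc, g, kap.
      replace (RtoC (ln r) + Ci * RtoC (t - 2 * PI))%C
        with ((RtoC (ln r) + Ci * RtoC t) - Ci * RtoC (2 * PI))%C
        by (rewrite RtoC_minus; ring).
      rewrite Cexp_2PI_shift.
      replace (Cexp (s * (RtoC (ln r) + Ci * RtoC t)))
        with (Cexp (s * (Ci * (2 * PI)%R)) * Cexp (s * ((RtoC (ln r) + Ci * RtoC t) - Ci * RtoC (2 * PI))))%C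
        by (rewrite <- Cexp_plus; f_equal; ring).
      ring.
    - apply is_int_scal. 
      (* The shift is the affine substitution with slope 1; the slope appears as a scalar factor and
         is removed by [scal_one]. *)
      assert (Q := is_RInt_comp_lin (V := C_R_NormedModule) (fun t => Ci * karc g r t)%C 1 (- (2 * PI))
         (2 * PI - phi0) (2 * PI) (P (RtoC r) - P (RtoC x0 + Ci * RtoC (- y)))%C).
      replace (1 * (2 * PI - phi0) + - (2 * PI)) with (- phi0) in Q by ring.
      replace (1 * (2 * PI) + - (2 * PI)) with 0 in Q by ring.
      specialize (Q J3'). eapply is_int_ext; [lra| |exact Q].
      intros t Ht. cbv beta.
      etransitivity; [apply (scal_one (V := C_R_NormedModule))|].
      do 2 f_equal. ring. }
  set (mid := int (fun t => Ci * karc g r t)%C phi0 (2 * PI - phi0)) in *.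
  assert (J2 : is_int (fun t => Ci * karc g r t)%C phi0 (2 * PI - phi0) mid).
  { apply int_correct; [lra|]. intros; apply cg; lra. }
  assert (JJ := is_int_Chasles _ _ _ _ _ _ (is_int_Chasles _ _ _ _ _ _ J1 J2) J3).
  assert (Jf := is_int_scal _ _ _ _ Ci (admits_int g r Hadm)).
  assert (EQ : (Ci * int (karc g r) 0 (2 * PI))%C =
    (P (RtoC x0 + Ci * RtoC y) - P (RtoC r) + mid
      + kap * (P (RtoC r) - P (RtoC x0 + Ci * RtoC (- y))))%C).
  { rewrite <- (is_int_unique _ _ _ _ Jf). apply is_int_unique. exact JJ. }
  split.
  - unfold ex_contour_int. fold x0 phi0. split; [|split].
    + eexists; exact GU.
    + eexists; exact Garc.
    + eexists; exact GL.
  - unfold contour_int. fold x0 phi0.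
    rewrite (is_RInt_gen_unique (V := C_R_CompleteNormedModule) _ _ GU).
    rewrite (is_RInt_gen_unique (V := C_R_CompleteNormedModule) _ _ GL).
    rewrite (is_RInt_unique (V := C_R_CompleteNormedModule) _ _ _ _ Garc).
    unfold hankel. fold T. rewrite T2, EQ. unfold L. ring.
Qed.

(** ** Admissible contours *)

Lemma one_minus_exp_strip (g z : C) h :
  g <> 0 -> z <> 0 -> h <= Rabs (Im (2 * RtoC PI * Ci / g)) -> Rabs (Im z) < h ->
  (1 - Cexp (- (g * z)))%C <> 0.
Proof.
  intros Hg Hz Hh Hi E.
  assert (X : Cexp (- (g * z)) = 1).
  { replace (Cexp (- (g * z))) with (1 - (1 - Cexp (- (g * z))))%C by ring. rewrite E. ring. }
  destruct (Cexp_eq_1 _ X) as [k Hk].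
  (* Any further zero is a nonzero integer multiple of 2 i PI / g, whose imaginary part is at least
     h in absolute value. *)
  assert (Ez : z = (RtoC (- IZR k) * (2 * RtoC PI * Ci / g))%C).
  { replace z with (- (- (g * z)) / g)%C by (field; auto). rewrite Hk, RtoC_opp. field. auto. }
  assert (k0 : k <> 0%Z).
  { intro K. rewrite K in Ez. apply Hz. rewrite Ez. rewrite Ropp_0. ring. }
  assert (K1 : 1 <= Rabs (IZR k)) by (rewrite <- abs_IZR; apply IZR_le; lia).
  assert (Ii : Rabs (Im z) = Rabs (IZR k) * Rabs (Im (2 * RtoC PI * Ci / g))).
  { rewrite Ez. set (u := (2 * RtoC PI * Ci / g)%C).
    replace (Im (RtoC (- IZR k) * u)) with (- (IZR k) * Im u) by (unfold Im; simpl; ring).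
    rewrite Rabs_mult, Rabs_Ropp. reflexivity. }
  assert (P := Rabs_pos (Im (2 * RtoC PI * Ci / g))).
  rewrite Ii in Hi. nra.
Qed.

(** On a horizontal strip the imaginary part costs a bounded factor exp(y G). Beyond X0 both
    exponentials of the denominator are below 1 / 2, so the denominator is at least 1 / 4. *)
Lemma fab_strip_bound al be c y :
  sector al be c -> 0 <= y -> exists M X0, 0 <= X0 /\ 0 <= M /\
    forall x t, X0 <= x -> Rabs t <= y ->
      Cmod (fab al be (RtoC x + Ci * RtoC t)%C) <= M * exp (- c * x).
Proof.
  intros Hs Hy. assert (Ha := Re_sector _ _ _ Hs). destruct Hs as [H0 [H1 H2]].
  set (G := Cmod (al + be) + Cmod (al - be) + Cmod al).
  assert (G0 : 0 <= G).
  { unfold G. generalize (Cmod_ge_0 (al + be)) (Cmod_ge_0 (al - be)) (Cmod_ge_0 al). lra. }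
  assert (B : forall g x t, c <= Re g -> Cmod g <= G -> 0 <= x -> Rabs t <= y ->
    Cmod (Cexp (- (g * (RtoC x + Ci * RtoC t)))) <= exp (y * G) * exp (- c * x)).
  { intros g x t Hg HG Hx Ht. rewrite Cmod_Cexp, <- exp_plus. apply exp_le.
    replace (Re (- (g * (x + Ci * t)))) with (- (Re g * x) + t * Im g)
      by (unfold Re, Im; simpl; ring).
    assert (t * Im g <= y * G).
    { eapply Rle_trans; [apply Rle_abs|]. rewrite Rabs_mult.
      apply Rmult_le_compat; auto using Rabs_pos.
      eapply Rle_trans; [apply Im_le_Cmod|auto]. }
    assert (c * x <= Re g * x) by (apply Rmult_le_compat_r; auto). lra. }
  destruct (exp_decay_small (exp (y * G)) c (1 / 2) H0) as [X0 [HX0 HX]]; [lra|].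
  exists (4 * exp (y * G)), X0. split; auto. split.
  { apply Rmult_le_pos; [lra|left; apply exp_pos]. }
  intros x t Hx Ht. specialize (HX x Hx).
  assert (L1 : Cmod (al + be) <= G) by (unfold G; generalize (Cmod_ge_0 (al - be)) (Cmod_ge_0 al); lra).
  assert (L2 : Cmod (al - be) <= G) by (unfold G; generalize (Cmod_ge_0 (al + be)) (Cmod_ge_0 al); lra).
  assert (L3 : Cmod al <= G) by (unfold G; generalize (Cmod_ge_0 (al + be)) (Cmod_ge_0 (al - be)); lra).
  assert (B1 := B (al + be)%C x t H1 L1 ltac:(lra) Ht).
  assert (B2 := B (al - be)%C x t H2 L2 ltac:(lra) Ht).
  assert (B3 := B al x t Ha L3 ltac:(lra) Ht).
  set (z := (RtoC x + Ci * RtoC t)%C) in *. set (p := exp (y * G) * exp (- c * x)) in *.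
  assert (D1 := Cmod_reverse 1 (Cexp (- ((al + be) * z)))).
  assert (D2 := Cmod_reverse 1 (Cexp (- ((al - be) * z)))). rewrite Cmod_1 in D1, D2.
  assert (Dn : / 4 <= Cmod (denom al be z)).
  { unfold denom. rewrite Cmod_mult. replace (/ 4) with (1 / 2 * (1 / 2)) by field.
    apply Rmult_le_compat; lra. }
  assert (Nn : denom al be z <> 0) by (apply Cmod_gt_0; lra).
  assert (Nu : Cmod (numer al be z) <= p).
  { unfold numer. rewrite Cmod_div, Cmod_R, Rabs_pos_eq by (try apply RtoC_neq; lra).
    assert (T1 := Cmod_triangle (Cexp (- ((al + be) * z)) + Cexp (- ((al - be) * z)))
       (2 * Cexp (- (al * z)))).
    assert (T2 := Cmod_triangle (Cexp (- ((al + be) * z))) (Cexp (- ((al - be) * z)))).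
    rewrite (Cmod_mult 2), Cmod_R, Rabs_pos_eq in T1 by lra. lra. }
  unfold fab. rewrite Cmod_div by auto.
  replace (4 * exp (y * G) * exp (- c * x)) with (p * / (/ 4)) by (unfold p; field).
  apply Rmult_le_compat; auto using Cmod_ge_0.
  - left; apply Rinv_0_lt_compat; lra.
  - apply Rinv_le_contravar; lra.
Qed.

Section Contour.
Context (tau : C) (Hlo : - (1 / 2) < Re tau) (Hhi : Re tau <= 1 / 2) (Him : 0 < Im tau).

Lemma one_plus_tau_neq_0 (d : R) : d = 1 \/ d = -1 -> (1 + RtoC d * tau)%C <> 0.
Proof.
  intros [->| ->]; apply Re_pos_neq_0; unfold Re in *; simpl; lra.
Qed.

Lemma Cmod_up_factors :
  Cmod (- (Ci * tau) + - Ci) = Cmod (1 + tau) /\ Cmod (- (Ci * tau) - - Ci) = Cmod (1 - tau).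
Proof.
  replace (- (Ci * tau) + - Ci)%C with ((- Ci) * (1 + tau))%C by ring.
  replace (- (Ci * tau) - - Ci)%C with (Ci * (1 - tau))%C by ring.
  rewrite !Cmod_mult, Cmod_opp, Cmod_Ci. split; ring.
Qed.

Lemma small_of_bounds r :
  0 < r -> r * Cmod (1 + tau) < 2 * PI -> r * Cmod (1 - tau) < 2 * PI ->
  small 1 tau r /\ small (- (Ci * tau)) (- Ci) r.
Proof.
  intros H0 H1 H2. destruct Cmod_up_factors as [E1 E2].
  unfold small. rewrite E1, E2. auto.
Qed.

(** The innermost points, k = 1, of the two families, with b choosing the family. They determine the
    admissible radius and the height of the free strip. *)
Lemma sing_intro (e d : R) (b : bool) : (e = 1 \/ e = -1) -> (d = 1 \/ d = -1) ->
  sing tau (RtoC e * (2 * RtoC PI * (if b then Ci else 1) / (1 + RtoC d * tau)))%C.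
Proof.
  intros He Hd. exists e, d, 1%nat. split; auto. split; auto. split; [lia|].
  destruct b; [left|right]; simpl INR; unfold Cdiv; ring.
Qed.

Lemma admissible_small r y :
  admissible tau r y -> small 1 tau r /\ small (- (Ci * tau)) (- Ci) r.
Proof.
  intros [Hy [Hyr [[rho [[_ Hrho] Hr]] _]]]. assert (P := PI_RGT_0).
  assert (B : forall d : R, d = 1 \/ d = -1 -> r * Cmod (1 + RtoC d * tau) < 2 * PI).
  { intros d Hd. assert (N := one_plus_tau_neq_0 d Hd).
    assert (S := Hrho _ (sing_intro 1 d true (or_introl eq_refl) Hd)). cbv iota in S.
    rewrite Cmod_mult, Cmod_div, !Cmod_mult, Cmod_Ci, !Cmod_R in S by auto.
    rewrite Rabs_R1, (Rabs_pos_eq 2), (Rabs_pos_eq PI) in S by lra.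
    apply Cmod_gt_0 in N.
    apply Rlt_le_trans with (1 * (2 * PI * 1 / Cmod (1 + d * tau)) * Cmod (1 + d * tau)).
    - apply Rmult_lt_compat_r; lra.
    - right. field. lra. }
  apply small_of_bounds; [lra| |].
  - replace (1 + tau)%C with (1 + RtoC 1 * tau)%C by ring. apply B; auto.
  - replace (1 - tau)%C with (1 + RtoC (-1) * tau)%C by ring. apply B; auto.
Qed.

(** The singularities come in opposite pairs, and one of u, -u has nonnegative real part. If |Im u|
    <= y, that one would lie between the two legs. *)
Lemma admissible_height r y (d : R) (b : bool) :
  admissible tau r y -> d = 1 \/ d = -1 ->
  y < Rabs (Im (2 * RtoC PI * (if b then Ci else 1) / (1 + RtoC d * tau))).
Proof.
  intros [Hy [_ [_ Hs]]] Hd. set (u := (_ / _)%C).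
  destruct (Rlt_dec y (Rabs (Im u))) as [L|L]; auto. exfalso.
  destruct (Rle_dec 0 (Re u)) as [H|H].
  - apply (Hs (RtoC 1 * u)%C); [now apply sing_intro; auto|]. right.
    replace (RtoC 1 * u)%C with u by ring. lra.
  - apply (Hs (RtoC (-1) * u)%C); [now apply sing_intro; auto|]. right.
    replace (Re (RtoC (-1) * u)) with (- Re u) by (unfold Re; simpl; ring).
    replace (Im (RtoC (-1) * u)) with (- Im u) by (unfold Im; simpl; ring).
    rewrite Rabs_Ropp. lra.
Qed.

Lemma admissible_strip r y :
  admissible tau r y -> exists h, y < h /\ forall z, half_strip h z ->
    denom 1 tau z <> 0 /\ denom (- (Ci * tau)) (- Ci) z <> 0.
Proof.
  intro Ha.
  set (u := fun d b => Rabs (Im (2 * RtoC PI * (if (b : bool) then Ci else 1) / (1 + RtoC d * tau)))).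
  (* The four heights belong to the factors of the two denominators: the imaginary family to the
     first term of [F], the real family to the second. *)
  set (h := Rmin (Rmin (u 1 true) (u (-1) true)) (Rmin (u 1 false) (u (-1) false))).
  exists h. split.
  { assert (HU : forall d b, d = 1 \/ d = -1 -> y < u d b)
      by (intros d b Hd; now apply (admissible_height r y d b)).
    unfold h. repeat apply Rmin_glb_lt; auto. }
  assert (h1 : h <= u 1 true) by (eapply Rle_trans; [apply Rmin_l|apply Rmin_l]).
  assert (h2 : h <= u (-1) true) by (eapply Rle_trans; [apply Rmin_l|apply Rmin_r]).
  assert (h3 : h <= u 1 false) by (eapply Rle_trans; [apply Rmin_r|apply Rmin_l]).
  assert (h4 : h <= u (-1) false) by (eapply Rle_trans; [apply Rmin_r|apply Rmin_r]).
  assert (N1 := one_plus_tau_neq_0 1 (or_introl eq_refl)).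
  assert (N2 := one_plus_tau_neq_0 (-1) (or_intror eq_refl)).
  unfold u in *. clearbody h. clear u.
  replace (1 + RtoC 1 * tau)%C with (1 + tau)%C in * by ring.
  replace (1 + RtoC (-1) * tau)%C with (1 - tau)%C in * by ring.
  assert (NI : Ci <> 0) by (apply Cmod_gt_0; rewrite Cmod_Ci; lra).
  assert (NmI : (- Ci)%C <> 0) by (apply Cmod_gt_0; rewrite Cmod_opp, Cmod_Ci; lra).
  intros z [Hz1 Hz2]. assert (Hz := Re_pos_neq_0 z Hz1).
  split; apply Cmult_neq_0; apply (one_minus_exp_strip _ z h); auto.
  - replace (- (Ci * tau) + - Ci)%C with ((- Ci) * (1 + tau))%C by ring. now apply Cmult_neq_0.
  - replace (- (Ci * tau) + - Ci)%C with ((- Ci) * (1 + tau))%C by ring.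
    replace (2 * PI * Ci / (- Ci * (1 + tau)))%C with (- (2 * PI * 1 / (1 + tau)))%C
      by (field; auto).
    replace (Im (- (2 * PI * 1 / (1 + tau)))) with (- Im (2 * PI * 1 / (1 + tau)))
      by (unfold Im; simpl; ring).
    now rewrite Rabs_Ropp.
  - replace (- (Ci * tau) - - Ci)%C with (Ci * (1 - tau))%C by ring. now apply Cmult_neq_0.
  - replace (- (Ci * tau) - - Ci)%C with (Ci * (1 - tau))%C by ring.
    replace (2 * PI * Ci / (Ci * (1 - tau)))%C with (2 * PI * 1 / (1 - tau))%C
      by (field; auto).
    auto.
Qed.

Definition phase (s : C) : C := Cexp (- (Ci * s * RtoC PI / 2)).

Definition jfun (r : R) (s : C) : C :=
  (phase s * hfab 1 tau s r + hfab (- (Ci * tau)) (- Ci) s r)%C.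

Theorem contour_jfun r y s :
  admissible tau r y ->
  ex_contour_int (integrand tau s) r y /\ contour_int (integrand tau s) r y = jfun r s.
Proof.
  intro Ha. destruct (admissible_small r y Ha) as [S1 S2].
  assert (C1 := sector_right tau Hlo Hhi). assert (C2 := sector_up tau Him).
  destruct (admissible_strip r y Ha) as [h [Hh Hden]].
  destruct Ha as [Hy [Hyr _]].
  destruct (fab_strip_bound 1 tau (1 / 2) y C1) as [M1 [X1 [HX1 [HM1 B1]]]]; [lra|].
  destruct (fab_strip_bound _ _ (Im tau) y C2) as [M2 [X2 [HX2 [HM2 B2]]]]; [lra|].
  set (c := Rmin (1 / 2) (Im tau)). assert (c0 : 0 < c) by (apply Rmin_pos; lra).
  assert (c1 : c <= 1 / 2) by apply Rmin_l. assert (c2 : c <= Im tau) by apply Rmin_r.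
  assert (A1 := admits_scal (phase s) _ r (admits_exp s _ r (admits_fab 1 tau (1 / 2) r C1 S1))).
  assert (A2 := admits_exp s _ r (admits_fab _ _ (Im tau) r C2 S2)).
  assert (EF : forall w, (Cexp (s * w) * F tau s (Cexp w))%C =
    (phase s * (Cexp (s * w) * fab 1 tau (Cexp w))
      + Cexp (s * w) * fab (- (Ci * tau)) (- Ci) (Cexp w))%C).
  { intro w. rewrite F_fab. unfold phase. ring. }
  assert (AF : admits (fun w => Cexp (s * w) * F tau s (Cexp w))%C r).
  { eapply admits_ext; [intro w; symmetry; apply EF|]. now apply admits_plus. }
  destruct (contour_hankel (F tau s) s r y h (Cmod (phase s) * M1 + M2) c (Rmax X1 X2))
    as [R1 R2]; auto.
  - apply holo_ext with (fun z => phase s * fab 1 tau z + fab (- (Ci * tau)) (- Ci) z)%C.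
    { intro z. now rewrite F_fab. }
    apply holo_plus; [apply holo_mult; [apply holo_const|]|]; apply holo_fab;
      intros z Hz; destruct (Hden z Hz) as [Q1 Q2]; assumption.
  - intros x t Hx Ht. rewrite F_fab. fold (phase s).
    assert (x1 : X1 <= x) by (apply Rle_trans with (1 := Rmax_l _ _) (2 := Hx)).
    assert (x2 : X2 <= x) by (apply Rle_trans with (1 := Rmax_r _ _) (2 := Hx)).
    eapply Rle_trans; [apply Cmod_triangle|]. rewrite Cmod_mult, Rmult_plus_distr_r, Rmult_assoc.
    apply Rplus_le_compat.
    + apply Rmult_le_compat_l; [apply Cmod_ge_0|]. eapply Rle_trans; [now apply B1|].
      apply Rmult_le_compat_l; auto. apply exp_le. apply Rmult_le_compat_r; lra.
    + eapply Rle_trans; [now apply B2|].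
      apply Rmult_le_compat_l; auto. apply exp_le. apply Rmult_le_compat_r; lra.
  - split; [exact R1|]. unfold integrand. rewrite R2. unfold jfun, hfab.
    rewrite (hankel_ext _ _ r EF), hankel_plus, hankel_scal; auto.
    now apply admits_exp, admits_fab with (1 / 2).
Qed.

Lemma hfab_any al be c s r r' :
  sector al be c -> small al be r -> small al be r' -> hfab al be s r = hfab al be s r'.
Proof.
  intros Hs H H'. destruct (Rle_dec r r') as [L|L].
  - apply (hfab_radius al be c); auto. apply H.
  - symmetry. apply (hfab_radius al be c); auto; [apply H'|lra].
Qed.

Lemma jfun_radius r r' s :
  small 1 tau r -> small (- (Ci * tau)) (- Ci) r ->
  small 1 tau r' -> small (- (Ci * tau)) (- Ci) r' -> jfun r s = jfun r' s.
Proof.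
  intros. unfold jfun.
  rewrite (hfab_any 1 tau (1 / 2) s r r'), (hfab_any _ _ (Im tau) s r r'); auto.
  - now apply sector_up.
  - now apply sector_right.
Qed.

End Contour.

(** ** Removable singularities *)

Definition twice_deriv (f : C -> C) : Prop :=
  exists f', (forall z, deriv_at cid f z (f' z)) /\ (forall z, exists l, deriv_at cid f' z l).

Lemma twice_deriv_plus f g :
  twice_deriv f -> twice_deriv g -> twice_deriv (fun z => f z + g z)%C.
Proof.
  intros [f' [F1 F2]] [g' [G1 G2]]. exists (fun z => f' z + g' z)%C. split.
  - intro z. now apply deriv_plus.
  - intro z. destruct (F2 z) as [l Hl]. destruct (G2 z) as [m Hm].
    eexists. apply deriv_plus; eassumption.
Qed.

Lemma twice_deriv_mult f g :
  twice_deriv f -> twice_deriv g -> twice_deriv (fun z => f z * g z)%C.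
Proof.
  intros [f' [F1 F2]] [g' [G1 G2]]. exists (fun z => f' z * g z + f z * g' z)%C. split.
  - intro z. now apply deriv_mult.
  - intro z. destruct (F2 z) as [l Hl]. destruct (G2 z) as [m Hm].
    eexists. apply deriv_plus; apply deriv_mult; eauto.
Qed.

Lemma twice_deriv_const c : twice_deriv (fun _ => c).
Proof.
  exists (fun _ => RtoC 0). split; intro z; [apply deriv_const|].
  eexists; apply deriv_const.
Qed.

Lemma twice_deriv_exp_lin c : twice_deriv (fun z => Cexp (c * z)).
Proof.
  assert (H : forall z, deriv_at cid (fun z => Cexp (c * z)) z (Cexp (c * z) * c)).
  { intro z. eapply deriv_eq; [apply deriv_exp, deriv_scal, (deriv_incl cid)|].
    cbv beta; ring. }
  exists (fun z => Cexp (c * z) * c)%C. split; auto.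
  intro z. eexists. apply deriv_mult; [apply H|apply deriv_const].
Qed.

(** The quotient f(z) / (z - p) has derivative f''(p) / 2 at p by the second-order Taylor expansion
    of f. That expansion follows from differentiability of f' at p, by integrating f' along the
    segment from p to z. *)
Lemma removable f f' f2 p :
  (forall z, deriv_at cid f z (f' z)) -> (forall z, cont_at cid f' z) ->
  deriv_at cid f' p f2 -> f p = 0 ->
  forall g, g p = f' p -> (forall z, z <> p -> g z = (f z / (z - p))%C) ->
  deriv_at cid g p (f2 / 2).
Proof.
  intros Hf Hc Hf2 Hp g Hg1 Hg2 eps He.
  destruct (Hf2 eps He) as [d [D Hd]]. exists d; split; auto. unfold cid in *.
  intros z Hz. rewrite Hg1.
  destruct (excluded_middle_informative (z = p)) as [->|Nz].
  { replace (g p - f' p - (p - p) * (f2 / 2))%C with (RtoC 0) by (rewrite Hg1; field).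
    rewrite Cmod_0. apply Rmult_le_pos; [lra|apply Cmod_ge_0]. }
  rewrite Hg2 by auto. set (h := (z - p)%C) in *.
  assert (Nh : h <> 0).
  { intro E. apply Nz. replace z with (h + p)%C by (unfold h; ring). rewrite E. ring. }
  (* The increment of this function over [0, 1] is the Taylor remainder, and its derivative is h
     times the first-order error of f' at p. *)
  assert (B := deriv_bound (fun t => f (p + RtoC t * h) - RtoC t * h * f' p
       - RtoC t * RtoC t * (h * h * f2 / 2))%C
     (fun t => h * (f' (p + RtoC t * h) - f' p - RtoC t * h * f2))%C 0 1
     (eps * Cmod h * Cmod h) Rle_0_1).
  cbv beta in B.
  assert (Lin : forall t, deriv_at RtoC (fun t => p + RtoC t * h)%C t h).
  { intro t. eapply deriv_eq; [apply deriv_plus; [apply deriv_const|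
      apply deriv_mult; [apply deriv_incl|apply deriv_const]]|]. cbv beta; ring. }
  assert (B' : Cmod (f z - h * f' p - h * h * f2 / 2) <= eps * Cmod h * Cmod h).
  { replace (f z - h * f' p - h * h * f2 / 2)%C
      with (f (p + 1 * h) - 1 * h * f' p - 1 * 1 * (h * h * f2 / 2)
        - (f (p + 0 * h) - 0 * h * f' p - 0 * 0 * (h * h * f2 / 2)))%C.
    2:{ replace (p + 1 * h)%C with z by (unfold h; ring).
        replace (p + 0 * h)%C with p by ring. rewrite Hp. field. }
    replace (eps * Cmod h * Cmod h) with ((1 - 0) * (eps * Cmod h * Cmod h)) by ring.
    apply B.
    - intros t Ht. eapply deriv_eq.
      + apply deriv_minus; [apply deriv_minus|].
        * apply (deriv_comp RtoC f (fun t => p + RtoC t * h)%C); [apply Hf|apply Lin].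
        * apply deriv_mult; [apply deriv_mult; [apply deriv_incl|apply deriv_const]|apply deriv_const].
        * apply deriv_mult; [apply deriv_mult; apply deriv_incl|apply deriv_const].
      + cbv beta. field.
    - intros t Ht. apply cont_mult; [apply cont_const|]. apply cont_minus; [apply cont_minus|].
      + apply (cont_comp RtoC f' (fun t => p + RtoC t * h)%C); auto. eapply deriv_cont, Lin.
      + apply cont_const.
      + apply cont_mult; [apply cont_mult; [apply cont_incl|apply cont_const]|apply cont_const].
    - intros t Ht. rewrite Cmod_mult.
      assert (Th : Cmod (p + RtoC t * h - p) <= Cmod h).
      { replace (p + t * h - p)%C with (t * h)%C by ring.
        rewrite Cmod_mult, Cmod_R, Rabs_pos_eq by lra.
        rewrite <- (Rmult_1_l (Cmod h)) at 2. apply Rmult_le_compat_r; [apply Cmod_ge_0|lra]. }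
      specialize (Hd (p + RtoC t * h)%C ltac:(lra)).
      replace (p + t * h - p)%C with (t * h)%C in Hd, Th by ring.
      rewrite (Rmult_comm (Cmod h)). apply Rmult_le_compat_r; [apply Cmod_ge_0|].
      eapply Rle_trans; [exact Hd|]. apply Rmult_le_compat_l; lra. }
  replace (f z / h - f' p - h * (f2 / 2))%C with ((f z - h * f' p - h * h * f2 / 2) * / h)%C
    by (field; auto).
  rewrite Cmod_mult, Cmod_inv by auto. apply Cmod_gt_0 in Nh.
  apply Rmult_le_reg_r with (Cmod h); auto.
  rewrite Rmult_assoc, Rinv_l, Rmult_1_r by lra. exact B'.
Qed.

Lemma deriv_ext_near (f g : C -> C) z l r :
  0 < r -> (forall w, Cmod (w - z) < r -> f w = g w) -> deriv_at cid f z l -> deriv_at cid g z l.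
Proof.
  intros Hr E H e He. destruct (H e He) as [d [D Hd]]. exists (Rmin r d).
  split; [now apply Rmin_pos|]. unfold cid in *. intros w Hw.
  assert (K1 := Rlt_le_trans _ _ _ Hw (Rmin_l _ _)).
  assert (K2 := Rlt_le_trans _ _ _ Hw (Rmin_r _ _)).
  rewrite <- (E w K1), <- (E z). { auto. }
  replace (z - z)%C with (RtoC 0) by ring. now rewrite Cmod_0.
Qed.

Lemma cont_neq_0_near (f : C -> C) z :
  cont_at cid f z -> f z <> 0 -> exists r, 0 < r /\ forall w, Cmod (w - z) < r -> f w <> 0.
Proof.
  intros Hc Hn. apply Cmod_gt_0 in Hn. destruct (Hc _ Hn) as [d [D Hd]].
  exists d; split; auto. intros w Hw E. specialize (Hd w Hw). rewrite E in Hd.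
  replace (0 - f z)%C with (- f z)%C in Hd by ring. rewrite Cmod_opp in Hd. lra.
Qed.

(** ** Zeros of [hk] *)

Definition hfac (k : nat) (s : C) : C :=
  (- (-1) ^ (S k) * rising (1 - s) k * hk (s - RtoC (INR (S k))))%C.

Lemma hk_hfac k s : hk s = ((s - RtoC (INR (S k))) * hfac k s)%C.
Proof.
  rewrite (hk_rising s (S k)). unfold hfac. cbn [rising].
  rewrite (S_INR k), RtoC_plus. ring.
Qed.

Lemma hfac_deriv_ex k s : exists l, deriv_at cid (hfac k) s l.
Proof.
  assert (R : holo (fun _ => True) (fun s => rising (1 - s) k)).
  { induction k as [|k IH]; cbn [rising]; [apply holo_const|].
    apply holo_mult; auto. apply holo_plus; [|apply holo_const].
    apply holo_minus; [apply holo_const|apply holo_id]. }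
  destruct (holo_deriv_ex _ _ s R I) as [l Hl].
  destruct (hk_deriv_ex (s - RtoC (INR (S k)))) as [m Hm].
  eexists. unfold hfac. apply deriv_mult.
  - apply deriv_mult; [apply deriv_const|exact Hl].
  - apply (deriv_comp cid hk (fun s => s - RtoC (INR (S k)))%C); [exact Hm|].
    apply deriv_minus; [apply (deriv_incl cid)|apply deriv_const].
Qed.

(** This makes the zero of [hk] at k + 1 simple: the remaining linear factors are nonzero there, and
    [hk] 0 is nonzero by [hk_neq_0]. *)
Lemma hfac_neq_0 k : hfac k (RtoC (INR (S k))) <> 0.
Proof.
  unfold hfac. apply Cmult_neq_0; [apply Cmult_neq_0|].
  - replace (- (-1) ^ S k)%C with ((-1) ^ k)%C by (simpl; ring).
    apply Cpow_nz. apply RtoC_neq; lra.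
  - assert (H : forall j, (j <= k)%nat -> rising (1 - RtoC (INR (S k))) j <> 0).
    { induction j as [|j IH]; intro Hj; cbn [rising]; [apply RtoC_neq; lra|].
      apply Cmult_neq_0; [apply IH; lia|].
      assert (Q : INR j < INR k) by (apply lt_INR; lia).
      rewrite S_INR, RtoC_plus.
      replace (1 - (INR k + 1) + INR j)%C with (INR j - INR k)%C by ring.
      rewrite <- RtoC_minus. apply RtoC_neq. lra. }
    now apply H.
  - replace (INR (S k) - INR (S k))%C with (RtoC 0) by ring.
    apply hk_neq_0. simpl. lra.
Qed.

Lemma Gamma_pole_iff s : Gamma_pole s <-> exists k, s = RtoC (INR (S k)).
Proof.
  split; intros [k Hk]; exists k.
  - rewrite S_INR, RtoC_plus. rewrite RtoC_opp in Hk.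
    replace s with (1 - (1 - s))%C by ring. rewrite Hk. ring.
  - rewrite Hk, S_INR, RtoC_plus, RtoC_opp. ring.
Qed.

Lemma hk_pole s : Gamma_pole s -> hk s = 0.
Proof.
  intro H. apply Gamma_pole_iff in H. destruct H as [k ->]. rewrite (hk_hfac k). ring.
Qed.

(** * The continuation as a quotient of entire functions *)

Section Final.
Context (tau : C) (Hlo : - (1 / 2) < Re tau) (Hhi : Re tau <= 1 / 2) (Him : 0 < Im tau).
Context (r0 : R) (S1 : small 1 tau r0) (S2 : small (- (Ci * tau)) (- Ci) r0).

(** Since Gamma(1 - s) [hk] s = 2 i PI exp(i PI s), the factor Gamma(1 - s) exp(-i PI s) / (i PI)
    equals 2 / [hk] s; this is the numerator left once [hk] s is cleared. *)
Definition nfun (s : C) : C := (2 * (2 * Ccos (RtoC PI / 2 * s)) * jfun tau r0 s)%C.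

Lemma twice_deriv_hfab al be c r :
  sector al be c -> small al be r -> twice_deriv (fun s => hfab al be s r).
Proof.
  intros Hs Hm. eexists. split.
  - intro z. now apply hfab_deriv with c.
  - intro z. now apply hfab_deriv2 with c.
Qed.

Lemma nfun_twice_deriv : twice_deriv nfun.
Proof.
  unfold nfun. apply twice_deriv_mult.
  - replace (fun z => 2 * (2 * Ccos (RtoC PI / 2 * z)))%C
      with (fun z => 2 * (Cexp (Ci * RtoC (PI / 2) * z) + Cexp (- (Ci * RtoC (PI / 2)) * z)))%C.
    + apply twice_deriv_mult; [apply twice_deriv_const|].
      apply twice_deriv_plus; apply twice_deriv_exp_lin.
    + apply functional_extensionality. intro s. rewrite Ccos_Cexp.
      do 3 f_equal. ring.
  - unfold jfun. apply twice_deriv_plus.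
    + apply twice_deriv_mult.
      * replace phase with (fun s => Cexp (- (Ci * RtoC PI / 2) * s)).
        -- apply twice_deriv_exp_lin.
        -- apply functional_extensionality. intro s. unfold phase. f_equal. field.
      * apply (twice_deriv_hfab 1 tau (1 / 2)); auto. now apply sector_right.
    + apply (twice_deriv_hfab _ _ (Im tau)); auto. now apply sector_up.
Qed.

(** The form multiplied by [hk] s remains valid at the integers s >= 3, where [hk] vanishes; there
    it forces [nfun] s = 0. *)
Lemma lattice_nfun s : 2 < Re s -> forall eps, 0 < eps -> exists K0, forall K, (K0 <= K)%nat ->
  Cmod (hk s * square_sum tau s K - nfun s) < eps.
Proof.
  intros Hs eps He.
  set (A := Cmod (2 * (2 * Ccos (RtoC PI / 2 * s)))).
  set (B := Cmod (phase s)).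
  assert (A0 : 0 <= A) by apply Cmod_ge_0. assert (B0 : 0 <= B) by apply Cmod_ge_0.
  set (e := eps / (2 * (A + 1) * (B + 1))).
  assert (E0 : 0 < e) by (unfold e; apply Rdiv_lt_0_compat; [lra|repeat apply Rmult_lt_0_compat; lra]).
  destruct (hfab_lattice 1 tau (1 / 2) r0 s (sector_right tau Hlo Hhi) S1 Hs e E0) as [N1 H1].
  destruct (hfab_lattice _ _ (Im tau) r0 s (sector_up tau Him) S2 Hs e E0) as [N2 H2].
  exists (max N1 N2). intros K HK. specialize (H1 K ltac:(lia)). specialize (H2 K ltac:(lia)).
  rewrite (square_sum_sectors tau s Hlo Hhi Him). unfold nfun, jfun.
  assert (Ph : Cexp (- (Ci * RtoC (PI / 2) * s)) = phase s).
  { unfold phase. f_equal. rewrite RtoC_div by lra. field. }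
  rewrite Ph. set (a := ssum K _) in *. set (b := ssum K (lpow (- (Ci * tau)) _ _)) in *.
  set (x := hfab 1 tau s r0) in *. set (y := hfab (- (Ci * tau)) (- Ci) s r0) in *.
  set (Q := (2 * Ccos (RtoC PI / 2 * s))%C) in *.
  replace (hk s * (Q * (phase s * a + b)) - 2 * Q * (phase s * x + y))%C
    with (- (2 * Q) * (phase s * (x - / 2 * (hk s * a)) + (y - / 2 * (hk s * b))))%C by field.
  rewrite Cmod_mult, Cmod_opp. fold A.
  apply Rle_lt_trans with (A * (2 * (B + 1) * e)).
  - apply Rmult_le_compat_l; auto. eapply Rle_trans; [apply Cmod_triangle|].
    rewrite Cmod_mult. fold B.
    assert (B * Cmod (x - / 2 * (hk s * a)) <= B * e) by (apply Rmult_le_compat_l; lra). nra.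
  - replace eps with ((A + 1) * (2 * (B + 1) * e)) by (unfold e; field; lra).
  - replace eps with ((A + 1) * (2 * (B + 1) * e)).
    2:{ unfold e. field. split; apply Rgt_not_eq; lra. }
    apply Rmult_lt_compat_r; [|lra]. apply Rmult_lt_0_compat; [lra|exact E0].
Qed.

(** The two double poles cancel: [phase] 2 = -1, while al^2 - be^2 equals 1 - tau^2 for both pairs
    of generators. *)
Lemma jfun_2 : jfun tau r0 2 = 0.
Proof.
  unfold jfun.
  rewrite (hfab_2 1 tau (1 / 2)) by (auto; now apply sector_right).
  rewrite (hfab_2 _ _ (Im tau)) by (auto; now apply sector_up).
  assert (Ph : phase 2 = (-1)%C).
  { unfold phase. replace (- (Ci * 2 * RtoC PI / 2))%C with (- (Ci * RtoC PI))%C by field.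
    rewrite Cexp_opp, Cexp_PI. field. }
  rewrite Ph.
  assert (I2_ : (Ci * Ci)%C = RtoC (-1)) by (apply injective_projections; simpl; ring).
  replace ((- (Ci * tau) + - Ci) * (- (Ci * tau) - - Ci))%C
    with ((Ci * Ci) * ((tau + 1) * (tau - 1)))%C by ring.
  rewrite I2_. replace ((-1) * ((tau + 1) * (tau - 1)))%C with ((1 + tau) * (1 - tau))%C by ring.
  unfold Cdiv. ring.
Qed.

Lemma nfun_pole s : Gamma_pole s -> nfun s = 0.
Proof.
  intro Hp. assert (Hk := hk_pole s Hp). apply Gamma_pole_iff in Hp. destruct Hp as [k Ek].
  destruct k as [|[|k]].
  - unfold nfun. rewrite Ek, Ccos_Cexp. simpl INR.
    replace (Ci * RtoC (PI / 2) * 1)%C with (Ci * RtoC (PI / 2))%C by ring.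
    rewrite Cexp_opp, Cexp_PI2.
    replace (Ci + / Ci)%C with (RtoC 0); [ring|].
    assert (NI : Ci <> 0) by (apply Cmod_gt_0; rewrite Cmod_Ci; lra).
    replace (Ci + / Ci)%C with ((Ci * Ci + 1) / Ci)%C by (field; auto).
    replace (Ci * Ci + 1)%C with (RtoC 0) by (apply injective_projections; simpl; ring).
    unfold Cdiv. ring.
  - unfold nfun. replace s with (RtoC 2) by (rewrite Ek; f_equal; simpl; ring).
    rewrite jfun_2. ring.
  - symmetry. apply C_eq_eps. intros eps He.
    destruct (lattice_nfun s) with (eps := eps) as [K0 HK]; auto.
    { rewrite Ek. change (2 < INR (S (S (S k)))). rewrite !S_INR. generalize (pos_INR k). lra. }
    specialize (HK K0 (le_n _)). rewrite Hk in HK.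
    replace (0 * square_sum tau s K0 - nfun s)%C with (0 - nfun s)%C in HK by ring. lra.
Qed.

(** At a pole of Gamma(1 - s) both numerator and denominator vanish, the latter simply, and the
    quotient of derivatives is the limit value. *)
Definition efun (s : C) : C :=
  if excluded_middle_informative (Gamma_pole s)
  then (C_derive nfun s / C_derive hk s)%C else (nfun s / hk s)%C.

Lemma efun_nonpole s : ~ Gamma_pole s -> efun s = (nfun s / hk s)%C.
Proof. intro H. unfold efun. now destruct (excluded_middle_informative (Gamma_pole s)). Qed.

(** The poles are zeros of [hk]. At a pole the factorization through [hfac] isolates the zero;
    elsewhere [hk] is nonzero nearby by continuity. *)
Lemma nonpole_near s : exists r, 0 < r /\ forall w, Cmod (w - s) < r -> w <> s -> ~ Gamma_pole w.
Proof.
  destruct (excluded_middle_informative (Gamma_pole s)) as [Hp|Hn].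
  - apply Gamma_pole_iff in Hp. destruct Hp as [k Ek].
    destruct (hfac_deriv_ex k s) as [l Hl].
    destruct (cont_neq_0_near (hfac k) s) as [r [Hr H]].
    + eapply deriv_cont, Hl.
    + rewrite Ek. apply hfac_neq_0.
    + exists r; split; auto. intros w Hw Nw Pw. apply hk_pole in Pw.
      rewrite (hk_hfac k), <- Ek in Pw. revert Pw. apply Cmult_neq_0; auto.
      intro E. apply Nw. replace w with ((w - s) + s)%C by ring. rewrite E. ring.
  - destruct (hk_deriv_ex s) as [l Hl].
    destruct (cont_neq_0_near hk s) as [r [Hr H]].
    + eapply deriv_cont, Hl.
    + now apply hk_neq_0_nonpole.
    + exists r; split; auto. intros w Hw _ Pw. apply (H w Hw). now apply hk_pole.
Qed.

Lemma efun_deriv_ex s : exists l, deriv_at cid efun s l.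
Proof.
  destruct (nonpole_near s) as [r [Hr Hn]].
  destruct nfun_twice_deriv as [n' [Hn1 Hn2]].
  destruct (hk_deriv_ex s) as [m Hm].
  destruct (excluded_middle_informative (Gamma_pole s)) as [Hp|Hnp].
  - assert (Hp' := Hp). apply Gamma_pole_iff in Hp'. destruct Hp' as [k Ek].
    destruct (Hn2 s) as [n2 Hn2']. destruct (hfac_deriv_ex k s) as [l Hl].
    assert (Nf : hfac k s <> 0) by (rewrite Ek; apply hfac_neq_0).
    destruct (cont_neq_0_near (hfac k) s) as [d [Hd Hdn]]; auto.
    { eapply deriv_cont, Hl. }
    (* Near the pole [efun] is g / [hfac] k, where g is [nfun] with its zero at s divided out and
       [hfac] k does not vanish. *)
    set (g := fun w => if excluded_middle_informative (w = s) then n' s else (nfun w / (w - s))%C).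
    assert (Dg : deriv_at cid g s (n2 / 2)).
    { apply (removable nfun n' n2 s); auto.
      - intro z. destruct (Hn2 z) as [q Hq]. eapply deriv_cont, Hq.
      - now apply nfun_pole.
      - unfold g. now destruct (excluded_middle_informative (s = s)).
      - intros z Hz. unfold g. now destruct (excluded_middle_informative (z = s)). }
    eexists. apply (deriv_ext_near (fun w => g w * / hfac k w)%C efun s _ (Rmin r d)).
    + now apply Rmin_pos.
    + intros w Hw. assert (K1 := Rlt_le_trans _ _ _ Hw (Rmin_l _ _)).
      assert (K2 := Rlt_le_trans _ _ _ Hw (Rmin_r _ _)).
      unfold g. destruct (excluded_middle_informative (w = s)) as [->|Nw].
      * unfold efun. destruct (excluded_middle_informative (Gamma_pole s)) as [_|Q]; [|easy].
        assert (D1 : C_derive nfun s = n' s).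
        { apply is_C_derive_unique. now apply deriv_at_is_derive. }
        assert (D2 : C_derive hk s = hfac k s).
        { apply is_C_derive_unique. apply deriv_at_is_derive.
          apply deriv_ext with (fun s => (s - RtoC (INR (S k))) * hfac k s)%C.
          { intro u. symmetry. apply hk_hfac. }
          eapply deriv_eq.
          - apply deriv_mult; [|exact Hl].
            apply deriv_minus; [apply (deriv_incl cid)|apply deriv_const].
          - cbv beta. rewrite <- Ek. ring. }
        rewrite D1, D2. reflexivity.
      * rewrite efun_nonpole by (apply Hn; auto). rewrite (hk_hfac k), <- Ek.
        assert (W : (w - s)%C <> 0).
        { intro E. apply Nw. replace w with ((w - s) + s)%C by ring. rewrite E. ring. }
        field. auto.
    + apply deriv_mult; [exact Dg|]. apply deriv_inv; [auto|exact Hl].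
  - assert (Nh := hk_neq_0_nonpole s Hnp).
    eexists. apply (deriv_ext_near (fun w => nfun w * / hk w)%C efun s _ r); auto.
    + intros w Hw. rewrite efun_nonpole; [reflexivity|].
      destruct (excluded_middle_informative (w = s)) as [->|Nw]; auto.
    + apply deriv_mult; [apply Hn1|]. apply deriv_inv; [auto|exact Hm].
Qed.

Lemma efun_cont s : cont_at cid efun s.
Proof. destruct (efun_deriv_ex s) as [l Hl]. eapply deriv_cont, Hl. Qed.

Lemma square_sum_efun s : 2 < Re s -> forall eps, 0 < eps ->
  exists K0, forall K, (K0 <= K)%nat -> Cmod (square_sum tau s K - efun s) < eps.
Proof.
  assert (Reg : forall s, ~ Gamma_pole s -> 2 < Re s -> forall eps, 0 < eps ->
    exists K0, forall K, (K0 <= K)%nat -> Cmod (square_sum tau s K - efun s) < eps).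
  { clear s. intros s Hn Hs eps He. assert (Nh := hk_neq_0_nonpole s Hn).
    assert (P := proj1 (Cmod_gt_0 _) Nh).
    destruct (lattice_nfun s Hs (eps * Cmod (hk s))) as [K0 HK]; [now apply Rmult_lt_0_compat|].
    exists K0. intros K HKK. specialize (HK K HKK). rewrite efun_nonpole by auto.
    replace (square_sum tau s K - nfun s / hk s)%C
      with ((hk s * square_sum tau s K - nfun s) * / hk s)%C by (field; auto).
    rewrite Cmod_mult, Cmod_inv by auto.
    apply Rmult_lt_reg_r with (Cmod (hk s)); auto.
    rewrite Rmult_assoc, Rinv_l, Rmult_1_r by lra. exact HK. }
  intros Hs eps He.
  destruct (excluded_middle_informative (Gamma_pole s)) as [Hp|Hn]; [|now apply Reg].
  destruct (nonpole_near s) as [r [Hr Hnr]].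
  destruct (proj2 (ucont_square_sum tau s Hlo Hhi Him Hs) (eps / 3)) as [d1 [D1 H1]]; [lra|].
  destruct (efun_cont s (eps / 3)) as [d2 [D2 H2]]; [lra|].
  set (d := Rmin r (Rmin d1 d2) / 2).
  assert (M1 := Rmin_l r (Rmin d1 d2)). assert (M2 := Rmin_r r (Rmin d1 d2)).
  assert (M3 := Rmin_l d1 d2). assert (M4 := Rmin_r d1 d2).
  assert (M5 : 0 < Rmin r (Rmin d1 d2)) by (repeat apply Rmin_pos; auto).
  assert (D0 : 0 < d) by (unfold d; lra).
  (* The displacement is to the right, so Re s' > 2 is preserved, and it is short enough to miss the
     other poles. The bound on the change of the partial sums is uniform in K, so the K0 found for
     s' serves s. *)
  set (s' := (s + RtoC d)%C).
  assert (Es : (s' - s)%C = RtoC d) by (unfold s'; ring).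
  assert (Cs : Cmod (s' - s) = d) by (rewrite Es, Cmod_R; apply Rabs_pos_eq; lra).
  assert (Np : ~ Gamma_pole s').
  { apply Hnr; [rewrite Cs; unfold d; lra|]. intro E. rewrite E in Cs.
    replace (s - s)%C with (RtoC 0) in Cs by ring. rewrite Cmod_0 in Cs. lra. }
  destruct (Reg s' Np) with (eps := eps / 3) as [K0 HK]; [|lra|].
  { unfold s'. replace (Re (s + RtoC d)) with (Re s + d) by (unfold Re; simpl; ring). lra. }
  exists K0. intros K HKK. specialize (HK K HKK).
  specialize (H1 K s' ltac:(rewrite Cs; unfold d; lra)).
  specialize (H2 s' ltac:(unfold cid; rewrite Cs; unfold d; lra)).
  rewrite Cmod_minus_sym in H1.
  replace (square_sum tau s K - efun s)%C with ((square_sum tau s K - square_sum tau s' K)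
    + ((square_sum tau s' K - efun s') + (efun s' - efun s)))%C by ring.
  eapply Rle_lt_trans; [apply Cmod_triangle|].
  assert (T := Cmod_triangle (square_sum tau s' K - efun s') (efun s' - efun s)). lra.
Qed.

Lemma continuation_efun r y s :
  admissible tau r y -> ~ Gamma_pole s -> continuation_formula tau r y s = efun s.
Proof.
  intros Ha Hn. unfold continuation_formula.
  destruct (contour_jfun tau Hlo Hhi Him r y s Ha) as [_ ->].
  destruct (admissible_small tau Hlo Hhi r y Ha) as [R1 R2].
  rewrite (jfun_radius tau Hlo Hhi Him r r0) by auto.
  rewrite efun_nonpole by auto. unfold nfun.
  assert (Nh := hk_neq_0_nonpole s Hn). assert (G := CGamma_hk s Hn).
  assert (P := PI_RGT_0). assert (NP : RtoC PI <> 0) by (apply RtoC_neq; lra).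
  assert (NI : Ci <> 0) by (apply Cmod_gt_0; rewrite Cmod_Ci; lra).
  replace (CGamma (1 - s)) with (hval s / hk s)%C by (rewrite <- G; field; auto).
  unfold hval.
  replace (- (Ci * s * RtoC PI))%C with (- (Ci * RtoC PI * s))%C by ring.
  rewrite Cexp_opp. field. repeat split; auto. apply Cexp_neq_0.
Qed.

End Final.

Lemma small_radius_ex tau : exists r, small 1 tau r /\ small (- (Ci * tau)) (- Ci) r.
Proof.
  assert (P := PI_RGT_0).
  assert (A := Cmod_ge_0 (1 + tau)). assert (B := Cmod_ge_0 (1 - tau)).
  set (S := Cmod (1 + tau) + Cmod (1 - tau) + 1).
  assert (HS : 0 < PI / S) by (apply Rdiv_lt_0_compat; unfold S; lra).
  assert (E : PI / S * S = PI) by (field; unfold S; lra).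
  exists (PI / S). apply small_of_bounds; auto; unfold S in *; nra.
Qed.

Theorem corollary7 (tau : C)
  (Hre_lo : - (1 / 2) < Re tau) (Hre_hi : Re tau <= 1 / 2)
  (Him : 0 < Im tau) (Hmod : 1 <= Cmod tau)
  (Hbd : Cmod tau = 1 -> 0 <= Re tau) :
  exists E : C -> C,
    entire E /\
    (forall s : C, 2 < Re s -> is_Etilde tau s (E s)) /\
    (forall r y : R, admissible tau r y ->
      forall s : C,
        ex_contour_int (integrand tau s) r y /\
        (~ Gamma_pole s -> E s = continuation_formula tau r y s) /\
        (Gamma_pole s ->
          filterlim (continuation_formula tau r y) (locally' s) (locally (E s)))).
Proof.
  destruct (small_radius_ex tau) as [r0 [S1 S2]].
  (* A reference radius is fixed before the contour is given, so one function serves all admissible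
     r and y. *)
  exists (efun tau r0). split; [|split].
  - intro s. destruct (efun_deriv_ex tau Hre_lo Hre_hi Him r0 S1 S2 s) as [l Hl].
    exists l. now apply deriv_at_is_derive.
  - intros s Hs P HP. apply locally_C in HP. destruct HP as [e He].
    destruct (square_sum_efun tau Hre_lo Hre_hi Him r0 S1 S2 s Hs e (cond_pos e)) as [K0 HK].
    exists K0. intros K HKK. apply He. now apply HK.
  - intros r y Ha s. split; [|split].
    + now apply contour_jfun.
    + intro Hn. symmetry. now apply continuation_efun.
    + intros _ P HP. apply locally_C in HP. destruct HP as [e He].
      destruct (nonpole_near s) as [d1 [D1 H1]].
      destruct (efun_cont tau Hre_lo Hre_hi Him r0 S1 S2 s e (cond_pos e)) as [d2 [D2 H2]].
      assert (D : 0 < Rmin d1 d2) by now apply Rmin_pos.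
      apply locally_C. exists (mkposreal _ D). intros w Hw Nw.
      change (Cmod (w - s) < Rmin d1 d2) in Hw.
      rewrite (continuation_efun tau Hre_lo Hre_hi Him r0 S1 S2 r y w Ha).
      * apply He. apply H2. apply Rlt_le_trans with (1 := Hw), Rmin_r.
      * apply H1; auto. apply Rlt_le_trans with (1 := Hw), Rmin_l.
Qed.
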